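(* Let $G\subset\mathbb{C}^2$ be a bounded, pseudoconvex, complete Reinhardt domain and let $R_1,R_2>0$ be such that the projections of $G$ onto the first and the second coordinate are $\pi_{\{1\}}(G)=R_1\cdot\mathbb{D}$ and $\pi_{\{2\}}(G)=R_2\cdot\mathbb{D}$. If $f=(f_1,f_2)\in\mathcal{O}(\mathbb{D},G)$ is an $\ell_G$-extremal or a $\kappa_G$-extremal map, then at least one of the following conditions holds: (i) there exists $j\in\{1,2\}$ such that $\frac{1}{R_j}f_j\in\mathrm{Aut}(\mathbb{D})$, or (ii) there exist $B_1,B_2\in\mathrm{Aut}(\mathbb{D})\cup\{1\}$ and $g\in\mathcal{G}(D_G)$ such that $f$ is of the form $$f=(B_1 e^{\varphi_1},B_2 e^{\varphi_2}),$$ where $\varphi=(\varphi_1,\varphi_2)\in\mathcal{M}^2$ is a map with boundary measure $g\,d\mathcal{L}^{\mathbb{T}}$.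
   Context: $\mathbb{D}$, $\mathbb{T}$ are the unit disc and circle in $\mathbb{C}$, $\mathbb{C}_*=\mathbb{C}\setminus\{0\}$, $\mathcal{L}^{\mathbb{T}}$ is arc length measure on $\mathbb{T}$ (total mass $2\pi$), $\langle\cdot,\cdot\rangle$ is the standard inner product on $\mathbb{R}^n$, $\mathcal{O}(X,Y)$ is the set of holomorphic maps $X\to Y$, $\mathrm{Aut}(\mathbb{D})$ is the group of holomorphic automorphisms of $\mathbb{D}$, and $1$ denotes the constant function. $\rho$ is the Poincaré distance on $\mathbb{D}$. Complete Reinhardt domain: a non-empty open $G\subset\mathbb{C}^n$ such that $(\lambda_1z_1,\ldots,\lambda_nz_n)\in G$ for all $(z_1,\dots,z_n)\in G$ and $\lambda_1,\dots,\lambda_n\in\overline{\mathbb{D}}$. Its logarithmic image is $\log G:=\{(\log|z_1|,\ldots,\log|z_n|):(z_1,\ldots,z_n)\in G\cap(\mathbb{C}_* )^n\}\subset\mathbb{R}^n$, and $D_G:=\log G+i\mathbb{R}^n$. For a domain $D\subset\mathbb{C}^n$, the Lempert function is $\ell_D(z,w)=\inf\{\rho(\sigma_1,\sigma_2):\sigma_1,\sigma_2\in\mathbb{D},\ \exists f\in\mathcal{O}(\mathbb{D},D): f(\sigma_1)=z, f(\sigma_2)=w\}$, and the Kobayashi-Royden pseudometric is $\kappa_D(z,X)=\inf\{\alpha>0:\exists f\in\mathcal{O}(\mathbb{D},D): f(0)=z,\ \alpha f'(0)=X\}$ ($z,w\in D$, $X\in\mathbb{C}^n$). A map $f\in\mathcal{O}(\mathbb{D},D)$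 is $\ell_D$-extremal if $\rho(\sigma_1,\sigma_2)=\ell_D(f(\sigma_1),f(\sigma_2))$ for some $\sigma_1\neq\sigma_2$ in $\mathbb{D}$; it is $\kappa_D$-extremal if $\kappa_D(f(\sigma),f'(\sigma))=\frac{1}{1-|\sigma|^2}$ for some $\sigma\in\mathbb{D}$. A real Borel measure is a finite signed Borel measure. The boundary measure of $\varphi\in\mathcal{O}(\mathbb{D},\mathbb{C}^n)$, if it exists, is the unique $n$-tuple $\mu$ of real Borel measures on $\mathbb{T}$ with $\varphi(\lambda)=\frac{1}{2\pi}\int_{\mathbb{T}}\frac{\zeta+\lambda}{\zeta-\lambda}\,d\mu(\zeta)+i\,\mathrm{Im}\,\varphi(0)$ for all $\lambda\in\mathbb{D}$; $\mathcal{M}^n$ is the set of $\varphi\in\mathcal{O}(\mathbb{D},\mathbb{C}^n)$ admitting a boundary measure. $\mathcal{H}^n:=\{h\in\mathcal{O}(\mathbb{C},\mathbb{C}^n):\bar\lambda h(\lambda)\in\mathbb{R}^n\ \forall\lambda\in\mathbb{T}\}$. For a convex tube domain $D=\mathrm{Re}\,D+i\mathbb{R}^n\subset\mathbb{C}^n$ (with base $\mathrm{Re}\,D\subset\mathbb{R}^n$) and $v\in\mathbb{R}^n$, $P_D(v):=\{p\in\overline{\mathrm{Re}\,D}:\langle x-p,v\rangle<0\ \forall x\in\mathrm{Re}\,D\}$. For a convex tube domain $D\subset\mathbb{C}^n$ containing no complex affine lines, $\mathcal{G}(D)$ is the family of all Borel-measurable $g=(g_1,\ldots,g_n):\mathbb{T}\to\mathbb{R}^n$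 with $g_1,\ldots,g_n\in L^1(\mathbb{T},\mathcal{L}^{\mathbb{T}})$ for which there is some $h\in\mathcal{H}^n$ with $g(\lambda)\in P_D(\bar\lambda h(\lambda))$ for $\mathcal{L}^{\mathbb{T}}$-a.e. $\lambda\in\mathbb{T}$. *)

(* Defs.v *)
From HB Require Import structures.
From mathcomp Require Import all_boot all_order all_algebra complex.
From mathcomp Require Import all_classical all_reals all_analysis measurable_realfun.

Set Implicit Arguments.
Unset Strict Implicit.
Unset Printing Implicit Defensive.

Import Order.TTheory GRing.Theory Num.Theory.
Import numFieldNormedType.Exports.

Local Open Scope classical_set_scope.
Local Open Scope complex_scope.
Local Open Scope ring_scope.

(* Complex numbers are [R[i]] with [R : realType], seen as a normed module over
   themselves, so that [derivable] and [derive1] over [R[i]] are complex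
   differentiability and the complex derivative. Points of C^n are row vectors
   ['rV[R[i]]_n]; a map defined on a subset of C is a total function of which
   only the values on that subset matter. *)
HB.instance Definition _ (R : realType) := NormedModule.copy R[i] R[i]^o.

Definition cabs (R : realType) (z : R[i]) : R := complex.Re `|z|.

Definition re_vec (R : realType) n (z : 'rV[R[i]]_n) : 'rV[R]_n :=
  map_mx (@complex.Re R) z.

Definition disc (R : realType) : set R[i] := [set z | `|z| < 1].

Definition cexp (R : realType) (z : R[i]) : R[i] :=
  (expR (complex.Re z))%:C * (cos (complex.Im z) +i* sin (complex.Im z)).

Definition expi (R : realType) (t : R) : R[i] := cos t +i* sin t.

Definition holomorphic_on (R : realType) (V : normedModType R[i])
    (U : set R[i]) (f : R[i] -> V) : Prop :=
  forall z, U z -> derivable f z 1.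

Definition holo_disc (R : realType) (V : normedModType R[i])
    (D : set V) : set (R[i] -> V) :=
  [set f | holomorphic_on (@disc R) f /\ (forall z, disc z -> D (f z))].

Definition aut_disc (R : realType) (B : R[i] -> R[i]) : Prop :=
  holo_disc (@disc R) B /\
  exists2 B' : R[i] -> R[i], holo_disc (@disc R) B' &
    forall z, disc z -> B' (B z) = z /\ B (B' z) = z.

Definition complete_reinhardt (R : realType) n (G : set 'rV[R[i]]_n) : Prop :=
  [/\ open G, G !=set0 &
      forall z lam : 'rV[R[i]]_n, G z -> (forall j, `|lam 0 j| <= 1) ->
        G (\row_j (lam 0 j * z 0 j))].

(* The coordinate-wise absolute values are positive below, so [ln] is the
   genuine logarithm. *)
Definition log_image (R : realType) n (G : set 'rV[R[i]]_n) : set 'rV[R]_n :=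
  [set x | exists z, [/\ G z, forall j, z 0 j != 0 &
                         x = \row_j ln (cabs (z 0 j))]].

Definition tube (R : realType) n (S : set 'rV[R]_n) : set 'rV[R[i]]_n :=
  [set z | S (re_vec z)].

Definition DG (R : realType) n (G : set 'rV[R[i]]_n) : set 'rV[R[i]]_n :=
  tube (log_image G).

(* Pseudoconvexity is the existence of a continuous plurisubharmonic exhaustion
   function; for continuous [u], subharmonicity of the restrictions of [u] to complex
   lines is the sub-mean value inequality on the closed discs contained in
   [G]. *)
Definition continuous_psh (R : realType) n (G : set 'rV[R[i]]_n)
    (u : 'rV[R[i]]_n -> R) : Prop :=
  (forall z, G z -> {for z, continuous u}) /\
  (forall a w : 'rV[R[i]]_n,
     (forall t : R[i], `|t| <= 1 -> G (a + t *: w)) ->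
     u a <= (2 * pi)^-1 *
            \int[lebesgue_measure]_(t in `[0, 2 * pi]) u (a + expi t *: w)).

Definition pseudoconvex (R : realType) n (G : set 'rV[R[i]]_n) : Prop :=
  exists u : 'rV[R[i]]_n -> R,
    continuous_psh G u /\
    forall c : R, exists K : set 'rV[R[i]]_n,
      [/\ compact K, K `<=` G & [set z | G z /\ u z < c] `<=` K].

(* Normalised so that the infinitesimal metric is [|dz| / (1 - |z|^2)]. *)
Definition poincare (R : realType) (a b : R[i]) : R :=
  let m := cabs ((a - b) / (1 - conjc a * b)) in
  2^-1 * ln ((1 + m) / (1 - m)).

(* Infima are taken in the extended reals, so that the infimum of the empty
   set is +oo. *)
Definition lempert (R : realType) n (D : set 'rV[R[i]]_n)
    (z w : 'rV[R[i]]_n) : \bar R :=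
  ereal_inf [set (poincare s.1 s.2)%:E | s in
    [set s : R[i] * R[i] | [/\ disc s.1, disc s.2 &
       exists2 f, holo_disc D f & f s.1 = z /\ f s.2 = w]]].

Definition kobayashi_royden (R : realType) n (D : set 'rV[R[i]]_n)
    (z X : 'rV[R[i]]_n) : \bar R :=
  ereal_inf [set a%:E | a in
    [set a : R | 0 < a /\
       exists2 f, holo_disc D f & f 0 = z /\ a%:C *: derive1 f 0 = X]].

Definition lempert_extremal (R : realType) n (D : set 'rV[R[i]]_n)
    (f : R[i] -> 'rV[R[i]]_n) : Prop :=
  holo_disc D f /\
  exists s1 s2 : R[i], [/\ disc s1, disc s2, s1 <> s2 &
    (poincare s1 s2)%:E = lempert D (f s1) (f s2)].

Definition kobayashi_extremal (R : realType) n (D : set 'rV[R[i]]_n)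
    (f : R[i] -> 'rV[R[i]]_n) : Prop :=
  holo_disc D f /\
  exists2 s : R[i], disc s &
    kobayashi_royden D (f s) (derive1 f s) = ((1 - cabs s ^+ 2)^-1)%:E.

Definition circle (R : realType) : Type :=
  set_type [set z : R[i] | `|z| = 1].

HB.instance Definition _ (R : realType) :=
  Topological.copy (circle R) (set_type [set z : R[i] | `|z| = 1]).

Lemma norm_expi (R : realType) (t : R) : `|expi t| = 1.
Proof. by rewrite normc_def /= cos2Dsin2 sqrtr1. Qed.

Definition circle_expi (R : realType) (t : R) : circle R :=
  SigSub (mem_set (norm_expi t)).

HB.instance Definition _ (R : realType) :=
  isPointed.Build (circle R) (circle_expi (0 : R)).

Definition borel_circle (R : realType) :=
  g_sigma_algebraType (@open (circle R)).

Lemma expi_continuous (R : realType) : continuous (@expi R).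
Proof.
move=> t; apply/cvgrPdist_lt => -[e1 e2] /= /[dup]; rewrite {1}ltcE /=.
move=> /andP[/eqP -> e1_gt0] _.
have e2_gt0 : 0 < e1 / 2 by rewrite divr_gt0.
near=> s.
have hc : `|cos t - cos s| < e1 / 2.
  by near: s; apply: (cvgrPdist_lt _ _).1 => //; exact: continuous_cos.
have hs : `|sin t - sin s| < e1 / 2.
  by near: s; apply: (cvgrPdist_lt _ _).1 => //; exact: continuous_sin.
have -> : expi t - expi s =
    (cos t - cos s)%:C + 'i * (sin t - sin s)%:C.
  by rewrite /expi; simpc.
apply: (le_lt_trans (ler_normD _ _)).
rewrite normrM !normc_def /= !expr0n /= !addr0 add0r expr1n sqrtr1 mul1r.
rewrite !sqrtr_sqr -rmorphD /= ltcR [ltRHS](splitr e1).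
exact: ltrD.
Unshelve. all: by end_near. Qed.

Lemma measurable_circle_expi (R : realType) :
  measurable_fun [set: measurableTypeR R]
    (@circle_expi R : measurableTypeR R -> borel_circle R).
Proof.
apply: (@measurability _ _ (measurableTypeR R) (borel_circle R) _ _
  (@open (circle R))) => //.
move=> _ [_ [U oU <-] <-]; rewrite setTI.
apply: open_measurable.
by move/continuousP : (@expi_continuous R) => /(_ _ oU).
Qed.

Definition arc_length (R : realType) : set (borel_circle R) -> \bar R :=
  pushforward (mrestr (@lebesgue_measure R) (measurable_itv `[0, 2 * pi[))
    (@circle_expi R : measurableTypeR R -> borel_circle R).

HB.instance Definition _ (R : realType) :=
  Measure.copy (@arc_length R)
    (measure_function_pushforward__canonical__measure_function_Measure
      (mrestr (@lebesgue_measure R) (measurable_itv `[0, 2 * pi[))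
      (@measurable_circle_expi R)).

Definition complex_integral (R : realType)
    (mu : {measure set borel_circle R -> \bar R})
    (f : borel_circle R -> R[i]) : R[i] :=
  (\int[mu]_z complex.Re (f z)) +i* (\int[mu]_z complex.Im (f z)).

(* Integral with respect to a finite signed measure through its Jordan
   decomposition, which does not depend on the Hahn decomposition chosen. *)
Definition charge_integral (R : realType)
    (nu : {charge set borel_circle R -> \bar R})
    (f : borel_circle R -> R[i]) : R[i] :=
  let P := cid (Hahn_decomposition nu) in
  let N := cid (projT2 P) in
  complex_integral (jordan_pos (projT2 N)) f -
  complex_integral (jordan_neg (projT2 N)) f.

Definition circle_val (R : realType) (z : borel_circle R) : R[i] :=
  set_val (z : set_type [set z : R[i] | `|z| = 1]).

Definition is_boundary_measure (R : realType) n
    (phi : R[i] -> 'rV[R[i]]_n)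
    (mu : 'I_n -> {charge set borel_circle R -> \bar R}) : Prop :=
  forall (l : R[i]) (j : 'I_n), disc l ->
    phi l 0 j =
      ((2 * pi)^-1)%:C *
        charge_integral (mu j)
          (fun z => (circle_val z + l) / (circle_val z - l)) +
      'i * (complex.Im (phi 0 0 j))%:C.

Definition Mclass (R : realType) n : set (R[i] -> 'rV[R[i]]_n) :=
  [set phi : R[i] -> 'rV[R[i]]_n | holomorphic_on (@disc R) phi /\
             exists mu, is_boundary_measure phi mu].

(* [mu] is the vector measure [g d(arc_length)]. *)
Definition has_density (R : realType) n
    (mu : 'I_n -> {charge set borel_circle R -> \bar R})
    (g : borel_circle R -> 'rV[R]_n) : Prop :=
  forall (j : 'I_n) (A : set (borel_circle R)), measurable A ->
    mu j A = (\int[@arc_length R]_(z in A) (g z 0 j)%:E)%E.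

Definition Hclass (R : realType) n : set (R[i] -> 'rV[R[i]]_n) :=
  [set h : R[i] -> 'rV[R[i]]_n | holomorphic_on setT h /\
     forall l : R[i], `|l| = 1 ->
       forall j, complex.Im (conjc l * h l 0 j) = 0].

Definition dot (R : realType) n (x y : 'rV[R]_n) : R :=
  \sum_(j < n) x 0 j * y 0 j.

Definition base (R : realType) n (D : set 'rV[R[i]]_n) : set 'rV[R]_n :=
  [set re_vec z | z in D].

Definition Pset (R : realType) n (D : set 'rV[R[i]]_n) (v : 'rV[R]_n) :
    set 'rV[R]_n :=
  [set p | closure (base D) p /\ forall x, base D x -> dot (x - p) v < 0].

(* For [h] in [Hclass] and [z] on the circle, [conjc z *: h z] has real
   entries; [re_vec] only changes its type. *)
Definition Gclass (R : realType) n (D : set 'rV[R[i]]_n) :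
    set (borel_circle R -> 'rV[R]_n) :=
  [set g : borel_circle R -> 'rV[R]_n |
    [/\ forall j, measurable_fun setT (fun z => g z 0 j : R),
        forall j, (@arc_length R).-integrable setT (fun z => (g z 0 j)%:E) &
        exists2 h, @Hclass R n h &
          {ae @arc_length R, forall z,
            Pset D (re_vec (conjc (circle_val z) *: h (circle_val z)))
                 (g z)}]].

(* Main.v *)
Require Import Defs.
From HB Require Import structures.
From mathcomp Require Import all_boot all_order all_algebra complex.
From mathcomp Require Import all_classical all_reals all_analysis measurable_realfun.
From mathcomp Require Import ring lra.

Set Implicit Arguments.
Unset Strict Implicit.
Unset Printing Implicit Defensive.

Import Order.TTheory GRing.Theory Num.Theory.
Import numFieldNormedType.Exports.

Local Open Scope classical_set_scope.
Local Open Scope complex_scope.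
Local Open Scope ring_scope.


(** The argument is a convex duality between maps of the disc and their boundary moduli.

    Extremality enters through one rigidity statement, [extremal_rigid]: there are points [s1], [s2]
    (equal in the Kobayashi-Royden case) such that no holomorphic [F] with the data of [f] there
    (two values, or a value and a derivative) leaves slack, in the sense that [e^c F] still maps
    into [G] for some [c > 0]. Slack could be spent on a small linear correction of [F], producing a
    competitor that beats the infimum.

    The other geometric input is that the logarithmic image of [G] is convex ([log_image_convex],
    from pseudoconvexity by a continuity principle) and closed under decreasing coordinates (from
    the Reinhardt property).

    If a coordinate of [f] vanishes identically, the other one solves an extremal problem in a disc
    and Schwarz-Pick gives condition (i) ([vanishing_coordinate]). Otherwise [boundary_log] provides
    integrable boundary values [g j] of [ln |f j|] along a sequence of radii, lying in the closure
    of the logarithmic image, with [|f j|] at most the exponential of the Poisson integral of [g j].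
    Hence [I j = f j * cexp (- herg (g j))] maps the disc into the closed disc. By
    [schwarz_pick_trichotomy] either [I j] is a unimodular constant or an automorphism, and then
    [c j = 0], or some [q j] with the same data satisfies [|q j| <= e^(- c j)] with [c j > 0].

    For a density [u], the value at [s1] of its Herglotz integral (up to an imaginary constant) and
    its divided difference are linear in [u], given by three real kernels. If some [u] well inside
    the logarithmic image had nearly the data of [g - c], then [q j] times the exponential of the
    corrected Herglotz integral of [u j] would contradict rigidity. So a hyperplane in [R^6]
    separates, and [dual_certificate] yields a nonzero matrix [V] whose rows define kernels [kap].
    Testing the certificate gives: the kernels are nonnegative almost everywhere; [c j * V j 0 = 0],
    so a nonzero row forces [c j = 0]; and [g] lies almost everywhere on the supporting line with
    normal the vector of kernels. Up to a common positive factor this normal is [conj z * h z] on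
    the circle for a polynomial map [h] of degree at most two ([kpolyE]), which is the function
    required by [Gclass].

    If both rows of [V] are nonzero, both [I j] are automorphisms or unimodular constants and
    [f j = I j * cexp (herg (g j))] is the form in (ii). If one row is zero, only the other
    coordinate [k] is constrained, so [g k = ln (r k)] almost everywhere ([one_sided]), [I k] is
    [f k / r k], and it must be an automorphism, which is (i). *)

Section complex_modulus.
Context {R : realType}.
Implicit Types z w : R[i].
Local Notation Re := (@complex.Re R).
Local Notation Im := (@complex.Im R).

(** * Real and imaginary parts, the real-valued modulus *)

Lemma complexP z w : Re z = Re w -> Im z = Im w -> z = w.
Proof. by case: z w => [a b] [c d] /= -> ->. Qed.

Lemma ReD z w : Re (z + w) = Re z + Re w.
Proof. by case: z w => [a b] [c d]. Qed.
Lemma ImD z w : Im (z + w) = Im z + Im w.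
Proof. by case: z w => [a b] [c d]. Qed.
Lemma ReN z : Re (- z) = - Re z.
Proof. by case: z => [a b]. Qed.
Lemma ImN z : Im (- z) = - Im z.
Proof. by case: z => [a b]. Qed.
Lemma ReB z w : Re (z - w) = Re z - Re w.
Proof. by rewrite ReD ReN. Qed.
Lemma ImB z w : Im (z - w) = Im z - Im w.
Proof. by rewrite ImD ImN. Qed.
Lemma ReM z w : Re (z * w) = Re z * Re w - Im z * Im w.
Proof. by case: z w => [a b] [c d]. Qed.
Lemma ImM z w : Im (z * w) = Re z * Im w + Im z * Re w.
Proof. by case: z w => [a b] [c d]. Qed.
Lemma ReJ z : Re z^* = Re z.
Proof. by case: z. Qed.
Lemma ImJ z : Im z^* = - Im z.
Proof. by case: z. Qed.
Lemma conjK z : (z^*)^* = z.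
Proof. by apply: complexP; rewrite ?ReJ ?ImJ ?opprK. Qed.
Lemma ReC (x : R) : Re x%:C = x. Proof. by []. Qed.
Lemma ImC (x : R) : Im x%:C = 0. Proof. by []. Qed.
Lemma Re1 : Re 1 = 1. Proof. by []. Qed.
Lemma Im1 : Im 1 = 0. Proof. by []. Qed.
Lemma Re0 : Re 0 = 0. Proof. by []. Qed.
Lemma Im0 : Im 0 = 0. Proof. by []. Qed.

Definition ReImE := (ReD, ImD, ReN, ImN, ReM, ImM, ReJ, ImJ, ReC, ImC, Re1, Im1, Re0, Im0).

Lemma normcE z : `|z| = (cabs z)%:C.
Proof. by rewrite /cabs normc_def. Qed.

Lemma cabsE z : cabs z = Num.sqrt (Re z ^+ 2 + Im z ^+ 2).
Proof. by rewrite /cabs normc_def. Qed.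

Lemma cabs_ge0 z : 0 <= cabs z.
Proof. by rewrite cabsE sqrtr_ge0. Qed.

Lemma cabs_sqr z : cabs z ^+ 2 = Re z ^+ 2 + Im z ^+ 2.
Proof. by rewrite cabsE sqr_sqrtr // addr_ge0 ?sqr_ge0. Qed.

Lemma cabsM z w : cabs (z * w) = cabs z * cabs w.
Proof. by apply: complexI; rewrite rmorphM /= -!normcE normrM. Qed.

Lemma cabsD z w : cabs (z + w) <= cabs z + cabs w.
Proof. by rewrite -lecR rmorphD /= -!normcE ler_normD. Qed.

Lemma cabsN z : cabs (- z) = cabs z.
Proof. by rewrite /cabs normrN. Qed.

Lemma cabsB z w : cabs (z - w) = cabs (w - z).
Proof. by rewrite -cabsN opprB. Qed.

Lemma cabsJ z : cabs z^* = cabs z.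
Proof. by rewrite !cabsE ReJ ImJ sqrrN. Qed.

Lemma cabs0 : cabs (0 : R[i]) = 0.
Proof. by rewrite /cabs normr0. Qed.

Lemma cabs1 : cabs (1 : R[i]) = 1.
Proof. by rewrite /cabs normr1. Qed.

Lemma cabsV z : cabs z^-1 = (cabs z)^-1.
Proof.
by apply: complexI; rewrite -normcE normfV normcE fmorphV.
Qed.

Lemma cabsX z n : cabs (z ^+ n) = cabs z ^+ n.
Proof. by elim: n => [|n IH]; rewrite ?expr0 ?cabs1 // !exprS cabsM IH. Qed.

Lemma cabs_eq0 z : (cabs z == 0) = (z == 0).
Proof. by rewrite -(inj_eq (@complexI R)) -normcE normr_eq0. Qed.

Lemma cabs_gt0 z : (0 < cabs z) = (z != 0).
Proof. by rewrite lt_def cabs_eq0 cabs_ge0 andbT. Qed.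

Lemma cabsC (x : R) : cabs x%:C = `|x|.
Proof. by rewrite cabsE /= expr0n addr0 sqrtr_sqr. Qed.

Lemma cabs_le_dist z w : cabs z - cabs w <= cabs (z - w).
Proof. by rewrite lerBlDr; apply: le_trans (cabsD _ _); rewrite subrK. Qed.

Lemma Re_le_cabs z : `|Re z| <= cabs z.
Proof. by rewrite cabsE -sqrtr_sqr ler_sqrt ?addr_ge0 ?sqr_ge0 // lerDl sqr_ge0. Qed.

Lemma Im_le_cabs z : `|Im z| <= cabs z.
Proof. by rewrite cabsE -sqrtr_sqr ler_sqrt ?addr_ge0 ?sqr_ge0 // lerDr sqr_ge0. Qed.

Lemma cabs_le_ReIm z : cabs z <= `|Re z| + `|Im z|.
Proof.
rewrite -(@ler_pXn2r _ 2) ?nnegrE ?cabs_ge0 ?addr_ge0 //.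
rewrite cabs_sqr sqrrD !real_normK ?num_real // -addrA lerD2l lerDr.
by rewrite mulrn_wge0 // mulr_ge0.
Qed.

Lemma mulrJ z : z * z^* = (cabs z ^+ 2)%:C.
Proof. by rewrite cabs_sqr; apply: complexP; rewrite !ReImE ; ring. Qed.

Lemma disc_cabs z : (@disc R z) = (cabs z < 1) :> Prop.
Proof. by rewrite /disc /= normcE -[1]/((1 : R)%:C) ltcR. Qed.

Lemma norm1_cabs z : (`|z| = 1) = (cabs z = 1) :> Prop.
Proof.
apply/propext; split=> [h|h]; last by rewrite normcE h.
by rewrite /cabs h.
Qed.

Lemma norm_le1_cabs z : (`|z| <= 1) = (cabs z <= 1).
Proof. by rewrite normcE -[1]/((1 : R)%:C) lecR. Qed.

Lemma cabs_expi (t : R) : cabs (expi t) = 1.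
Proof. by rewrite -norm1_cabs norm_expi. Qed.

Lemma expiJ (t : R) : expi t * (expi t)^* = 1.
Proof. by rewrite mulrJ cabs_expi expr1n. Qed.

Lemma lerB_cabs z w : cabs z - cabs w <= cabs (z + w).
Proof. by rewrite -[w in X in _ <= X]opprK -(cabsN w) cabs_le_dist. Qed.

Lemma cvgr_cabsP (T : Type) (F : set_system T) {FF : Filter F} (f : T -> R[i]) l :
  (f x @[x --> F] --> l) <->
  (forall e : R, 0 < e -> \forall x \near F, cabs (f x - l) < e).
Proof.
split=> [/cvgrPdist_lt h e e0|h].
  have e0' : 0 < e%:C :> R[i] by rewrite ltcR.
  by near do rewrite -ltcR -normcE distrC; exact: (h _ e0').
apply/cvgrPdist_lt => -[e1 e2] /[dup]; rewrite {1}ltcE /= => /andP[/eqP -> e10] _.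
by near do rewrite distrC normcE ltcR; exact: h.
Unshelve. all: by end_near. Qed.

Lemma nbhs_cabsP z (P : set R[i]) :
  nbhs z P <-> exists2 e : R, 0 < e & forall w, cabs (w - z) < e -> P w.
Proof.
split=> [/nbhs_ballP[[e1 e2] /= /[dup]]|[e e0 h]].
  rewrite {1}ltcE /= => /andP[/eqP -> e10] _ h; exists e1 => // w wz.
  by apply: h; rewrite /ball /= distrC normcE ltcR.
apply/nbhs_ballP; exists e%:C; first by rewrite /= ltcR.
by move=> w; rewrite /ball /= distrC normcE ltcR; exact: h.
Qed.

Lemma continuous_cabsP (F : R[i] -> R[i]) z : {for z, continuous F} <->
  forall e : R, 0 < e -> exists2 r : R, 0 < r & forall w, cabs (w - z) < r -> cabs (F w - F z) < e.
Proof.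
split=> [/(@cvgr_cabsP _ (nbhs z)) h e /h/nbhs_cabsP //|h].
by apply/(@cvgr_cabsP _ (nbhs z)) => e /h H; exact/nbhs_cabsP.
Qed.

End complex_modulus.

(** * Rules of complex differentiation *)

Section complex_derivative.
Context {R : realType}.
Implicit Types (z w d : R[i]) (f g : R[i] -> R[i]).

(** Differentiability as a linear error estimate with real radii, so that the calculus rules become
    inequalities between moduli. [cder_derivable] and [derivable_cder] link it with [derivable] and
    [derive1]. *)
Definition cder f z d := forall e : R, 0 < e -> exists2 r : R, 0 < r &
  forall h, cabs h < r -> cabs (f (z + h) - f z - d * h) <= e * cabs h.

Lemma cder_derivable f z d : cder f z d -> derivable f z 1 /\ derive1 f z = d.
Proof.
move=> fd.
have cv : (fun h : R[i] => h^-1 *: (f (h *: 1 + z) - f z)) @ 0^' --> d.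
  apply/cvgr_cabsP => e e0.
  have [r r0 H] := fd _ (divr_gt0 e0 (@ltr0Sn R 1)).
  suff : \forall h \near 0^', (h != 0) -> cabs (h^-1 *: (f (h *: 1 + z) - f z) - d) < e.
    move=> S; near=> h; apply: (near S h) => //.
    by near: h; exact: nbhs_dnbhs_neq.
  apply: nbhs_dnbhs; apply/nbhs_cabsP; exists r => // h; rewrite subr0 => hr h0.
  have -> : h^-1 *: (f (h *: 1 + z) - f z) - d = h^-1 * (f (z + h) - f z - d * h).
    by rewrite -[h *: 1]/(h * 1) mulr1 (addrC h) -[_ *: _]/(_ * _) [RHS]mulrBr (mulrC d) mulKf.
  rewrite cabsM cabsV mulrC ltr_pdivrMr ?cabs_gt0 //.
  apply: le_lt_trans (H _ hr) _.
  by rewrite ltr_pM2r ?cabs_gt0 // ltr_pdivrMr // ltr_pMr // ltr1n.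
split; first by apply/cvg_ex; exists d; exact: cv.
by rewrite derive1E /derive; apply/cvg_lim => //; exact: cv.
Unshelve. all: by end_near. Qed.

Lemma derivable_cder f z : derivable f z 1 -> cder f z (derive1 f z).
Proof.
move=> /cvg_ex[/= d cv]; have -> : derive1 f z = d.
  by rewrite derive1E /derive; apply/cvg_lim => //; exact: cv.
move=> e e0; move/cvgr_cabsP : cv => /(_ _ e0) /=.
rewrite near_withinE => /nbhs_cabsP[r r0 H]; exists r => // h hr.
have [->|h0] := eqVneq h 0; first by rewrite addr0 subrr mulr0 subrr cabs0 mulr0.
have := H h; rewrite subr0 => /(_ hr h0) /ltW.
have -> : h^-1 *: (f (h *: 1 + z) - f z) - d = h^-1 * (f (z + h) - f z - d * h).
  by rewrite -[h *: 1]/(h * 1) mulr1 (addrC h) -[_ *: _]/(_ * _) [RHS]mulrBr (mulrC d) mulKf.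
by rewrite cabsM cabsV mulrC ler_pdivrMr ?cabs_gt0.
Qed.

Lemma cder_unique f z d d' : cder f z d -> cder f z d' -> d = d'.
Proof. by move=> /cder_derivable[_ <-] /cder_derivable[_ <-]. Qed.

Lemma cder_near f g z d : (exists2 r : R, 0 < r & forall w, cabs (w - z) < r -> f w = g w) ->
  cder f z d -> cder g z d.
Proof.
move=> [r r0 fg] fd e e0; have [s s0 H] := fd e e0.
exists (Num.min r s); first by rewrite lt_min r0.
move=> h; rewrite lt_min => /andP[hr hs]; rewrite -!fg ?subrr ?cabs0 //; first exact: H.
by rewrite addrC addKr.
Qed.

Lemma cder_cst a z : cder (fun=> a) z 0.
Proof.
by move=> e e0; exists 1 => // h _; rewrite subrr mul0r subrr cabs0 mulr_ge0 ?cabs_ge0 ?ltW.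
Qed.

Lemma cder_id z : cder id z 1.
Proof.
move=> e e0; exists 1 => // h _.
have -> : id (z + h) - id z - 1 * h = 0 by rewrite /=; ring.
by rewrite cabs0 mulr_ge0 ?cabs_ge0 ?ltW.
Qed.

Lemma cderD f g z a b : cder f z a -> cder g z b -> cder (fun w => f w + g w) z (a + b).
Proof.
move=> fa gb e e0; have e20 : 0 < e / 2 by rewrite divr_gt0.
have [r r0 Hr] := fa _ e20; have [s s0 Hs] := gb _ e20.
exists (Num.min r s); first by rewrite lt_min r0.
move=> h; rewrite lt_min => /andP[hr hs].
have -> : f (z + h) + g (z + h) - (f z + g z) - (a + b) * h =
  (f (z + h) - f z - a * h) + (g (z + h) - g z - b * h) by ring.
apply: le_trans (cabsD _ _) _.
by rewrite [e]splitr mulrDl lerD ?Hr ?Hs.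
Qed.

Lemma cderZ f z a c : cder f z a -> cder (fun w => c * f w) z (c * a).
Proof.
move=> fa e e0; have c0 : 0 < cabs c + 1 by rewrite ltr_wpDl ?cabs_ge0.
have [r r0 Hr] := fa _ (divr_gt0 e0 c0); exists r => // h hr.
have -> : c * f (z + h) - c * f z - c * a * h = c * (f (z + h) - f z - a * h) by ring.
rewrite cabsM; apply: (@le_trans _ _ ((cabs c + 1) * (e / (cabs c + 1) * cabs h))).
  by rewrite ler_pM ?cabs_ge0 ?lerDl ?Hr.
by rewrite mulrA mulrCA divff ?mulr1 // gt_eqF.
Qed.

Lemma cderN f z a : cder f z a -> cder (fun w => - f w) z (- a).
Proof.
move=> /(@cderZ _ _ _ (-1)); rewrite mulN1r; apply: cder_near.
by exists 1 => // w _; rewrite mulN1r.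
Qed.

Lemma cderB f g z a b : cder f z a -> cder g z b -> cder (fun w => f w - g w) z (a - b).
Proof. by move=> fa gb; apply: cderD => //; exact: cderN. Qed.

Lemma cder_lip f z a : cder f z a -> exists2 r : R, 0 < r &
  forall h, cabs h < r -> cabs (f (z + h) - f z) <= (cabs a + 1) * cabs h.
Proof.
move=> fa; have [r r0 H] := fa _ (@ltr01 R); exists r => // h hr.
rewrite -(subrK (a * h) (f (z + h) - f z)) mulrDl addrC.
by apply: le_trans (cabsD _ _) _; rewrite cabsM lerD2l H.
Qed.

Lemma cder_cvg f z a : cder f z a -> {for z, continuous f}.
Proof.
move=> /cder_lip[r r0 H]; apply/(@cvgr_cabsP _ _ (nbhs z)) => e e0.
have c0 : 0 < cabs a + 1 by rewrite ltr_wpDl ?cabs_ge0.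
apply/nbhs_cabsP; exists (Num.min r (e / (cabs a + 1))); first by rewrite lt_min r0 divr_gt0.
move=> w; rewrite lt_min => /andP[wr we]; rewrite -(subrKC z w).
apply: le_lt_trans (H _ wr) _.
by rewrite mulrC -ltr_pdivlMr.
Qed.

Lemma cder_comp f g z a b : cder f z a -> cder g (f z) b ->
  cder (fun w => g (f w)) z (b * a).
Proof.
move=> fa gb e e0.
have a0 : 0 < cabs a + 1 by rewrite ltr_wpDl ?cabs_ge0.
have b0 : 0 < cabs b + 1 by rewrite ltr_wpDl ?cabs_ge0.
have e1 : 0 < e / 2 / (cabs a + 1) by rewrite !divr_gt0.
have e2 : 0 < e / 2 / (cabs b + 1) by rewrite !divr_gt0.
have [r r0 Hr] := cder_lip fa; have [s s0 Hs] := fa _ e2.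
have [u u0 Hu] := gb _ e1.
exists (Num.min r (Num.min s (u / (cabs a + 1)))).
  by rewrite !lt_min r0 s0 divr_gt0.
move=> h; rewrite !lt_min => /and3P[hr hs hu].
set k := f (z + h) - f z.
have kh : cabs k <= (cabs a + 1) * cabs h by exact: Hr.
have ku : cabs k < u by apply: le_lt_trans kh _; rewrite mulrC -ltr_pdivlMr.
have -> : g (f (z + h)) - g (f z) - b * a * h =
  (g (f z + k) - g (f z) - b * k) + b * (k - a * h) by rewrite /k subrKC; ring.
apply: le_trans (cabsD _ _) _; rewrite [e]splitr mulrDl lerD //.
  apply: le_trans (Hu _ ku) _.
  apply: (@le_trans _ _ (e / 2 / (cabs a + 1) * ((cabs a + 1) * cabs h))).
    by rewrite ler_wpM2l // ltW.
  by rewrite mulrA divfK // gt_eqF.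
rewrite cabsM; apply: (@le_trans _ _ ((cabs b + 1) * (e / 2 / (cabs b + 1) * cabs h))).
  by rewrite ler_pM ?cabs_ge0 ?lerDl ?Hs.
by rewrite mulrA mulrCA divff ?mulr1 // gt_eqF.
Qed.

Lemma cder_sqr z : cder (fun w => w * w) z (2 * z).
Proof.
move=> e e0; exists e => // h he.
have -> : (z + h) * (z + h) - z * z - 2 * z * h = h * h by ring.
by rewrite cabsM ler_wpM2r ?cabs_ge0 // ltW.
Qed.

(** Polarisation: [f g] is a quarter of [(f + g)^2 - (f - g)^2], which reduces the product rule to
    the chain rule for squaring. *)
Lemma cderM f g z a b : cder f z a -> cder g z b ->
  cder (fun w => f w * g w) z (a * g z + f z * b).
Proof.
move=> fa gb.
have H1 := cder_comp (cderD fa gb) (@cder_sqr (f z + g z)).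
have H2 := cder_comp (cderB fa gb) (@cder_sqr (f z - g z)).
have H3 := cderZ 4^-1 (cderB H1 H2).
have -> : a * g z + f z * b =
  4^-1 * (2 * (f z + g z) * (a + b) - 2 * (f z - g z) * (a - b)).
  by field.
by apply: cder_near H3; exists 1 => // w _; field.
Qed.

Lemma cder_inv z : z != 0 -> cder (fun w => w^-1) z (- z ^- 2).
Proof.
move=> z0 e e0; have zp : 0 < cabs z by rewrite cabs_gt0.
pose r := Num.min (cabs z / 2) (e * cabs z ^+ 3 / 2).
have r0 : 0 < r by rewrite lt_min !divr_gt0 ?mulr_gt0 ?exprn_gt0.
exists r => // h; rewrite lt_min => /andP[h1 h2].
have zh : cabs z / 2 <= cabs (z + h).
  have := lerB_cabs z h; lra.
have zh0 : z + h != 0 by rewrite -cabs_gt0; lra.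
have -> : (z + h)^-1 - z^-1 - - z ^- 2 * h = h * (h * (z ^- 2 * (z + h)^-1)).
  by field; rewrite z0 zh0.
rewrite cabsM mulrC ler_wpM2r ?cabs_ge0 // !cabsM !cabsV cabsX.
have h3 : (cabs (z + h))^-1 <= 2 / cabs z.
  by rewrite -[2 / cabs z]invrK invf_div lef_pV2 ?posrE ?divr_gt0 //; lra.
apply: (@le_trans _ _ ((e * cabs z ^+ 3 / 2) * (cabs z ^- 2 * (2 / cabs z)))).
  rewrite ler_pM ?cabs_ge0 // ?mulr_ge0 ?invr_ge0 ?exprn_ge0 ?cabs_ge0 //; first exact: ltW.
  by rewrite ler_wpM2l // invr_ge0 exprn_ge0 ?cabs_ge0.
by rewrite le_eqVlt; apply/orP; left; apply/eqP; field; rewrite gt_eqF.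
Qed.

Lemma cderV f z a : f z != 0 -> cder f z a -> cder (fun w => (f w)^-1) z (- a / f z ^+ 2).
Proof. by move=> f0 fa; rewrite mulNr mulrC -mulNr; apply: cder_comp fa (cder_inv f0). Qed.

Lemma cderX f z a n : cder f z a -> cder (fun w => f w ^+ n) z (n%:R * f z ^+ n.-1 * a).
Proof.
move=> fa; elim: n => [|n IH].
  rewrite !mul0r; have := @cder_cst 1 z; apply: cder_near.
  by exists 1 => // w _; rewrite expr0.
have := cderM fa IH; rewrite -pred_Sn.
have -> : a * f z ^+ n + f z * (n%:R * f z ^+ n.-1 * a) = n.+1%:R * f z ^+ n * a.
  case: n {IH} => [|n]; first by rewrite !mul0r mulr0 addr0 expr0; ring.
  by rewrite -pred_Sn exprS -[n.+2%:R]natr1; ring.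
by apply: cder_near; exists 1 => // w _; rewrite exprS.
Qed.

Lemma cder_conj f z d : cder f z^* d -> cder (fun w => (f w^*)^*) z d^*.
Proof.
move=> fd e e0; have [r r0 H] := fd _ e0; exists r => // h hr.
have := H h^*; rewrite cabsJ => /(_ hr); rewrite -[cabs (f _ - _ - _)]cabsJ.
have -> // : (f (z^* + h^*) - f z^* - d * h^*)^* = (f (z + h)^*)^* - (f z^*)^* - d^* * h.
by rewrite !rmorphB rmorphM rmorphD /= conjK.
Qed.

End complex_derivative.

(** * The complex exponential: derivative, modulus, surjectivity *)

Section complex_exponential.
Context {R : realType}.
Implicit Types z w : R[i].
Local Notation Re := (@complex.Re R).
Local Notation Im := (@complex.Im R).

Lemma Re_cexp z : Re (cexp z) = expR (Re z) * cos (Im z).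
Proof. by rewrite /cexp !ReImE mul0r subr0. Qed.

Lemma Im_cexp z : Im (cexp z) = expR (Re z) * sin (Im z).
Proof. by rewrite /cexp !ReImE mul0r addr0. Qed.

Lemma cabs_cexp z : cabs (cexp z) = expR (Re z).
Proof.
rewrite cabsE Re_cexp Im_cexp !exprMn -mulrDr cos2Dsin2 mulr1.
by rewrite sqrtr_sqr ger0_norm ?expR_ge0.
Qed.

Lemma cexp_neq0 z : cexp z != 0.
Proof. by rewrite -cabs_gt0 cabs_cexp expR_gt0. Qed.

Lemma cexpD z w : cexp (z + w) = cexp z * cexp w.
Proof.
apply: complexP; rewrite ?(ReM, ImM) !(Re_cexp, Im_cexp, ReD, ImD) expRD ?(cosD, sinD) /=; ring.
Qed.

Lemma cexp0 : cexp 0 = 1 :> R[i].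
Proof. by apply: complexP; rewrite ?Re_cexp ?Im_cexp /= expR0 ?cos0 ?sin0 ?mul1r ?mulr0. Qed.

Lemma cexpN z : cexp (- z) = (cexp z)^-1.
Proof.
apply: (mulfI (cexp_neq0 z)).
by rewrite -cexpD subrr cexp0 mulfV ?cexp_neq0.
Qed.

Lemma cexpB z w : cexp (z - w) = cexp z / cexp w.
Proof. by rewrite cexpD cexpN. Qed.

Lemma cexpE (x y : R) : cexp (x +i* y) = (expR x)%:C * expi y.
Proof. by []. Qed.

Lemma expi0 : expi 0 = 1 :> R[i].
Proof. by rewrite /expi cos0 sin0. Qed.

Lemma expi_2pi : expi (2 * pi) = 1 :> R[i].
Proof. by rewrite /expi mulrC mulr_natr cos2pi sin2pi. Qed.

Lemma is_derive_linear_bound (f : R -> R) (x d : R) : is_derive x 1 f d ->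
  forall e : R, 0 < e -> exists2 r : R, 0 < r &
  forall h, `|h| < r -> `|f (x + h) - f x - d * h| <= e * `|h|.
Proof.
move=> [+ fd] e e0; rewrite -fd => /cvg_ex[/= l]; rewrite /derive => cv.
have -> : lim (h^-1 *: (f (h *: 1 + x) - f x) @[h --> 0^']) = l by exact: cvg_lim.
move/cvgrPdist_lt : cv => /(_ _ e0); rewrite near_withinE => /nbhs_ballP[r /= r0 H].
exists r => // h hr.
have [->|h0] := eqVneq h 0; first by rewrite addr0 subrr mulr0 subrr normr0 mulr0.
have := H h; rewrite /ball /= sub0r normrN => /(_ hr h0) /ltW.
have -> : l - h^-1 *: (f (h *: 1 + x) - f x) = - h^-1 * (f (x + h) - f x - l * h).
  by rewrite -[h *: 1]/(h * 1) mulr1 (addrC h) -[_ *: _]/(_ * _); field.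
by rewrite normrM normrN normfV mulrC ler_pdivrMr // normr_gt0.
Qed.

(** First-order expansions of [expR], [cos] and [sin] at 0 suffice here; the functional equation
    carries the result to every point in [cder_cexp]. *)
Lemma cder_cexp0 : cder (@cexp R) 0 1.
Proof.
move=> e e0; have e4 : 0 < e / 8 by rewrite divr_gt0.
have [r1 r10 H1] := is_derive_linear_bound (@is_derive_expR R 0) e4.
have [r2 r20 H2] := is_derive_linear_bound (@is_derive_cos R 0) e4.
have [r3 r30 H3] := is_derive_linear_bound (@is_derive_sin R 0) e4.
pose r := Num.min 1 (Num.min (e / 8) (Num.min r1 (Num.min r2 r3))).
exists r; first by rewrite !lt_min ltr01 e4 r10 r20 r30.
move=> h; rewrite !lt_min => /and5P[h1 he hr1 hr2 hr3].
rewrite add0r cexp0 mul1r.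
have := Re_le_cabs h; have := Im_le_cabs h.
set x := Re h; set y := Im h; set c := cabs h => yc xc.
have := H1 x; have := H2 y; have := H3 y.
rewrite !add0r expR0 cos0 sin0 oppr0 mul0r !mul1r !(subr0, addr0).
move=> /(_ (le_lt_trans yc hr3)) H3' /(_ (le_lt_trans yc hr2)) H2' /(_ (le_lt_trans xc hr1)) H1'.
have c0 : 0 <= c by exact: cabs_ge0.
apply: le_trans (cabs_le_ReIm _) _.
rewrite !ReB !ImB Re_cexp Im_cexp /= -/x -/y subr0.
have -> : expR x * cos y - 1 - x = (expR x - 1 - x) * cos y + (cos y - 1) + x * (cos y - 1) by ring.
have -> : expR x * sin y - y = (expR x - 1 - x) * sin y + (sin y - y) + x * sin y by ring.
have ey : e / 8 * `|y| <= e / 8 * c by rewrite ler_wpM2l // ltW.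
have ex : e / 8 * `|x| <= e / 8 * c by rewrite ler_wpM2l // ltW.
have M (u v k : R) : `|u| <= k -> `|v| <= 1 -> `|u * v| <= k.
  by move=> uk v1; rewrite normrM (le_trans _ uk) // ler_piMr.
have A1 : `|(expR x - 1 - x) * cos y| <= e / 8 * c by apply: (M); [apply: (le_trans H1')|exact: cos_max].
have A2 : `|(expR x - 1 - x) * sin y| <= e / 8 * c by apply: (M); [apply: (le_trans H1')|exact: sin_max].
have A3 : `|cos y - 1| <= e / 8 * c by exact: le_trans H2' ey.
have A4 : `|sin y - y| <= e / 8 * c by exact: le_trans H3' ey.
have A5 : `|x * (cos y - 1)| <= e / 8 * c.
  rewrite mulrC; apply: M => //; apply: le_trans xc _; exact: ltW.
have A6 : `|x * (sin y - y)| <= e / 8 * c.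
  by rewrite mulrC; apply: M => //; apply: le_trans xc _; exact: ltW.
have A7 : `|x * y| <= e / 8 * c.
  by rewrite normrM ler_pM //; apply: le_trans xc (ltW he).
have -> : x * sin y = x * (sin y - y) + x * y by ring.
move/ler_normlP: A1 => [? ?]; move/ler_normlP: A2 => [? ?].
move/ler_normlP: A3 => [? ?]; move/ler_normlP: A4 => [? ?].
move/ler_normlP: A5 => [? ?]; move/ler_normlP: A6 => [? ?].
move/ler_normlP: A7 => [? ?].
have ec : 0 <= e * c by rewrite mulr_ge0 // ltW.
(* Three error terms in the real part and four in the imaginary part, each at most [e / 8 * c]. *)
rewrite [leRHS](_ : _ = 3 * (e / 8 * c) + 5 * (e / 8 * c)); last by field.
by rewrite lerD // ler_norml; apply/andP; split; lra.
Qed.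

Lemma cder_cexp z : cder (@cexp R) z (cexp z).
Proof.
have H1 : cder (fun w => w - z) z 1.
  by have := cderB (cder_id z) (cder_cst z z); rewrite subr0.
have H2 := cderZ (cexp z) (cder_comp (g := @cexp R) H1 (a := 1) (b := 1)
  (eq_rect _ (fun t => cder _ t _) cder_cexp0 _ (esym (subrr z)))).
rewrite !mulr1 in H2; apply: cder_near H2.
by exists 1 => // w _; rewrite -cexpD subrKC.
Qed.

Lemma unimodular_expi z : cabs z = 1 -> exists2 t : R, -pi <= t <= pi & expi t = z.
Proof.
move=> z1; set x := Re z; set y := Im z.
have xy : x ^+ 2 + y ^+ 2 = 1 by rewrite -cabs_sqr z1 expr1n.
have x1 : -1 <= x <= 1.
  by rewrite -ler_norml -(@expr_le1 _ 2) // real_normK ?num_real // -xy lerDl sqr_ge0.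
have a0 := acos_ge0 x1; have api := acos_lepi x1.
pose t := if 0 <= y then acos x else - acos x.
have ct : cos t = x by rewrite /t; case: ifP => _; rewrite ?cosN acosK // in_itv /= x1.
have st : sin t = y.
  have h := sin_acos x1.
  have y2 : y ^+ 2 = 1 - x ^+ 2 by rewrite -xy addrC addKr.
  rewrite /t; case: ifPn => y0; rewrite ?sinN h -y2 sqrtr_sqr; first by rewrite ger0_norm.
  by rewrite ltr0_norm ?opprK // ltNge.
exists t; last by apply: complexP.
by rewrite /t; case: ifP => _; lra.
Qed.

Lemma cexp_surj z : z != 0 -> exists w, cexp w = z.
Proof.
move=> z0; have c0 : 0 < cabs z by rewrite cabs_gt0.
have cV : (cabs z)%:C * ((cabs z)^-1)%:C = 1 :> R[i].
  by rewrite -rmorphM /= divff // gt_eqF.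
have [|t _ tz] := @unimodular_expi (((cabs z)^-1)%:C * z).
  by rewrite cabsM cabsC ger0_norm ?invr_ge0 ?cabs_ge0 // mulVf // gt_eqF.
exists (ln (cabs z) +i* t).
by rewrite cexpE lnK ?posrE // tz mulrA cV mul1r.
Qed.

End complex_exponential.

(** * Integration of complex-valued functions *)

Section complex_integral.
Context {d : measure_display} {T : measurableType d} {R : realType}.
Variable mu : {measure set T -> \bar R}.
Implicit Types (D : set T) (F G : T -> R[i]) (f : T -> R).
Local Notation Re := (@complex.Re R).
Local Notation Im := (@complex.Im R).

Definition cint D F : R[i] :=
  (\int[mu]_(x in D) Re (F x)) +i* (\int[mu]_(x in D) Im (F x)).

Definition cintegrable D F :=
  mu.-integrable D (EFin \o (Re \o F)) /\ mu.-integrable D (EFin \o (Im \o F)).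

Definition cmeasurable D F :=
  measurable_fun D (Re \o F) /\ measurable_fun D (Im \o F).

Lemma Re_cint D F : Re (cint D F) = \int[mu]_(x in D) Re (F x).
Proof. by []. Qed.
Lemma Im_cint D F : Im (cint D F) = \int[mu]_(x in D) Im (F x).
Proof. by []. Qed.

Lemma eq_cint D F G : (forall x, D x -> F x = G x) -> cint D F = cint D G.
Proof.
by move=> FG; congr (_ +i* _); apply: eq_Rintegral => x /set_mem /FG ->.
Qed.

Lemma eq_cintegrable D F G : measurable D -> (forall x, D x -> F x = G x) ->
  cintegrable D F -> cintegrable D G.
Proof.
move=> mD FG [h1 h2]; split; [move: h1|move: h2]; apply: eq_integrable => // x /set_mem Dx /=;
  by rewrite FG.
Qed.

Lemma cintegrable_measurable D F : cintegrable D F -> cmeasurable D F.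
Proof. by move=> [/measurable_int/measurable_EFinP ? /measurable_int/measurable_EFinP ?]. Qed.

Lemma cmeasurableD D F G : cmeasurable D F -> cmeasurable D G ->
  cmeasurable D (fun x => F x + G x).
Proof.
move=> [F1 F2] [G1 G2]; split.
  by rewrite (_ : _ \o _ = (fun x => Re (F x) + Re (G x))); [exact: measurable_funD|
    apply/funext => x /=; rewrite ReD].
by rewrite (_ : _ \o _ = (fun x => Im (F x) + Im (G x))); [exact: measurable_funD|
  apply/funext => x /=; rewrite ImD].
Qed.

Lemma cmeasurableM D F G : cmeasurable D F -> cmeasurable D G ->
  cmeasurable D (fun x => F x * G x).
Proof.
move=> [F1 F2] [G1 G2]; split.
  rewrite (_ : _ \o _ = (fun x => Re (F x) * Re (G x) - Im (F x) * Im (G x))); last first.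
    by apply/funext => x /=; rewrite ReM.
  by apply: measurable_funB; exact: measurable_funM.
rewrite (_ : _ \o _ = (fun x => Re (F x) * Im (G x) + Im (F x) * Re (G x))); last first.
  by apply/funext => x /=; rewrite ImM.
by apply: measurable_funD; exact: measurable_funM.
Qed.

Lemma cmeasurable_cst D (c : R[i]) : cmeasurable D (fun=> c).
Proof. by split; exact: measurable_cst. Qed.

Lemma cmeasurable_real D f : measurable_fun D f -> cmeasurable D (fun x => (f x)%:C).
Proof. by move=> mf; split; [exact: mf|exact: measurable_cst]. Qed.

Lemma measurable_cabs D F : cmeasurable D F -> measurable_fun D (fun x => cabs (F x)).
Proof.
move=> [F1 F2].
rewrite (_ : (fun _ => _) = (fun x => Num.sqrt (Re (F x) ^+ 2 + Im (F x) ^+ 2))).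
  apply: (measurableT_comp (continuous_measurable_fun (@sqrt_continuous R))).
  by apply: measurable_funD; exact: measurable_funX.
by apply/funext => x; rewrite cabsE.
Qed.

Lemma cintegrable_cabs D F : measurable D -> cintegrable D F ->
  mu.-integrable D (EFin \o (fun x => cabs (F x))).
Proof.
move=> mD iF; have [i1 i2] := iF.
have i3 := integrableD mD (integrable_abse i1) (integrable_abse i2).
apply: le_integrable i3 => //.
  by apply/measurable_EFinP/measurable_cabs/cintegrable_measurable.
move=> x _ /=; rewrite lee_fin ger0_norm ?cabs_ge0 //.
by rewrite (le_trans (cabs_le_ReIm _)) // ler_norm.
Qed.

Lemma cintegrable_le D F f : measurable D -> cmeasurable D F ->
  mu.-integrable D (EFin \o f) -> (forall x, D x -> cabs (F x) <= f x) -> cintegrable D F.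
Proof.
move=> mD [mF1 mF2] fi Ff; split; apply: le_integrable fi => //=;
  try (exact/measurable_EFinP); move=> x Dx; rewrite lee_fin (le_trans _ (ler_norm _)) //;
  rewrite (le_trans _ (Ff _ Dx)) // ?Re_le_cabs ?Im_le_cabs //.
Qed.

Lemma finite_integrable_cst D (k : R) : measurable D -> (mu D < +oo)%E ->
  mu.-integrable D (EFin \o cst k).
Proof.
move=> mD Doo; apply: measurable_bounded_integrable => //.
exact: bounded_cst.
Qed.

Lemma cintegrable_bounded D F M : measurable D -> (mu D < +oo)%E -> cmeasurable D F ->
  (forall x, D x -> cabs (F x) <= M) -> cintegrable D F.
Proof.
move=> mD Doo mF FM; apply: (@cintegrable_le _ _ (cst M)) => //.
exact: finite_integrable_cst.
Qed.

Lemma cintegrableM_bounded D F G M : measurable D -> cintegrable D F -> cmeasurable D G ->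
  (forall x, D x -> cabs (G x) <= M) -> cintegrable D (fun x => F x * G x).
Proof.
move=> mD iF mG GM.
apply: (@cintegrable_le _ _ (fun x => M * cabs (F x))) => //.
- exact: cmeasurableM (cintegrable_measurable iF) mG.
- rewrite (_ : _ \o _ = (fun x => M%:E * (EFin \o (fun x => cabs (F x))) x)%E).
    by apply: integrableZl => //; exact: cintegrable_cabs.
  by apply/funext => x; rewrite /= EFinM.
- by move=> x Dx; rewrite cabsM mulrC ler_wpM2r ?cabs_ge0 ?GM.
Qed.

Lemma cintegrableD D F G : measurable D -> cintegrable D F -> cintegrable D G ->
  cintegrable D (fun x => F x + G x).
Proof.
move=> mD [F1 F2] [G1 G2]; split.
  by move: (integrableD mD F1 G1); apply: eq_integrable => // x _ /=; rewrite ReD.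
by move: (integrableD mD F2 G2); apply: eq_integrable => // x _ /=; rewrite ImD.
Qed.

Lemma cintegrableZ D F c : measurable D -> cintegrable D F ->
  cintegrable D (fun x => c * F x).
Proof.
move=> mD iF; apply: (@cintegrable_le _ _ (fun x => cabs c * cabs (F x))) => //.
- by apply: cmeasurableM (cintegrable_measurable iF); exact: cmeasurable_cst.
- rewrite (_ : _ \o _ = (fun x => (cabs c)%:E * (EFin \o (fun x => cabs (F x))) x)%E).
    by apply: integrableZl => //; exact: cintegrable_cabs.
  by apply/funext => x; rewrite /= EFinM.
- by move=> x Dx; rewrite cabsM.
Qed.

Lemma cintegrableN D F : measurable D -> cintegrable D F -> cintegrable D (fun x => - F x).
Proof.
by move=> mD /(cintegrableZ (-1) mD); apply: eq_cintegrable => // x _; rewrite mulN1r.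
Qed.

Lemma cintegrableB D F G : measurable D -> cintegrable D F -> cintegrable D G ->
  cintegrable D (fun x => F x - G x).
Proof. by move=> mD iF iG; apply: cintegrableD => //; exact: cintegrableN. Qed.

Lemma cintD D F G : measurable D -> cintegrable D F -> cintegrable D G ->
  cint D (fun x => F x + G x) = cint D F + cint D G.
Proof.
move=> mD [F1 F2] [G1 G2]; apply: complexP; rewrite ?(ReD, ImD) /=.
  by rewrite -RintegralD //; apply: eq_Rintegral => x _; rewrite ReD.
by rewrite -RintegralD //; apply: eq_Rintegral => x _; rewrite ImD.
Qed.

Lemma cintZ D F c : measurable D -> cintegrable D F ->
  cint D (fun x => c * F x) = c * cint D F.
Proof.
move=> mD [F1 F2].
have iZ (k : R) f : mu.-integrable D (EFin \o f) -> mu.-integrable D (EFin \o (fun x => k * f x)).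
  by move=> /(integrableZl mD k); apply: eq_integrable.
apply: complexP; rewrite ?(ReM, ImM) /= -!RintegralZl //.
  rewrite -RintegralB //; try exact: iZ.
  by apply: eq_Rintegral => x _; rewrite ReM.
rewrite -RintegralD //; try exact: iZ.
by apply: eq_Rintegral => x _; rewrite ImM.
Qed.

Lemma cintN D F : measurable D -> cintegrable D F -> cint D (fun x => - F x) = - cint D F.
Proof. by move=> mD iF; rewrite -mulN1r -cintZ //; apply: eq_cint => x _; rewrite mulN1r. Qed.

Lemma cintB D F G : measurable D -> cintegrable D F -> cintegrable D G ->
  cint D (fun x => F x - G x) = cint D F - cint D G.
Proof. by move=> mD iF iG; rewrite cintD ?cintN //; exact: cintegrableN. Qed.

Lemma cint_cst D c : measurable D -> cint D (fun=> c) = c * (fine (mu D))%:C.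
Proof.
by move=> mD; apply: complexP; rewrite ?(ReM, ImM) /= Rintegral_cst // mulr0 ?subr0 ?add0r.
Qed.

(** Test the integral [I] against its own conjugate: [|I|^2] is the integral of [Re (conj I * F)],
    hence at most [|I|] times the integral of [|F|]. *)
Lemma cabs_cint_le D F : measurable D -> cintegrable D F ->
  cabs (cint D F) <= \int[mu]_(x in D) cabs (F x).
Proof.
move=> mD iF; set I := cint D F.
have [->|I0] := eqVneq I 0.
  by rewrite cabs0; apply: Rintegral_ge0 => x _; exact: cabs_ge0.
have c0 : 0 < cabs I by rewrite cabs_gt0.
rewrite -(ler_pM2l c0) -expr2.
have -> : cabs I ^+ 2 = Re (I^* * I) by rewrite mulrC mulrJ.
rewrite -cintZ // Re_cint -RintegralZl //; last exact: cintegrable_cabs.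
apply: le_Rintegral => //; first by have [] := cintegrableZ I^* mD iF.
  by have := integrableZl mD (cabs I) (cintegrable_cabs mD iF); apply: eq_integrable.
by move=> x _; rewrite (le_trans (ler_norm _)) // (le_trans (Re_le_cabs _)) // cabsM cabsJ.
Qed.

Lemma cabs_cint_bound D F (M : R) : measurable D -> (mu D < +oo)%E -> cintegrable D F ->
  (forall x, D x -> cabs (F x) <= M) -> cabs (cint D F) <= M * fine (mu D).
Proof.
move=> mD Doo iF FM; apply: le_trans (cabs_cint_le mD iF) _.
rewrite -Rintegral_cst //; apply: le_Rintegral => //; first exact: cintegrable_cabs.
exact: finite_integrable_cst.
Qed.

End complex_integral.

(** * Contour integrals along rectangles *)

Section rectangle.
Context {R : realType}.
Local Notation leb := (@lebesgue_measure R).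
Local Notation Re := (@complex.Re R).
Local Notation Im := (@complex.Im R).
Implicit Types (F : R -> R[i]) (g : R[i] -> R[i]).

Lemma continuous_Re (T : topologicalType) (F : T -> R[i]) x : {for x, continuous F} -> {for x, continuous (Re \o F)}.
Proof.
move=> /cvgr_cabsP cF; apply/cvgrPdist_lt => e /cF cFe; near do rewrite distrC -ReB.
by near=> y; apply: le_lt_trans (Re_le_cabs _) _; near: y.
Unshelve. all: by end_near. Qed.

Lemma continuous_Im (T : topologicalType) (F : T -> R[i]) x : {for x, continuous F} -> {for x, continuous (Im \o F)}.
Proof.
move=> /cvgr_cabsP cF; apply/cvgrPdist_lt => e /cF cFe; near do rewrite distrC -ImB.
by near=> y; apply: le_lt_trans (Im_le_cabs _) _; near: y.
Unshelve. all: by end_near. Qed.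

Lemma continuous_cintegrable F (a b : R) :
  (forall x, a <= x <= b -> {for x, continuous F}) -> cintegrable leb `[a, b] F.
Proof.
move=> cF; split; (apply: continuous_compact_integrable; first exact: segment_compact);
  apply: continuous_in_subspaceT => x; rewrite inE /= in_itv /= => /cF.
  exact: continuous_Re.
exact: continuous_Im.
Qed.

Lemma cint_itv_split F (a m b : R) : a <= m <= b -> cintegrable leb `[a, b] F ->
  cint leb `[a, b] F = cint leb `[a, m] F + cint leb `[m, b] F.
Proof.
move=> /andP[am mb] [F1 F2].
have S (f : R -> R) : leb.-integrable `[a, b] (EFin \o f) ->
    \int[leb]_(x in `[a, b]) f x = \int[leb]_(x in `[a, m]) f x + \int[leb]_(x in `[m, b]) f x.
  move=> fi; rewrite -(Rintegral_itv_obnd_cbnd (r := m)).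
    by rewrite -(Rintegral_itvB fi) ?bnd_simp // subrKC.
  by apply: integrableS fi => // x /=; rewrite !in_itv /= => /andP[/ltW mx ->];
    rewrite (le_trans am mx).
by apply: complexP; rewrite ?(ReD, ImD) /= S.
Qed.

Lemma fine_leb_itv (a b : R) : a <= b -> fine (leb `[a, b]) = b - a.
Proof.
rewrite lebesgue_measure_itv /= lte_fin le_eqVlt => /orP[/eqP ->|->//].
by rewrite ltxx subrr.
Qed.

Lemma leb_itv_lty (a b : R) : (leb `[a, b] < +oo)%E.
Proof. by rewrite lebesgue_measure_itv /=; case: ifP => // _; rewrite -EFinB ltry. Qed.

Lemma cabs_cint_itv F (a b M : R) : a <= b -> cintegrable leb `[a, b] F ->
  (forall x, a <= x <= b -> cabs (F x) <= M) -> cabs (cint leb `[a, b] F) <= M * (b - a).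
Proof.
move=> ab iF FM; rewrite -(fine_leb_itv ab); apply: cabs_cint_bound => //.
exact: leb_itv_lty.
Qed.

(** The counterclockwise contour integral along the boundary of [[a, b] x [c, d]], with opposite
    sides grouped under one integral. *)
Definition rect g (a b c d : R) : R[i] :=
  cint leb `[a, b] (fun x => g (x +i* c) - g (x +i* d)) +
  'i * cint leb `[c, d] (fun y => g (b +i* y) - g (a +i* y)).

Definition cder_rect g (a b c d : R) :=
  forall x y, a <= x <= b -> c <= y <= d -> exists l, cder g (x +i* y) l.

Lemma continuous_hseg g x y l : cder g (x +i* y) l ->
  {for x, continuous (fun t => g (t +i* y))}.
Proof.
move=> /cder_cvg/(@cvgr_cabsP _ _ (nbhs (x +i* y))) cg.
apply/cvgr_cabsP => e /cg /nbhs_cabsP[r r0 H].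
apply/nbhs_ballP; exists r => // t /= tx; apply: H; apply: le_lt_trans (cabs_le_ReIm _) _.
by rewrite !ReImE /= subrr normr0 addr0 distrC.
Qed.

Lemma continuous_vseg g x y l : cder g (x +i* y) l ->
  {for y, continuous (fun t => g (x +i* t))}.
Proof.
move=> /cder_cvg/(@cvgr_cabsP _ _ (nbhs (x +i* y))) cg.
apply/cvgr_cabsP => e /cg /nbhs_cabsP[r r0 H].
apply/nbhs_ballP; exists r => // t /= ty; apply: H; apply: le_lt_trans (cabs_le_ReIm _) _.
by rewrite !ReImE /= subrr normr0 add0r distrC.
Qed.

Lemma cintegrable_hseg g a b c d y : cder_rect g a b c d -> c <= y <= d ->
  cintegrable leb `[a, b] (fun x => g (x +i* y)).
Proof.
by move=> gd yd; apply: continuous_cintegrable => x xab; have [l] := gd _ _ xab yd;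
  exact: continuous_hseg.
Qed.

Lemma cintegrable_vseg g a b c d x : cder_rect g a b c d -> a <= x <= b ->
  cintegrable leb `[c, d] (fun y => g (x +i* y)).
Proof.
by move=> gd xd; apply: continuous_cintegrable => y yab; have [l] := gd _ _ xd yab;
  exact: continuous_vseg.
Qed.

Lemma cder_rectS g a b c d a' b' c' d' : a <= a' -> b' <= b -> c <= c' -> d' <= d ->
  cder_rect g a b c d -> cder_rect g a' b' c' d'.
Proof.
move=> aa bb cc dd gd x y /andP[ax xb] /andP[cy yd]; apply: gd.
  by rewrite (le_trans aa ax) (le_trans xb bb).
by rewrite (le_trans cc cy) (le_trans yd dd).
Qed.

Lemma rectE g a b c d : a <= b -> c <= d -> cder_rect g a b c d ->
  rect g a b c d =
   cint leb `[a, b] (fun x => g (x +i* c)) - cint leb `[a, b] (fun x => g (x +i* d)) +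
  'i * (cint leb `[c, d] (fun y => g (b +i* y)) - cint leb `[c, d] (fun y => g (a +i* y))).
Proof.
move=> ab cd gd; rewrite /rect !cintB //;
  by (apply: (cintegrable_hseg gd) || apply: (cintegrable_vseg gd)); rewrite ?lexx ?ab ?cd.
Qed.

Lemma rect_splitx g a m b c d : a <= m <= b -> c <= d -> cder_rect g a b c d ->
  rect g a b c d = rect g a m c d + rect g m b c d.
Proof.
move=> /andP[am mb] cd gd; have ab := le_trans am mb.
rewrite !rectE //; try by apply: cder_rectS gd.
rewrite !(@cint_itv_split _ a m b) ?am ?mb //; first by ring.
  by apply: (cintegrable_hseg gd); rewrite ?lexx ?cd.
by apply: (cintegrable_hseg gd); rewrite ?lexx ?cd.
Qed.

Lemma rect_splity g a b c m d : a <= b -> c <= m <= d -> cder_rect g a b c d ->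
  rect g a b c d = rect g a b c m + rect g a b m d.
Proof.
move=> ab /andP[cm md] gd; have cd := le_trans cm md.
rewrite !rectE //; try by apply: cder_rectS gd.
rewrite !(@cint_itv_split _ c m d) ?cm ?md //; first by ring.
  by apply: (cintegrable_vseg gd); rewrite ?lexx ?ab.
by apply: (cintegrable_vseg gd); rewrite ?lexx ?ab.
Qed.

Lemma rectB g1 g2 a b c d : a <= b -> c <= d -> cder_rect g1 a b c d -> cder_rect g2 a b c d ->
  rect (fun z => g1 z - g2 z) a b c d = rect g1 a b c d - rect g2 a b c d.
Proof.
move=> ab cd gd1 gd2.
have gd3 : cder_rect (fun z => g1 z - g2 z) a b c d.
  move=> x y xab ycd; have [l1 h1] := gd1 _ _ xab ycd; have [l2 h2] := gd2 _ _ xab ycd.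
  by exists (l1 - l2); exact: cderB.
have [cc dd] : (c <= c <= d) /\ (c <= d <= d) by rewrite !lexx cd.
have [aa bb] : (a <= a <= b) /\ (a <= b <= b) by rewrite !lexx ab.
rewrite !rectE //.
have [i1 i2 i3 i4] := And4 (cintegrable_hseg gd1 cc) (cintegrable_hseg gd1 dd)
  (cintegrable_vseg gd1 aa) (cintegrable_vseg gd1 bb).
have [j1 j2 j3 j4] := And4 (cintegrable_hseg gd2 cc) (cintegrable_hseg gd2 dd)
  (cintegrable_vseg gd2 aa) (cintegrable_vseg gd2 bb).
by rewrite !cintB //; ring.
Qed.

Lemma rect_affine (u v : R[i]) a b c d : a <= b -> c <= d ->
  rect (fun z => u + v * z) a b c d = 0.
Proof.
move=> ab cd; rewrite /rect.
rewrite (@eq_cint _ _ _ _ _ _ (fun=> v * ('i * (c - d)%:C))); last first.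
  move=> x _; have -> : x +i* c = x +i* d + 'i * (c - d)%:C; last by ring.
  by apply: complexP => /=; ring.
rewrite [X in _ + 'i * X](@eq_cint _ _ _ _ _ _ (fun=> v * (b - a)%:C)); last first.
  move=> y _; have -> : b +i* y = a +i* y + (b - a)%:C; last by ring.
  by apply: complexP => /=; ring.
by rewrite !cint_cst // !fine_leb_itv // -(opprB c d) rmorphN /=; ring.
Qed.

Lemma rect_bound g a b c d M : a <= b -> c <= d -> cder_rect g a b c d -> 0 <= M ->
  (forall x y, a <= x <= b -> c <= y <= d -> cabs (g (x +i* y)) <= M) ->
  cabs (rect g a b c d) <= 2 * M * ((b - a) + (d - c)).
Proof.
move=> ab cd gd M0 gM.
apply: le_trans (cabsD _ _) _; rewrite mulrDr lerD //.
  apply: cabs_cint_itv => // [|x xab].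
    by apply: cintegrableB => //; apply: (cintegrable_hseg gd); rewrite ?lexx ?cd.
  by apply: le_trans (cabsD _ _) _; rewrite cabsN mulrDl mul1r lerD // gM ?lexx ?cd.
rewrite cabsM (_ : cabs 'i = 1) ?mul1r; last by rewrite cabsE /= expr0n expr1n add0r sqrtr1.
apply: cabs_cint_itv => // [|x xab].
  by apply: cintegrableB => //; apply: (cintegrable_vseg gd); rewrite ?lexx ?ab.
by apply: le_trans (cabsD _ _) _; rewrite cabsN mulrDl mul1r lerD // gM ?lexx ?ab.
Qed.

End rectangle.

(** * Goursat's theorem by bisection *)

Section goursat.
Context {R : realType}.
Variable g : R[i] -> R[i].

Record rectangle := Rectangle { rxl : R; rxr : R; ryl : R; ryr : R }.

Definition rwf (r : rectangle) :=
  [/\ rxl r <= rxr r, ryl r <= ryr r & cder_rect g (rxl r) (rxr r) (ryl r) (ryr r)].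

(** The threshold is quadratic in the half-perimeter, so it drops by a factor four under bisection
    and one of the four quarters of a bad rectangle is bad again. *)
Definition rbad (e : R) (r : rectangle) := rwf r /\
  e * ((rxr r - rxl r) + (ryr r - ryl r)) ^+ 2 < cabs (rect g (rxl r) (rxr r) (ryl r) (ryr r)).

Definition rhalf (r s : rectangle) :=
  [/\ rxl r <= rxl s, rxr s <= rxr r, ryl r <= ryl s, ryr s <= ryr r &
     rxr s - rxl s = (rxr r - rxl r) / 2 /\ ryr s - ryl s = (ryr r - ryl r) / 2].

Lemma bisection e r : rbad e r -> exists s, rbad e s /\ rhalf r s.
Proof.
move: r => [a b c d]; rewrite /rbad /rwf /rhalf /= => -[[ab cd gd] bad].
pose m := (a + b) / 2; pose k := (c + d) / 2.
have am : a <= m by rewrite /m; lra.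
have mb : m <= b by rewrite /m; lra.
have ck : c <= k by rewrite /k; lra.
have kd : k <= d by rewrite /k; lra.
apply: contrapT => /forallNP H.
have Q x1 x2 y1 y2 : a <= x1 -> x2 <= b -> c <= y1 -> y2 <= d ->
    x2 - x1 = (b - a) / 2 -> y2 - y1 = (d - c) / 2 ->
    cabs (rect g x1 x2 y1 y2) <= e * ((b - a) + (d - c)) ^+ 2 / 4.
  move=> h1 h2 h3 h4 h5 h6; rewrite leNgt; apply/negP => h.
  apply: (H (Rectangle x1 x2 y1 y2)) => /=; split; last by split.
  split; first by split; [lra|lra|exact: cder_rectS gd].
  by rewrite h5 h6; apply: le_lt_trans h; rewrite le_eqVlt; apply/orP; left; apply/eqP; field.
have am' : a <= m <= b by rewrite am.
have [ma bm] : m - a = (b - a) / 2 /\ b - m = (b - a) / 2 by rewrite /m; split; lra.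
have [kc dk] : k - c = (d - c) / 2 /\ d - k = (d - c) / 2 by rewrite /k; split; lra.
have gd1 : cder_rect g a m c d by apply: cder_rectS gd.
have gd2 : cder_rect g m b c d by apply: cder_rectS gd.
have := bad; rewrite (rect_splitx am' cd gd).
rewrite (rect_splity am _ gd1 (m := k)) ?ck // (rect_splity mb _ gd2 (m := k)) ?ck //.
apply/negP; rewrite -leNgt.
apply: le_trans (cabsD _ _) _; apply: le_trans (lerD (cabsD _ _) (cabsD _ _)) _.
set A := e * _.
have -> : A = (A / 4 + A / 4) + (A / 4 + A / 4) by field.
by rewrite !lerD // Q.
Qed.

Lemma nested_point (a b : nat -> R) : (forall n, a n <= a n.+1) -> (forall n, b n.+1 <= b n) ->
  (forall n, a n <= b n) -> exists p, forall n, a n <= p <= b n.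
Proof.
move=> ha hb ab.
have am n m : (n <= m)%N -> a n <= a m.
  by move: n m; exact/nondecreasing_seqP.
have bm n m : (n <= m)%N -> b m <= b n.
  by move: n m; exact/nonincreasing_seqP.
have abnm n m : a n <= b m.
  apply: le_trans (am _ _ (leq_maxl n m)) _; apply: le_trans (ab _) _.
  exact/bm/leq_maxr.
have ub m : ubound (range a) (b m) by move=> _ [n _ <-].
exists (sup (range a)) => n; apply/andP; split.
  by apply: ub_le_sup; [exists (b 0%N)|exists n].
by apply: ge_sup => //; exists (a 0%N), 0%N.
Qed.

(** Bad rectangles shrink to a point where [g] is affine up to a small multiple of the size [L n].
    Affine maps integrate to 0, so the integral is a small multiple of [L n ^+ 2], below the
    threshold. *)
Theorem goursat a b c d : a <= b -> c <= d -> cder_rect g a b c d -> rect g a b c d = 0.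
Proof.
move=> ab cd gd; apply/eqP; rewrite -cabs_eq0 eq_le cabs_ge0 andbT.
apply/ler_addgt0Pr => e0 e00; rewrite add0r.
set L0 := (b - a) + (d - c).
have L0ge : 0 <= L0 by rewrite addr_ge0 ?subr_ge0.
(* The [+ 1] keeps the quotient meaningful for a degenerate rectangle. *)
pose e := e0 / (L0 ^+ 2 + 1).
have D0 : 0 < L0 ^+ 2 + 1 by rewrite ltr_wpDl // sqr_ge0.
have egt0 : 0 < e by rewrite divr_gt0.
suff H : ~ rbad e (Rectangle a b c d).
  have : cabs (rect g a b c d) <= e * L0 ^+ 2.
    by rewrite leNgt; apply/negP => h; apply: H; split.
  move=> h; apply: le_trans h _; rewrite /e mulrAC ler_pdivrMr // ler_pM2l //.
  by rewrite lerDl.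
move=> bad0.
have [next nextP] : exists next, forall r, rbad e r -> rbad e (next r) /\ rhalf r (next r).
  have /choice[f fP] : forall r, exists s, rbad e r -> rbad e s /\ rhalf r s.
    by move=> r; have [/bisection[s ?]|nb] := pselect (rbad e r); [exists s|exists r].
  by exists f.
pose r n := iter n next (Rectangle a b c d).
have rb n : rbad e (r n) by elim: n => // n IH; have [] := nextP _ IH.
have rh n : rhalf (r n) (r n.+1) by have [] := nextP _ (rb n).
have [p pP] : exists p, forall n, rxl (r n) <= p <= rxr (r n).
  by apply: nested_point => n; [have [] := rh n|have [] := rh n|have [[]] := rb n].
have [q qP] : exists q, forall n, ryl (r n) <= q <= ryr (r n).
  by apply: nested_point => n; [have [] := rh n|have [] := rh n|have [[]] := rb n].
pose L n := (rxr (r n) - rxl (r n)) + (ryr (r n) - ryl (r n)).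
have LE n : L n = L0 / 2 ^+ n.
  elim: n => [|n IH]; first by rewrite expr0 divr1.
  have [_ _ _ _ [h1 h2]] := rh n.
  rewrite /L h1 h2 -mulrDl -/(L n) IH exprSr invfM mulrA //.
have [l gl] := gd p q (pP 0%N) (qP 0%N).
have [s s0 Hs] := gl _ (divr_gt0 egt0 (@ltr0Sn R 1)).
have [n Ln] : exists n, L n < s.
  pose n := Num.bound (L0 / s); exists n; rewrite LE ltr_pdivrMr ?exprn_gt0 //.
  rewrite mulrC -ltr_pdivrMr //.
  apply: lt_le_trans (archi_boundP (divr_ge0 L0ge (ltW s0))) _.
  by rewrite -natrX ler_nat ltnW // ltn_expl.
have [[xlr ylr gdn] badn] := rb n.
move: badn; apply/negP; rewrite -leNgt -/(L n).
pose z := p +i* q; pose aff := fun w => (g z - l * z) + l * w.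
have affd : cder_rect aff (rxl (r n)) (rxr (r n)) (ryl (r n)) (ryr (r n)).
  move=> x y _ _; exists (0 + l * 1); apply: cderD; first exact: cder_cst.
  exact: cderZ (cder_id _).
(* Subtracting the tangent affine map at the limit point does not change the contour integral. *)
have -> : rect g (rxl (r n)) (rxr (r n)) (ryl (r n)) (ryr (r n)) =
          rect (fun w => g w - aff w) (rxl (r n)) (rxr (r n)) (ryl (r n)) (ryr (r n)).
  by rewrite rectB // rect_affine // subr0.
have Ln0 : 0 <= L n by rewrite /L addr_ge0 ?subr_ge0.
have M0 : 0 <= e / 2 * L n by rewrite mulr_ge0 // divr_ge0 // ltW.
apply: (@le_trans _ _ (2 * (e / 2 * L n) * L n)); last first.
  by rewrite le_eqVlt; apply/orP; left; apply/eqP; field.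
apply: rect_bound => //.
  move=> x y hx hy; have [l' hl'] := gdn x y hx hy; have [l2 hl2] := affd x y hx hy.
  by exists (l' - l2); exact: cderB.
move=> x y /andP[hx1 hx2] /andP[hy1 hy2].
have /andP[p1 p2] := pP n; have /andP[q1 q2] := qP n.
have hL : cabs ((x +i* y) - z) <= L n.
  apply: le_trans (cabs_le_ReIm _) _; rewrite !ReImE /=.
  by rewrite lerD // ler_norml; apply/andP; split; lra.
have := Hs _ (le_lt_trans hL Ln).
rewrite subrKC => h; rewrite /aff.
have -> : g (x +i* y) - (g z - l * z + l * (x +i* y)) =
  g (x +i* y) - g z - l * (x +i* y - z) by ring.
by apply: le_trans h _; rewrite ler_wpM2l // divr_ge0 // ltW.
Qed.

End goursat.

(** * Arc length, continuous functions on the circle and their means *)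

Section circle_measure.
Context {R : realType}.
Local Notation leb := (@lebesgue_measure R).
Local Notation arc := (@arc_length R).
Local Notation Re := (@complex.Re R).
Local Notation Im := (@complex.Im R).
Local Notation T := (borel_circle R).
Implicit Types (F : R[i] -> R[i]) (f : T -> R) (w : T).

Lemma cabs_circle_val w : cabs (circle_val w) = 1.
Proof.
by rewrite -norm1_cabs /circle_val; have := set_valP (w : set_type [set z : R[i] | `|z| = 1]).
Qed.

Lemma circle_val_expi (t : R) : circle_val (circle_expi t : T) = expi t.
Proof. by []. Qed.

Lemma measurable_circle_continuous (f : R[i] -> R) :
  (forall z, cabs z = 1 -> {for z, continuous f}) ->
  measurable_fun setT (fun w : T => f (circle_val w)).
Proof.
move=> cf; apply: (@measurability _ _ (borel_circle R) (measurableTypeR R) _ _ (@RGenOpens.G R)); first exact: RGenOpens.measurableE.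
move=> _ [_ [a [b ->] <-]]; rewrite setTI.
apply: sub_sigma_algebra; rewrite openE /= => w /= fw.
have : nbhs (circle_val w) (f @^-1` `]a, b[%classic).
  by apply: cf; [exact: cabs_circle_val|apply: open_nbhs_nbhs; split => //; exact: interval_open].
exact: (@initial_continuous _ _ (@set_val R[i] [set z : R[i] | `|z| = 1]) w).
Qed.

(** Continuity in the plane at the points of the circle, which is what differentiability provides
    and what passes to products and compositions. *)
Definition ccont F := forall z, cabs z = 1 -> {for z, continuous F}.

Lemma cmeasurable_ccont F : ccont F -> cmeasurable setT (fun w : T => F (circle_val w)).
Proof.
move=> cF; split.
  by apply: (measurable_circle_continuous (f := Re \o F)) => z /cF; exact: continuous_Re.
by apply: (measurable_circle_continuous (f := Im \o F)) => z /cF; exact: continuous_Im.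
Qed.

Lemma expi_cvg (F : R[i] -> R[i]) (t : R) : {for expi t, continuous F} ->
  {for t, continuous (F \o @expi R)}.
Proof.
move=> /continuous_cabsP cF; apply/cvgr_cabsP => e /cF[r r0 H].
have /cvgr_cabsP/(_ r r0) h := @expi_continuous R t.
by near=> s; apply: H; near: s.
Unshelve. all: by end_near. Qed.

Lemma ccont_bounded F : ccont F -> exists2 M, 0 <= M & forall z, cabs z = 1 -> cabs (F z) <= M.
Proof.
move=> cF.
have pipi : - pi <= pi :> R by have := pi_ge0 R; lra.
have [|t _ Ht] := @EVT_max R (fun t => cabs (F (expi t))) (- pi) pi pipi.
  apply: continuous_in_subspaceT => t _.
  have /cvgr_cabsP h := expi_cvg (cF _ (cabs_expi t)).
  apply/cvgrPdist_lt => e /h he; near=> s.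
  rewrite ltr_norml; apply/andP; split.
    rewrite ltrNl opprB; apply: le_lt_trans (cabs_le_dist _ _) _.
    by near: s.
  by apply: le_lt_trans (cabs_le_dist _ _) _; rewrite cabsB; near: s.
exists (cabs (F (expi t))); first exact: cabs_ge0.
by move=> z /unimodular_expi[s sp <-]; apply: Ht; rewrite in_itv.
Unshelve. all: by end_near. Qed.

Lemma arc_lty : (arc setT < +oo)%E.
Proof.
rewrite /arc_length /pushforward preimage_setT /mrestr setTI.
by rewrite lebesgue_measure_itv /=; case: ifP => // _; rewrite -EFinB ltry.
Qed.

Lemma fine_arc : fine (arc setT) = 2 * pi.
Proof.
rewrite /arc_length /pushforward preimage_setT /mrestr setTI.
by rewrite lebesgue_measure_itv /= lte_fin mulr_gt0 ?pi_gt0 //= subr0.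
Qed.

Lemma arc_Rintegral f (M : R) : measurable_fun setT f -> (forall w, `|f w| <= M) ->
  \int[arc]_w f w = \int[leb]_(t in `[0, 2 * pi]) f (circle_expi t).
Proof.
move=> mf fM; have mphi := @measurable_circle_expi R.
have mfe : measurable_fun setT (EFin \o f) by exact/measurable_EFinP.
have mfp : measurable_fun [set: measurableTypeR R] (f \o @circle_expi R : _ -> R).
  exact: (measurableT_comp mf mphi).
pose D : set (measurableTypeR R) := `[0, 2 * pi[%classic.
have mD : measurable D by exact: measurable_itv.
pose m1 := mrestr leb mD.
have Doo : (leb D < +oo)%E.
  by rewrite lebesgue_measure_itv /=; case: ifP => // _; rewrite -EFinB ltry.
have bd A : [bounded (f \o @circle_expi R) x | x in A].
  exists M; split; rewrite ?num_real // => k Mk x _.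
  by apply: le_trans (fM _) _; exact: ltW.
have i1 : (m1 : {measure set _ -> \bar R}).-integrable setT (EFin \o (f \o @circle_expi R)).
  apply: measurable_bounded_integrable => //.
  by rewrite /= /m1 /mrestr /= setTI.
have i2 : leb.-integrable D (EFin \o (f \o @circle_expi R)).
  by apply: measurable_bounded_integrable => //; exact: measurable_funS mfp.
rewrite -Rintegral_itv_bndo_bndc // /Rintegral; congr fine.
rewrite (_ : (\int[arc]_w (f w)%:E = \int[pushforward m1 (@circle_expi R : measurableTypeR R -> T)]_w (EFin \o f) w)%E) //.
rewrite (integral_pushforward mphi) ?preimage_setT //.
rewrite (@negligible_integral _ _ _ m1 setT (~` D)) //; last 2 first.
- exact: measurableC.
- by rewrite /m1 /= /mrestr /= setICl measure0.
rewrite setTD setCK; apply: eq_measure_integral => A mA AD.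
by rewrite /m1 /= /mrestr /= setIidl.
Qed.

Definition cmean (F : R[i] -> R[i]) : R[i] :=
  ((2 * pi)^-1)%:C * cint arc setT (fun w => F (circle_val w)).

Lemma ccont_cintegrable F : ccont F -> cintegrable arc setT (fun w => F (circle_val w)).
Proof.
move=> cF; have [M _ HM] := ccont_bounded cF.
apply: (cintegrable_bounded _ arc_lty (cmeasurable_ccont cF)) => // w _.
exact/HM/cabs_circle_val.
Qed.

Lemma cmean_itv F : ccont F ->
  cmean F = ((2 * pi)^-1)%:C * cint leb `[0, 2 * pi] (F \o @expi R).
Proof.
move=> cF; have [M _ HM] := ccont_bounded cF; have [m1 m2] := cmeasurable_ccont cF.
congr (_ * (_ +i* _)).
  apply: (arc_Rintegral (M := M)) => // w.
  by rewrite (le_trans (Re_le_cabs _)) // HM // cabs_circle_val.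
apply: (arc_Rintegral (M := M)) => // w.
by rewrite (le_trans (Im_le_cabs _)) // HM // cabs_circle_val.
Qed.

Lemma eq_cmean F G : (forall z, cabs z = 1 -> F z = G z) -> cmean F = cmean G.
Proof. by move=> FG; congr (_ * _); apply: eq_cint => w _; rewrite FG ?cabs_circle_val. Qed.

Lemma cmeanD F G : ccont F -> ccont G -> cmean (fun z => F z + G z) = cmean F + cmean G.
Proof.
by move=> /ccont_cintegrable iF /ccont_cintegrable iG; rewrite /cmean cintD // mulrDr.
Qed.

Lemma cmeanB F G : ccont F -> ccont G -> cmean (fun z => F z - G z) = cmean F - cmean G.
Proof.
by move=> /ccont_cintegrable iF /ccont_cintegrable iG; rewrite /cmean cintB // mulrBr.
Qed.

Lemma cmeanZ F c : ccont F -> cmean (fun z => c * F z) = c * cmean F.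
Proof. by move=> /ccont_cintegrable iF; rewrite /cmean cintZ // mulrCA. Qed.

Lemma twopi_gt0 : 0 < 2 * pi :> R.
Proof. by rewrite mulr_gt0 ?pi_gt0. Qed.

Lemma cmean_cst c : cmean (fun=> c) = c.
Proof.
rewrite /cmean cint_cst // fine_arc mulrCA -rmorphM /= mulVf ?mulr1 //.
by rewrite gt_eqF // twopi_gt0.
Qed.

Lemma cabs_cmean F (M : R) : ccont F -> (forall z, cabs z = 1 -> cabs (F z) <= M) ->
  cabs (cmean F) <= M.
Proof.
move=> cF FM; rewrite /cmean cabsM cabsC ger0_norm ?invr_ge0 ?(ltW twopi_gt0) //.
rewrite mulrC ler_pdivrMr ?twopi_gt0 // -fine_arc; apply: cabs_cint_bound => //.
- exact: arc_lty.
- exact: ccont_cintegrable.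
- by move=> w _; rewrite FM // cabs_circle_val.
Qed.

Lemma ccont_cst c : ccont (fun=> c).
Proof. by move=> z _; exact: cst_continuous. Qed.

Lemma ccontB F G : ccont F -> ccont G -> ccont (fun z => F z - G z).
Proof. by move=> cF cG z z1; apply: continuousB; [exact: cF|exact: cG]. Qed.

Lemma ccontM F G : ccont F -> ccont G -> ccont (fun z => F z * G z).
Proof. by move=> cF cG z z1; apply: continuousM; [exact: cF|exact: cG]. Qed.

Lemma ccont_scale F (r : R) : (forall z, cabs z = r -> {for z, continuous F}) -> 0 <= r ->
  ccont (fun z => F (r%:C * z)).
Proof.
move=> cF r0 z z1; have rz : cabs (r%:C * z) = r by rewrite cabsM z1 mulr1 cabsC ger0_norm.
move/continuous_cabsP: (cF _ rz) => cFz; apply/continuous_cabsP => e /cFz[d d0 Hd].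
have r1 : 0 < r + 1 by rewrite ltr_wpDl.
exists (d / (r + 1)); first by rewrite divr_gt0.
move=> w; rewrite ltr_pdivlMr // => wz; apply: Hd; rewrite -mulrBr cabsM cabsC ger0_norm //.
apply: le_lt_trans wz; rewrite mulrC ler_wpM2l ?cabs_ge0 // lerDl //.
Qed.

End circle_measure.

(** * Circle means of holomorphic functions and the mean value property *)

Section annulus.
Context {R : realType}.
Local Notation leb := (@lebesgue_measure R).
Implicit Types (F f : R[i] -> R[i]) (z w : R[i]).

(* Goursat for [F \o cexp] on [ln r1, ln r2] x [0, 2 pi]: the horizontal sides cancel by
   periodicity. *)
Lemma annulus_mean F (a b r1 r2 : R) :
  (forall z, a < cabs z < b -> exists l, cder F z l) ->
  a < r1 -> 0 < r1 -> r1 <= r2 -> r2 < b ->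
  cmean (fun z => F (r1%:C * z)) = cmean (fun z => F (r2%:C * z)).
Proof.
move=> dF ar1 r10 r12 r2b; have r20 := lt_le_trans r10 r12.
have cF r : r1 <= r -> r <= r2 -> ccont (fun z => F (r%:C * z)).
  move=> h1 h2; apply: ccont_scale; last by rewrite (le_trans (ltW r10)).
  move=> z zr; have [|l dl] := dF z; last exact: cder_cvg dl.
  by rewrite zr (lt_le_trans ar1 h1) (le_lt_trans h2 r2b).
rewrite !cmean_itv; [|exact: cF|exact: cF]; congr (_ * _).
pose g := fun z => F (cexp z).
have lr12 : ln r1 <= ln r2 by rewrite ler_ln ?posrE.
have gd : cder_rect g (ln r1) (ln r2) 0 (2 * pi).
  move=> x y /andP[x1 x2] _.
  have [|l dl] := dF (cexp (x +i* y)); last first.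
    exists (l * cexp (x +i* y)); exact: cder_comp (cder_cexp _) dl.
  rewrite cabs_cexp /= (lt_le_trans ar1) ?(le_lt_trans _ r2b) //.
    by rewrite -[leRHS](@lnK _ r2) ?posrE // ler_expR.
  by rewrite -[leLHS](@lnK _ r1) ?posrE // ler_expR.
have := goursat lr12 (ltW (@twopi_gt0 R)) gd.
rewrite rectE ?(ltW (@twopi_gt0 R)) //.
have E x y : g (x +i* y) = F ((expR x)%:C * expi y) by rewrite /g cexpE.
have -> : cint leb `[ln r1, ln r2] (fun x => g (x +i* (2 * pi))) =
          cint leb `[ln r1, ln r2] (fun x => g (x +i* 0)).
  by apply: eq_cint => x _; rewrite !E expi_2pi expi0.
rewrite subrr add0r => /eqP; rewrite mulf_eq0 => /orP[|].
  by rewrite eq_complex /= oner_eq0 andbF.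
rewrite subr_eq0 => /eqP/esym.
have Er r : 0 < r -> cint leb `[0, 2 * pi] (fun y => g (ln r +i* y)) =
    cint leb `[0, 2 * pi] ((fun z => F (r%:C * z)) \o @expi R).
  by move=> r0; apply: eq_cint => y _; rewrite E lnK ?posrE.
by rewrite !Er.
Qed.

Definition hol (b : R) F := forall z, cabs z < b -> exists l, cder F z l.

Lemma hol_continuous b F z : hol b F -> cabs z < b -> {for z, continuous F}.
Proof. by move=> hF /hF[l dl]; exact: cder_cvg dl. Qed.

Lemma hol_ccont b F r : hol b F -> 0 <= r -> r < b -> ccont (fun z => F (r%:C * z)).
Proof. by move=> hF r0 rb; apply: ccont_scale => // z zr; apply: (hol_continuous hF); rewrite zr. Qed.

(** By [annulus_mean] the circle mean is independent of the radius, and on small circles continuity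
    at 0 brings it arbitrarily close to [F 0]. *)
Lemma mean_value_near F (b r : R) : 0 < r -> r < b -> {for 0, continuous F} ->
  (forall z, 0 < cabs z < b -> exists l, cder F z l) ->
  cmean (fun z => F (r%:C * z)) = F 0.
Proof.
move=> r0 rb cF0 dF; apply/eqP; rewrite -subr_eq0 -cabs_eq0 eq_le cabs_ge0 andbT.
apply/ler_addgt0Pr => e e0; rewrite add0r.
have [s s0 Hs] := (continuous_cabsP _ _).1 cF0 e e0.
pose t := Num.min r (s / 2).
have t0 : 0 < t by rewrite lt_min r0 divr_gt0.
have ts : t < s by rewrite gt_min; apply/orP; right; lra.
have tr : t <= r by rewrite ge_min lexx.
rewrite -(annulus_mean (r1 := t) dF) //.
have cF : ccont (fun z => F (t%:C * z)).
  apply: ccont_scale; last exact: ltW.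
  move=> z zt; have [|l dl] := dF z; last exact: cder_cvg dl.
  by rewrite zt t0 (le_lt_trans tr rb).
have -> : cmean (fun z => F (t%:C * z)) - F 0 = cmean (fun z => F (t%:C * z) - F 0).
  by rewrite (cmeanB cF (@ccont_cst R (F 0))) cmean_cst.
apply: cabs_cmean; first exact: ccontB cF (@ccont_cst R (F 0)).
by move=> z z1; apply/ltW/Hs; rewrite subr0 cabsM z1 mulr1 cabsC gtr0_norm.
Qed.

Lemma mean_value F (b r : R) : 0 < r -> r < b -> hol b F ->
  cmean (fun z => F (r%:C * z)) = F 0.
Proof.
move=> r0 rb hF; apply: (mean_value_near r0 rb).
  by apply: (hol_continuous hF); rewrite cabs0 (lt_trans r0).
by move=> z /andP[_ zb]; exact: hF.
Qed.

(** Compactness of the interval of angles makes continuity uniform along the circle. This lets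
    circle means be followed across a radius at which holomorphy is not known. *)
Lemma cmean_near F (r b : R) : 0 < r -> r < b ->
  (forall z, 0 < cabs z < b -> {for z, continuous F}) ->
  forall e : R, 0 < e -> \forall s \near r,
    cabs (cmean (fun z => F (s%:C * z)) - cmean (fun z => F (r%:C * z))) <= e.
Proof.
move=> r0 rb cF e e0.
have pipi : - pi <= pi :> R by have := pi_ge0 R; lra.
have cFs s : 0 < s -> s < b -> ccont (fun z => F (s%:C * z)).
  by move=> s0 sb; apply: ccont_scale => [z zs|]; [apply: cF; rewrite zs s0|exact: ltW].
have : \forall s \near r, forall t, t \in `[-pi, pi] ->
    cabs (F (s%:C * expi t) - F (r%:C * expi t)) < e.
  have /compact_near_coveringP cov : compact `[-pi, pi : R]%classic by exact: segment_compact.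
  apply: (cov _ (nbhs r) (fun s t => cabs (F (s%:C * expi t) - F (r%:C * expi t)) < e)) => t _.
  have rt : cabs (r%:C * expi t) = r by rewrite cabsM cabs_expi mulr1 cabsC gtr0_norm.
  have : {for r%:C * expi t, continuous F} by apply: cF; rewrite rt r0.
  move=> /continuous_cabsP/(_ _ (divr_gt0 e0 (@ltr0Sn R 1)))[d d0 Hd].
  have d3 : 0 < d / 3 by rewrite divr_gt0.
  have c1 : \forall t' \near t, cabs (expi t' - expi t) < d / 3 / r.
    have /cvgr_cabsP hh := @expi_continuous R t.
    by apply: hh; rewrite !divr_gt0.
  have r3 : 0 < Num.min (d / 3) r by rewrite lt_min d3.
  exists ([set t' | cabs (expi t' - expi t) < d / 3 / r], [set s | `|r - s| < d / 3]).
    by split => //=; apply/nbhs_ballP; exists (d / 3).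
  move=> [t' s] /= [ht' hs].
  have A (u : R) : `|r - u| < d / 3 -> cabs (u%:C * expi t' - r%:C * expi t) < d.
    move=> hu; have -> : u%:C * expi t' - r%:C * expi t =
      (u - r)%:C * expi t' + r%:C * (expi t' - expi t) by rewrite rmorphB /=; ring.
    apply: le_lt_trans (cabsD _ _) _.
    rewrite !cabsM cabs_expi mulr1 !cabsC (gtr0_norm r0) distrC.
    have : r * cabs (expi t' - expi t) < d / 3 by rewrite mulrC -ltr_pdivlMr.
    lra.
  have h1 := Hd _ (A s hs).
  have h2 : cabs (F (r%:C * expi t') - F (r%:C * expi t)) < e / 2.
    by apply/Hd/A; rewrite subrr normr0.
  have -> : F (s%:C * expi t') - F (r%:C * expi t') =
    (F (s%:C * expi t') - F (r%:C * expi t)) - (F (r%:C * expi t') - F (r%:C * expi t)) by ring.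
  apply: le_lt_trans (cabsD _ _) _; rewrite cabsN; lra.
move=> near_r; near=> s.
have sr : 0 < s < b.
  near: s; apply/nbhs_ballP; exists (Num.min r (b - r)); rewrite /= ?lt_min ?subr_gt0 ?r0 //.
  move=> s; rewrite /ball /= lt_min !ltr_norml => /andP[/andP[? ?] /andP[? ?]].
  by apply/andP; split; lra.
move/andP: sr => [s0 sb].
rewrite -(cmeanB (cFs _ s0 sb) (cFs _ r0 rb)); apply: cabs_cmean.
  exact: ccontB (cFs _ s0 sb) (cFs _ r0 rb).
move=> z /unimodular_expi[t tp <-]; apply: ltW.
by move: t tp; near: s; apply: filterS near_r => s H t tp; apply: H; rewrite in_itv.
Unshelve. all: by end_near. Qed.

End annulus.

(** * Cauchy's formula and Cauchy transforms *)

Section cauchy.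
Context {R : realType}.
Local Notation arc := (@arc_length R).
Local Notation Re := (@complex.Re R).
Local Notation Im := (@complex.Im R).
Local Notation T := (borel_circle R).
Implicit Types (F K f : R[i] -> R[i]) (z w : R[i]) (u : T -> R[i]).

Lemma ccont_cder F : (forall z, cabs z = 1 -> exists l, cder F z l) -> ccont F.
Proof. by move=> dF z /dF[l dl]; exact: cder_cvg dl. Qed.

Lemma continuousJ F z : {for z, continuous F} -> {for z, continuous (fun w => (F w)^*)}.
Proof.
move=> /continuous_cabsP cF; apply/continuous_cabsP => e /cF[r r0 H]; exists r => // w /H.
by rewrite -rmorphB /= cabsJ.
Qed.

Lemma continuous_realC (f : R[i] -> R) z : {for z, continuous f} ->
  {for z, continuous (fun w => (f w)%:C)}.
Proof.
move=> /cvgrPdist_lt cf; apply/continuous_cabsP => e /cf/nbhs_cabsP[r r0 H]; exists r => // w /H.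
by rewrite -rmorphB /= cabsC distrC.
Qed.

Lemma cmeanJ F : ccont F -> cmean (fun z => (F z)^*) = (cmean F)^*.
Proof.
move=> cF; have [i1 i2] := ccont_cintegrable cF.
rewrite /cmean rmorphM /=; congr (_ * _); first by apply: complexP; rewrite ?ImJ //= oppr0.
congr (_ +i* _); first by apply: eq_Rintegral => x _; rewrite ReJ.
rewrite -mulN1r -RintegralZl //; apply: eq_Rintegral => x _.
by rewrite ImJ mulN1r.
Qed.

Lemma mean_value1 F (b : R) : 1 < b -> hol b F -> cmean F = F 0.
Proof.
move=> b1 hF; rewrite -(mean_value ltr01 b1 hF); apply: eq_cmean => z _.
by rewrite mul1r.
Qed.

Lemma sub_neq0 z w : cabs w < cabs z -> z - w != 0.
Proof. by move=> wz; rewrite subr_eq0; apply: contraTneq wz => ->; rewrite ltxx. Qed.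

Lemma cder_subV w z : z - w != 0 -> exists l, cder (fun z => (z - w)^-1) z l.
Proof.
move=> zw; have D := cderB (cder_id z) (cder_cst w z).
by eexists; exact: (@cderV _ (fun z => z - w) z _ zw D).
Qed.

(** On the circle [z / (z - w)] is the conjugate of [1 / (1 - conj w * z)], which is holomorphic
    past the closed disc and equals 1 at 0. *)
Lemma mean_cauchy_kernel w : cabs w < 1 -> cmean (fun z => z / (z - w)) = 1.
Proof.
move=> w1; pose G z := (1 - w^* * z)^-1.
have dG z : w^* * z != 1 -> exists l, cder G z l.
  move=> h; eexists; apply: cderV; first by rewrite subr_eq0 eq_sym.
  by apply: cderB; [exact: cder_cst|apply: cderZ; exact: cder_id].
have w0 := cabs_ge0 w; have w2 : 0 < 1 + cabs w by rewrite ltr_wpDr.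
have hG : hol (2 / (1 + cabs w)) G.
  move=> z; rewrite ltr_pdivlMr // => h; apply: dG; apply/eqP => /(congr1 (@cabs R)).
  rewrite cabsM cabsJ cabs1 => wz.
  have z1 : 1 <= cabs z by rewrite -wz ler_piMl ?cabs_ge0 // ltW.
  by move: h; rewrite mulrDr mulr1 mulrC wz; lra.
have b1 : 1 < 2 / (1 + cabs w) by rewrite ltr_pdivlMr //; lra.
have := mean_value1 b1 hG; rewrite {2}/G mulr0 subr0 invr1 => mG.
have cG : ccont G.
  apply: ccont_cder => z z1; apply: dG; apply/eqP => /(congr1 (@cabs R)).
  by rewrite cabsM cabsJ cabs1 z1 mulr1 => h; rewrite h ltxx in w1.
have <- : (cmean G)^* = 1 by rewrite mG rmorph1.
rewrite -(cmeanJ cG).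
apply: eq_cmean => z z1; rewrite /G fmorphV rmorphB rmorphM rmorph1 /= conjK.
have zz : z * z^* = 1 by rewrite mulrJ z1 expr1n.
have zw : z - w != 0 by apply: sub_neq0; rewrite z1.
have zE : z - w = z * (1 - w * z^*) by rewrite mulrBr mulr1 mulrCA zz mulr1.
have [z0 zw'] : z != 0 /\ 1 - w * z^* != 0.
  by apply/andP; rewrite -negb_or -mulf_eq0 -zE.
by rewrite zE invfM mulrA mulfV // mul1r.
Qed.

Lemma near_below (x d : R) : 0 < x -> 0 < d -> exists2 s, 0 < s < x & `|x - s| < d.
Proof.
move=> x0 d0; exists (Num.max (x / 2) (x - d / 2)).
  by rewrite lt_max gt_max; apply/andP; split; [apply/orP; left|apply/andP; split]; lra.
rewrite ger0_norm ?subr_ge0 ?ge_max; last by apply/andP; split; lra.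
by rewrite ltrBlDr -ltrBlDl lt_max; apply/orP; right; lra.
Qed.

Lemma near_above (x y d : R) : x < y -> 0 < d -> exists2 s, x < s <= y & `|x - s| < d.
Proof.
move=> xy d0; exists (Num.min y (x + d / 2)).
  by rewrite lt_min ge_min lexx xy /= andbT ltrDl divr_gt0.
rewrite distrC ger0_norm ?subr_ge0 ?le_min; last by apply/andP; split; lra.
by rewrite ltrBlDr gt_min; apply/orP; right; lra.
Qed.

(** The function [H], essentially [z] times the difference quotient of [f] at [w], is holomorphic
    off [w] and continuous at [w]. Its circle means equal [H 0 = 0] for radii below [|w|], are
    constant above [|w|], and are continuous at [|w|], so they all vanish. *)
Lemma cauchy_formula f (b r : R) w : hol b f -> cabs w < r -> r < b ->
  cmean (fun z => f (r%:C * z) * (r%:C * z / (r%:C * z - w))) = f w.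
Proof.
move=> hf wr rb; have r0 : 0 < r := le_lt_trans (cabs_ge0 w) wr.
have rC0 : r%:C != 0 :> R[i] by rewrite -cabs_gt0 cabsC normr_gt0 gt_eqF.
have wb := lt_trans wr rb.
have [w0|w0] := eqVneq w 0.
  rewrite w0 -(mean_value r0 rb hf); apply: eq_cmean => z z1.
  rewrite subr0 divff ?mulr1 // mulf_neq0 //.
  by rewrite -cabs_gt0 z1.
pose rho := cabs w; have rho0 : 0 < rho by rewrite cabs_gt0.
have [d dw] := hf w wb.
pose H z := if z == w then d * w else (f z - f w) * z / (z - w).
have dH z : cabs z < b -> z != w -> exists l, cder H z l.
  move=> zb zw; have [l fl] := hf z zb.
  have zw0 : z - w != 0 by rewrite subr_eq0.
  have D1 := cderM (cderB fl (cder_cst (f w) z)) (cder_id z).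
  have [l2 D2] := cder_subV zw0.
  eexists; apply: cder_near (cderM D1 D2).
  exists (cabs (z - w)); first by rewrite cabs_gt0.
  move=> z'; rewrite /H; case: eqP => // -> /=.
  by rewrite cabsB ltxx.
have cH z : cabs z < b -> {for z, continuous H}.
  move=> zb; have [->|zw] := eqVneq z w; last by have [l dl] := dH z zb zw; exact: cder_cvg dl.
  apply/continuous_cabsP => e e0.
  have D0 : 0 < cabs d + 1 by rewrite ltr_wpDl ?cabs_ge0.
  have R0 : 0 < rho + 1 by rewrite ltr_wpDl // ltW.
  have [s s0 Hs] := dw _ (divr_gt0 (divr_gt0 e0 (@ltr0Sn R 1)) R0).
  exists (Num.min (Num.min s 1) (e / 2 / (cabs d + 1))).
    by rewrite !lt_min s0 ltr01 !divr_gt0.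
  move=> z'; rewrite !lt_min => /andP[/andP[zs z1] ze].
  rewrite /H eqxx; case: eqVneq => [_|zw]; first by rewrite subrr cabs0.
  have zw0 : z' - w != 0 by rewrite subr_eq0.
  have := Hs _ zs; rewrite subrKC => h.
  have -> : (f z' - f w) * z' / (z' - w) - d * w =
    (f z' - f w - d * (z' - w)) / (z' - w) * z' + d * (z' - w) by field.
  apply: le_lt_trans (cabsD _ _) _; rewrite [ltRHS]splitr ler_ltD //.
    rewrite !cabsM cabsV.
    have : cabs (f z' - f w - d * (z' - w)) / cabs (z' - w) <= e / 2 / (rho + 1).
      by rewrite ler_pdivrMr ?cabs_gt0.
    move=> h1; apply: (@le_trans _ _ (e / 2 / (rho + 1) * (rho + 1))); last by rewrite divfK // gt_eqF.
    rewrite ler_pM ?divr_ge0 ?cabs_ge0 //.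
    by rewrite -[z'](subrK w) (le_trans (cabsD _ _)) // addrC lerD // ltW.
  rewrite cabsM; apply: (@le_lt_trans _ _ ((cabs d + 1) * cabs (z' - w))).
    by rewrite ler_wpM2r ?cabs_ge0 // lerDl.
  by rewrite mulrC -ltr_pdivlMr.
pose m s := cmean (fun z => H (s%:C * z)).
have m0 s : 0 < s -> s < rho -> m s = 0.
  move=> s0 srho; have Hh : hol rho H.
    move=> z zr; apply: dH; first exact: lt_trans zr _.
    by apply: contraTneq zr => ->; rewrite ltxx.
  by rewrite /m (mean_value s0 srho Hh) /H eq_sym (negbTE w0) mulr0 mul0r.
have mr s : rho < s -> s <= r -> m s = m r.
  move=> rs sr; apply: (annulus_mean (a := rho) (b := b)) => //.
    by move=> z /andP[zr zb]; apply: dH => //; apply: contraTneq zr => ->; rewrite ltxx.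
  exact: lt_trans rho0 rs.
have mrho e : 0 < e -> cabs (m r) <= e + e.
  move=> e0.
  have cH' z : 0 < cabs z < b -> {for z, continuous H} by move=> /andP[_]; exact: cH.
  have /nbhs_ballP[d0 /= d00 Hd] := cmean_near rho0 wb cH' e0.
  have [s1 /andP[s10 s1r] k1] := near_below rho0 d00.
  have [s2 /andP[s2r s2r'] k2] := near_above wr d00.
  have := Hd _ k1; have := Hd _ k2; rewrite /= -/(m s1) -/(m s2) -/(m rho).
  rewrite (m0 _ s10 s1r) (mr _ s2r s2r') sub0r cabsN => a1 a2.
  by rewrite -[m r](subrK (m rho)); apply: le_trans (cabsD _ _) _; exact: lerD.
have mr0 : m r = 0.
  apply/eqP; rewrite -cabs_eq0 eq_le cabs_ge0 andbT; apply/ler_addgt0Pr => e e0; rewrite add0r.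
  by have := mrho _ (divr_gt0 e0 (@ltr0Sn R 1)); rewrite -splitr.
have rz z : cabs z = 1 -> r%:C * z - w != 0.
  by move=> z1; apply: sub_neq0; rewrite cabsM z1 mulr1 cabsC gtr0_norm.
have c1 : ccont (fun z => r%:C * z / (r%:C * z - w)).
  apply: ccont_cder => z z1; have D := cderZ r%:C (cder_id z).
  have D2 := cderB D (cder_cst w z); eexists.
  exact: (cderM D (@cderV _ (fun z => r%:C * z - w) z _ (rz _ z1) D2)).
have c2 : ccont (fun z => f (r%:C * z)) by exact: hol_ccont hf (ltW r0) rb.
have K1 : cmean (fun z => r%:C * z / (r%:C * z - w)) = 1.
  rewrite -(@mean_cauchy_kernel (w / r%:C)); last first.
    by rewrite cabsM cabsV cabsC gtr0_norm // ltr_pdivrMr // mul1r.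
  apply: eq_cmean => z z1; have := rz _ z1 => h.
  have -> : z - w / r%:C = (r%:C * z - w) / r%:C by field.
  by rewrite invf_div mulrA (mulrC z).
move: mr0; rewrite /m (@eq_cmean _ _ (fun z => f (r%:C * z) * (r%:C * z / (r%:C * z - w)) -
   f w * (r%:C * z / (r%:C * z - w)))); last first.
  move=> z z1; rewrite /H; case: eqVneq => [e|_]; last by ring.
  by have := rz _ z1; rewrite e subrr eqxx.
rewrite cmeanB.
- by rewrite cmeanZ // K1 mulr1 => /eqP; rewrite subr_eq0 => /eqP.
- by move=> z z1; apply: continuousM; [exact: c2|exact: c1].
- by move=> z z1; apply: continuousM; [exact: cst_continuous|exact: c1].
Qed.

Lemma cintegrableK u K : cintegrable arc setT u -> ccont K ->
  cintegrable arc setT (fun x => u x * K (circle_val x)).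
Proof.
move=> iu cK; have [M _ HM] := ccont_bounded cK.
apply: (cintegrableM_bounded (M := M)) => //; first exact: cmeasurable_ccont.
by move=> x _; exact/HM/cabs_circle_val.
Qed.

Lemma cabs_cintK u K (M : R) : cintegrable arc setT u -> ccont K ->
  (forall z, cabs z = 1 -> cabs (K z) <= M) ->
  cabs (cint arc setT (fun x => u x * K (circle_val x))) <= M * \int[arc]_x cabs (u x).
Proof.
move=> iu cK KM; apply: le_trans (cabs_cint_le _ (cintegrableK iu cK)) _ => //.
have iu' := cintegrable_cabs measurableT iu.
rewrite -RintegralZl //; apply: le_Rintegral => //.
- exact: cintegrable_cabs (cintegrableK iu cK).
- by have := integrableZl measurableT M iu'; apply: eq_integrable.
- by move=> x _; rewrite cabsM mulrC ler_wpM2r ?cabs_ge0 // KM // cabs_circle_val.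
Qed.

Lemma ccont_subV w : cabs w < 1 -> ccont (fun z => (z - w)^-1).
Proof. by move=> w1; apply: ccont_cder => z z1; apply: cder_subV; apply: sub_neq0; rewrite z1. Qed.

Definition cauchyT u w := cint arc setT (fun x => u x * (circle_val x - w)^-1).

(** Differentiation under the integral: the remainder [1/(z-w-h) - 1/(z-w) - h/(z-w)^2] equals [h^2]
    divided by [(z-w)^2 (z-w-h)], and both distances to the circle are bounded below in terms of
    [d = 1 - |w|]. *)
Lemma cder_cauchyT u w : cintegrable arc setT u -> cabs w < 1 ->
  cder (cauchyT u) w (cint arc setT (fun x => u x * (circle_val x - w)^-2)).
Proof.
move=> iu w1 e e0; pose d := 1 - cabs w.
have d0 : 0 < d by rewrite subr_gt0.
pose I := \int[arc]_x cabs (u x).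
have I0 : 0 <= I by apply: Rintegral_ge0 => x _; exact: cabs_ge0.
pose C := 2 / d ^+ 3 * I.
have C0 : 0 <= C by rewrite mulr_ge0 // divr_ge0 // exprn_ge0 // ltW.
have C1 : 0 < C + 1 by rewrite ltr_wpDl.
exists (Num.min (d / 2) (e / (C + 1))); first by rewrite lt_min !divr_gt0.
move=> h; rewrite lt_min => /andP[h1 h2].
have wh1 : cabs (w + h) < 1 by have := cabsD w h; rewrite /d in h1; lra.
have c2 : ccont (fun z => (z - w)^-2).
  move=> z z1; rewrite (_ : (fun z => _) = (fun z => (z - w)^-1 * (z - w)^-1)).
    by apply: continuousM; exact: ccont_subV.
  by apply/funext => y; rewrite -exprVn expr2.
have -> : cauchyT u (w + h) - cauchyT u w - cint arc setT (fun x => u x * (circle_val x - w)^-2) * h =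
   cint arc setT (fun x => u x * ((fun z => (z - (w + h))^-1 - (z - w)^-1 - h * (z - w)^-2) (circle_val x))).
  rewrite (mulrC _ h) -cintZ //; last exact: (cintegrableK (K := fun z => (z - w)^-2)).
  rewrite /cauchyT -cintB //; last 2 first.
  - exact: (cintegrableK (K := fun z => (z - (w + h))^-1)) iu (ccont_subV wh1).
  - exact: (cintegrableK (K := fun z => (z - w)^-1)) iu (ccont_subV w1).
  rewrite -cintB //; last 2 first.
  - apply: cintegrableB => //.
      exact: (cintegrableK (K := fun z => (z - (w + h))^-1)) iu (ccont_subV wh1).
    exact: (cintegrableK (K := fun z => (z - w)^-1)) iu (ccont_subV w1).
  - apply: cintegrableZ => //; exact: (cintegrableK (K := fun z => (z - w)^-2)).
  by apply: eq_cint => x _; ring.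
have cK : ccont (fun z => (z - (w + h))^-1 - (z - w)^-1 - h * (z - w)^-2).
  exact: (ccontB (ccontB (ccont_subV wh1) (ccont_subV w1)) (ccontM (@ccont_cst R h) c2)).
apply: le_trans (cabs_cintK (M := cabs h ^+ 2 * (2 / d ^+ 3)) iu cK _) _.
  move=> z z1.
  have zw : z - w != 0 by apply: sub_neq0; rewrite z1.
  have zwh : z - (w + h) != 0 by apply: sub_neq0; rewrite z1.
  have -> : (z - (w + h))^-1 - (z - w)^-1 - h * (z - w)^-2 =
    h ^+ 2 * ((z - w)^-2 * (z - (w + h))^-1) by field; rewrite zw zwh.
  rewrite cabsM cabsX ler_wpM2l ?sqr_ge0 // cabsM !cabsV cabsX.
  have k1 : d <= cabs (z - w) by have := cabs_le_dist z w; rewrite z1.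
  have k2 : d / 2 <= cabs (z - (w + h)).
    by have := cabs_le_dist z (w + h); have := cabsD w h; rewrite z1; move: h1; rewrite /d; lra.
  have -> : 2 / d ^+ 3 = d ^- 2 * (d / 2)^-1 by field; rewrite gt_eqF.
  rewrite ler_pM ?invr_ge0 ?exprn_ge0 ?cabs_ge0 //.
    by rewrite lef_pV2 ?posrE ?exprn_gt0 ?(lt_le_trans d0) // ler_pXn2r // nnegrE ?cabs_ge0 // ltW.
  by rewrite lef_pV2 ?posrE ?(lt_le_trans _ k2) ?divr_gt0.
rewrite -/I -mulrA -/C expr2 mulrAC ler_wpM2r ?cabs_ge0 //.
  apply: (@le_trans _ _ (cabs h * (C + 1))); first by rewrite ler_wpM2l ?cabs_ge0 // lerDl.
  by rewrite -ler_pdivlMr // ltW.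
Qed.

End cauchy.

(** * Poisson and Herglotz kernels, Poisson's formula, maximum principle *)

Section poisson.
Context {R : realType}.
Local Notation arc := (@arc_length R).
Local Notation Re := (@complex.Re R).
Local Notation Im := (@complex.Im R).
Local Notation T := (borel_circle R).
Implicit Types (F K f H J N : R[i] -> R[i]) (z w a s : R[i]) (u : T -> R).

Lemma invcE z : z^-1 = (cabs z ^- 2)%:C * z^*.
Proof.
have [->|z0] := eqVneq z 0; first by rewrite invr0 rmorph0 mulr0.
apply: (mulfI z0); rewrite mulfV // mulrCA mulrJ -rmorphM /= mulVf //.
by rewrite expf_neq0 // cabs_eq0.
Qed.

Lemma Re_div z w : Re (z / w) = (Re z * Re w + Im z * Im w) / cabs w ^+ 2.
Proof. by rewrite invcE !ReImE; ring. Qed.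

Lemma Re_cmean F : Re (cmean F) = (2 * pi)^-1 * \int[arc]_x Re (F (circle_val x)).
Proof. by rewrite /cmean ReM ReC ImC mul0r subr0. Qed.

(** The Poisson kernel at [w], written as the real part of the Herglotz kernel ([hk] below). *)
Definition pk w z := Re ((z + w) / (z - w)).

Lemma pkE w z : cabs z = 1 -> pk w z = (1 - cabs w ^+ 2) / cabs (z - w) ^+ 2.
Proof.
move=> z1; rewrite /pk Re_div; congr (_ / _); rewrite -[1](expr1n _ 2) -z1 !cabs_sqr !ReImE; ring.
Qed.

Lemma pkC w z : cabs z = 1 -> cabs w < 1 ->
  (pk w z)%:C = z / (z - w) + (w / (z - w))^*.
Proof.
move=> z1 w1; have zw : z - w != 0 by apply: sub_neq0; rewrite z1.
have E : z / (z - w) = 1 + w / (z - w) by rewrite -[X in _ = X + _](divff zw) -mulrDl subrK.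
rewrite /pk mulrDl E; move: (w / _) => q; apply: complexP; rewrite !ReImE; ring.
Qed.

Lemma pk_ge0 w z : cabs z = 1 -> cabs w < 1 -> 0 <= pk w z.
Proof.
move=> z1 w1; rewrite pkE // divr_ge0 ?sqr_ge0 // subr_ge0.
by rewrite expr_le1 ?cabs_ge0 // ltW.
Qed.

Lemma pk_le w z : cabs z = 1 -> cabs w < 1 -> pk w z <= (1 + cabs w) / (1 - cabs w).
Proof.
move=> z1 w1; have d0 : 0 < 1 - cabs w by rewrite subr_gt0.
have zw : 1 - cabs w <= cabs (z - w) by rewrite -{1}z1 cabs_le_dist.
rewrite pkE // ler_pdivrMr ?exprn_gt0 ?(lt_le_trans d0) //.
have -> : 1 - cabs w ^+ 2 = (1 + cabs w) / (1 - cabs w) * (1 - cabs w) ^+ 2 by field; rewrite gt_eqF.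
apply: ler_wpM2l; first exact: (divr_ge0 (addr_ge0 ler01 (cabs_ge0 w)) (ltW d0)).
by rewrite ler_pXn2r // nnegrE ?cabs_ge0 // ltW.
Qed.

Lemma pk_ge w z : cabs z = 1 -> cabs w < 1 -> (1 - cabs w) / (1 + cabs w) <= pk w z.
Proof.
move=> z1 w1; have d0 : 0 < 1 - cabs w by rewrite subr_gt0.
have d1 : 0 < 1 + cabs w by rewrite ltr_pwDl ?cabs_ge0.
have zw : cabs (z - w) <= 1 + cabs w by rewrite -{1}z1 -(cabsN w) cabsD.
have zw0 : 0 < cabs (z - w) by rewrite cabs_gt0 sub_neq0 // z1.
rewrite pkE // ler_pdivlMr ?exprn_gt0 //.
have -> : 1 - cabs w ^+ 2 = (1 - cabs w) / (1 + cabs w) * (1 + cabs w) ^+ 2 by field; rewrite gt_eqF.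
apply: ler_wpM2l; first exact: (divr_ge0 (ltW d0) (ltW d1)).
by rewrite ler_pXn2r // nnegrE ?cabs_ge0 // ltW.
Qed.

Definition hk w z := (z + w) / (z - w).

Lemma hkE w z : cabs z = 1 -> cabs w < 1 -> hk w z = 2 * z / (z - w) - 1.
Proof.
by move=> z1 w1; rewrite /hk; field; apply: sub_neq0; rewrite z1.
Qed.

Lemma ccont_id : ccont (@id R[i]).
Proof. by apply: ccont_cder => z _; exists 1; exact: cder_id. Qed.

Lemma ccont_hk w : cabs w < 1 -> ccont (hk w).
Proof.
move=> w1; apply: (ccontM (F := fun z => z + w)); last exact: ccont_subV.
by apply: ccont_cder => z _; eexists; exact: cderD (cder_id z) (cder_cst w z).
Qed.

Lemma ccont_pk w : cabs w < 1 -> ccont (fun z => (pk w z)%:C).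
Proof. by move=> w1 z z1; apply/continuous_realC/continuous_Re/ccont_hk. Qed.

Lemma geom_hol w : cabs w < 1 -> hol (2 / (1 + cabs w)) (fun z => (1 - w^* * z)^-1).
Proof.
move=> w1; have w0 := cabs_ge0 w; have w2 : 0 < 1 + cabs w by rewrite ltr_wpDr.
move=> z; rewrite ltr_pdivlMr // => h.
have D := cderB (cder_cst 1 z) (cderZ w^* (cder_id z)).
eexists; apply: (@cderV _ (fun z => 1 - w^* * z) z _ _ D).
rewrite subr_eq0 eq_sym; apply/eqP => /(congr1 (@cabs R)).
rewrite cabsM cabsJ cabs1 => wz.
have z1 : 1 <= cabs z by rewrite -wz ler_piMl ?cabs_ge0 // ltW.
by move: h; rewrite mulrDr mulr1 mulrC wz; lra.
Qed.

Lemma holM b F K : hol b F -> hol b K -> hol b (fun z => F z * K z).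
Proof.
by move=> hF hK z zb; have [l dl] := hF z zb; have [k dk] := hK z zb;
  eexists; exact: cderM dl dk.
Qed.

Lemma holD b F K : hol b F -> hol b K -> hol b (fun z => F z + K z).
Proof.
by move=> hF hK z zb; have [l dl] := hF z zb; have [k dk] := hK z zb;
  eexists; exact: cderD dl dk.
Qed.

Lemma holB b F K : hol b F -> hol b K -> hol b (fun z => F z - K z).
Proof.
by move=> hF hK z zb; have [l dl] := hF z zb; have [k dk] := hK z zb;
  eexists; exact: cderB dl dk.
Qed.

Lemma hol_cst b a : hol b (fun=> a).
Proof. by move=> z _; exists 0; exact: cder_cst. Qed.

Lemma hol_id b : hol b (@id R[i]).
Proof. by move=> z _; exists 1; exact: cder_id. Qed.

Lemma holZ b a F : hol b F -> hol b (fun z => a * F z).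
Proof. by move=> hF; apply: holM hF; exact: hol_cst. Qed.

Lemma hol_comp b c F K : hol b F -> (forall z, cabs z < b -> cabs (F z) < c) -> hol c K ->
  hol b (fun z => K (F z)).
Proof.
move=> hF Fc hK z zb; have [l dl] := hF z zb; have [k dk] := hK _ (Fc z zb).
by eexists; exact: cder_comp dl dk.
Qed.

Lemma hol_sub b c F : c <= b -> hol b F -> hol c F.
Proof. by move=> cb hF z zc; apply: hF; exact: lt_le_trans cb. Qed.

Lemma hol_scale b r F : 0 < r -> hol b F -> hol (b / r) (fun z => F (r%:C * z)).
Proof.
move=> r0 hF; apply: hol_comp hF; first exact/holZ/hol_id.
by move=> z; rewrite ltr_pdivlMr // cabsM cabsC gtr0_norm // mulrC.
Qed.

Lemma hol_ccont1 b F : hol b F -> 1 < b -> ccont F.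
Proof. by move=> hF b1 z z1; apply: (hol_continuous hF); rewrite z1. Qed.

(** On the circle the Poisson kernel is the Cauchy kernel plus [conj w * z / (1 - conj w * z)]. The
    second term is holomorphic past the closed disc and vanishes at 0, so its product with [f] has
    mean 0. *)
Lemma poisson_formula f (b : R) w : hol b f -> 1 < b -> cabs w < 1 ->
  cmean (fun z => f z * (pk w z)%:C) = f w.
Proof.
move=> hf b1 w1.
have w0 := cabs_ge0 w; have w2 : 0 < 1 + cabs w by rewrite ltr_wpDr.
have cf := hol_ccont1 hf b1.
pose b' := Num.min b (2 / (1 + cabs w)).
have b'1 : 1 < b' by rewrite lt_min b1 ltr_pdivlMr //=; lra.
have hG : hol b' (fun z => f z * (w^* * z * (1 - w^* * z)^-1)).
  apply: holM; first by apply: hol_sub hf; rewrite ge_min lexx.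
  apply: holM; first exact/holZ/hol_id.
  by apply: hol_sub (geom_hol w1); rewrite ge_min lexx orbT.
have mG := mean_value1 b'1 hG.
have cG := hol_ccont1 hG b'1.
have c1 : ccont (fun z => f z * (z / (z - w))).
  exact: ccontM cf (ccontM ccont_id (ccont_subV w1)).
rewrite -(cauchy_formula hf w1 b1) -[RHS]addr0.
have -> : (0 : R[i]) = cmean (fun z => f z * (w^* * z * (1 - w^* * z)^-1)).
  by rewrite mG mulr0 mul0r mulr0.
rewrite [X in _ = X + _](@eq_cmean _ _ (fun z => f z * (z / (z - w)))); last first.
  by move=> z _; rewrite mul1r.
rewrite -cmeanD //; apply: eq_cmean => z z1; rewrite pkC // mulrDr; congr (_ + _ * _).
have zz : z * z^* = 1 by rewrite mulrJ z1 expr1n.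
have z0 : z != 0 by rewrite -cabs_gt0 z1.
have zzV : z^* = z^-1 by rewrite -[LHS]mul1r -(mulVf z0) -mulrA zz mulr1.
rewrite rmorphM fmorphV rmorphB /= zzV.
have -> : z^-1 - w^* = (1 - w^* * z) / z by field.
by rewrite invf_div mulrA.
Qed.

Lemma cabs_cmean_pk F (M : R) w : ccont F -> cabs w < 1 -> (forall z, cabs z = 1 -> cabs (F z) <= M) ->
  cabs (cmean (fun z => F z * (pk w z)%:C)) <= M.
Proof.
move=> cF w1 FM; have cP := ccont_pk w1.
have M0 : 0 <= M by apply: le_trans (FM 1 (@cabs1 R)); exact: cabs_ge0.
have ci := ccont_cintegrable (ccontM cF cP).
rewrite /cmean cabsM cabsC ger0_norm ?invr_ge0 ?(ltW twopi_gt0) //.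
rewrite mulrC ler_pdivrMr ?twopi_gt0 //.
apply: le_trans (cabs_cint_le _ ci) _ => //.
have iP := (ccont_cintegrable cP).1.
have E : \int[arc]_x pk w (circle_val x) = 2 * pi.
  have := poisson_formula (@hol_cst 2 1) (ltr1n _ 2) w1 => /(congr1 Re).
  rewrite Re_cmean Re1 => h; have tp : (2 * pi : R) != 0 by rewrite gt_eqF ?twopi_gt0.
  have tpV : (2 * pi : R)^-1 != 0 by rewrite invr_eq0.
  apply: (mulfI tpV); rewrite mulVf //; apply: etrans h; congr (_ * _).
  apply: eq_Rintegral => x _.
  by rewrite mul1r ReC.
rewrite -E -RintegralZl //; apply: le_Rintegral => //.
- exact: cintegrable_cabs.
- by have := integrableZl measurableT M iP; apply: eq_integrable.
- move=> x _; have x1 := cabs_circle_val x.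
  by rewrite cabsM cabsC ger0_norm ?pk_ge0 // ler_wpM2r ?pk_ge0 // FM.
Qed.

(** After rescaling, Poisson's formula writes [H w] as an average of the values on the circle of
    radius [r] against a nonnegative kernel of mean 1. *)
Lemma hol_max H (b r M : R) w : hol b H -> r < b -> cabs w < r ->
  (forall z, cabs z = r -> cabs (H z) <= M) -> cabs (H w) <= M.
Proof.
move=> hH rb wr HM; have r0 : 0 < r := le_lt_trans (cabs_ge0 w) wr.
have rC0 : r%:C != 0 :> R[i] by rewrite -cabs_gt0 cabsC normr_gt0 gt_eqF.
have hS := hol_scale r0 hH.
have b1 : 1 < b / r by rewrite ltr_pdivlMr // mul1r.
have w1 : cabs (w / r%:C) < 1 by rewrite cabsM cabsV cabsC gtr0_norm // ltr_pdivrMr // mul1r.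
have -> : H w = H (r%:C * (w / r%:C)) by rewrite mulrCA divff // mulr1.
rewrite -(poisson_formula hS b1 w1); apply: cabs_cmean_pk => //; first exact: hol_ccont1 hS b1.
by move=> z z1; apply: HM; rewrite cabsM z1 mulr1 cabsC gtr0_norm.
Qed.

Lemma unimodular_Re1 z : cabs z <= 1 -> Re z = 1 -> z = 1.
Proof.
move=> z1 Rz; have := cabs_sqr z; rewrite Rz expr1n => h.
have : Im z ^+ 2 <= 0.
  have : cabs z ^+ 2 <= 1 by rewrite expr_le1 ?cabs_ge0.
  lra.
rewrite le_eqVlt ltNge sqr_ge0 orbF sqrf_eq0 => /eqP Iz.
by apply: complexP; rewrite ?Rz ?Iz.
Qed.

(* Harnack's inequality for [1 - J^* 0 * J], whose real part is nonnegative and vanishes at 0. *)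
Lemma hol_const0 J w : hol 1 J -> (forall z, cabs z < 1 -> cabs (J z) <= 1) ->
  cabs (J 0) = 1 -> cabs w < 1 -> J w = J 0.
Proof.
move=> hJ J1 J01 w1.
pose V z := 1 - (J 0)^* * J z.
have JJ : (J 0)^* * J 0 = 1 by rewrite mulrC mulrJ J01 expr1n.
have hV : hol 1 V by apply: holB; [exact: hol_cst|exact: holZ].
have VRe z : cabs z < 1 -> 0 <= Re (V z).
  move=> z1; rewrite /V ReB subr_ge0 (le_trans (ler_norm _)) // (le_trans (Re_le_cabs _)) //.
  by rewrite cabsM cabsJ J01 mul1r J1.
suff V0 : Re (V w) <= 0.
  have Vw : Re ((J 0)^* * J w) = 1.
    by have := VRe _ w1; move: V0; rewrite /V ReB /=; lra.
  have E : (J 0)^* * J w = 1.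
    by apply: unimodular_Re1 => //; rewrite cabsM cabsJ J01 mul1r J1.
  by rewrite -[LHS]mul1r -JJ (mulrC _ (J 0)) -mulrA E mulr1.
pose r := (cabs w + 1) / 2.
have w0 := cabs_ge0 w.
have r0 : 0 < r by rewrite divr_gt0 // ltr_wpDl.
have wr : cabs w < r by rewrite /r; lra.
have r1 : r < 1 by rewrite /r; lra.
have rC0 : r%:C != 0 :> R[i] by rewrite -cabs_gt0 cabsC normr_gt0 gt_eqF.
have b1 : 1 < 1 / r by rewrite ltr_pdivlMr // mul1r.
have hS := hol_scale r0 hV.
have v1 : cabs (w / r%:C) < 1 by rewrite cabsM cabsV cabsC gtr0_norm // ltr_pdivrMr // mul1r.
have cS := hol_ccont1 hS b1.
have := poisson_formula hS b1 v1; rewrite [r%:C * _]mulrCA divff // mulr1 => <-.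
rewrite Re_cmean; have := mean_value1 b1 hS; rewrite mulr0 [X in _ = X]/V JJ subrr.
move=> /(congr1 Re) h1; rewrite Re_cmean in h1; move/eqP: h1; rewrite mulf_eq0 invr_eq0 gt_eqF ?twopi_gt0 //=.
move=> /eqP h0; rewrite pmulr_rle0 ?invr_gt0 ?twopi_gt0 //.
set C := (1 + cabs (w / r%:C)) / (1 - cabs (w / r%:C)).
apply: (@le_trans _ _ (\int[arc]_x (C * Re (V (r%:C * circle_val x))))).
  apply: le_Rintegral => //.
  - exact: (ccont_cintegrable (ccontM cS (ccont_pk v1))).1.
  - by have := integrableZl measurableT C (ccont_cintegrable cS).1; apply: eq_integrable.
  move=> x _; have x1 := cabs_circle_val x; rewrite ReM ReC ImC mulr0 subr0 mulrC.
  apply: ler_wpM2r; last exact: pk_le.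
  by apply: VRe; rewrite cabsM x1 mulr1 cabsC gtr0_norm.
by rewrite RintegralZl ?h0 ?mulr0 //; exact: (ccont_cintegrable cS).1.
Qed.

End poisson.

(** * Moebius maps of the disc and Schwarz's lemma *)

Section mobius.
Context {R : realType}.
Local Notation Re := (@complex.Re R).
Local Notation Im := (@complex.Im R).
Implicit Types (F J N I : R[i] -> R[i]) (z w a s : R[i]).

Definition mob a z := (z + a) / (1 + a^* * z).

Lemma mob_den a z : cabs a < 1 -> cabs z <= 1 -> 1 + a^* * z != 0.
Proof.
move=> a1 z1; rewrite addrC -[X in _ + X]opprK subr_eq0; apply/eqP => /(congr1 (@cabs R)).
rewrite cabsN cabs1 cabsM cabsJ => h.
have : cabs a * cabs z < 1 by apply: le_lt_trans a1; rewrite ler_piMr ?cabs_ge0.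
by rewrite h ltxx.
Qed.

Lemma mob_cabs a z : cabs (1 + a^* * z) ^+ 2 - cabs (z + a) ^+ 2 =
  (1 - cabs a ^+ 2) * (1 - cabs z ^+ 2).
Proof. by rewrite !cabs_sqr !ReImE; ring. Qed.

Lemma mob_lt1 a z : cabs a < 1 -> cabs z < 1 -> cabs (mob a z) < 1.
Proof.
move=> a1 z1; have d0 := mob_den a1 (ltW z1).
rewrite cabsM cabsV ltr_pdivrMr ?cabs_gt0 // mul1r -(@ltr_pXn2r _ 2) ?nnegrE ?cabs_ge0 //.
rewrite -subr_gt0 mob_cabs mulr_gt0 // subr_gt0 expr_lt1 ?cabs_ge0 //.
Qed.

Lemma mobK a z : cabs a < 1 -> cabs z < 1 -> mob (- a) (mob a z) = z.
Proof.
move=> a1 z1; have d0 := mob_den a1 (ltW z1).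
have d1 : 1 - a^* * mob a z != 0.
  have := mob_den (a := - a) (z := mob a z); rewrite rmorphN /= mulNr; apply.
    by rewrite cabsN.
  exact/ltW/mob_lt1.
rewrite /mob rmorphN /= mulNr -/(mob a z).
apply: (mulIf d1); rewrite divfK // /mob.
by field.
Qed.

Lemma mob0 a : mob a 0 = a.
Proof. by rewrite /mob add0r mulr0 addr0 divr1. Qed.

Lemma mobN a : mob (- a) a = 0.
Proof. by rewrite /mob subrr mul0r. Qed.

Lemma cder_mob a z : cabs a < 1 -> cabs z <= 1 ->
  cder (mob a) z ((1 - (cabs a ^+ 2)%:C) / (1 + a^* * z) ^+ 2).
Proof.
move=> a1 z1; have d0 := mob_den a1 z1.
have D1 := cderD (cder_id z) (cder_cst a z).
have D2 := cderD (cder_cst 1 z) (cderZ a^* (cder_id z)).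
have := cderM D1 (@cderV _ (fun z => 1 + a^* * z) z _ d0 D2).
rewrite -mulrJ.
by have -> : (1 + 0) * (1 + a^* * id z)^-1 + (id z + a) * (- (0 + a^* * 1) / (1 + a^* * z) ^+ 2) =
  (1 - a * a^*) / (1 + a^* * z) ^+ 2 by rewrite /=; field.
Qed.

Lemma hol_mob a : cabs a < 1 -> hol 1 (mob a).
Proof. by move=> a1 z /ltW z1; eexists; exact: cder_mob. Qed.

(** Composition with [mob a] moves the point where the modulus is maximal to 0, the case of
    [hol_const0]. *)
Lemma hol_const J a w : hol 1 J -> (forall z, cabs z < 1 -> cabs (J z) <= 1) ->
  cabs a < 1 -> cabs (J a) = 1 -> cabs w < 1 -> J w = J a.
Proof.
move=> hJ J1 a1 Ja w1.
have Na1 : cabs (- a) < 1 by rewrite cabsN.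
have := @hol_const0 R (fun z => J (mob a z)) (mob (- a) w).
rewrite mob0 => /(_ _ _ Ja (mob_lt1 Na1 w1)).
have -> : mob a (mob (- a) w) = w by rewrite -{1}[a]opprK mobK.
apply.
  by apply: (hol_comp (hol_mob a1)) hJ => z z1; exact: mob_lt1.
by move=> z z1; apply: J1; exact: mob_lt1.
Qed.

(** Cauchy's formula on the circle of radius 1/2 writes [N z / z] near 0 as a Cauchy transform, so
    the quotient is holomorphic at 0. Its bound comes from the maximum principle on circles tending
    to the unit circle. *)
Lemma schwarz N : hol 1 N -> (forall z, cabs z < 1 -> cabs (N z) <= 1) -> N 0 = 0 ->
  exists J, [/\ hol 1 J, (forall z, cabs z < 1 -> cabs (J z) <= 1) &
                 forall z, cabs z < 1 -> N z = z * J z].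
Proof.
move=> hN N1 N0.
pose r : R := 2^-1.
have r0 : 0 < r by rewrite invr_gt0.
have r1 : r < 1 by rewrite invf_lt1 // ltr1n.
have rC0 : r%:C != 0 :> R[i] by rewrite -cabs_gt0 cabsC normr_gt0 gt_eqF.
pose u (x : borel_circle R) := N (r%:C * circle_val x).
pose J' z := ((2 * pi)^-1)%:C * r%:C^-1 * cauchyT u (r%:C^-1 * z).
have cN : ccont (fun z => N (r%:C * z)) by apply: hol_ccont hN (ltW r0) r1.
have iu : cintegrable (@arc_length R) setT u by exact: (ccont_cintegrable cN).
have J'E z : cabs z < r -> N z = z * J' z.
  move=> zr; have zr1 : cabs (r%:C^-1 * z) < 1.
    by rewrite cabsM cabsV cabsC gtr0_norm // mulrC ltr_pdivrMr // mul1r.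
  have nz w : cabs w = 1 -> r%:C * w - z != 0.
    by move=> w1; apply: sub_neq0; rewrite cabsM w1 mulr1 cabsC gtr0_norm.
  rewrite -[LHS]subr0 -N0 -(cauchy_formula hN zr r1).
  rewrite -(cauchy_formula hN (w := 0) (r := r)) ?cabs0 //.
  have cr : ccont (fun w => r%:C * w) by apply: ccont_cder => w _; eexists; exact: cderZ (cder_id w).
  have cV : ccont (fun w => (w - r%:C^-1 * z)^-1) by exact: ccont_subV.
  have cQ : ccont (fun w => r%:C * w / (r%:C * w - z)).
    apply: ccont_cder => w w1; have D := cderZ r%:C (cder_id w).
    have D2 := cderB D (cder_cst z w); eexists.
    exact: (cderM D (@cderV _ (fun w => r%:C * w - z) w _ (nz _ w1) D2)).
  have cQ0 : ccont (fun w => r%:C * w / (r%:C * w - 0)).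
    apply: ccont_cder => w w1; have D := cderZ r%:C (cder_id w).
    have D2 := cderB D (cder_cst 0 w); eexists.
    have nz0 : r%:C * w - 0 != 0 by rewrite subr0 mulf_neq0 // -cabs_gt0 w1.
    exact: (cderM D (@cderV _ (fun w => r%:C * w - 0) w _ nz0 D2)).
  rewrite -(cmeanB (ccontM cN cQ) (ccontM cN cQ0)) /J' /cauchyT.
  rewrite -[_ * _ * cint _ _ _]mulrA mulrCA /cmean; congr (_ * _).
  have iK := cintegrableK iu cV.
  rewrite -(cintZ r%:C^-1 measurableT iK) -(cintZ z measurableT (cintegrableZ r%:C^-1 measurableT iK)).
  apply: eq_cint => x _; have x1 := cabs_circle_val x.
  have x0 : circle_val x != 0 by rewrite -cabs_gt0 x1.
  have h := nz _ x1; rewrite /u subr0.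
  have E : circle_val x - r%:C^-1 * z = (r%:C * circle_val x - z) / r%:C by field.
  rewrite E; move: (N _) => Nx.
  by field; rewrite h rC0 x0.
pose J z := if z == 0 then J' 0 else N z / z.
have NJ z : cabs z < 1 -> N z = z * J z.
  by move=> z1; rewrite /J; case: eqVneq => [->|z0]; rewrite ?N0 ?mul0r // mulrC divfK.
have hJ : hol 1 J.
  move=> z z1; have [->|z0] := eqVneq z 0.
    have q0 : cabs (r%:C^-1 * 0 : R[i]) < 1 by rewrite mulr0 cabs0.
    have D := cder_comp (cderZ r%:C^-1 (cder_id 0)) (cder_cauchyT iu q0).
    eexists; apply: cder_near (cderZ (((2 * pi)^-1)%:C * r%:C^-1) D).
    exists r => // w; rewrite subr0 => wr; rewrite -[LHS]/(J' w) /J.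
    case: eqVneq => [->//|w0]; rewrite (J'E _ wr) mulrC mulKf //.
  have [l dl] := hN z z1.
  eexists; apply: cder_near (cderM dl (cder_inv z0)).
  exists (cabs z); first by rewrite cabs_gt0.
  move=> w wz; rewrite /J; case: eqVneq wz => // ->.
  by rewrite sub0r cabsN ltxx.
exists J; split=> // z z1.
apply/ler_addgt0Pr => e e0.
(* A radius beyond [|z|] for which [1 / t <= 1 + e]. *)
pose t := Num.max ((cabs z + 1) / 2) (1 + e)^-1.
have e1 : 0 < 1 + e by rewrite addr_gt0.
have zt : cabs z < t by rewrite /t lt_max; apply/orP; left; lra.
have t1 : t < 1.
  by rewrite gt_max; apply/andP; split; [lra|rewrite invf_lt1 // ltrDl].
have t0 : 0 < t := le_lt_trans (cabs_ge0 z) zt.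
apply: (hol_max hJ t1 zt) => w wt.
have w1 : cabs w < 1 by rewrite wt.
have w0 : w != 0 by rewrite -cabs_gt0 wt.
have := NJ w w1 => /(congr1 (@cabs R)); rewrite cabsM wt => h.
rewrite -(ler_pM2l t0) -h (le_trans (N1 _ w1)) //.
by rewrite -ler_pdivrMr // mul1r /t le_max lexx orbT.
Qed.

End mobius.

(** * Two-point data and the Schwarz-Pick trichotomy *)

Section divided_difference.
Context {R : realType}.
Local Notation arc := (@arc_length R).
Local Notation Re := (@complex.Re R).
Local Notation Im := (@complex.Im R).
Local Notation T := (borel_circle R).
Implicit Types (F K f k H J N I E : R[i] -> R[i]) (z w a : R[i]).
Variables s1 s2 : R[i].
Hypotheses (s1D : cabs s1 < 1) (s2D : cabs s2 < 1).

(** The divided difference, confluent when [s1 = s2]. Together with the value at [s1] it encodes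
    both the two-point data of the Lempert function and the point-and-direction data of the
    Kobayashi-Royden metric, so that one proof serves both. *)
Definition dd F := if s1 == s2 then derive1 F s1 else (F s2 - F s1) / (s2 - s1).

Lemma cder_derive1 F z l : cder F z l -> derive1 F z = l.
Proof. by move=> /cder_derivable[]. Qed.

Lemma dd_step F : F s2 = F s1 + dd F * (s2 - s1).
Proof.
rewrite /dd; case: eqVneq => [->|s12]; first by rewrite subrr mulr0 addr0.
by rewrite divfK ?subrKC // subr_eq0 eq_sym.
Qed.

Lemma ddM F K : hol 1 F -> hol 1 K -> dd (fun z => F z * K z) = dd F * K s2 + F s1 * dd K.
Proof.
move=> hF hK; rewrite /dd; case: eqVneq => [e|s12].
  have [l dl] := hF _ s1D; have [m dm] := hK _ s1D.
  by rewrite (cder_derive1 dl) (cder_derive1 dm) (cder_derive1 (cderM dl dm)) -e.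
by have : s2 - s1 != 0 by [rewrite subr_eq0 eq_sym]; move=> h; field.
Qed.

Lemma ddB F K : hol 1 F -> hol 1 K -> dd (fun z => F z - K z) = dd F - dd K.
Proof.
move=> hF hK; rewrite /dd; case: eqVneq => [e|s12].
  have [l dl] := hF _ s1D; have [m dm] := hK _ s1D.
  by rewrite (cder_derive1 dl) (cder_derive1 dm) (cder_derive1 (cderB dl dm)).
by have : s2 - s1 != 0 by [rewrite subr_eq0 eq_sym]; move=> h; field.
Qed.

Lemma ddD F K : hol 1 F -> hol 1 K -> dd (fun z => F z + K z) = dd F + dd K.
Proof.
move=> hF hK; rewrite /dd; case: eqVneq => [e|s12].
  have [l dl] := hF _ s1D; have [m dm] := hK _ s1D.
  by rewrite (cder_derive1 dl) (cder_derive1 dm) (cder_derive1 (cderD dl dm)).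
by have : s2 - s1 != 0 by [rewrite subr_eq0 eq_sym]; move=> h; field.
Qed.

Lemma dd_cst a : dd (fun=> a) = 0.
Proof.
rewrite /dd; case: eqVneq => _; first by rewrite (cder_derive1 (cder_cst a _)).
by rewrite subrr mul0r.
Qed.

Lemma dd_id : dd id = 1.
Proof.
rewrite /dd; case: eqVneq => s12; first by rewrite (cder_derive1 (cder_id _)).
by rewrite divff // subr_eq0 eq_sym.
Qed.

Definition same_data F f := F s1 = f s1 /\ dd F = dd f.

Lemma same_data_s2 F f : same_data F f -> F s2 = f s2.
Proof. by move=> [h1 h2]; rewrite dd_step h1 h2 -dd_step. Qed.

Lemma same_dataM F f K k : hol 1 F -> hol 1 f -> hol 1 K -> hol 1 k ->
  same_data F f -> same_data K k -> same_data (fun z => F z * K z) (fun z => f z * k z).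
Proof.
move=> hF hf hK hk h1 h2; split; first by rewrite h1.1 h2.1.
by rewrite !ddM // h1.2 h2.2 h1.1 (same_data_s2 h2).
Qed.

Lemma same_data_comp E F f : hol 1 F -> hol 1 f -> (exists l, cder E (F s1) l) ->
  same_data F f -> same_data (fun z => E (F z)) (fun z => E (f z)).
Proof.
move=> hF hf [l El] h; have h2 := same_data_s2 h; have [h1 h3] := h.
split; first by rewrite h1.
move: h3; rewrite /dd; case: eqVneq => [e|s12 _]; last by rewrite h1 h2.
have [m dm] := hF _ s1D; have [n dn] := hf _ s1D.
rewrite (cder_derive1 dm) (cder_derive1 dn) => mn.
rewrite (cder_derive1 (cder_comp dm El)).
by move: El; rewrite h1 => El; rewrite (cder_derive1 (cder_comp dn El)) mn.
Qed.

Lemma eq_on_disc_cder F f z l : (forall z, cabs z < 1 -> F z = f z) -> cabs z < 1 ->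
  cder F z l -> cder f z l.
Proof.
move=> Ff z1; apply: cder_near; exists (1 - cabs z); first by rewrite subr_gt0.
move=> w wz; apply: Ff; rewrite -[w](subrK z); apply: le_lt_trans (cabsD _ _) _.
by rewrite -ltrBrDr.
Qed.

Lemma eq_hol F f : (forall z, cabs z < 1 -> F z = f z) -> hol 1 F -> hol 1 f.
Proof. by move=> Ff hF z z1; have [l dl] := hF z z1; exists l; exact: eq_on_disc_cder dl. Qed.

Lemma eq_same_data F f : hol 1 F -> (forall z, cabs z < 1 -> F z = f z) -> same_data F f.
Proof.
move=> hF Ff; split; first exact: Ff.
rewrite /dd; case: eqVneq => [e|s12]; last by rewrite !Ff.
have [l dl] := hF _ s1D; rewrite (cder_derive1 dl).
by rewrite (cder_derive1 (eq_on_disc_cder Ff s1D dl)).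
Qed.

Lemma same_data_trans F f k : same_data F f -> same_data f k -> same_data F k.
Proof. by move=> [a1 a2] [b1 b2]; split; [rewrite a1|rewrite a2]. Qed.

Lemma same_data_sym F f : same_data F f -> same_data f F.
Proof. by move=> [a1 a2]. Qed.

Lemma holomorphic_on_hol F : holomorphic_on (@disc R) F <-> hol 1 F.
Proof.
split=> hF z.
  by move=> z1; exists (derive1 F z); apply: derivable_cder; apply: hF; rewrite disc_cabs.
by rewrite disc_cabs => /hF[l /cder_derivable[]].
Qed.

Lemma hol_mobN a : cabs a < 1 -> hol 1 (mob (- a)).
Proof. by move=> a1; apply: hol_mob; rewrite cabsN. Qed.

Lemma aut_disc_mob I a b c : cabs a < 1 -> cabs b < 1 -> cabs c = 1 ->
  (forall z, cabs z < 1 -> I z = mob b (c * mob (- a) z)) -> aut_disc I.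
Proof.
move=> a1 b1 c1 IE; have Na1 : cabs (- a) < 1 by rewrite cabsN.
have Nb1 : cabs (- b) < 1 by rewrite cabsN.
have c0 : c != 0 by rewrite -cabs_gt0 c1.
have cV1 : cabs c^-1 = 1 by rewrite cabsV c1 invr1.
have h1 z : cabs z < 1 -> cabs (c * mob (- a) z) < 1 by move=> z1; rewrite cabsM c1 mul1r mob_lt1.
have h2 z : cabs z < 1 -> cabs (c^-1 * mob (- b) z) < 1 by move=> z1; rewrite cabsM cV1 mul1r mob_lt1.
have H1 : hol 1 (fun z => mob b (c * mob (- a) z)).
  by apply: hol_comp (hol_mob b1); [apply: holZ; exact: hol_mobN|exact: h1].
split.
  split; first by apply/holomorphic_on_hol; apply: eq_hol H1 => z z1; rewrite IE.
  by move=> z; rewrite !disc_cabs => z1; rewrite IE // mob_lt1 // h1.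
exists (fun w => mob a (c^-1 * mob (- b) w)).
  split.
    by apply/holomorphic_on_hol; apply: hol_comp (hol_mob a1);
      [apply: holZ; exact: hol_mobN|exact: h2].
  by move=> z; rewrite !disc_cabs => z1; rewrite mob_lt1 // h2.
move=> z; rewrite disc_cabs => z1; split.
  rewrite IE // mobK ?h1 // mulKf //; rewrite -{1}[a]opprK mobK //.
rewrite IE; last by rewrite mob_lt1 // h2.
by rewrite mobK ?h2 // mulVKf // -{1}[b]opprK mobK.
Qed.

(** If [I] takes no unimodular value, conjugation by Moebius maps and Schwarz's lemma give
    [I = mob b (W * J(W))] with [W s1 = 0]. By the Leibniz rule for [dd], only the number
    [t = J (W s2)] enters the data, so [J] may be replaced by the constant [t]. If [J] takes no
    unimodular value either, [|t| < 1] and the new map stays in a smaller disc. *)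
Lemma schwarz_pick_trichotomy I : hol 1 I -> (forall z, cabs z < 1 -> cabs (I z) <= 1) ->
  [\/ exists2 c, cabs c = 1 & forall z, cabs z < 1 -> I z = c,
      aut_disc I |
      exists q (rho : R), [/\ hol 1 q, 0 < rho < 1, forall z, cabs z < 1 -> cabs (q z) <= rho &
        same_data q I]].
Proof.
move=> hI I1.
have [[a a1 Ia]|nI] := pselect (exists2 a, cabs a < 1 & cabs (I a) = 1).
  by apply: Or31; exists (I a) => // z z1; exact: (hol_const hI I1 a1 Ia).
have I2 z : cabs z < 1 -> cabs (I z) < 1.
  move=> z1; rewrite lt_neqAle I1 // andbT; apply/eqP => h; apply: nI; by exists z.
pose b := I s1; have b1 : cabs b < 1 := I2 _ s1D.
have Nb1 : cabs (- b) < 1 by rewrite cabsN.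
have Ns1 : cabs (- s1) < 1 by rewrite cabsN.
pose N z := mob (- b) (I (mob s1 z)).
have hN : hol 1 N.
  apply: hol_comp (hol_mobN b1); last by move=> z z1; apply/I2/mob_lt1.
  by apply: hol_comp hI; [exact: hol_mob|move=> z; exact: mob_lt1].
have N1 z : cabs z < 1 -> cabs (N z) <= 1 by move=> z1; apply/ltW/mob_lt1 => //; apply/I2/mob_lt1.
have N0 : N 0 = 0 by rewrite /N mob0 mobN.
have [J [hJ J1 NJ]] := schwarz hN N1 N0.
pose W : R[i] -> R[i] := mob (- s1).
have W1 z : cabs z < 1 -> cabs (W z) < 1 by exact: mob_lt1.
have hW : hol 1 W by exact: hol_mobN.
have IE z : cabs z < 1 -> I z = mob b (W z * J (W z)).
  move=> z1; rewrite -NJ ?W1 // /N -{1}[b]opprK mobK //.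
    by rewrite /W -{1}[s1]opprK mobK.
  by rewrite /W -{1}[s1]opprK mobK // I2.
have [[a a1 Ja]|nJ] := pselect (exists2 a, cabs a < 1 & cabs (J a) = 1).
  apply: Or32; apply: (aut_disc_mob s1D b1 Ja) => z z1.
  by rewrite IE // mulrC (hol_const hJ J1 a1 Ja) // W1.
apply: Or33; pose t := J (W s2).
have t1 : cabs t < 1.
  rewrite lt_neqAle J1 ?W1 // andbT; apply/eqP => h; apply: nJ; exists (W s2) => //; exact: W1.
have Wt z : cabs z < 1 -> cabs (W z * t) <= cabs t.
  by move=> z1; rewrite cabsM ler_piMl ?cabs_ge0 // ltW // W1.
have Wt1 z : cabs z < 1 -> cabs (W z * t) < 1 by move=> /Wt h; exact: le_lt_trans h t1.
pose q z := mob b (W z * t).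
(* From [1 - |mob b v|^2 = (1 - |b|^2)(1 - |v|^2) / |1 + conj b * v|^2], with [|v| <= |t|] and
   denominator at most 4. *)
pose kap := (1 - cabs b ^+ 2) * (1 - cabs t ^+ 2) / 4.
have sq1 (x : R) : 0 <= x < 1 -> 0 < 1 - x ^+ 2.
  by move=> /andP[x0 x1]; rewrite subr_gt0 expr_lt1.
have k0 : 0 < kap by rewrite divr_gt0 // mulr_gt0 // sq1 // cabs_ge0.
have k1 : kap < 1.
  have B1 : 1 - cabs b ^+ 2 <= 1 by rewrite gerBl sqr_ge0.
  have T1 : 1 - cabs t ^+ 2 <= 1 by rewrite gerBl sqr_ge0.
  rewrite ltr_pdivrMr // mul1r; apply: (@le_lt_trans _ _ 1); last by rewrite ltr1n.
  by rewrite mulr_ile1 // ltW // sq1 // cabs_ge0.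
have hWt : hol 1 (fun z => W z * t) by exact: (holM hW (@hol_cst R 1 t)).
have hWJ : hol 1 (fun z => W z * J (W z)) by exact: (holM hW (hol_comp hW W1 hJ)).
have s0 : Num.sqrt (1 - kap) < 1.
  by rewrite -[ltRHS]sqrtr1 ltr_sqrt // gtrBl.
have sp : 0 < Num.sqrt (1 - kap) by rewrite sqrtr_gt0 subr_gt0.
exists q, (Num.sqrt (1 - kap)); split.
- exact: (hol_comp hWt Wt1 (hol_mob b1)).
- by rewrite sp s0.
- move=> z z1; rewrite -(@ler_pXn2r _ 2) ?nnegrE ?cabs_ge0 ?sqrtr_ge0 //.
  rewrite sqr_sqrtr ?subr_ge0 ?(ltW k1) //.
  have v1 := Wt1 z z1; have vt := Wt z z1.
  rewrite lerBrDl -lerBrDr /q; move: (W z * t) v1 vt => v v1 vt.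
  have D0 := mob_den b1 (ltW v1).
  have D2 : cabs (1 + b^* * v) ^+ 2 <= 4.
    rewrite -[4](_ : 2 ^+ 2 = _); last by rewrite expr2; ring.
    rewrite ler_pXn2r ?nnegrE ?cabs_ge0 // (le_trans (cabsD _ _)) // cabs1 cabsM cabsJ.
    rewrite -[2]/(1 + 1) lerD2l mulr_ile1 ?cabs_ge0 // ltW //.
  have -> : 1 - cabs (mob b v) ^+ 2 = (1 - cabs b ^+ 2) * (1 - cabs v ^+ 2) / cabs (1 + b^* * v) ^+ 2.
    by rewrite -mob_cabs cabsM cabsV; field; rewrite cabs_eq0.
  rewrite ler_pM ?invr_ge0 ?ler0n //.
  + by rewrite mulr_ge0 // ltW // sq1 // cabs_ge0.
  + rewrite ler_wpM2l ?(ltW (sq1 _ _)) ?cabs_ge0 //.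
    by rewrite lerD2l lerN2 ler_pXn2r ?nnegrE ?cabs_ge0.
  + by rewrite lef_pV2 // posrE ?exprn_gt0 ?cabs_gt0.
- apply: (@same_data_trans _ (fun z => mob b (W z * J (W z)))).
    apply: same_data_comp => //; first by eexists; apply: cder_mob => //; exact/ltW/Wt1.
    have W0 : W s1 = 0 by exact: mobN.
    split; first by rewrite W0 !mul0r.
    rewrite (ddM hW (@hol_cst R 1 t)) (ddM (K := fun z => J (W z)) hW) ?W0 ?mul0r //.
    exact: hol_comp hW W1 hJ.
  apply: same_data_sym; apply: eq_same_data => //.
Qed.

End divided_difference.

(** * Herglotz integrals and their divided differences *)

Section herglotz.
Context {R : realType}.
Local Notation arc := (@arc_length R).
Local Notation Re := (@complex.Re R).
Local Notation Im := (@complex.Im R).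
Local Notation T := (borel_circle R).
Implicit Types (u v : T -> R) (z w s : R[i]).

Definition rint u := arc.-integrable setT (EFin \o u).

(** The holomorphic function whose real part is the Poisson integral of [u] and whose value at 0 is
    real. *)
Definition herg u w : R[i] :=
  ((2 * pi)^-1)%:C * cint arc setT (fun x => (u x)%:C * hk w (circle_val x)).

Definition pint u (k : R[i] -> R) := (2 * pi)^-1 * \int[arc]_x (u x * k (circle_val x)).

Lemma rint_cintegrable u : rint u -> cintegrable arc setT (fun x => (u x)%:C).
Proof. by move=> iu; split => //; exact: (finite_integrable_cst 0 measurableT arc_lty). Qed.

Lemma herg_integrable u w : rint u -> cabs w < 1 ->
  cintegrable arc setT (fun x => (u x)%:C * hk w (circle_val x)).
Proof. by move=> iu w1; apply: cintegrableK; [exact: rint_cintegrable|exact: ccont_hk]. Qed.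

Lemma Re_herg u w : Re (herg u w) = pint u (pk w).
Proof.
rewrite /herg ReM ReC ImC mul0r subr0 /pint Re_cint; congr (_ * _).
by apply: eq_Rintegral => x _; rewrite ReM ReC ImC mul0r subr0.
Qed.

Lemma Im_herg0 u : Im (herg u 0) = 0.
Proof.
rewrite /herg ImM ReC ImC mul0r addr0 Im_cint (@eq_Rintegral _ _ _ _ _ (fun=> 0)).
  by rewrite Rintegral_cst // mul0r mulr0.
move=> x _; have x0 : circle_val x != 0 by rewrite -cabs_gt0 cabs_circle_val.
by rewrite /hk addr0 subr0 divff // mulr1 ImC.
Qed.

Lemma hergE u w : rint u -> cabs w < 1 -> herg u w = ((2 * pi)^-1)%:C *
  (2 * cauchyT (fun x => (u x)%:C * circle_val x) w - cint arc setT (fun x => (u x)%:C)).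
Proof.
move=> iu w1; congr (_ * _); have iC := rint_cintegrable iu.
have i1 := cintegrableK (cintegrableK iC ccont_id) (ccont_subV w1).
rewrite /cauchyT -(cintZ 2 measurableT i1) -cintB //; last exact: cintegrableZ.
apply: eq_cint => x _; rewrite hkE ?cabs_circle_val //=; ring.
Qed.

(** The divided difference at [s1], [s2] of the Herglotz kernel [hk w z] in its parameter [w],
    confluent case included. *)
Definition dk s1 s2 z := 2 * z / ((z - s1) * (z - s2)).

Lemma ccont_dk s1 s2 : cabs s1 < 1 -> cabs s2 < 1 -> ccont (dk s1 s2).
Proof.
move=> h1 h2; apply: ccont_cder => z z1.
have zs1 : z - s1 != 0 by apply: sub_neq0; rewrite z1.
have zs2 : z - s2 != 0 by apply: sub_neq0; rewrite z1.
have D := cderM (cderB (cder_id z) (cder_cst s1 z)) (cderB (cder_id z) (cder_cst s2 z)).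
have zn : (z - s1) * (z - s2) != 0 by rewrite mulf_neq0.
eexists; apply: (cderM (cderZ 2 (cder_id z))).
exact: (@cderV _ (fun z => (z - s1) * (z - s2)) z _ zn D).
Qed.

Lemma cder_herg u w : rint u -> cabs w < 1 ->
  cder (herg u) w (((2 * pi)^-1)%:C * cint arc setT (fun x => (u x)%:C * dk w w (circle_val x))).
Proof.
move=> iu w1; have iC := rint_cintegrable iu.
have iCz := cintegrableK iC ccont_id.
have D := cderZ ((2 * pi)^-1)%:C (cderB (cderZ 2 (cder_cauchyT iCz w1))
  (cder_cst (cint arc setT (fun x => (u x)%:C)) w)).
have -> : cint arc setT (fun x => (u x)%:C * dk w w (circle_val x)) =
  2 * cint arc setT (fun x => (u x)%:C * id (circle_val x) * (circle_val x - w)^-2) - 0.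
  have c2 : ccont (fun z => (z - w)^-2).
    rewrite (_ : (fun z => _) = (fun z => (z - w)^-1 * (z - w)^-1)).
      exact: ccontM (ccont_subV w1) (ccont_subV w1).
    by apply/funext => y; rewrite -exprVn expr2.
  rewrite subr0 -(cintZ 2 measurableT (cintegrableK iCz c2)).
  by apply: eq_cint => x _; rewrite /dk -expr2 /=; ring.
apply: eq_on_disc_cder D => // z z1; rewrite hergE //.
Qed.

Lemma hol_herg u : rint u -> hol 1 (herg u).
Proof. by move=> iu z z1; eexists; exact: cder_herg. Qed.

Lemma dd_herg u s1 s2 : rint u -> cabs s1 < 1 -> cabs s2 < 1 ->
  dd s1 s2 (herg u) = ((2 * pi)^-1)%:C * cint arc setT (fun x => (u x)%:C * dk s1 s2 (circle_val x)).
Proof.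
move=> iu h1 h2; rewrite /dd; case: eqVneq => [e|s12].
  by rewrite (cder_derive1 (cder_herg iu h1)) e.
have s0 : s2 - s1 != 0 by rewrite subr_eq0 eq_sym.
rewrite /herg -mulrBr -mulrA; congr (_ * _).
rewrite -cintB //; [|exact: herg_integrable|exact: herg_integrable].
have iD := cintegrableK (rint_cintegrable iu) (ccont_dk h1 h2).
apply: (mulIf s0); rewrite divfK // mulrC -(cintZ _ measurableT iD).
apply: eq_cint => x _; have x1 := cabs_circle_val x.
rewrite !hkE // /dk; field.
by rewrite !sub_neq0 // x1.
Qed.

Lemma Re_dd_herg u s1 s2 : rint u -> cabs s1 < 1 -> cabs s2 < 1 ->
  Re (dd s1 s2 (herg u)) = pint u (Re \o dk s1 s2).
Proof.
move=> iu h1 h2; rewrite dd_herg // ReM ReC ImC mul0r subr0 Re_cint; congr (_ * _).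
by apply: eq_Rintegral => x _; rewrite ReM ReC ImC mul0r subr0.
Qed.

Lemma Im_dd_herg u s1 s2 : rint u -> cabs s1 < 1 -> cabs s2 < 1 ->
  Im (dd s1 s2 (herg u)) = pint u (Im \o dk s1 s2).
Proof.
move=> iu h1 h2; rewrite dd_herg // ImM ReC ImC mul0r addr0 Im_cint; congr (_ * _).
by apply: eq_Rintegral => x _; rewrite ImM ReC ImC mul0r addr0.
Qed.

End herglotz.

(** * Linearity and monotonicity of Poisson integrals *)

Section poisson_integral.
Context {R : realType}.
Local Notation arc := (@arc_length R).
Local Notation Re := (@complex.Re R).
Local Notation Im := (@complex.Im R).
Local Notation T := (borel_circle R).
Implicit Types (u v : T -> R) (z w s : R[i]) (k : R[i] -> R) (F : R[i] -> R[i]).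

Lemma rintD u v : rint u -> rint v -> rint (fun x => u x + v x).
Proof. by move=> iu iv; have := integrableD measurableT iu iv; apply: eq_integrable. Qed.

Lemma rintZ c u : rint u -> rint (fun x => c * u x).
Proof. by move=> iu; have := integrableZl measurableT c iu; apply: eq_integrable. Qed.

Lemma rintB u v : rint u -> rint v -> rint (fun x => u x - v x).
Proof. by move=> iu iv; have := integrableB measurableT iu iv; apply: eq_integrable. Qed.

Lemma rint_cst (c : R) : rint (fun=> c).
Proof. exact: finite_integrable_cst measurableT arc_lty. Qed.

Lemma rint_bounded u (M : R) : measurable_fun setT u -> (forall x, `|u x| <= M) -> rint u.
Proof.
move=> mu uM; apply: measurable_bounded_integrable => //; first exact: arc_lty.
by exists M; split; rewrite ?num_real // => t Mt x _; rewrite /= (le_trans (uM _)) // ltW.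
Qed.

Definition kcont k := ccont (fun z => (k z)%:C).

Lemma rintK u k : rint u -> kcont k -> rint (fun x => u x * k (circle_val x)).
Proof.
move=> iu ck; have := (cintegrableK (rint_cintegrable iu) ck).1.
by apply: eq_integrable => // x _ /=; rewrite mulr0 subr0.
Qed.

Lemma pintD u v k : rint u -> rint v -> kcont k ->
  pint (fun x => u x + v x) k = pint u k + pint v k.
Proof.
move=> iu iv ck; rewrite /pint -mulrDr -RintegralD //; try exact: rintK.
by congr (_ * _); apply: eq_Rintegral => x _; rewrite mulrDl.
Qed.

Lemma pintZ c u k : rint u -> kcont k -> pint (fun x => c * u x) k = c * pint u k.
Proof.
move=> iu ck; have iuk := rintK iu ck; rewrite /pint mulrCA; congr (_ * _).
by rewrite -RintegralZl //; apply: eq_Rintegral => x _; rewrite mulrA.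
Qed.

Lemma pintB u v k : rint u -> rint v -> kcont k ->
  pint (fun x => u x - v x) k = pint u k - pint v k.
Proof.
move=> iu iv ck; rewrite /pint -mulrBr -RintegralB //; try exact: rintK.
by congr (_ * _); apply: eq_Rintegral => x _; rewrite mulrBl.
Qed.

Lemma le_pint u v k : rint u -> rint v -> kcont k ->
  (forall x, u x * k (circle_val x) <= v x * k (circle_val x)) -> pint u k <= pint v k.
Proof.
move=> iu iv ck uv; rewrite ler_wpM2l ?invr_ge0 ?(ltW twopi_gt0) //.
by apply: le_Rintegral => //; exact: rintK.
Qed.

Lemma kcont_pk w : cabs w < 1 -> kcont (pk w).
Proof. exact: ccont_pk. Qed.

Lemma le_pint_pk u v w : rint u -> rint v -> cabs w < 1 -> (forall x, u x <= v x) ->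
  pint u (pk w) <= pint v (pk w).
Proof.
move=> iu iv w1 uv; apply: le_pint => //; first exact: kcont_pk.
by move=> x; rewrite ler_wpM2r // pk_ge0 // cabs_circle_val.
Qed.

Lemma pint_cst c w : cabs w < 1 -> pint (fun=> c) (pk w) = c.
Proof.
move=> w1; have := congr1 Re (poisson_formula (@hol_cst R 2 c%:C) (ltr1n _ 2) w1).
rewrite Re_cmean ReC => h; rewrite -[RHS]h; congr (_ * _); apply: eq_Rintegral => x _.
by rewrite ReM !ReC !ImC mulr0 subr0.
Qed.

(** On the circle [|zeta - z|^2] is the real part of the affine function
    [1 + |z|^2 - 2 * conj z * zeta], which Poisson's formula evaluates at [z]. *)
Lemma pint_dist_sqr z : cabs z < 1 ->
  pint (fun x => cabs (circle_val x - z) ^+ 2) (pk z) = 1 - cabs z ^+ 2.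
Proof.
move=> z1; pose f w : R[i] := (1 + cabs z ^+ 2)%:C - (2 : R)%:C * (z^* * w).
have hf : hol 2 f.
  by apply: holB; [exact: hol_cst|apply: holZ; apply: holZ; exact: hol_id].
have Ref w : Re (f w) = 1 + cabs z ^+ 2 - 2 * (Re z * Re w + Im z * Im w).
  by rewrite /f !ReImE; ring.
have := congr1 Re (poisson_formula hf (ltr1n _ 2) z1).
rewrite Ref -!expr2 -cabs_sqr (_ : _ - _ = 1 - cabs z ^+ 2); last by ring.
rewrite Re_cmean => <-; congr (_ * _); apply: eq_Rintegral => x _.
rewrite ReM !ReC !ImC mulr0 subr0 Ref; congr (_ * _).
have x1 : Re (circle_val x) ^+ 2 + Im (circle_val x) ^+ 2 = 1.
  by rewrite -cabs_sqr cabs_circle_val expr1n.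
rewrite !cabs_sqr; set p := circle_val x in x1 *.
have -> : Re (p - z) ^+ 2 + Im (p - z) ^+ 2 = (Re p ^+ 2 + Im p ^+ 2) +
  (Re z ^+ 2 + Im z ^+ 2) - 2 * (Re z * Re p + Im z * Im p) by rewrite !ReImE; ring.
by rewrite x1.
Qed.

Lemma measurable_dist_sqr z : measurable_fun setT (fun x : T => cabs (circle_val x - z) ^+ 2).
Proof.
apply: measurable_funX; apply: measurable_cabs.
apply: (cmeasurable_ccont (F := fun w => w - z)); apply: ccont_cder => w _.
by eexists; exact: cderB (cder_id w) (cder_cst z w).
Qed.

Lemma rint_dist_sqr z : cabs z < 1 -> rint (fun x => cabs (circle_val x - z) ^+ 2).
Proof.
move=> z1; apply: (@rint_bounded _ 4); first exact: measurable_dist_sqr.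
move=> x; rewrite ger0_norm ?sqr_ge0 //.
have -> : 4 = 2 ^+ 2 :> R by ring.
rewrite ler_pXn2r ?nnegrE ?cabs_ge0 // (le_trans (cabsD _ _)) //.
by rewrite cabsN cabs_circle_val -[2]/(1 + 1) lerD2l ltW.
Qed.

End poisson_integral.

(** * The Poisson-Jensen inequality for functions holomorphic past the closed disc *)

Section poisson_jensen.
Context {R : realType}.
Local Notation arc := (@arc_length R).
Local Notation T := (borel_circle R).
Implicit Types (z w s : R[i]).
Variables (F : R[i] -> R[i]) (b : R).
Hypotheses (hF : hol b F) (b1 : 1 < b).

(** The circle of radius [(1 + b) / 2] encloses the closed disc at positive distance: the maximum
    principle gives the bound, and Cauchy's formula on this circle the Lipschitz constant. *)
Lemma hol_lipschitz : exists M L : R, [/\ 0 < M, 0 < L,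
  forall z, cabs z <= 1 -> cabs (F z) <= M &
  forall z w, cabs z <= 1 -> cabs w <= 1 -> cabs (F z - F w) <= L * cabs (z - w)].
Proof.
pose r := (1 + b) / 2.
have r1 : 1 < r by rewrite /r; move: b1; lra.
have rb : r < b by rewrite /r; move: b1; lra.
have r0 : 0 < r by rewrite (lt_trans ltr01).
have cF := hol_ccont hF (ltW r0) rb.
have [M M0 HM] := ccont_bounded cF.
have d0 : 0 < r - 1 by rewrite subr_gt0.
have M1 : 0 < M + 1 by rewrite ltr_wpDl.
have rC0 : r%:C != 0 :> R[i] by rewrite -cabs_gt0 cabsC normr_gt0 gt_eqF.
exists (M + 1), ((M + 1) * r / (r - 1) ^+ 2); split => //.
- exact: (divr_gt0 (mulr_gt0 M1 r0) (exprn_gt0 2 d0)).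
- move=> z z1; apply: (@hol_max _ _ b r _ z hF rb) => [|w wr]; first exact: le_lt_trans r1.
  have -> : w = r%:C * (w / r%:C) by rewrite mulrCA divff // mulr1.
  apply: (@le_trans _ _ M); last by rewrite lerDl.
  by apply: HM; rewrite cabsM cabsV cabsC wr gtr0_norm // divff // gt_eqF.
move=> z w z1 w1.
have nz y x : cabs y <= 1 -> cabs x = 1 -> r%:C * x - y != 0.
  move=> y1 x1; apply: sub_neq0; rewrite cabsM x1 mulr1 cabsC gtr0_norm //.
  exact: le_lt_trans r1.
have cQ y : cabs y <= 1 -> ccont (fun x => r%:C * x / (r%:C * x - y)).
  move=> y1; apply: ccont_cder => x x1; have D := cderZ r%:C (cder_id x).
  have D2 := cderB D (cder_cst y x); eexists.
  exact: (cderM D (@cderV _ (fun x => r%:C * x - y) x _ (nz _ _ y1 x1) D2)).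
rewrite -(cauchy_formula hF (le_lt_trans z1 r1) rb) -(cauchy_formula hF (le_lt_trans w1 r1) rb).
rewrite -(cmeanB (ccontM cF (cQ _ z1)) (ccontM cF (cQ _ w1))).
apply: cabs_cmean; first exact: (ccontB (ccontM cF (cQ _ z1)) (ccontM cF (cQ _ w1))).
move=> x x1; have h1 := nz _ _ z1 x1; have h2 := nz _ _ w1 x1.
have -> : F (r%:C * x) * (r%:C * x / (r%:C * x - z)) - F (r%:C * x) * (r%:C * x / (r%:C * x - w)) =
  F (r%:C * x) * (r%:C * x) / ((r%:C * x - z) * (r%:C * x - w)) * (z - w).
  by field; rewrite h1 h2.
rewrite cabsM ler_wpM2r ?cabs_ge0 // !cabsM cabsV cabsM x1 mulr1 cabsC gtr0_norm //.
have E y : cabs y <= 1 -> r - 1 <= cabs (r%:C * x - y).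
  move=> y1; apply: le_trans (cabs_le_dist _ _).
  by rewrite cabsM x1 mulr1 cabsC gtr0_norm // lerD2l lerN2.
apply: ler_pM.
- by rewrite mulr_ge0 ?cabs_ge0 // ltW.
- by rewrite invr_ge0 mulr_ge0 // cabs_ge0.
- by apply: ler_wpM2r; [exact: ltW|rewrite (le_trans (HM _ x1)) // lerDl].
- rewrite lef_pV2 ?posrE ?exprn_gt0 ?mulr_gt0 ?cabs_gt0 // expr2.
  by apply: ler_pM; rewrite ?(ltW d0) ?E.
Qed.

Variable eps : R.
Hypothesis eps0 : 0 < eps.

(** A regularisation of [ln |F|] from above, finite at the zeros of [F]. *)
Definition logF z : R := 2^-1 * ln (cabs (F z) ^+ 2 + eps).

Lemma logF_pos z : 0 < cabs (F z) ^+ 2 + eps.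
Proof. by rewrite ltr_wpDl ?sqr_ge0. Qed.

Lemma logF_dist (M : R) z w : cabs (F z) <= M -> cabs (F w) <= M ->
  logF z - logF w <= M / eps * cabs (F z - F w).
Proof.
move=> zM wM; rewrite -mulrBr -ln_div ?posrE ?logF_pos //.
have -> : (cabs (F z) ^+ 2 + eps) / (cabs (F w) ^+ 2 + eps) =
  1 + (cabs (F z) ^+ 2 - cabs (F w) ^+ 2) / (cabs (F w) ^+ 2 + eps).
  by field; rewrite gt_eqF // logF_pos.
have M0 : 0 <= M by apply: le_trans zM; exact: cabs_ge0.
apply: (@le_trans _ _ (2^-1 * (2 * M * cabs (F z - F w) / eps))); last first.
  by rewrite le_eqVlt; apply/orP; left; apply/eqP; field; rewrite gt_eqF.
rewrite ler_wpM2l ?invr_ge0 //; apply: le_trans (le_ln1Dx _) _.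
  rewrite -subr_gt0 opprK addrC; set A := _ / _.
  have -> : 1 + A = (cabs (F z) ^+ 2 + eps) / (cabs (F w) ^+ 2 + eps).
    by rewrite /A; field; rewrite gt_eqF // logF_pos.
  by rewrite divr_gt0 ?logF_pos.
apply: (@le_trans _ _ (`|cabs (F z) ^+ 2 - cabs (F w) ^+ 2| / (cabs (F w) ^+ 2 + eps))).
  by rewrite ler_wpM2r ?invr_ge0 ?(ltW (logF_pos _)) // ler_norm.
apply: ler_pM; rewrite ?invr_ge0 ?(ltW (logF_pos _)) //; last first.
  by rewrite lef_pV2 ?posrE ?logF_pos // lerDr sqr_ge0.
rewrite subr_sqr normrM mulrC; apply: ler_pM => //.
  rewrite ger0_norm ?addr_ge0 ?cabs_ge0 // mulr_natl mulr2n; exact: lerD.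
by rewrite ler_norml cabs_le_dist andbT lerNl opprB cabsB cabs_le_dist.
Qed.

Lemma rint_logF : rint (fun x : T => logF (circle_val x)).
Proof.
have [M [L [M0 _ FM _]]] := hol_lipschitz.
have cF := hol_ccont1 hF b1.
have mF : measurable_fun setT (fun x : T => cabs (F (circle_val x)) ^+ 2 + eps).
  apply: measurable_funD => //; apply: measurable_funX; apply: measurable_cabs.
  exact: cmeasurable_ccont.
apply: (@rint_bounded _ _ (`|2^-1 * ln eps| + `|2^-1 * ln (M ^+ 2 + eps)|)).
  by apply: measurable_funM => //; exact: (measurableT_comp (@measurable_ln R) mF).
move=> x; have x1 : cabs (circle_val x) <= 1 by rewrite cabs_circle_val.
have h1 : 2^-1 * ln eps <= logF (circle_val x).
  by rewrite ler_wpM2l ?invr_ge0 // ler_ln ?posrE ?logF_pos // lerDr sqr_ge0.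
have h2 : logF (circle_val x) <= 2^-1 * ln (M ^+ 2 + eps).
  rewrite ler_wpM2l ?invr_ge0 // ler_ln ?posrE ?logF_pos ?ltr_wpDl ?sqr_ge0 //.
  by rewrite lerD2r ler_pXn2r ?nnegrE ?cabs_ge0 ?(ltW M0) // FM.
move: (logF _) (2^-1 * ln eps) (2^-1 * ln (M ^+ 2 + eps)) h1 h2 => l a c h1 h2.
have A := ler_norm (- a); rewrite normrN in A; have B := ler_norm c.
have C := normr_ge0 a; have D := normr_ge0 c.
by rewrite ler_norml; apply/andP; split; lra.
Qed.

(* The quadratic bound [|zeta - z| <= eta + |zeta - z|^2 / eta] makes the boundary behaviour of the
   Poisson integral computable: the Poisson mean of [|zeta - z|^2] is [1 - |z|^2]. *)
Lemma logF_le_pint : exists2 K : R, 0 < K & forall z (eta : R), cabs z < 1 -> 0 < eta ->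
  logF z <= pint (fun x : T => logF (circle_val x)) (pk z) + K * (eta + (1 - cabs z ^+ 2) / eta).
Proof.
have [M [L [M0 L0 FM FL]]] := hol_lipschitz.
exists (M / eps * L); first by rewrite mulr_gt0 ?divr_gt0.
move=> z eta z1 eta0; set K := M / eps * L.
have K0 : 0 <= K by rewrite mulr_ge0 ?divr_ge0 ?ltW.
have i1 := rint_logF; have i2 := rint_dist_sqr z1.
have i3 : rint (fun x : T => eta + eta^-1 * cabs (circle_val x - z) ^+ 2).
  by apply: rintD; [exact: rint_cst|exact: rintZ].
have ck := kcont_pk z1.
have -> : eta + (1 - cabs z ^+ 2) / eta =
    pint (fun x : T => eta + eta^-1 * cabs (circle_val x - z) ^+ 2) (pk z).
  rewrite (pintD (@rint_cst _ eta) (rintZ eta^-1 i2) ck) (pintZ eta^-1 i2 ck).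
  by rewrite (pint_cst eta z1) (pint_dist_sqr z1) mulrC.
rewrite -(pintZ K i3 ck) -(pintD i1 (rintZ K i3) ck) -[leLHS](pint_cst (logF z) z1).
apply: le_pint_pk => //; [exact: rint_cst|by apply: rintD => //; exact: rintZ|].
move=> x; rewrite -lerBlDl.
have x1 : cabs (circle_val x) <= 1 by rewrite cabs_circle_val.
apply: le_trans (logF_dist (FM _ (ltW z1)) (FM _ x1)) _.
rewrite /K -[leRHS]mulrA; apply: ler_wpM2l; first exact: (divr_ge0 (ltW M0) (ltW eps0)).
apply: le_trans (FL _ _ (ltW z1) x1) _; rewrite ler_wpM2l ?(ltW L0) // cabsB.
move: (cabs _) (cabs_ge0 (circle_val x - z)) => t t0.
have [te|te] := leP t eta; first by rewrite (le_trans te) // lerDl mulr_ge0 ?invr_ge0 ?sqr_ge0 // ltW.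
apply: (@le_trans _ _ (eta^-1 * t ^+ 2)); last by rewrite lerDr ltW.
by rewrite mulrC ler_pdivlMr // expr2 ler_wpM2l // ltW.
Qed.

(** With [u] the boundary values of [logF], the modulus of [F * cexp (- herg u)] is at most
    [exp (logF - P u)]. By [logF_le_pint] this is at most [exp d] on circles close to the unit
    circle, and the maximum principle brings the bound to [w]. *)
Theorem poisson_jensen w : cabs w < 1 ->
  cabs (F w) <= expR (pint (fun x : T => logF (circle_val x)) (pk w)).
Proof.
move=> w1; set u := fun x : T => logF (circle_val x).
have iu : rint u := rint_logF.
have [K K0 HK] := logF_le_pint.
pose H z := F z * cexp (- herg u z).
have hH : hol 1 H.
  apply: holM; first exact: hol_sub (ltW b1) hF.
  move=> z z1; have [l dl] := hol_herg iu z1.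
  by eexists; exact: cder_comp (cderN dl) (cder_cexp _).
have Hz z : cabs (H z) = cabs (F z) * expR (- pint u (pk z)).
  by rewrite cabsM cabs_cexp ReN Re_herg.
have FlogF z : cabs (F z) <= expR (logF z).
  rewrite -(@ler_pXn2r _ 2) ?nnegrE ?cabs_ge0 ?expR_ge0 // -expRM_natl /logF mulrA mulfV // mul1r.
  by rewrite lnK ?posrE ?logF_pos // lerDl ltW.
suff S : forall d, 0 < d -> cabs (H w) <= expR d.
  have : cabs (H w) <= 1.
    rewrite leNgt; apply/negP => h; have l0 : 0 < ln (cabs (H w)) by rewrite ln_gt0.
    have := S _ (divr_gt0 l0 (@ltr0Sn R 1)); rewrite -{1}[cabs (H w)]lnK ?posrE ?(lt_trans ltr01) //.
    by rewrite ler_expR; move: (ln _) l0 => l; lra.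
  by rewrite Hz expRN ler_pdivrMr ?expR_gt0 // mul1r.
(* The error [K * (eta + (1 - r^2) / eta)] is at most [2 * K * eta = d] as soon as
   [1 - r^2 <= eta^2]. *)
move=> d d0; pose eta := d / (2 * K).
have eta0 : 0 < eta by rewrite divr_gt0 ?mulr_gt0.
have [r [wr r1 re]] : exists r, [/\ cabs w < r, r < 1 & 1 - r ^+ 2 <= eta ^+ 2].
  pose m := Num.min (1 - cabs w) (eta ^+ 2).
  have m0 : 0 < m by rewrite lt_min subr_gt0 w1 exprn_gt0.
  have m1 : m <= 1 - cabs w by rewrite /m ge_min lexx.
  have m2 : m <= eta ^+ 2 by rewrite /m ge_min lexx orbT.
  have w0 := cabs_ge0 w.
  exists (1 - m / 2); split; [lra|lra|].
  apply: le_trans m2; rewrite sqrrB expr1n mul1r.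
  by have := sqr_ge0 (m / 2); lra.
have r0 : 0 < r := le_lt_trans (cabs_ge0 w) wr.
apply: (hol_max hH r1 wr) => z zr; have z1 : cabs z < 1 by rewrite zr.
rewrite Hz; apply: le_trans (ler_wpM2r (expR_ge0 _) (FlogF z)) _.
rewrite -expRD ler_expR lerBlDr addrC; apply: le_trans (HK z eta z1 eta0) _.
rewrite lerD2l zr.
have : (1 - r ^+ 2) / eta <= eta by rewrite ler_pdivrMr // -expr2.
move=> h; apply: (@le_trans _ _ (K * (eta + eta))); first by rewrite ler_wpM2l ?(ltW K0) // lerD2l.
by rewrite le_eqVlt; apply/orP; left; apply/eqP; rewrite /eta; field; rewrite gt_eqF.
Qed.

End poisson_jensen.

(* A function that is midpoint convex in [ln x] and bounded above as [x -> 0] is nondecreasing. *)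
Lemma log_midpoint_convex_homo {R : realType} (N : R -> R) (B a b : R) :
  (forall t s : R, 0 < t < 1 -> 0 < s < 1 -> 2 * N (t * s) <= N (t * t) + N (s * s)) ->
  (forall x : R, 0 < x < 1 -> N x <= B) ->
  0 < a -> a <= b -> b < 1 -> N a <= N b.
Proof.
move=> Nmid NB a0; rewrite le_eqVlt => /orP[/eqP->//|ab] b1; rewrite leNgt; apply/negP => lt_ba.
have b0 := lt_trans a0 ab.
have [q q0 aE] : exists2 q, 0 < q & a = b * q.
  by exists (a / b); [rewrite divr_gt0|rewrite mulrCA divff ?mulr1 // gt_eqF].
have q1 : q < 1 by move: ab; rewrite aE gtr_pMr.
have [x [x0 x1 xq xz xo]] : exists x : nat -> R, [/\ forall n, 0 < x n, forall n, x n < 1,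
    forall n, x n * x n.+2 = x n.+1 ^+ 2, x 0%N = b & x 1%N = a].
  exists (fun n => b * q ^+ n); split; rewrite ?expr0 ?expr1 ?mulr1 // => n.
  - by rewrite mulr_gt0 ?exprn_gt0.
  - by apply: le_lt_trans b1; rewrite ler_piMr ?(ltW b0) // exprn_ile1 ?(ltW q0) ?(ltW q1).
  - by rewrite !exprS; ring.
have mid n : 2 * N (x n.+1) <= N (x n) + N (x n.+2).
  have sq m : Num.sqrt (x m) * Num.sqrt (x m) = x m by rewrite -expr2 sqr_sqrtr // ltW.
  have s01 m : 0 < Num.sqrt (x m) < 1.
    by rewrite sqrtr_gt0 x0 /= -[ltRHS]sqrtr1 ltr_sqrt.
  have := Nmid _ _ (s01 n) (s01 n.+2); rewrite !sq.
  by rewrite -sqrtrM ?(ltW (x0 n)) // xq sqrtr_sqr (gtr0_norm (x0 _)).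
have inc n : N a - N b <= N (x n.+1) - N (x n).
  by elim: n => [|n IH]; [rewrite xz xo|have := mid n; move: IH; lra].
have grow n : N b + n%:R * (N a - N b) <= N (x n).
  elim: n => [|n IH]; first by rewrite mul0r addr0 xz.
  by have := inc n; rewrite -natr1 mulrDl mul1r; move: IH; lra.
have d0 : 0 < N a - N b by rewrite subr_gt0.
have [n Hn] : exists n, (B - N b) / (N a - N b) < n%:R.
  exists (Num.bound ((B - N b) / (N a - N b))); apply: archi_boundP.
  by rewrite divr_ge0 ?(ltW d0) // subr_ge0 NB // b0.
have := grow n; have := NB (x n); rewrite x0 x1 => /(_ isT).
by move: Hn; rewrite ltr_pdivrMr //; move: (n%:R * _) => y; lra.
Qed.

(** * Mean squares on circles: dilates of a bounded function are Cauchy in mean square *)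

Section mean_square.
Context {R : realType}.
Local Notation arc := (@arc_length R).
Local Notation Re := (@complex.Re R).
Local Notation Im := (@complex.Im R).
Local Notation T := (borel_circle R).
Implicit Types (z w : R[i]).
Variables (f : R[i] -> R[i]) (M : R).
Hypotheses (hf : hol 1 f) (fM : forall z, cabs z < 1 -> cabs (f z) <= M).

Definition corr (t s : R) := cmean (fun z => f (t%:C * z) * (f (s%:C * z))^*).

Lemma hol_conj : hol 1 (fun w => (f w^*)^*).
Proof.
by move=> z z1; have [|l dl] := hf (z := z^*); rewrite ?cabsJ //; exists l^*; exact: cder_conj dl.
Qed.

Lemma annulus_den (c : R) z : 0 < c -> c < cabs z -> z != 0 /\ cabs (c%:C * z^-1) < 1.
Proof.
move=> c0 cz; have z0 : 0 < cabs z by exact: lt_trans cz.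
by rewrite -cabs_gt0 z0 cabsM cabsV cabsC gtr0_norm // ltr_pdivrMr // mul1r.
Qed.

(** The product of [f z] and the conjugate of [f (c / conj z)] is holomorphic for [c < |z| < 1], and
    on the circle of radius [r] it is the integrand of [corr r (c / r)]. So the correlation depends
    only on the product of the two radii. *)
Lemma corr_annulus (c r1 r2 : R) : 0 < c -> c < r1 -> r1 <= r2 -> r2 < 1 ->
  corr r1 (c / r1) = corr r2 (c / r2).
Proof.
move=> c0 cr1 r12 r21; pose Phi z := f z * (f (c%:C * z^-1)^*)^*.
have r10 := lt_trans c0 cr1; have r20 := lt_le_trans r10 r12.
have dPhi z : c < cabs z < 1 -> exists l, cder Phi z l.
  move=> /andP[cz z1]; have [l dl] := hf z1; have [z0 cz1] := annulus_den c0 cz.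
  have [k hk] := hol_conj cz1.
  eexists; apply: (cderM dl); exact: cder_comp (cderZ c%:C (cder_inv z0)) hk.
have E r : 0 < r -> corr r (c / r) = cmean (fun z => Phi (r%:C * z)).
  move=> r0; apply: eq_cmean => z z1; congr (_ * (f _)^*).
  have zz : z * z^* = 1 by rewrite mulrJ z1 expr1n.
  have z0 : z != 0 by rewrite -cabs_gt0 z1.
  have rC0 : r%:C != 0 :> R[i] by rewrite -cabs_gt0 cabsC normr_gt0 gt_eqF.
  have -> : (c / r)%:C = c%:C * r%:C^-1 :> R[i] by rewrite rmorphM fmorphV.
  have RJ (x : R) : (x%:C)^* = x%:C by apply: complexP; rewrite ?ReJ ?ImJ //= oppr0.
  have -> : (r%:C * z)^-1 = r%:C^-1 * z^* .
    by rewrite invfM -[X in _ = _ * X]mul1r -(mulVf z0) -mulrA zz mulr1.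
  by rewrite !rmorphM fmorphV /= !RJ conjK mulrA.
rewrite (E _ r10) (E _ r20); exact: annulus_mean dPhi cr1 r10 r12 r21.
Qed.

(** Mean square of [f] on the circle of radius [Num.sqrt x]; with this parametrisation the real part
    of [corr t s] is [msq (t * s)]. *)
Definition msq (x : R) := Re (corr (Num.sqrt x) (Num.sqrt x)).

Lemma Re_corr (t s : R) : 0 < t < 1 -> 0 < s < 1 -> Re (corr t s) = msq (t * s).
Proof.
move=> /andP[t0 t1] /andP[s0 s1].
have c0 : 0 < t * s by rewrite mulr_gt0.
pose q := Num.sqrt (t * s).
have q0 : 0 < q by rewrite sqrtr_gt0.
have qq : q * q = t * s by rewrite -expr2 sqr_sqrtr // ltW.
have c1 : t * s < 1 by rewrite mulr_ilt1 // ltW.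
have q1 : q < 1 by rewrite -sqrtr1 ltr_sqrt.
have cq : t * s < q by rewrite -qq gtr_pMr.
have ct : t * s < t by rewrite gtr_pMr.
have qE : t * s / q = q by rewrite -qq mulfK // gt_eqF.
have tE : t * s / t = s by rewrite mulrAC divff ?mul1r // gt_eqF.
rewrite /msq -/q; congr Re.
have [tq|/ltW qt] := leP t q.
  by have := corr_annulus c0 ct tq q1; rewrite qE tE.
by have := corr_annulus c0 cq qt t1; rewrite qE tE.
Qed.

Definition msd (t s : R) := (2 * pi)^-1 * \int[arc]_x
  cabs (f (t%:C * circle_val x) - f (s%:C * circle_val x)) ^+ 2.

Lemma ccont_ray (t : R) : 0 < t < 1 -> ccont (fun z => f (t%:C * z)).
Proof. by move=> /andP[t0 t1]; exact: hol_ccont hf (ltW t0) t1. Qed.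

Lemma ccontJ F : @ccont R F -> ccont (fun z => (F z)^*).
Proof. by move=> cF z z1; apply: continuousJ; exact: cF. Qed.

Lemma ccont_corr (t s : R) : 0 < t < 1 -> 0 < s < 1 ->
  ccont (fun z => f (t%:C * z) * (f (s%:C * z))^*).
Proof. by move=> t01 s01; exact: ccontM (ccont_ray t01) (ccontJ (ccont_ray s01)). Qed.

Lemma msdE (t s : R) : 0 < t < 1 -> 0 < s < 1 ->
  msd t s = msq (t * t) + msq (s * s) - 2 * msq (t * s).
Proof.
move=> t01 s01; rewrite -!Re_corr //.
have ctt := ccont_corr t01 t01; have css := ccont_corr s01 s01; have cts := ccont_corr t01 s01.
have cst := ccont_corr s01 t01.
have Est : Re (corr s t) = Re (corr t s).
  rewrite /corr !Re_cmean; congr (_ * _); apply: eq_Rintegral => x _.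
  by rewrite !ReM !ReJ !ImJ; ring.
have -> : 2 * Re (corr t s) = Re (corr t s) + Re (corr s t) by rewrite Est mulr_natl mulr2n.
rewrite -!ReD -ReB /corr -(cmeanD ctt css) -(cmeanD cts cst).
have cD1 : ccont (fun z => f (t%:C * z) * (f (t%:C * z))^* + f (s%:C * z) * (f (s%:C * z))^*).
  by move=> z z1; apply: continuousD; [exact: ctt|exact: css].
have cD2 : ccont (fun z => f (t%:C * z) * (f (s%:C * z))^* + f (s%:C * z) * (f (t%:C * z))^*).
  by move=> z z1; apply: continuousD; [exact: cts|exact: cst].
rewrite -(cmeanB cD1 cD2) Re_cmean /msd; congr (_ * _); apply: eq_Rintegral => x _.
by rewrite cabs_sqr !ReImE; ring.
Qed.

Lemma msd_ge0 (t s : R) : 0 <= msd t s.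
Proof.
rewrite mulr_ge0 ?invr_ge0 ?(ltW twopi_gt0) //.
by apply: Rintegral_ge0 => x _; exact: sqr_ge0.
Qed.

(** The defect is the mean square distance [msd t s], which is nonnegative. *)
Lemma msq_midpoint (t s : R) : 0 < t < 1 -> 0 < s < 1 ->
  2 * msq (t * s) <= msq (t * t) + msq (s * s).
Proof. by move=> t01 s01; rewrite -subr_ge0 -msdE // msd_ge0. Qed.

Lemma msq_bound (x : R) : 0 < x < 1 -> msq x <= M ^+ 2.
Proof.
move=> /andP[x0 x1]; have q0 : 0 < Num.sqrt x by rewrite sqrtr_gt0.
have q1 : Num.sqrt x < 1 by rewrite -sqrtr1 ltr_sqrt.
have q01 : 0 < Num.sqrt x < 1 by rewrite q0.
apply: le_trans (ler_norm _) _; apply: le_trans (Re_le_cabs _) _.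
apply: cabs_cmean; first exact: ccont_corr.
move=> z z1; rewrite cabsM cabsJ -expr2.
have qz : cabs ((Num.sqrt x)%:C * z) < 1 by rewrite cabsM z1 mulr1 cabsC gtr0_norm.
by rewrite ler_pXn2r ?nnegrE ?cabs_ge0 ?fM // (le_trans (cabs_ge0 _) (fM qz)).
Qed.

Lemma msq_homo (a b : R) : 0 < a -> a <= b -> b < 1 -> msq a <= msq b.
Proof. exact: (log_midpoint_convex_homo msq_midpoint msq_bound). Qed.

(** [msq] is nondecreasing and bounded, so near radius 1 the three terms of [msdE] are all within
    [e / 2] of its supremum. *)
Lemma msd_cauchy (e : R) : 0 < e -> exists2 r : R, 0 < r < 1 &
  forall t s, r <= t < 1 -> r <= s < 1 -> msd t s <= e.
Proof.
move=> e0; pose A := [set msq x | x in [set x : R | 0 < x < 1]].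
have hA : has_sup A.
  split; first by exists (msq 2^-1), 2^-1 => //=; rewrite invr_gt0 ltr0n invf_lt1 // ltr1n.
  by exists (M ^+ 2) => _ [x x01 <-]; exact: msq_bound.
have e2 : 0 < e / 2 by rewrite divr_gt0.
have [_ [x x01 <-] Hx] := sup_adherent e2 hA.
have /andP[x0 x1] := x01.
have sx x' : Num.sqrt x <= x' -> 0 < x'.
  by apply: lt_le_trans; rewrite sqrtr_gt0.
exists (Num.sqrt x); first by rewrite sqrtr_gt0 x0 -sqrtr1 ltr_sqrt.
move=> t s /andP[xt t1] /andP[xs s1].
have t0 := sx _ xt; have s0 := sx _ xs.
rewrite msdE ?(andb_true_intro (conj t0 t1)) ?(andb_true_intro (conj s0 s1)) //.
have U y : 0 < y < 1 -> msq y <= sup A by move=> y01; apply: ub_le_sup; [exact: hA.2|exists y].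
have u1 : msq (t * t) <= sup A by apply: U; rewrite mulr_gt0 // mulr_ilt1 // ltW.
have u2 : msq (s * s) <= sup A by apply: U; rewrite mulr_gt0 // mulr_ilt1 // ltW.
have u3 : msq x <= msq (t * s).
  apply: msq_homo => //; last by rewrite mulr_ilt1 // ltW.
  have xx : x = Num.sqrt x * Num.sqrt x by rewrite -expr2 sqr_sqrtr // ltW.
  by rewrite {1}xx ler_pM ?sqrtr_ge0.
move: Hx u1 u2 u3; move: (msq x) (msq (t * t)) (msq (s * s)) (msq (t * s)) (sup A).
by move=> v1 v2 v3 v4 v5; lra.
Qed.

(** From [y <= h + y^2 / h] under the integral; the parameter [h] replaces a Cauchy-Schwarz
    inequality. *)
Lemma int_dist_le (t s h : R) : 0 < t < 1 -> 0 < s < 1 -> 0 < h ->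
  \int[arc]_x cabs (f (t%:C * circle_val x) - f (s%:C * circle_val x)) <=
  2 * pi * (h + msd t s / h).
Proof.
move=> t01 s01 h0.
have cD := ccontB (ccont_ray t01) (ccont_ray s01).
have i1 := cintegrable_cabs measurableT (ccont_cintegrable cD).
have [K K0 HK] := ccont_bounded cD.
have i2 : rint (fun x : T => cabs (f (t%:C * circle_val x) - f (s%:C * circle_val x)) ^+ 2).
  apply: (@rint_bounded _ _ (K ^+ 2)).
    by apply: measurable_funX; apply: measurable_cabs; exact: cmeasurable_ccont cD.
  move=> x; rewrite ger0_norm ?sqr_ge0 // ler_pXn2r ?nnegrE ?cabs_ge0 //.
  exact: (HK _ (cabs_circle_val x)).
have tp0 : (2 * pi : R) != 0 by rewrite gt_eqF ?twopi_gt0.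
apply: (@le_trans _ _ (\int[arc]_x (h + h^-1 *
    cabs (f (t%:C * circle_val x) - f (s%:C * circle_val x)) ^+ 2))).
  apply: le_Rintegral => //; first by apply: rintD; [exact: rint_cst|exact: rintZ].
  move=> x _; move: (cabs _) (cabs_ge0 (f (t%:C * circle_val x) - f (s%:C * circle_val x))) => c c0.
  have [ch|ch] := leP c h; first by rewrite (le_trans ch) // lerDl mulr_ge0 ?invr_ge0 ?sqr_ge0 // ltW.
  apply: (@le_trans _ _ (h^-1 * c ^+ 2)); last by rewrite lerDr ltW.
  by rewrite mulrC ler_pdivlMr // expr2 ler_wpM2l // ltW.
rewrite RintegralD //; [|exact: rint_cst|exact: rintZ].
rewrite Rintegral_cst // fine_arc RintegralZl // /msd.
move: (Rintegral _ _ _) => I.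
have -> : 2 * pi * (h + (2 * pi)^-1 * I / h) = h * (2 * pi) + h^-1 * I; last exact: lexx.
by rewrite mulrDr (mulrC h); congr (_ + _); rewrite -[_ / h]mulrA mulVKf // mulrC.
Qed.

End mean_square.

(** * Fatou's lemma for real-valued sequences on the circle *)

Section fatou_real.
Context {R : realType}.
Local Notation arc := (@arc_length R).
Local Notation T := (borel_circle R).
Implicit Types (v : nat -> T -> R) (h p : T -> R) (B : R).

Lemma limn_einf_le (u : (\bar R)^nat) (B : \bar R) (N : nat) :
  (forall n, (N <= n)%N -> (u n <= B)%E) -> (limn_einf u <= B)%E.
Proof.
move=> uB; rewrite limn_einf_lim; apply: lime_le; first exact: is_cvg_einfs.
near=> n; apply: le_trans (uB (maxn n N) (leq_maxr _ _)).
by apply: ereal_inf_lbound; exists (maxn n N) => //=; exact: leq_maxl.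
Unshelve. all: by end_near. Qed.

Lemma measurable_limn_einf (v : nat -> T -> \bar R) :
  (forall n, measurable_fun setT (v n)) ->
  measurable_fun setT (fun x => limn_einf (v ^~ x)).
Proof.
move=> mv; apply: (measurableT_comp (@oppe_measurable R setT)).
by apply: measurable_fun_limn_esup => n; exact: (measurableT_comp (@oppe_measurable R setT) (mv n)).
Qed.

Lemma integral_rint h : rint h -> (\int[arc]_x (h x)%:E)%E = (\int[arc]_x h x)%:E.
Proof. by move=> ih; rewrite /Rintegral fineK //; exact: integrable_fin_num. Qed.

Lemma ae_and (P Q : T -> Prop) : {ae arc, forall x, P x} -> {ae arc, forall x, Q x} ->
  {ae arc, forall x, P x /\ Q x}.
Proof. by move=> hP hQ; near=> x; split; near: x. Unshelve. all: by end_near. Qed.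

Lemma ae_sub (P Q : T -> Prop) : (forall x, P x -> Q x) -> {ae arc, forall x, P x} ->
  {ae arc, forall x, Q x}.
Proof. by move=> PQ; apply: filterS. Qed.

(** Fatou's lemma makes the lower limit integrable, hence finite almost everywhere, which rules out
    divergence to [+oo] off a null set. *)
Lemma fatou_finite v B : (forall n, rint (v n)) -> (forall n x, 0 <= v n x) ->
  (exists N, forall n, (N <= n)%N -> \int[arc]_x v n x <= B) ->
  {ae arc, forall x, (exists y : R, v n x @[n --> \oo] --> y) \/ (v n x)%:E @[n --> \oo] --> +oo%E} ->
  exists h, rint h /\ {ae arc, forall x, v n x @[n --> \oo] --> h x}.
Proof.
move=> iv v0 [N vB] cv.
pose L x := limn_einf (fun n => (v n x)%:E).
have mv n : measurable_fun setT (fun x => (v n x)%:E) by exact: (measurable_int _ (iv n)).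
have mL : measurable_fun setT L by exact: (@measurable_limn_einf (fun n x => (v n x)%:E)).
have L0 x : (0 <= L x)%E.
  rewrite /L limn_einf_lim; apply: lime_ge; first exact: is_cvg_einfs.
  by near=> n; apply: le_ereal_inf_tmp => _ [k _ <-]; rewrite lee_fin.
have iL : arc.-integrable setT L.
  apply/integrableP; split => //.
  under eq_integral do rewrite gee0_abs //.
  have v0' n x : setT x -> (0 <= (v n x)%:E)%E by rewrite lee_fin.
  apply: le_lt_trans (@fatou _ _ _ arc setT measurableT (fun n x => (v n x)%:E) mv v0') _.
  apply: (@le_lt_trans _ _ B%:E); last by rewrite ltry.
  apply: (@limn_einf_le _ _ N) => n Nn.
  by rewrite (integral_rint (iv n)) lee_fin vB.
exists (fine \o L); split.
  have : arc.-integrable setT (EFin \o (fine \o L)).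
    apply: (le_integrable measurableT _ _ iL).
      apply/measurable_EFinP; exact: (measurableT_comp (@fine_measurable R setT measurableT) mL).
    move=> x _ /=; rewrite ger0_norm ?fine_ge0 // gee0_abs //.
    by have := L0 x; case: (L x) => //= _; rewrite leey.
  by [].
apply: ae_sub (ae_and cv (integrable_ae measurableT iL)) => x [cx /(_ I) fL].
case: cx => [[y vy]|vy].
  have vyE : (v n x)%:E @[n --> \oo] --> y%:E by apply: cvg_EFin; [exact: nearW|].
  rewrite (_ : (fine \o L) x = y) //.
  by rewrite /= /L is_cvg_limn_einfE; [rewrite (cvg_lim _ vyE)|apply/cvg_ex; exists y%:E].
move: fL; rewrite /L is_cvg_limn_einfE; last by apply/cvg_ex; exists +oo%E.
by rewrite (cvg_lim _ vy).
Unshelve. all: by end_near. Qed.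

Lemma fatou_weighted v h p B : (forall n, rint (fun x => p x * v n x)) ->
  (forall n x, 0 <= v n x) -> (forall x, 0 <= p x) -> rint (fun x => p x * h x) ->
  (exists N, forall n, (N <= n)%N -> \int[arc]_x (p x * v n x) <= B) ->
  {ae arc, forall x, v n x @[n --> \oo] --> h x} ->
  \int[arc]_x (p x * h x) <= B.
Proof.
move=> ipv v0 p0 iph [N NB] cv.
pose w n x := (p x * v n x)%:E.
have mw n : measurable_fun setT (w n) by exact: (measurable_int _ (ipv n)).
rewrite -lee_fin -(integral_rint iph).
have -> : (\int[arc]_x (p x * h x)%:E = \int[arc]_x limn_einf (w ^~ x))%E.
  apply: ae_eq_integral => //.
  - exact: (measurable_int _ iph).
  - exact: measurable_limn_einf.
  apply: ae_sub cv => x vx _.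
  have wx : w n x @[n --> \oo] --> (p x * h x)%:E.
    by apply: cvg_EFin; [exact: nearW|apply: cvgM => //; exact: cvg_cst].
  by rewrite is_cvg_limn_einfE; [rewrite (cvg_lim _ wx)|apply/cvg_ex; exists (p x * h x)%:E].
have w0 n x : setT x -> (0 <= w n x)%E by rewrite lee_fin mulr_ge0.
apply: le_trans (@fatou _ _ _ arc setT measurableT w mw w0) _.
by apply: (@limn_einf_le _ _ N) => n /NB; rewrite /w (integral_rint (ipv n)) lee_fin.
Qed.

End fatou_real.

(** * Radial limits along a fast sequence of radii *)

Section radial_limits.
Context {R : realType}.
Local Notation arc := (@arc_length R).
Local Notation Re := (@complex.Re R).
Local Notation Im := (@complex.Im R).
Local Notation T := (borel_circle R).

(** The same radii serve both coordinates. The rate [4^-k] in mean square becomes the summable rate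
    [2^-k] in mean. *)
Lemma fast_radii (f : 'I_2 -> R[i] -> R[i]) (M : R) :
  (forall j, hol 1 (f j)) -> (forall j z, cabs z < 1 -> cabs (f j z) <= M) ->
  exists t : nat -> R, [/\ forall k, 0 < t k < 1,
    (forall e, 0 < e -> exists N, forall n, (N <= n)%N -> 1 - t n < e) &
    forall j k, msd (f j) (t k.+1) (t k) <= 4^-1 ^+ k].
Proof.
move=> hf fM.
have q0 k : 0 < (4^-1 : R) ^+ k by rewrite exprn_gt0.
have /choice[rho Hrho] : forall jk : 'I_2 * nat, exists r : R, 0 < r < 1 /\
    forall t s, r <= t < 1 -> r <= s < 1 -> msd (f jk.1) t s <= 4^-1 ^+ jk.2.
  move=> [j k]; have [r r01 Hr] := msd_cauchy (hf j) (@fM j) (q0 k).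
  by exists r.
(* The second argument forces the radii to tend to 1. *)
pose r k := Num.max (Num.max (rho (ord0, k)) (rho (lift ord0 ord0, k))) (1 - (k.+2%:R)^-1).
have r01 k : 0 < r k < 1.
  have [/andP[a1 a2] _] := Hrho (ord0, k); have [/andP[b1 b2] _] := Hrho (lift ord0 ord0, k).
  by rewrite /r !lt_max a1 !gt_max a2 b2 /= gtrBl invr_gt0 ltr0Sn.
(* The running maximum keeps every later radius above each earlier threshold. *)
pose t := fix t k := match k with 0%N => r 0%N | k'.+1 => Num.max (t k') (r k'.+1) end.
have t01 k : 0 < t k < 1.
  elim: k => [|k /andP[IH1 IH2]]; first exact: r01.
  by have /andP[a1 a2] := r01 k.+1; rewrite /= lt_max gt_max IH1 IH2 a2.
have rt k : r k <= t k by case: k => [|k] //=; rewrite le_max lexx orbT.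
exists t; split => // [e e0|j k].
  exists (Num.bound e^-1) => n Nn; have := rt n; rewrite /r ge_max => /andP[_ h].
  rewrite ltrBlDl -ltrBlDr; apply: lt_le_trans h; rewrite ltrD2l ltrN2.
  rewrite -[ltRHS]invrK ltf_pV2 ?posrE ?invr_gt0 //.
  have eV : 0 <= e^-1 by rewrite invr_ge0 ltW.
  by apply: lt_le_trans (archi_boundP eV) _; rewrite ler_nat (leq_trans Nn) // -addn2 leq_addr.
have [_ H] := Hrho (j, k).
have jr : rho (j, k) <= r k.
  rewrite /r !le_max; case: (unliftP ord0 j) => [i ->|->]; last by rewrite lexx.
  by rewrite (ord1 i) lexx orbT.
have /andP[_ tk1] := t01 k; have /andP[_ tk2] := t01 k.+1.
have jt : rho (j, k) <= t k := le_trans jr (rt k).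
apply: H; rewrite ?tk1 ?tk2 ?jt //.
by rewrite andbT /= le_max jt.
Qed.

(** With [h = 2^-k] in [int_dist_le], the successive differences have integrals of order [2^-k].
    Their sum is therefore finite almost everywhere, and the telescoping series converges there. *)
Lemma ae_radial_limit (f : R[i] -> R[i]) (M : R) (t : nat -> R) :
  hol 1 f -> (forall z, cabs z < 1 -> cabs (f z) <= M) ->
  (forall k, 0 < t k < 1) -> (forall k, msd f (t k.+1) (t k) <= 4^-1 ^+ k) ->
  {ae arc, forall x, exists l : R[i], f ((t n)%:C * circle_val x) @[n --> \oo] --> l}.
Proof.
move=> hf fM t01 tmsd.
pose a n x := f ((t n)%:C * circle_val x).
pose D k x := cabs (a k.+1 x - a k x).
have iD k : rint (D k).
  have cD := ccontB (ccont_ray hf (t01 k.+1)) (ccont_ray hf (t01 k)).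
  exact: (cintegrable_cabs measurableT (ccont_cintegrable cD)).
have mD k : measurable_fun setT (fun x => (D k x)%:E) by exact: (measurable_int _ (iD k)).
have D0 k x : setT x -> (0 <= (D k x)%:E)%E by rewrite lee_fin cabs_ge0.
have DB k : \int[arc]_x D k x <= 2 * pi * (2 * 2^-1 ^+ k).
  have h0 : 0 < 2^-1 ^+ k :> R by rewrite exprn_gt0.
  apply: le_trans (int_dist_le hf (t01 k.+1) (t01 k) h0) _.
  apply: ler_wpM2l; first exact: (ltW twopi_gt0).
  have E : (4^-1 : R) ^+ k = 2^-1 ^+ k * 2^-1 ^+ k by rewrite -exprMn; congr (_ ^+ k); field.
  by rewrite mulr_natl mulr2n lerD2l ler_pdivrMr // -E.
pose S x := (\sum_(k <oo) (D k x)%:E)%E.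
have iS : arc.-integrable setT S.
  apply/integrableP; split.
    exact: (@ge0_emeasurable_sum _ T R setT (fun k x => (D k x)%:E) xpredT (fun k x Dx _ => D0 k x Dx) (fun k _ => mD k)).
  have S0 x : (0 <= S x)%E by apply: nneseries_ge0 => k _ _; rewrite lee_fin cabs_ge0.
  under eq_integral do rewrite gee0_abs //.
  rewrite integral_nneseries //.
  apply: (@le_lt_trans _ _ (2 * pi * (2 * 2))%:E); last by rewrite ltry.
  apply: lime_le; first by apply: is_cvg_nneseries => k _ _; apply: integral_ge0 => x; exact: D0.
  near=> n; under eq_bigr do rewrite (integral_rint (iD _)).
  rewrite sumEFin lee_fin; apply: (@le_trans _ _ (\sum_(0 <= k < n) 2 * pi * (2 * 2^-1 ^+ k))).
    by apply: ler_sum => k _; exact: DB.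
  rewrite -mulr_sumr; apply: ler_wpM2l; first exact: (ltW twopi_gt0).
  rewrite -mulr_sumr; apply: ler_wpM2l => //.
  have : forall m, \sum_(0 <= k < m) 2^-1 ^+ k = 2 - 2 * 2^-1 ^+ m :> R.
    elim=> [|m IH]; first by rewrite big_geq // expr0 mulr1 subrr.
    by rewrite big_nat_recr //= IH exprSr; field.
  by move=> ->; rewrite gerBl mulr_ge0 // exprn_ge0.
apply: ae_sub (integrable_ae measurableT iS) => x /(_ I) fS.
have C (u : nat -> R) : (forall k, `|u k.+1 - u k| <= D k x) -> cvgn u.
  move=> uD.
  have : cvgn [normed series (telescope u)].
    apply: nondecreasing_is_cvgn.
      by apply: nondecreasing_series => k _ _; exact: normr_ge0.
    exists (fine (S x)) => _ [n _ <-].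
    rewrite -lee_fin fineK // /series /= -sumEFin.
    apply: le_trans (nneseries_lim_ge n _); last by move=> k _ _; rewrite lee_fin cabs_ge0.
    by apply: lee_sum => k _; rewrite lee_fin; exact: uD.
  move=> /normed_cvg cs.
  have -> : u = (fun n => u 0%N + series (telescope u) n).
    by apply/funext => n; exact: eq_sum_telescope.
  by apply: is_cvgD => //; exact: is_cvg_cst.
have /cvg_ex[l1 h1] : cvgn (fun n => Re (a n x)).
  by apply: C => k; rewrite -ReB Re_le_cabs.
have /cvg_ex[l2 h2] : cvgn (fun n => Im (a n x)).
  by apply: C => k; rewrite -ImB Im_le_cabs.
exists (l1 +i* l2); apply/cvgr_cabsP => e e0.
have e20 : 0 < e / 2 by rewrite divr_gt0.
near=> n; apply: le_lt_trans (cabs_le_ReIm _) _.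
rewrite [e]splitr ReB ImB; apply: ltrD; rewrite distrC.
  by near: n; exact: ((cvgrPdist_lt _ _).1 h1).
by near: n; exact: ((cvgrPdist_lt _ _).1 h2).
Unshelve. all: by end_near. Qed.

End radial_limits.

(** * Integrable boundary values of [ln |f|] *)

Section boundary_logarithm.
Context {R : realType}.
Local Notation arc := (@arc_length R).
Local Notation T := (borel_circle R).

Lemma cvg_cabs (a : nat -> R[i]) (l : R[i]) : a n @[n --> \oo] --> l ->
  cabs (a n) @[n --> \oo] --> cabs l.
Proof.
move=> /cvgr_cabsP h; apply/cvgrPdist_lt => e e0; near=> n.
have ae : cabs (a n - l) < e by near: n; exact: h.
rewrite ltr_norml; apply/andP; split.
  by rewrite ltrNl opprB; apply: le_lt_trans ae; exact: cabs_le_dist.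
by apply: le_lt_trans ae; rewrite cabsB; exact: cabs_le_dist.
Unshelve. all: by end_near. Qed.

Lemma cvg_ln (a : nat -> R) (l : R) : 0 < l -> a n @[n --> \oo] --> l ->
  ln (a n) @[n --> \oo] --> ln l.
Proof. by move=> l0 al; apply: (cvg_comp _ _ al); exact: (continuous_ln l0). Qed.

(** Each dilate of [f] is holomorphic past the closed disc, so [poisson_jensen] bounds from below
    the Poisson means of its regularised logarithm at a point where [f] is nonzero. Fatou's lemma
    then excludes the boundary value 0 off a null set, and also carries the inequality for [|f|] to
    the limit. *)
Lemma boundary_log1 (f : R[i] -> R[i]) (M : R) (t : nat -> R) :
  hol 1 f -> (forall z, cabs z < 1 -> cabs (f z) <= M) ->
  (forall k, 0 < t k < 1) ->
  (forall e, 0 < e -> exists N, forall n, (N <= n)%N -> 1 - t n < e) ->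
  {ae arc, forall x, exists l : R[i], f ((t n)%:C * circle_val x) @[n --> \oo] --> l} ->
  (exists2 w, cabs w < 1 & f w != 0) ->
  exists g : T -> R, [/\ rint g,
    (forall z, cabs z < 1 -> cabs (f z) <= expR (pint g (pk z))) &
    {ae arc, forall x, (exists N, forall n, (N <= n)%N -> f ((t n)%:C * circle_val x) != 0) /\
       ln (cabs (f ((t n)%:C * circle_val x))) @[n --> \oo] --> g x}].
Proof.
move=> hf fM t01 t1 fl [w0 w01 fw0].
have M0 : 0 <= M by apply: le_trans (fM _ w01); exact: cabs_ge0.
have tp := twopi_gt0 (R := R).
pose F n z := f ((t n)%:C * z).
have t0 n : 0 < t n by case/andP: (t01 n).
have t1' n : t n < 1 by case/andP: (t01 n).
have hF n : hol (1 / t n) (F n) by exact: hol_scale.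
have b1 n : 1 < 1 / t n by rewrite ltr_pdivlMr // mul1r.
pose eps n : R := n.+1%:R^-1.
have eps0 n : 0 < eps n by rewrite invr_gt0 ltr0Sn.
have eps1 n : eps n <= 1 by rewrite invf_le1 ?ltr0Sn // ler1n.
pose u n (x : T) := logF (F n) (eps n) (circle_val x).
have iu n : rint (u n) by exact: (rint_logF (hF n) (b1 n) (eps0 n)).
have tz n z : cabs z <= 1 -> cabs ((t n)%:C * z) < 1.
  move=> z1; rewrite cabsM cabsC gtr0_norm //; apply: le_lt_trans (t1' n).
  by rewrite ler_piMr ?(ltW (t0 n)).
have tx n (x : T) : cabs ((t n)%:C * circle_val x) < 1 by apply: tz; rewrite cabs_circle_val.
(* An upper bound of all [u n], because [eps n <= 1]; it makes [C - u n] nonnegative, as Fatou's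
   lemma requires. *)
pose C : R := 2^-1 * ln (M ^+ 2 + 1).
have uC n x : u n x <= C.
  rewrite ler_wpM2l ?invr_ge0 // ler_ln ?posrE; last 2 first.
  - exact: logF_pos.
  - by rewrite ltr_wpDl ?sqr_ge0.
  by rewrite lerD // ler_pXn2r ?nnegrE ?cabs_ge0 // fM.
pose v n x := C - u n x.
have iv n : rint (v n) by apply: rintB => //; exact: rint_cst.
have v0 n x : 0 <= v n x by rewrite subr_ge0.
have ipv w n : cabs w < 1 -> rint (fun x => pk w (circle_val x) * v n x).
  move=> w1; have := rintK (iv n) (kcont_pk w1).
  by apply: eq_integrable => // x _ /=; rewrite mulrC.
have pv w n : cabs w < 1 ->
    \int[arc]_x (pk w (circle_val x) * v n x) = 2 * pi * (C - pint (u n) (pk w)).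
  move=> w1; rewrite -{1}(pint_cst C w1) -(pintB (@rint_cst _ C) (iu n) (kcont_pk w1)).
  rewrite /pint mulVKf ?gt_eqF //; apply: eq_Rintegral => x _; exact: mulrC.
(* Continuity of [f] at [w] lets the modulus of the dilate at [w] be replaced by [|f w|], at the
   price of [eta]. *)
have bound w : cabs w < 1 -> f w != 0 -> forall eta, 0 < eta -> exists N, forall n, (N <= n)%N ->
    \int[arc]_x (pk w (circle_val x) * v n x) <= 2 * pi * (C - ln (cabs (f w)) + eta).
  move=> w1 fw eta eta0; have fwp : 0 < cabs (f w) by rewrite cabs_gt0.
  have e0 : 0 < cabs (f w) * (1 - expR (- eta)).
    by rewrite mulr_gt0 // subr_gt0 expR_lt1 oppr_lt0.
  have /continuous_cabsP/(_ _ e0)[d d0 Hd] := hol_continuous hf w1.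
  have [N HN] := t1 _ d0; exists N => n Nn.
  rewrite pv // ler_pM2l // -addrA lerD2l lerNl opprD opprK.
  have h : cabs ((t n)%:C * w - w) < d.
    rewrite -{2}[w]mul1r -mulrBl cabsM -[1]/((1 : R)%:C) -rmorphB /= cabsC distrC.
    rewrite ger0_norm ?subr_ge0 ?(ltW (t1' n)) //; apply: le_lt_trans (HN _ Nn).
    by rewrite ler_piMr ?subr_ge0 ?(ltW (t1' n)) // ltW.
  have h2 : cabs (f w) * expR (- eta) <= cabs (F n w).
    have := Hd _ h; rewrite mulrBr mulr1 cabsB => h3.
    have := le_lt_trans (cabs_le_dist (f w) (f ((t n)%:C * w))) h3.
    by rewrite ltrD2l ltrN2 => /ltW.
  have h4 := le_trans h2 (poisson_jensen (hF n) (b1 n) (eps0 n) w1).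
  rewrite -ler_expR; apply: le_trans h4.
  by rewrite expRD lnK ?posrE.
have lim_pos x l : l != 0 -> F n (circle_val x) @[n --> \oo] --> l ->
    u n x @[n --> \oo] --> ln (cabs l).
  move=> l0 Fl; have lp : 0 < cabs l by rewrite cabs_gt0.
  have h1 : cabs (F n (circle_val x)) ^+ 2 + eps n @[n --> \oo] --> cabs l ^+ 2 + 0.
    apply: cvgD; last exact: cvg_harmonic.
    by rewrite expr2; under eq_fun do rewrite expr2; apply: cvgM; exact: cvg_cabs.
  rewrite addr0 in h1.
  have -> : ln (cabs l) = 2^-1 * ln (cabs l ^+ 2).
    by rewrite lnXn // mulr2n; move: (ln _) => y; field.
  by apply: cvgM; [exact: cvg_cst|apply: cvg_ln => //; rewrite exprn_gt0].
(* A zero boundary value corresponds to divergence of [v n], the alternative removed by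
   [fatou_finite]. *)
have lim_zero x : F n (circle_val x) @[n --> \oo] --> (0 : R[i]) ->
    (v n x)%:E @[n --> \oo] --> +oo%E.
  move=> F0; apply/cvgeyPge => A.
  have h1 : cabs (F n (circle_val x)) ^+ 2 + eps n @[n --> \oo] --> (0 : R).
    have -> : (0 : R) = cabs (0 : R[i]) * cabs (0 : R[i]) + 0 by rewrite cabs0 mul0r addr0.
    apply: cvgD; last exact: cvg_harmonic.
    by under eq_fun do rewrite expr2; apply: cvgM; exact: cvg_cabs.
  near=> n; rewrite lee_fin lerBrDl -lerBrDr.
  have h2 : cabs (F n (circle_val x)) ^+ 2 + eps n < expR (2 * (C - A)).
    apply: le_lt_trans (ler_norm _) _; rewrite -normrN -sub0r.
    by near: n; exact: ((cvgrPdist_lt _ _).1 h1 _ (expR_gt0 _)).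
  rewrite /u /logF -[leRHS](mulKf (x := 2)) ?pnatr_eq0 // ler_pM2l ?invr_gt0 //.
  by rewrite -[leRHS]expRK ler_ln ?posrE ?expR_gt0 ?(ltW h2) //; exact: logF_pos.
have [h [ih vh]] : exists h, rint h /\ {ae arc, forall x, v n x @[n --> \oo] --> h x}.
  (* A positive lower bound of the Poisson kernel at [w0]; it turns the weighted bound into a bound
     of the plain integral. *)
  pose c := (1 - cabs w0) / (1 + cabs w0).
  have c0 : 0 < c by rewrite divr_gt0 ?subr_gt0 // ltr_pwDl ?cabs_ge0.
  have [N HN] := bound w0 w01 fw0 1 ltr01.
  apply: (fatou_finite (B := c^-1 * (2 * pi * (C - ln (cabs (f w0)) + 1)))) => //.
    exists N => n /HN h; apply: (@le_trans _ _ (c^-1 * \int[arc]_x (pk w0 (circle_val x) * v n x))).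
      rewrite ler_pdivlMl // -RintegralZl //; last exact: iv.
       apply: le_Rintegral => //.
      - exact: rintZ.
      - exact: ipv.
      - by move=> x _; rewrite ler_wpM2r // pk_ge // cabs_circle_val.
    by rewrite ler_wpM2l // invr_ge0 ltW.
  apply: ae_sub fl => x [l fx]; have [l0|l0] := eqVneq l 0.
    by right; apply: lim_zero; rewrite -l0.
  left; exists (C - ln (cabs l)); apply: cvgB; first exact: cvg_cst.
  exact: lim_pos.
exists (fun x => C - h x); split.
- by apply: rintB => //; exact: rint_cst.
- move=> z z1; have [->|fz] := eqVneq (f z) 0; first by rewrite cabs0 expR_ge0.
  have fzp : 0 < cabs (f z) by rewrite cabs_gt0.
  rewrite -[leLHS]lnK ?posrE // ler_expR; apply/ler_addgt0Pr => eta eta0.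
  have [N HN] := bound z z1 fz eta eta0.
  rewrite (pintB (@rint_cst _ C) ih (kcont_pk z1)) (pint_cst C z1).
  have iph : rint (fun x => pk z (circle_val x) * h x).
    have := rintK ih (kcont_pk z1).
    by apply: eq_integrable => // x _ /=; rewrite mulrC.
  have p0 (x : T) : 0 <= pk z (circle_val x) by rewrite pk_ge0 // cabs_circle_val.
  have := fatou_weighted (ipv z ^~ z1) v0 p0 iph (ex_intro _ N HN) vh.
  have -> : \int[arc]_x (pk z (circle_val x) * h x) = 2 * pi * pint h (pk z).
    rewrite /pint mulVKf ?gt_eqF //; apply: eq_Rintegral => x _; exact: mulrC.
  by rewrite ler_pM2l //; move: (pint _ _) (ln _) => p l; lra.
- apply: ae_sub (ae_and fl vh) => x [[l fx] vx].
  have [l0|l0] := eqVneq l 0.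
    have vy : (v n x)%:E @[n --> \oo] --> +oo%E by apply: lim_zero; rewrite -l0.
    have vh' : (v n x)%:E @[n --> \oo] --> (h x)%:E by apply: cvg_EFin; [exact: nearW|].
    have e1 := cvg_lim (@ereal_hausdorff R) vy; have e2 := cvg_lim (@ereal_hausdorff R) vh'.
    have : (h x)%:E = +oo%E :> \bar R by rewrite -e1 -e2.
    discriminate.
  have lp : 0 < cabs l by rewrite cabs_gt0.
  have ca := cvg_cabs fx.
  split.
    have := (cvgrPdist_lt _ _).1 ca _ lp => -[N _ HN]; exists N => n Nn.
    have := HN n Nn; rewrite /=; apply: contraTneq => ->.
    by rewrite cabs0 subr0 ger0_norm ?ltxx // ltW.
  have -> : C - h x = ln (cabs l).
    have : v n x @[n --> \oo] --> C - ln (cabs l).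
      by apply: cvgB; [exact: cvg_cst|exact: lim_pos].
    move=> /(cvg_lim (@Rhausdorff R)); rewrite (cvg_lim (@Rhausdorff R) vx) => ->.
    by rewrite subKr.
  exact: cvg_ln.
Unshelve. all: by end_near. Qed.

Theorem boundary_log (f : 'I_2 -> R[i] -> R[i]) (M : R) :
  (forall j, hol 1 (f j)) -> (forall j z, cabs z < 1 -> cabs (f j z) <= M) ->
  (forall j, exists2 w, cabs w < 1 & f j w != 0) ->
  exists (t : nat -> R) (g : 'I_2 -> T -> R), [/\ forall n, 0 < t n < 1,
    forall j, rint (g j),
    forall j z, cabs z < 1 -> cabs (f j z) <= expR (pint (g j) (pk z)) &
    {ae arc, forall x, forall j,
       (exists N, forall n, (N <= n)%N -> f j ((t n)%:C * circle_val x) != 0) /\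
       ln (cabs (f j ((t n)%:C * circle_val x))) @[n --> \oo] --> g j x}].
Proof.
move=> hf fM f0; have [t [t01 t1 tm]] := fast_radii hf fM.
have /choice[g Hg] j := boundary_log1 (hf j) (@fM j) t01 t1
  (ae_radial_limit (hf j) (@fM j) t01 (tm j)) (f0 j).
exists t, g; split => //; [by move=> j; have [] := Hg j|by move=> j; have [] := Hg j|].
have [_ _ a0] := Hg ord0; have [_ _ a1] := Hg (lift ord0 ord0).
apply: ae_sub (ae_and a0 a1) => x [h0 h1] j.
by case: (unliftP ord0 j) => [i ->|->] //; rewrite (ord1 i).
Qed.

End boundary_logarithm.

Lemma cvg_sum_seq {R : realType} (T : Type) (F : set_system T) {FF : Filter F}
    (I : Type) (s : seq I) (f : I -> T -> R) (l : I -> R) :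
  (forall j, f j @ F --> l j) ->
  (fun x => \sum_(j <- s) f j x) @ F --> \sum_(j <- s) l j.
Proof.
move=> H; elim: s => [|j s IH].
  rewrite big_nil (_ : (fun x => _) = cst (0 : R)); first exact: cvg_cst.
  by apply/funext => x; rewrite big_nil.
rewrite big_cons (_ : (fun x => _) = f j \+ (fun x => \sum_(j <- s) f j x)); first exact: cvgD.
by apply/funext => x; rewrite big_cons.
Qed.

Lemma nbhs_rowP {K : numFieldType} {n : nat} (x : 'rV[K]_n) (P : set 'rV[K]_n) :
  nbhs x P <-> exists2 e : K, 0 < e & forall y : 'rV[K]_n, (forall j, `|y 0 j - x 0 j| < e) -> P y.
Proof.
split=> [/nbhs_ballP[e /= e0 H]|[e e0 H]].
  exists e => // y h; apply: H; split=> // i j.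
  by rewrite (ord1 i) /ball /= distrC; exact: h.
apply/nbhs_ballP; exists e => // y [_ h].
by apply: H => j; have := h 0 j; rewrite /ball /= distrC.
Qed.

(** * Separation of convex sets in real coordinate space *)

Section separation.
Context {R : realType} {n : nat}.
Implicit Types (x y z v : 'rV[R]_n) (C : set 'rV[R]_n).

Lemma closure_rowP C x : closure C x <->
  forall e : R, 0 < e -> exists2 y, C y & forall j, `|y 0 j - x 0 j| < e.
Proof.
split=> [h e e0|h P /nbhs_rowP[e e0 H]].
  have [|y [Cy Py]] := h [set y | forall j, `|y 0 j - x 0 j| < e]; last by exists y.
  by apply/nbhs_rowP; exists e.
by have [y Cy hy] := h e e0; exists y; split => //; exact: H.
Qed.

Lemma dotDl x y z : dot (x + y) z = dot x z + dot y z.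
Proof. by rewrite /dot -big_split; apply: eq_bigr => j _; rewrite !mxE mulrDl. Qed.
Lemma dotZl (a : R) x z : dot (a *: x) z = a * dot x z.
Proof. by rewrite /dot mulr_sumr; apply: eq_bigr => j _; rewrite !mxE mulrA. Qed.
Lemma dotC x y : dot x y = dot y x.
Proof. by apply: eq_bigr => j _; rewrite mulrC. Qed.
Lemma dotNl x z : dot (- x) z = - dot x z.
Proof. by rewrite -scaleN1r dotZl mulN1r. Qed.
Lemma dotBl x y z : dot (x - y) z = dot x z - dot y z.
Proof. by rewrite dotDl dotNl. Qed.
Lemma dotDr x y z : dot z (x + y) = dot z x + dot z y.
Proof. by rewrite !(dotC z) dotDl. Qed.
Lemma dotZr (a : R) x z : dot z (a *: x) = a * dot z x.
Proof. by rewrite !(dotC z) dotZl. Qed.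
Lemma dotBr x y z : dot z (x - y) = dot z x - dot z y.
Proof. by rewrite !(dotC z) dotBl. Qed.

Lemma dot_ge0 x : 0 <= dot x x.
Proof. by apply: sumr_ge0 => j _; rewrite -expr2 sqr_ge0. Qed.

Lemma dot_coord x j : x 0 j ^+ 2 <= dot x x.
Proof.
rewrite /dot (bigD1 j) //= -expr2 lerDl.
by apply: sumr_ge0 => i _; rewrite -expr2 sqr_ge0.
Qed.

Lemma dot_eq0 x : dot x x = 0 -> x = 0.
Proof.
move=> h; apply/rowP => j; rewrite mxE; apply/eqP; rewrite -sqrf_eq0 eq_le sqr_ge0 andbT.
by rewrite -h dot_coord.
Qed.

Lemma dot_continuous (f g : 'rV[R]_n -> 'rV[R]_n) :
  (forall j, continuous (fun x => f x 0 j)) -> (forall j, continuous (fun x => g x 0 j)) ->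
  continuous (fun x => dot (f x) (g x)).
Proof.
move=> cf cg x; apply: (@cvg_sum_seq _ _ _ (nbhs_filter (x : 'rV[R]_n))) => j.
by apply: cvgM; [exact: cf|exact: cg].
Qed.

Lemma coord_continuous_row j : continuous (fun x : 'rV[R]_n => x 0 j).
Proof. exact: coord_continuous. Qed.

Definition convex_set C := forall x y (t : R), C x -> C y -> 0 <= t <= 1 ->
  C (x + t *: (y - x)).

Lemma convex_closure C : convex_set C -> convex_set (closure C).
Proof.
move=> cC x y t /closure_rowP clx /closure_rowP cly t01; apply/closure_rowP => e e0.
have [x' Cx' hx] := clx e e0; have [y' Cy' hy] := cly e e0.
exists (x' + t *: (y' - x')); first exact: cC.
move=> j; rewrite !mxE; have := hx j; have := hy j; move/andP: t01 => [t0 t1].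
set a := x' 0 j; set b := x 0 j; set c := y' 0 j; set d := y 0 j => h1 h2.
have -> : a + t * (c - a) - (b + t * (d - b)) = (1 - t) * (a - b) + t * (c - d) by ring.
apply: le_lt_trans (ler_normD _ _) _; rewrite !normrM (ger0_norm t0) ger0_norm ?subr_ge0 //.
have [->|tn] := eqVneq t 0; first by rewrite subr0 mul1r mul0r addr0.
have tp : 0 < t by rewrite lt_neqAle eq_sym tn.
have : t * `|c - d| < t * e by rewrite ltr_pM2l.
have : (1 - t) * `|a - b| <= (1 - t) * e by rewrite ler_wpM2l ?subr_ge0 // ltW.
have -> : (1 - t) * e = e - t * e by ring.
by move: (t * `|_|) (_ * `|a - b|) (t * e) => u p q; clear; lra.
Qed.

(** The point [y] of the closure nearest to [x0] supplies the normal [x0 - y] and the gap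
    [|x0 - y|^2]. *)
Lemma strict_separation C x0 : convex_set C -> C !=set0 -> ~ closure C x0 ->
  exists v, exists2 d : R, 0 < d & forall c, C c -> dot v c + d <= dot v x0.
Proof.
move=> cC [c0 Cc0] nx0.
pose q y := dot (y - x0) (y - x0).
have cq : continuous q.
  have h j : continuous (fun y : 'rV[R]_n => (y - x0) 0 j).
    move=> y; rewrite (_ : (fun y => _) = (fun y : 'rV[R]_n => y 0 j - x0 0 j)); last first.
      by apply/funext => z; rewrite !mxE.
    by apply: (@cvgB _ _ _ _ (nbhs_filter (y : 'rV[R]_n))); [exact: coord_continuous_row|exact: cvg_cst].
  exact: dot_continuous.
(* Points farther from [x0] than [c0] cannot be nearest, so the minimisation takes place on a
   compact set. *)
pose K := closure C `&` [set y | q y <= q c0].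
have clK : closed K.
  apply: closedI; first exact: closed_closure.
  by apply: (@preimage_closed _ _ q [set t | t <= q c0]) => [y _|]; [exact: cq|exact: closed_le].
have bK : bounded_set K.
  exists (1 + (q c0 + \sum_j `|x0 0 j|)); split; first exact: num_real.
  move=> M HM y [_ /= qy]; rewrite /Num.Def.normr /= mx_normrE.
  apply: bigmax_le => [|[i j] _ /=]; first by apply: le_trans (ltW HM); rewrite !addr_ge0 ?dot_ge0 ?sumr_ge0.
  rewrite (ord1 i); apply: le_trans (ltW HM).
  have -> : y 0 j = (y - x0) 0 j + x0 0 j by rewrite !mxE subrK.
  apply: le_trans (ler_normD _ _) _; rewrite addrA; apply: lerD; last first.
    by rewrite (bigD1 j) //= lerDl sumr_ge0.
  have h2 := le_trans (dot_coord (y - x0) j) qy.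
  move: ((y - x0) 0 j) h2 => a h2.
  rewrite -real_normK ?num_real // in h2; move: (normr_ge0 a); move: `|a| h2 => b h2 b0.
  have [b1|b1] := leP b 1; first by rewrite (le_trans b1) // lerDl dot_ge0.
  by apply: le_trans (_ : b <= b ^+ 2) _; [rewrite expr2 ler_peMl // ltW|rewrite (le_trans h2) // lerDr].
have K0 : K !=set0 by exists c0; split; [exact: subset_closure|exact: lexx].
have [y /set_mem[cly qy] ymin] := EVT_min_rV K0 (bounded_closed_compact bK clK)
  (continuous_subspaceT cq).
have w0 : 0 < q y.
  rewrite lt_neqAle dot_ge0 andbT eq_sym; apply/eqP => /dot_eq0/eqP; rewrite subr_eq0 => /eqP yx.
  by apply: nx0; rewrite -yx.
exists (x0 - y), (q y) => // c Cc.
(* First variation of the squared distance when [y] moves towards [c], divided by [t]. *)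
have key (t : R) : 0 < t -> t <= 1 -> 0 <= 2 * dot (y - x0) (c - y) + t * dot (c - y) (c - y).
  move=> t0 t1; pose z := y + t *: (c - y).
  have clz : closure C z.
    by apply: (convex_closure cC) => //; [exact: subset_closure|rewrite (ltW t0)].
  have qz : q y <= q z.
    have [h|h] := leP (q z) (q c0); last by apply: le_trans qy (ltW h).
    by apply: ymin; apply/mem_set.
  have E : q z = q y + t * (2 * dot (y - x0) (c - y) + t * dot (c - y) (c - y)).
    have -> : q z = dot ((y - x0) + t *: (c - y)) ((y - x0) + t *: (c - y)).
      by rewrite /q /z addrAC.
    rewrite /q; move: (y - x0) (c - y) => a b.
    by rewrite !dotDl !dotDr !dotZl !dotZr (dotC b a); ring.
  by move: qz; rewrite E lerDl pmulr_rge0.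
have : 0 <= dot (y - x0) (c - y).
  rewrite leNgt; apply/negP => neg.
  set a := dot (y - x0) (c - y) in neg key; set b := dot (c - y) (c - y) in key.
  have b0 : 0 <= b by exact: dot_ge0.
  (* So small that the quadratic term cannot compensate a negative linear term. *)
  pose t := Num.min 1 (- a / (b + 1)).
  have b1 : 0 < b + 1 by rewrite ltr_wpDl.
  have t0 : 0 < t by rewrite lt_min ltr01 divr_gt0 // oppr_gt0.
  have t1 : t <= 1 by rewrite ge_min lexx.
  have tb : t * b <= - a.
    apply: (@le_trans _ _ (- a / (b + 1) * b)); first by rewrite ler_wpM2r // ge_min lexx orbT.
    by rewrite mulrAC ler_pdivrMr // ler_wpM2l ?oppr_ge0 ?(ltW neg) // lerDl.
  by have := key t t0 t1; move: neg tb; move: (t * b) => s; lra.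
have -> : dot (y - x0) (c - y) = dot (x0 - y) x0 - dot (x0 - y) c - q y.
  rewrite /q !dotBl !dotBr (dotC x0 y); ring.
by rewrite subr_ge0 lerBrDl.
Qed.

(** Unit normals separating [x0] from the sets [C k] have a cluster point on the compact unit
    sphere; since the sets increase, each inequality holds for all later normals and survives in the
    limit. *)
Lemma limit_separation (C : nat -> set 'rV[R]_n) x0 :
  (forall k, convex_set (C k)) -> C 0%N !=set0 -> (forall k m, (k <= m)%N -> C k `<=` C m) ->
  (forall k, ~ closure (C k) x0) ->
  exists2 v, v != 0 & forall k c, C k c -> dot v c <= dot v x0.
Proof.
move=> cC [c0 Cc0] Cinc ncl.
have sep k : exists v, dot v v = 1 /\ forall c, C k c -> dot v c <= dot v x0.
  have [|v [d d0 Hv]] := strict_separation (cC k) _ (ncl k).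
    by exists c0; exact: (Cinc 0%N).
  have vp : 0 < dot v v.
    rewrite lt_neqAle dot_ge0 andbT eq_sym; apply/eqP => /dot_eq0 v0.
    have := Hv c0 (Cinc _ _ (leq0n k) _ Cc0).
    rewrite v0 -(scale0r (0 : 'rV[R]_n)) !dotZl !mul0r add0r.
    by rewrite leNgt d0.
  pose s := Num.sqrt (dot v v); have s0 : 0 < s by rewrite sqrtr_gt0.
  exists (s^-1 *: v); split.
    rewrite dotZl dotZr mulrA -invfM -expr2 sqr_sqrtr ?dot_ge0 // mulVf // gt_eqF //.
  move=> c Cc; rewrite !dotZl ler_pM2l ?invr_gt0 //.
  by apply: le_trans (Hv c Cc); rewrite lerDl ltW.
have /choice[v Hv] := sep.
pose K := [set w : 'rV[R]_n | dot w w = 1].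
have cdot : continuous (fun w : 'rV[R]_n => dot w w).
  by apply: dot_continuous; exact: coord_continuous_row.
have clK : closed K.
  apply: (@preimage_closed _ _ (fun w : 'rV[R]_n => dot w w) [set t | t = 1]).
    by move=> w _; exact: cdot.
  exact: closed_eq.
have bK : bounded_set K.
  exists 1; split; first exact: num_real.
  move=> M HM w /= w1; rewrite /Num.Def.normr /= mx_normrE.
  apply: bigmax_le => [|[i j] _ /=]; first by rewrite (le_trans ler01) // ltW.
  rewrite (ord1 i); apply: le_trans (ltW HM).
  by rewrite -(@expr_le1 _ 2) // real_normK ?num_real // -w1 dot_coord.
have cK := bounded_closed_compact bK clK.
have [|w [Kw clw]] := cK (v @ \oo) _.
  by exists 0%N => // k _; exact: (Hv k).1.
exists w.
  apply: contraTneq isT => w0; move: Kw; rewrite /K /= w0 -(scale0r (0 : 'rV[R]_n)) dotZl mul0r.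
  by move=> /eqP; rewrite eq_sym oner_eq0.
move=> k c Cc.
have clS : closed [set u : 'rV[R]_n | dot u (c - x0) <= 0].
  apply: (@preimage_closed _ _ (fun u : 'rV[R]_n => dot u (c - x0)) [set t | t <= 0]).
    move=> u _; apply: dot_continuous; first exact: coord_continuous_row.
    by move=> j; exact: cst_continuous.
  exact: closed_le.
suff : [set u : 'rV[R]_n | dot u (c - x0) <= 0] w by rewrite /= dotBr subr_le0.
apply: clS => B Bw.
have [|u [h1 h2]] := clw [set u | dot u (c - x0) <= 0] B _ Bw; last by exists u.
exists k => // m km; rewrite /= dotBr subr_le0; apply: (Hv m).2.
exact: (Cinc k m km).
Qed.

End separation.

(** * Poisson averages of maps with values in a convex set *)

Section average.
Context {R : realType}.
Let D : set (borel_circle R) := setT.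

Lemma rint_sum (I : Type) (s : seq I) (u : I -> borel_circle R -> R) :
  (forall j, rint (u j)) -> rint (fun x => \sum_(j <- s) u j x).
Proof.
move=> H; elim: s => [|j s IH].
  rewrite (_ : (fun x => _) = (fun=> 0)); first exact: (@rint_cst R 0).
  by apply/funext => x; rewrite big_nil.
rewrite (_ : (fun x => _) = (fun x => u j x + \sum_(j <- s) u j x)); first exact: rintD.
by apply/funext => x; rewrite big_cons.
Qed.

Lemma pint_sum (I : Type) (s : seq I) (u : I -> borel_circle R -> R) (k : R[i] -> R) :
  kcont k -> (forall j, rint (u j)) ->
  pint (fun x => \sum_(j <- s) u j x) k = \sum_(j <- s) pint (u j) k.
Proof.
move=> kc H; elim: s => [|j s IH].
  rewrite big_nil (_ : (fun x => _) = (fun x => 0 * (fun=> 0) x)).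
    by rewrite pintZ ?mul0r //; exact: (@rint_cst R 0).
  by apply/funext => x; rewrite big_nil mul0r.
rewrite big_cons -IH -pintD //; last exact: rint_sum.
by congr pint; apply/funext => x; rewrite big_cons.
Qed.

(** Otherwise a separating functional would lie below its value at the average by at least [d] at
    every point of the circle, hence also on average. *)
Lemma average_closure n (C : set 'rV[R]_n) (u : 'I_n -> borel_circle R -> R) (w : R[i]) :
  convex_set C -> (forall j, rint (u j)) -> (forall x, C (\row_j u j x)) -> cabs w < 1 ->
  closure C (\row_j pint (u j) (pk w)).
Proof.
move=> cC ru Cu w1; apply: contrapT => ncl.
have [|v [d d0 H]] := strict_separation cC _ ncl.
  by exists (\row_j u j (point : borel_circle R)).
have rs : rint (fun x => \sum_(j <- index_enum 'I_n) v 0 j * u j x).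
  by apply: rint_sum => j; apply: rintZ.
have : pint (fun x => \sum_(j <- index_enum 'I_n) v 0 j * u j x) (pk w) <=
    pint (fun=> dot v (\row_j pint (u j) (pk w)) - d) (pk w).
  apply: le_pint_pk => //; first exact: rint_cst.
  move=> x; rewrite lerBrDr; apply: le_trans (H _ (Cu x)).
  by rewrite lerD2r le_eqVlt; apply/orP; left; apply/eqP; apply: eq_bigr => j _; rewrite mxE.
rewrite pint_cst // pint_sum; [|exact: kcont_pk|by move=> j; exact: rintZ].
suff -> : \sum_(j <- index_enum 'I_n) pint (fun x => v 0 j * u j x) (pk w) =
    dot v (\row_j pint (u j) (pk w)) by rewrite lerBrDr gerDl leNgt d0.
by apply: eq_bigr => j _; rewrite pintZ ?mxE //; exact: kcont_pk.
Qed.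

End average.

(** * Second-order expansion of the logarithm of the modulus *)

Section log_expansion.
Context {R : realType}.
Implicit Types (z w : R[i]).
Local Notation Re := (@complex.Re R).
Local Notation Im := (@complex.Im R).

(** Mean value theorem for [h x = ln x + x^2 / 2 - 2 x], whose derivative is [(x - 1)^2 / x]. *)
Lemma ln_expansion (v : R) : `|v| <= 1 / 2 -> `|ln (1 + v) - v + v ^+ 2 / 2| <= 2 * `|v| ^+ 3.
Proof.
move=> v2; pose h := (@ln R) + (fun x : R => x * (x / 2 - 2)).
have dh (x : R) : 0 < x -> is_derive x (1 : R) h ((x - 1) ^+ 2 / x).
  move=> x0; have d1 : is_derive x (1 : R) (@ln R) x^-1 by exact: is_derive1_ln.
  by apply: is_derive_eq; rewrite /GRing.scale /=; field; rewrite gt_eqF.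
have main (a b : R) : 0 < a -> a <= b -> exists2 c, a <= c <= b & h b - h a = (c - 1) ^+ 2 / c * (b - a).
  move=> a0 ab; have [||c] := @MVT_segment R h (fun x => (x - 1) ^+ 2 / x) a b ab.
  - by move=> x; rewrite in_itv /= => /andP[ax _]; apply: dh; exact: lt_trans ax.
  - apply: derivable_within_continuous => x; rewrite in_itv /= => /andP[ax _].
    by have [] := dh x (lt_le_trans a0 ax).
  by rewrite in_itv /= => cab E; exists c.
have h1 : h 1 = - (3 / 2) by rewrite /h fctE ln1 add0r mul1r; field.
have hv : h (1 + v) = ln (1 + v) - v + v ^+ 2 / 2 - 3 / 2 by rewrite /h fctE; field.
have bound (c : R) : `|c - 1| <= `|v| -> `|(c - 1) ^+ 2 / c| <= 2 * `|v| ^+ 2.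
  move=> cv; have c2 : 1 / 2 <= c.
    by have := le_trans cv v2; rewrite ler_norml => /andP[]; clear; lra.
  have c0 : 0 < c by apply: lt_le_trans c2.
  rewrite normrM normrX normfV (gtr0_norm c0) ler_pdivrMr //.
  have le1 : `|c - 1| ^+ 2 <= `|v| ^+ 2 by rewrite lerXn2r // nnegrE.
  apply: (le_trans le1); rewrite mulrAC ler_peMl ?exprn_ge0 //.
  by move: c2; clear; lra.
have fin (c d : R) : `|c - 1| <= `|v| -> `|d| = `|v| ->
    `|(c - 1) ^+ 2 / c * d| <= 2 * `|v| ^+ 3.
  by move=> /bound H dv; rewrite normrM dv [_ ^+ 3]exprSr [leRHS]mulrA ler_wpM2r.
have -> : ln (1 + v) - v + v ^+ 2 / 2 = h (1 + v) - h 1 by rewrite hv h1; ring.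
have v1 : 0 < 1 + v by move: v2; rewrite ler_norml => /andP[]; clear; lra.
have [v0|v0] := leP 0 v.
  have [|c /andP[c1 c2] ->] := main 1 (1 + v) ltr01; first by rewrite lerDl.
  by apply: fin; [rewrite !ger0_norm ?subr_ge0 ?lerBlDl|rewrite addrAC subrr add0r].
have [|c /andP[c1 c2] E] := main (1 + v) 1 v1; first by rewrite gerDl ltW.
rewrite -opprB E normrN; apply: fin.
  by rewrite distrC ger0_norm ?subr_ge0 // ltr0_norm // lerBlDl -lerBlDr opprK.
by rewrite opprD addrA subrr add0r normrN.
Qed.

(** Apply [ln_expansion] to [|1 + w|^2 = 1 + v]; the second-order terms combine through
    [Re (w^2) = 2 (Re w)^2 - |w|^2]. *)
Lemma ln_cabs_expansion w : cabs w <= 1 / 8 ->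
  `|ln (cabs (1 + w)) - Re w + Re (w ^+ 2) / 2| <= 40 * cabs w ^+ 3.
Proof.
move=> w8; have w0 := cabs_ge0 w; set m := cabs w in w8 w0 *.
have rw : `|Re w| <= m by exact: Re_le_cabs.
pose v := 2 * Re w + m ^+ 2.
have E : cabs (1 + w) ^+ 2 = 1 + v.
  by rewrite /v cabs_sqr /m cabs_sqr ReD ImD Re1 Im1; ring.
have vm : `|v| <= 3 * m.
  apply: (le_trans (ler_normD _ _)); rewrite normrM (ger0_norm (ler0n R 2)) (ger0_norm (sqr_ge0 m)) expr2.
  have : m * m <= m by rewrite ler_piMl // (le_trans w8) //; lra.
  by move: rw; clear; lra.
have v2 : `|v| <= 1 / 2 by apply: (le_trans vm); move: w8; clear; lra.
have c0 : 0 < cabs (1 + w).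
  rewrite cabs_gt0; apply/eqP => h; move: E; rewrite h cabs0 expr0n /= => h0.
  by move: v2; rewrite ler_norml => /andP[]; move: h0; clear; lra.
have -> : ln (cabs (1 + w)) = 2^-1 * ln (1 + v) by rewrite -E lnXn //; field.
have w2 : Re (w ^+ 2) = 2 * Re w ^+ 2 - m ^+ 2.
  by rewrite /m cabs_sqr expr2 ReM; ring.
set x := Re w in rw v vm v2 E w2 *.
have := ln_expansion v2; set L := ln (1 + v) => HL.
have -> : 2^-1 * L - x + Re (w ^+ 2) / 2 = 2^-1 * (L - v + v ^+ 2 / 2) - (x * m ^+ 2 + m ^+ 4 / 4).
  by rewrite w2 /v; field.
apply: (le_trans (ler_normB _ _)).
have h1 : `|2^-1 * (L - v + v ^+ 2 / 2)| <= 27 * m ^+ 3.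
  rewrite normrM ger0_norm // ler_pdivrMl //; apply: (le_trans HL).
  have -> : 2 * (27 * m ^+ 3) = 2 * (3 * m) ^+ 3 by ring.
  by rewrite ler_pM2l // lerXn2r // nnegrE // mulr_ge0.
have h2 : `|x * m ^+ 2 + m ^+ 4 / 4| <= 2 * m ^+ 3.
  apply: (le_trans (ler_normD _ _)); rewrite normrM !(ger0_norm (exprn_ge0 _ _)) //.
  rewrite (ger0_norm (divr_ge0 _ _)) ?exprn_ge0 //.
  have a1 : `|x| * m ^+ 2 <= m ^+ 3 by rewrite [leRHS]exprS ler_wpM2r ?exprn_ge0.
  have a2 : m ^+ 4 <= m ^+ 3 by rewrite exprS ler_piMl ?exprn_ge0 // (le_trans w8) //; lra.
  by move: a1 a2 (exprn_ge0 3 w0); move: (`|x| * m ^+ 2) (m ^+ 4) (m ^+ 3) => p q r; clear; lra.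
by move: h1 h2 (exprn_ge0 3 w0); move: `|_ * _| `|_ + _| (m ^+ 3) => p q r; clear; lra.
Qed.

End log_expansion.

(** * Plurisubharmonic functions on affine discs *)

Section sub_mean_value.
Context {R : realType}.
Local Notation Re := (@complex.Re R).
Local Notation Im := (@complex.Im R).
Local Notation leb := (@lebesgue_measure R).

(** Comparison on the boundary of the disc with the harmonic function [Re P], whose circle mean is
    its value at the centre. *)
Lemma psh_mean n (G : set 'rV[R[i]]_n) (u : 'rV[R[i]]_n -> R) (a w : 'rV[R[i]]_n)
    (P : R[i] -> R[i]) :
  continuous_psh G u -> (forall t, cabs t <= 1 -> G (a + t *: w)) -> hol 2 P ->
  (forall t, cabs t = 1 -> u (a + t *: w) <= Re (P t)) -> u a <= Re (P 0).
Proof.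
move=> [cu smv] aG hP uP.
have aG' t : `|t| <= 1 -> G (a + t *: w) by move=> t1; apply: aG; rewrite -norm_le1_cabs.
apply: (le_trans (smv a w aG')).
have c2 : (1 : R) < 2 by rewrite ltr1n.
have cP : ccont P by exact: (hol_ccont1 hP c2).
have cG : continuous (fun t : R => u (a + expi t *: w)).
  move=> t; have Gt : G (a + expi t *: w) by apply: aG; rewrite cabs_expi.
  apply: (@continuous_comp _ _ _ (fun t : R => a + expi t *: w) u); last exact: cu.
  by apply: cvgD; [exact: cvg_cst|apply: cvgZr_tmp; exact: expi_continuous].
have cF : continuous (fun t : R => Re (P (expi t))).
  move=> t; apply: (@continuous_comp _ _ _ (@expi R) (Re \o P)); first exact: expi_continuous.
  apply: continuous_Re; apply: cP; exact: cabs_expi.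
have -> : Re (P 0) = (2 * pi)^-1 * \int[leb]_(t in `[0, 2 * pi]) Re (P (expi t)).
  have <- := @mean_value R P 2 1 ltr01 c2 hP.
  rewrite (eq_cmean (G := P)); last by move=> z _; rewrite mul1r.
  by rewrite cmean_itv // ReM ReC ImC mul0r subr0 Re_cint.
apply: ler_wpM2l; first by rewrite invr_ge0 ltW // twopi_gt0.
have int (g : R -> R) : continuous g -> leb.-integrable `[0, 2 * pi] (EFin \o g).
  move=> cg; apply: continuous_compact_integrable; first exact: segment_compact.
  exact: continuous_subspaceT.
apply: le_Rintegral => //; [exact: (int _ cG)|exact: (int _ cF)|].
by move=> t _; apply: uP; exact: cabs_expi.
Qed.


(* The affine disc through [p] in the direction of [p * xi] keeps the linear functional
   [b] of [ln |z|] constant up to second order, so the penalty [C] costs only [O(e ^+ 3)]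
   while the strictly plurisubharmonic term gains [d * e ^+ 2]. *)
Lemma psh_no_local_max n (G : set 'rV[R[i]]_n) (u : 'rV[R[i]]_n -> R) (p : 'rV[R[i]]_n)
    (b xi : 'I_n -> R) (c0 d C rho : R) :
  continuous_psh G u -> (forall j, p 0 j != 0) -> \sum_j b j * xi j = 0 ->
  (exists j, xi j != 0) -> (forall j, `|xi j| <= 1) -> 0 < d -> 0 <= C -> 0 < rho ->
  ~ (forall z : 'rV[R[i]]_n, (forall j, cabs (z 0 j - p 0 j) <= rho * cabs (p 0 j)) -> G z /\
      u z + d * (\sum_j cabs (z 0 j) ^+ 2) - C * (\sum_j b j * ln (cabs (z 0 j)) - c0) ^+ 2 <=
      u p + d * (\sum_j cabs (p 0 j) ^+ 2) - C * (\sum_j b j * ln (cabs (p 0 j)) - c0) ^+ 2).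
Proof.
move=> psh p0 bxi [j0 xj0] xi1 d0 C0 rho0 H.
set N := (\sum_j b j * ln (cabs (p 0 j)) - c0) in H.
pose kap := \sum_j b j * xi j ^+ 2; pose Q := \sum_j cabs (p 0 j) ^+ 2 * xi j ^+ 2.
pose L := \sum_j cabs (p 0 j) ^+ 2 * xi j; pose B := \sum_j `|b j|.
have B0 : 0 <= B by exact: sumr_ge0.
have Q0 : 0 < Q.
  rewrite /Q (bigD1 j0) //= ltr_pwDl //.
    by apply: mulr_gt0; [rewrite exprn_gt0 ?cabs_gt0|rewrite exprn_even_gt0].
  by apply: sumr_ge0 => j _; rewrite mulr_ge0 // sqr_ge0.
(* Collects the third-order cost of the penalty: the cross term [2 N T] and the square [S^2]. *)
pose K := C * (80 * `|N| * B + (41 * B) ^+ 2).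
have K0 : 0 <= K by rewrite mulr_ge0 // addr_ge0 ?sqr_ge0 // !mulr_ge0.
(* Small enough for the logarithmic expansion, for the disc to stay in the given neighbourhood, and
   for the gain [d Q e^2] to exceed the cost [K e^3]. *)
pose e := Num.min (1 / 8) (Num.min rho (d * Q / (K + 1) / 2)).
have K1 : 0 < K + 1 by rewrite ltr_wpDl.
have e0 : 0 < e by rewrite !lt_min rho0 !divr_gt0 ?mulr_gt0.
have e8 : e <= 1 / 8 by rewrite ge_min lexx.
have er : e <= rho by rewrite !ge_min lexx orbT.
have eK : K * e < d * Q.
  have h : e <= d * Q / (K + 1) / 2 by rewrite !ge_min lexx !orbT.
  rewrite !ler_pdivlMr // (_ : e * 2 * (K + 1) = 2 * (K * e) + 2 * e) in h; last by ring.
  by move: h e0 (mulr_ge0 K0 (ltW e0)); move: (d * Q) (K * e) => q k; clear; lra.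
pose w : 'rV[R[i]]_n := \row_j ((e * xi j)%:C * p 0 j).
have zE t j : (p + t *: w) 0 j = p 0 j * (1 + (e * xi j)%:C * t) by rewrite !mxE; ring.
have Wle t j : cabs t <= 1 -> cabs ((e * xi j)%:C * t) <= e.
  move=> t1; rewrite cabsM cabsC normrM (gtr0_norm e0) -mulrA ler_piMr ?(ltW e0) //.
  by rewrite mulr_ile1 ?cabs_ge0.
have near t : cabs t <= 1 -> forall j, cabs ((p + t *: w) 0 j - p 0 j) <= rho * cabs (p 0 j).
  move=> t1 j; rewrite zE mulrDr mulr1 addrAC subrr add0r cabsM mulrC ler_wpM2r ?cabs_ge0 //.
  exact: (le_trans (Wle t j t1)).
(* Holomorphic majorant: [Re P] dominates [u] on the boundary of the disc, while
   [Re (P 0) = u p - d Q e^2 + K e^3] is less than [u p]. *)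
pose P t : R[i] := (u p - d * e ^+ 2 * Q + K * e ^+ 3)%:C + (- (2 * d * e * L))%:C * t +
  (- (C * N * kap * e ^+ 2))%:C * (t * t).
have hP : hol 2 P.
  have hi : @hol R 2 id by move=> z _; eexists; exact: cder_id.
  apply: holD; first apply: holD; first exact: (@hol_cst R 2).
    by apply: holM => //; exact: (@hol_cst R 2).
  by apply: holM; [exact: (@hol_cst R 2)|exact: holM].
have key t : cabs t = 1 -> u (p + t *: w) <= Re (P t).
  move=> t1; have t1' : cabs t <= 1 by rewrite t1.
  have [_] := H _ (near t t1').
  have -> : \sum_j cabs ((p + t *: w) 0 j) ^+ 2 =
      \sum_j cabs (p 0 j) ^+ 2 + 2 * e * Re t * L + e ^+ 2 * Q.
    rewrite /L /Q !mulr_sumr -!big_split; apply: eq_bigr => j _ /=.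
    rewrite zE cabsM exprMn (cabs_sqr (1 + _)) ReD ImD Re1 Im1 ReM ImM ReC ImC !mul0r.
    have tt : Im t ^+ 2 = 1 - Re t ^+ 2 by rewrite -(expr1n _ 2) -t1 cabs_sqr; ring.
    by move: tt; move: (Re t) (Im t) (cabs _) (xi j) => x y q a tt; ring: tt.
  pose W j : R[i] := (e * xi j)%:C * t.
  pose E j := ln (cabs (1 + W j)) - Re (W j) + Re (W j ^+ 2) / 2.
  have We j : cabs (W j) <= e by exact: Wle.
  have Eb j : `|E j| <= 40 * e ^+ 3.
    apply: (le_trans (ln_cabs_expansion (le_trans (We j) e8))).
    by rewrite ler_pM2l // lerXn2r // nnegrE ?cabs_ge0 // ltW.
  pose T := \sum_j b j * E j.
  have Tb : `|T| <= 40 * B * e ^+ 3.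
    rewrite mulrAC /B mulr_sumr; apply: (le_trans (ler_norm_sum _ _ _)); apply: ler_sum => j _.
    by rewrite normrM mulrC ler_wpM2r.
  have W1 j : 1 + W j != 0.
    rewrite -cabs_gt0 lt_neqAle cabs_ge0 andbT eq_sym; apply/eqP => h.
    have := cabsD (1 + W j) (- W j); rewrite addrK cabs1 h add0r cabsN.
    by move: (We j) e8; move: (cabs _) => q; clear; lra.
  have -> : \sum_j b j * ln (cabs ((p + t *: w) 0 j)) - c0 = N + (T - e ^+ 2 * kap * Re (t * t) / 2).
    have -> : \sum_j b j * ln (cabs ((p + t *: w) 0 j)) = \sum_j (b j * ln (cabs (p 0 j)) +
        b j * xi j * (e * Re t) + b j * xi j ^+ 2 * (- (e ^+ 2 * Re (t * t) / 2)) + b j * E j).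
      apply: eq_bigr => j _; rewrite zE cabsM lnM ?posrE ?cabs_gt0 ?W1 // /E.
      have -> : Re (W j) = e * xi j * Re t by rewrite /W ReM ReC ImC mul0r subr0.
      have -> : Re (W j ^+ 2) = (e * xi j) ^+ 2 * Re (t * t).
        have -> : W j ^+ 2 = ((e * xi j) ^+ 2)%:C * (t * t) by rewrite /W rmorphXn /=; ring.
        by rewrite ReM ReC ImC mul0r subr0.
      by rewrite -/(W j); move: (ln _) (ln _) (Re t) (Re _) => x1 x2 x3 x4; field.
    rewrite !big_split /= -!mulr_suml bxi mul0r addr0 -/kap -/T /N.
    by move: (\sum_j b j * _) (Re _) => x3 x4; field.
  have kB : `|kap| <= B.
    apply: (le_trans (ler_norm_sum _ _ _)); apply: ler_sum => j _.
    by rewrite normrM normrX ler_piMr // exprn_ile1.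
  have r1 : `|Re (t * t)| <= 1 by rewrite (le_trans (Re_le_cabs _)) // cabsM t1 mul1r.
  have -> : Re (P t) = u p - d * e ^+ 2 * Q + K * e ^+ 3 - 2 * d * e * L * Re t -
      C * N * kap * e ^+ 2 * Re (t * t).
    by rewrite /P !ReD !(ReM (_)%:C) !ReC !ImC !mul0r !subr0; ring.
  move: (u (p + t *: w)) (\sum_j cabs _ ^+ 2) (Re (t * t)) r1 (Re t) => ut X r r1 x Hu.
  have Sb : `|T - e ^+ 2 * kap * r / 2| <= 41 * B * e ^+ 2.
    apply: (le_trans (ler_normB _ _)).
    have h1 : `|e ^+ 2 * kap * r / 2| <= B * e ^+ 2.
      have -> : e ^+ 2 * kap * r / 2 = (e ^+ 2 / 2) * (kap * r) by field.
      have kr : `|kap * r| <= B by rewrite normrM -[leRHS]mulr1 ler_pM.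
      have ee : 0 <= e ^+ 2 / 2 by rewrite divr_ge0 ?sqr_ge0.
      rewrite normrM (ger0_norm ee) mulrC; apply: (@le_trans _ _ (B * (e ^+ 2 / 2))); first by rewrite ler_wpM2r.
      by rewrite ler_wpM2l // ler_pdivrMr // ler_peMr ?sqr_ge0 // ler1n.
    have h2 : `|T| <= 40 * (B * e ^+ 2).
      apply: (le_trans Tb); rewrite -mulrA ler_pM2l // ler_wpM2l //.
      by rewrite exprS ler_piMl ?sqr_ge0 // (le_trans e8) //; lra.
    have -> : 41 * B * e ^+ 2 = 40 * (B * e ^+ 2) + B * e ^+ 2 by ring.
    exact: lerD.
  move: Hu Sb; set S := T - _ => Hu Sb.
  have S2 : S ^+ 2 <= (41 * B) ^+ 2 * e ^+ 3.
    rewrite -real_normK ?num_real //.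
    apply: (@le_trans _ _ ((41 * B * e ^+ 2) ^+ 2)); first by rewrite lerXn2r // nnegrE mulr_ge0 ?sqr_ge0 // mulr_ge0.
    rewrite exprMn ler_wpM2l ?sqr_ge0 // (_ : e ^+ 2 ^+ 2 = e ^+ 3 * e); last by ring.
    rewrite ler_piMr ?exprn_ge0 ?(ltW e0) //.
    by rewrite (le_trans e8) //; lra.
  have NT : 2 * (N * T) <= 80 * `|N| * B * e ^+ 3.
    have : N * T <= `|N| * (40 * B * e ^+ 3).
      by apply: (le_trans (ler_norm _)); rewrite normrM ler_wpM2l.
    have -> : 80 * `|N| * B * e ^+ 3 = 2 * (`|N| * (40 * B * e ^+ 3)) by ring.
    by move=> h; rewrite ler_pM2l.
  have fin : C * (2 * (N * T) + S ^+ 2) <= K * e ^+ 3.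
    have -> : K * e ^+ 3 = C * (80 * `|N| * B * e ^+ 3 + (41 * B) ^+ 2 * e ^+ 3) by rewrite /K; ring.
    by apply: ler_wpM2l => //; apply: lerD.
  have E2 : C * (N + S) ^+ 2 = C * N ^+ 2 + C * (2 * (N * T) + S ^+ 2) - C * N * kap * e ^+ 2 * r.
    have E0 : 2 * (N * S) = 2 * (N * T) - N * kap * e ^+ 2 * r by rewrite /S; field.
    transitivity (C * N ^+ 2 + C * (2 * (N * S) + S ^+ 2)); first by ring.
    by rewrite E0; ring.
  move: Hu fin; rewrite E2 !mulrDr.
  have -> : d * (2 * e * x * L) = 2 * d * e * L * x by ring.
  have -> : d * (e ^+ 2 * Q) = d * e ^+ 2 * Q by ring.
  move: (2 * d * e * L * x) (d * e ^+ 2 * Q) (d * X) (C * N * kap * e ^+ 2 * r) (K * e ^+ 3)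
    (C * (2 * (N * T))) (C * S ^+ 2) (C * N ^+ 2) => y1 y2 y3 y4 y5 y6 y7 y8.
  clear; lra.
have := psh_mean psh (fun t t1 => (H _ (near t t1)).1) hP key.
rewrite /P !mulr0 !addr0 ReC => h.
have : 0 < e ^+ 2 * (d * Q - K * e) by rewrite mulr_gt0 ?exprn_gt0 // subr_gt0.
have -> : e ^+ 2 * (d * Q - K * e) = d * e ^+ 2 * Q - K * e ^+ 3 by ring.
by move: h; move: (u p) (d * e ^+ 2 * Q) (K * e ^+ 3) => x y z; clear; lra.
Qed.

End sub_mean_value.

(** * Logarithmic polar coordinates *)

Section polar.
Context {R : realType}.
Local Notation Re := (@complex.Re R).
Local Notation Im := (@complex.Im R).

Lemma continuous_row {K : numFieldType} n (T : topologicalType) (F : T -> 'rV[K]_n) x :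
  (forall j, {for x, continuous (fun t => F t 0 j)}) -> {for x, continuous F}.
Proof.
move=> cF P /nbhs_rowP[e e0 H].
have : nbhs x [set t | forall j, `|F t 0 j - F x 0 j| < e].
  apply: filter_forall => j; have /cvgrPdist_lt/(_ _ e0) := cF j.
  by apply: filterS => t; rewrite distrC.
by apply: filterS => t; exact: H.
Qed.

Lemma cvg_realC (T : Type) (F : set_system T) {FF : Filter F} (f : T -> R) (l : R) :
  f x @[x --> F] --> l -> (f x)%:C @[x --> F] --> l%:C.
Proof.
move=> /cvgrPdist_lt cf; apply/cvgr_cabsP => e /cf; apply: filterS => x.
by rewrite -rmorphB /= cabsC distrC.
Qed.

Definition polar (x t : R) : R[i] := (expR x)%:C * expi t.

Lemma cabs_polar x t : cabs (polar x t) = expR x.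
Proof. by rewrite cabsM cabsC cabs_expi mulr1 ger0_norm ?expR_ge0. Qed.

Lemma polar_neq0 x t : polar x t != 0.
Proof. by rewrite -cabs_gt0 cabs_polar expR_gt0. Qed.

Lemma polar_ln z : z != 0 -> exists2 t, -pi <= t <= pi & polar (ln (cabs z)) t = z.
Proof.
move=> z0; have c0 : 0 < cabs z by rewrite cabs_gt0.
have [|t tpi Et] := @unimodular_expi R (z / (cabs z)%:C).
  by rewrite cabsM cabsV cabsC gtr0_norm // divff // gt_eqF.
exists t => //; rewrite /polar lnK ?posrE // Et mulrCA divff ?mulr1 //.
by rewrite -cabs_gt0 cabsC normr_gt0 gt_eqF.
Qed.

Definition polar2 (p : (R * R) * (R * R)) : 'rV[R[i]]_2 :=
  \row_j (if j == 0 then polar p.1.1 p.2.1 else polar p.1.2 p.2.2).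

Lemma polar_continuous (T : topologicalType) (f g : T -> R) p :
  {for p, continuous f} -> {for p, continuous g} ->
  {for p, continuous (fun q => polar (f q) (g q))}.
Proof.
move=> cf cg; apply: cvgM.
  by apply: cvg_realC; apply: (continuous_comp cf); exact: continuous_expR.
by apply: (continuous_comp cg); exact: expi_continuous.
Qed.

Lemma polar2_continuous : continuous polar2.
Proof.
move=> p; apply: continuous_row => j.
have c11 : {for p, continuous (fun q : (R * R) * (R * R) => q.1.1)}.
  by apply: (@continuous_comp _ _ _ fst fst); exact: cvg_fst.
have c12 : {for p, continuous (fun q : (R * R) * (R * R) => q.1.2)}.
  by apply: (@continuous_comp _ _ _ fst snd); [exact: cvg_fst|exact: cvg_snd].
have c21 : {for p, continuous (fun q : (R * R) * (R * R) => q.2.1)}.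
  by apply: (@continuous_comp _ _ _ snd fst); [exact: cvg_snd|exact: cvg_fst].
have c22 : {for p, continuous (fun q : (R * R) * (R * R) => q.2.2)}.
  by apply: (@continuous_comp _ _ _ snd snd); exact: cvg_snd.
rewrite (_ : (fun t => _) = if j == 0 then (fun q => polar q.1.1 q.2.1) else
  (fun q => polar q.1.2 q.2.2)); last by apply/funext => q; rewrite mxE; case: ifP.
by case: ifP => _; exact: polar_continuous.
Qed.

End polar.

(** * Moduli in complete Reinhardt domains *)

Section reinhardt.
Context {R : realType} {n : nat}.
Implicit Types (x y : 'rV[R]_n).
Variable G : set 'rV[R[i]]_n.
Hypothesis reinG : complete_reinhardt G.

(** The quotients [w j / z j] are admissible multipliers. Where [z j = 0], also [w j = 0], and the
    default value 0 of the division does no harm. *)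
Lemma reinhardt_le (z w : 'rV[R[i]]_n) :
  G z -> (forall j, cabs (w 0 j) <= cabs (z 0 j)) -> G w.
Proof.
move=> Gz wz; have [_ _ H] := reinG.
have -> : w = \row_j ((\row_j (w 0 j / z 0 j)) 0 j * z 0 j).
  apply/rowP => j; rewrite !mxE.
  have [z0|z0] := eqVneq (z 0 j) 0; last by rewrite divfK.
  by apply/eqP; rewrite z0 mulr0 -cabs_eq0 eq_le cabs_ge0 andbT; have := wz j; rewrite z0 cabs0.
apply: H => // j; rewrite mxE norm_le1_cabs cabsM cabsV.
have [z0|z0] := eqVneq (z 0 j) 0; first by rewrite z0 cabs0 invr0 mulr0.
by rewrite ler_pdivrMr ?cabs_gt0 // mul1r.
Qed.

Lemma log_imageP x (w : 'rV[R[i]]_n) : (forall j, cabs (w 0 j) = expR (x 0 j)) ->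
  (log_image G x <-> G w).
Proof.
move=> E; split=> [[z [Gz z0 xE]]|Gw].
  by apply: (reinhardt_le Gz) => j; rewrite E xE mxE lnK // posrE cabs_gt0.
exists w; split=> //; first by move=> j; rewrite -cabs_gt0 E expR_gt0.
by apply/rowP => j; rewrite mxE E expRK.
Qed.

Lemma log_image_le x y : log_image G x -> (forall j, y 0 j <= x 0 j) -> log_image G y.
Proof.
move=> Lx yx.
have E (z : 'rV[R]_n) j : cabs ((\row_j (expR (z 0 j))%:C : 'rV[R[i]]_n) 0 j) = expR (z 0 j :> R).
  by rewrite mxE cabsC ger0_norm ?expR_ge0.
apply: (log_imageP (E y)).2; apply: (@reinhardt_le (\row_j (expR (x 0 j))%:C)).
  exact: (log_imageP (E x)).1.
by move=> j; rewrite !E ler_expR.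
Qed.

End reinhardt.

(** * Convexity of the logarithmic image of a pseudoconvex Reinhardt domain *)

Section log_convex.
Context {R : realType}.
Local Notation Re := (@complex.Re R).
Local Notation Im := (@complex.Im R).
Local Notation P4 := ((R * R) * (R * R))%type.
Implicit Types (G : set 'rV[R[i]]_2) (u : 'rV[R[i]]_2 -> R).

Definition angles : set (R * R) := `[-pi, pi]%classic `*` `[-pi, pi]%classic.

Lemma compact_angles : compact angles.
Proof. by apply: compact_setX; exact: segment_compact. Qed.

Lemma G_polar2 G (reinG : complete_reinhardt G) (x1 x2 : R) t t' : G (polar2 ((x1, x2), t)) -> G (polar2 ((x1, x2), t')).
Proof.
move=> H; apply: (reinhardt_le reinG H) => j; rewrite !mxE /=.
by case: ifP; rewrite !cabs_polar.
Qed.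

Lemma G_polar2_le G (reinG : complete_reinhardt G) (x y : R * R) t t' : G (polar2 (x, t)) -> y.1 <= x.1 -> y.2 <= x.2 ->
  G (polar2 (y, t')).
Proof.
move=> H h1 h2; apply: (reinhardt_le reinG H) => j; rewrite !mxE /=.
by case: ifP; rewrite !cabs_polar ler_expR.
Qed.

Lemma u_polar2_continuous G u (psh : continuous_psh G u) p : G (polar2 p) -> {for p, continuous (u \o polar2)}.
Proof.
by move=> Gp; apply: continuous_comp; [exact: polar2_continuous|exact: psh.1].
Qed.

Lemma u_compact_max G u (psh : continuous_psh G u) (A : set P4) (q : P4 -> R) : A !=set0 -> compact A ->
  (forall p, A p -> G (polar2 p)) -> continuous q ->
  exists2 p, A p & forall p', A p' -> u (polar2 p') + q p' <= u (polar2 p) + q p.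
Proof.
move=> A0 cA AG cq.
have [|c /set_mem Ac H] := @compact_EVT_max P4 R (fun p => u (polar2 p) + q p) A A0 cA.
  apply: continuous_in_subspaceT => p /set_mem Ap; apply: cvgD; last exact: cq.
  exact: (u_polar2_continuous psh (AG _ Ap)).
by exists c => // p' Ap'; apply: H; apply/mem_set.
Qed.

Lemma u_compact_bound G u (psh : continuous_psh G u) (A : set P4) : compact A -> (forall p, A p -> G (polar2 p)) ->
  exists M, forall p, A p -> u (polar2 p) <= M.
Proof.
move=> cA AG; have [A0|A0] := pselect (A !=set0); last first.
  by exists 0 => p Ap; exfalso; apply: A0; exists p.
have [|p Ap H] := @u_compact_max G u psh A (cst 0) A0 cA AG; first exact: cst_continuous.
by exists (u (polar2 p)) => p' /H; rewrite /cst !addr0.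
Qed.

Lemma cabs_dist (z w : R[i]) : `|cabs z - cabs w| <= cabs (z - w).
Proof. by rewrite ler_norml lerNl opprB {1}cabsB !cabs_le_dist. Qed.

Lemma ord2P (j : 'I_2) : j = 0 \/ j = 1.
Proof. by case: j => [[|[|//]] p]; [left|right]; exact: val_inj. Qed.

Lemma sumI2 (F : 'I_2 -> R) : \sum_j F j = F 0 + F 1.
Proof. by rewrite !big_ord_recl big_ord0 addr0; congr (_ + F _); exact: val_inj. Qed.

(** Points at small relative distance have polar coordinates with angles in a compact square. This
    turns a maximum over a compact set of polar coordinates into a local maximum in [C^2]. *)
Lemma near_polar2 (x : R * R) t (O : set (R * R)) : nbhs x O ->
  exists2 rho : R, 0 < rho & forall z : 'rV[R[i]]_2,
    (forall j, cabs (z 0 j - polar2 (x, t) 0 j) <= rho * cabs (polar2 (x, t) 0 j)) ->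
    exists2 p : P4, angles p.2 /\ O p.1 & polar2 p = z.
Proof.
move=> /nbhs_ballP[r /= r0 H].
have /cvgrPdist_lt/(_ _ r0)/nbhs_ballP[e /= e0 He] := @continuous_ln R 1 ltr01.
exists (Num.min (1 / 2) (e / 2)); first by rewrite lt_min !divr_gt0.
move=> z zp.
have one j (a s : R) (zj : R[i]) : polar2 (x, t) 0 j = polar a s -> zj = z 0 j ->
    zj != 0 /\ `|ln (cabs zj) - a| < r.
  move=> E ->; have := zp j; rewrite E cabs_polar => h.
  have ea := expR_gt0 a.
  have h2 : `|cabs (z 0 j) / expR a - 1| <= Num.min (1 / 2) (e / 2).
    have -> : cabs (z 0 j) / expR a - 1 = (cabs (z 0 j) - expR a) / expR a.
      by field; rewrite gt_eqF.
    rewrite normrM normfV (gtr0_norm ea) ler_pdivrMr //.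
    by apply: le_trans h; rewrite -(cabs_polar a s); exact: cabs_dist.
  have [h3 h4] : `|cabs (z 0 j) / expR a - 1| <= 1 / 2 /\ `|cabs (z 0 j) / expR a - 1| <= e / 2.
    by move: h2; rewrite le_min => /andP.
  have q0 : 0 < cabs (z 0 j) / expR a.
    by move: h3; rewrite ler_norml => /andP[]; move: (cabs (z 0 j) / expR a) => q; clear; lra.
  have c0 : 0 < cabs (z 0 j) by move: q0; rewrite pmulr_lgt0 // invr_gt0.
  split; first by rewrite -cabs_gt0.
  have := He (cabs (z 0 j) / expR a); rewrite /ball /= ln1 ln_div ?posrE // expRK sub0r normrN.
  by apply; rewrite distrC (le_lt_trans h4) // ltr_pdivrMr // ltr_pMr // ltr1n.
have [||z0 l0] := one 0 x.1 t.1 (z 0 0); [by rewrite mxE|by []|].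
have [||z1 l1] := one 1 x.2 t.2 (z 0 1); [by rewrite mxE|by []|].
have [t0 t0pi E0] := polar_ln z0; have [t1 t1pi E1] := polar_ln z1.
exists ((ln (cabs (z 0 0)), ln (cabs (z 0 1))), (t0, t1)).
  split; first by split; rewrite /= in_itv.
  by apply: H; split; rewrite /ball /= distrC.
by apply/rowP => j; rewrite mxE /=; case: (ord2P j) => -> /=.
Qed.

Lemma polar2_angles (x t : R * R) : exists t', angles t' /\ polar2 (x, t) = polar2 (x, t').
Proof.
have H (a : R) : exists2 b : R, -pi <= b <= pi & expi b = expi a by apply: unimodular_expi; exact: cabs_expi.
have [b1 h1 e1] := H t.1; have [b2 h2 e2] := H t.2.
exists (b1, b2); split; first by split; rewrite /= in_itv.
by apply/rowP => j; rewrite !mxE /= /polar e1 e2.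
Qed.

Lemma near_box (p : R * R) (a a' b b' b1 b2 c0 e : R) :
  a < p.1 < a' -> b < p.2 < b' -> (b1 * p.1 + b2 * p.2 - c0) ^+ 2 < e ->
  nbhs p [set x : R * R | (a < x.1 < a' /\ b < x.2 < b') /\ (b1 * x.1 + b2 * x.2 - c0) ^+ 2 < e].
Proof.
move=> pin pb pn; apply: open_nbhs_nbhs; split => //.
have oc (h : R * R -> R) (U : set R) : continuous h -> open U -> open (h @^-1` U).
  by move/continuousP; apply.
have c1 : continuous (fun x : R * R => x.1) by move=> x; exact: cvg_fst.
have c2 : continuous (fun x : R * R => x.2) by move=> x; exact: cvg_snd.
have cl : continuous (fun x : R * R => b1 * x.1 + b2 * x.2 - c0).
  by move=> x; apply: cvgB; [apply: cvgD; apply: cvgMr; [exact: c1|exact: c2]|exact: cvg_cst].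
have cn : continuous (fun x : R * R => (b1 * x.1 + b2 * x.2 - c0) ^+ 2).
  by move=> x; rewrite /continuous_at; under eq_fun do rewrite expr2; apply: cvgM; exact: cl.
rewrite (_ : [set x | _] = (((fun x : R * R => x.1) @^-1` [set y | a < y] `&`
    (fun x : R * R => x.1) @^-1` [set y | y < a']) `&`
    ((fun x : R * R => x.2) @^-1` [set y | b < y] `&` (fun x : R * R => x.2) @^-1` [set y | y < b'])) `&`
    (fun x : R * R => (b1 * x.1 + b2 * x.2 - c0) ^+ 2) @^-1` [set y | y < e]); last first.
  by apply/seteqP; split=> x [[h1 h2] h3]; split => //; split; apply/andP.
by do !apply: openI; apply: oc => //; (exact: open_lt || exact: open_gt).
Qed.

(* Maximum principle on the tori over a segment of the logarithmic image. *)
Lemma segment_max G u (reinG : complete_reinhardt G) (psh : continuous_psh G u) (a a' b b' c : R) : a < a' -> b < b' ->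
  (forall s t, 0 <= s <= 1 -> G (polar2 ((a + s * (a' - a), b + (1 - s) * (b' - b)), t))) ->
  (forall t, u (polar2 ((a, b'), t)) <= c) -> (forall t, u (polar2 ((a', b), t)) <= c) ->
  forall s t, 0 <= s <= 1 -> angles t ->
    u (polar2 ((a + s * (a' - a), b + (1 - s) * (b' - b)), t)) <= c.
Proof.
move=> aa bb segG ub ua s0 t0 s01 ang; rewrite leNgt; apply/negP => ltc.
set q0 : P4 := (_, t0) in ltc.
(* The excess at [q0] is [3 gam]: one [gam] pays for the strictly plurisubharmonic perturbation and
   one for the neighbourhoods of the endpoints. *)
pose gam := (u (polar2 q0) - c) / 3.
have gam0 : 0 < gam by rewrite divr_gt0 // subr_gt0.
pose b1 := b' - b; pose b2 := a' - a; pose c0 := b1 * a + b2 * b'.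
have b10 : 0 < b1 by rewrite subr_gt0.
have b20 : 0 < b2 by rewrite subr_gt0.
pose nu (p : P4) := b1 * p.1.1 + b2 * p.1.2 - c0.
have cx : continuous (fun p : P4 => p.1.1).
  by move=> p; apply: (@continuous_comp _ _ _ fst fst); exact: cvg_fst.
have cy : continuous (fun p : P4 => p.1.2).
  by move=> p; apply: (@continuous_comp _ _ _ fst snd); [exact: cvg_fst|exact: cvg_snd].
have cnu : continuous nu.
  move=> p; apply: cvgB; last exact: cvg_cst.
  by apply: cvgD; apply: cvgMr; [exact: cx|exact: cy].
have cnu2 : continuous (fun p => nu p ^+ 2).
  by move=> p; rewrite /continuous_at; under eq_fun do rewrite expr2; apply: cvgM; exact: cnu.
pose K : set P4 := (`[a, a']%classic `*` `[b - 1, b' + 1]%classic) `*` angles.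
have cK : compact K.
  by apply: compact_setX; [apply: compact_setX; exact: segment_compact|exact: compact_angles].
(* Either [u] is below [c + gam], as it is near the endpoints, or the first coordinate is away from
   them. *)
pose good p := G (polar2 p) /\ (u (polar2 p) < c + gam \/ a < p.1.1 < a').
have onseg p : K p -> nu p = 0 -> good p.
  move=> [[/=]]; rewrite !in_itv /= => /andP[p1 p2] _ _ n0.
  pose s := (p.1.1 - a) / b2.
  have s01' : 0 <= s <= 1.
    apply/andP; split; first by apply: divr_ge0; [rewrite subr_ge0|exact: ltW].
    by rewrite /s ler_pdivrMr // mul1r /b2 lerD2r.
  have Ep : p = ((a + s * (a' - a), b + (1 - s) * (b' - b)), p.2).
    case: p n0 @s s01' p1 p2 => [[x y] t] /= n0 s01' p1 p2; congr ((_, _), _).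
      by rewrite -/b2; field; rewrite gt_eqF.
    have -> : y = b' - b1 * (x - a) / b2.
      have : b2 * y = b2 * b' - b1 * (x - a) by move: n0; rewrite /nu /c0 /=; lra.
      by move=> h; rewrite -[y](mulKf (lt0r_neq0 b20)) h; field; rewrite gt_eqF.
    by rewrite /b1 -/b2; field; rewrite gt_eqF.
  split; first by rewrite Ep; exact: segG.
  have [e1|e1] := eqVneq p.1.1 a.
    left; have s0' : s = 0 by rewrite /s e1 subrr mul0r.
    rewrite Ep s0' mul0r addr0 subr0 mul1r subrKC.
    by apply: le_lt_trans (ub _) _; rewrite ltrDl.
  have [e2|e2] := eqVneq p.1.1 a'.
    left; have s1' : s = 1 by rewrite /s e2 divff // gt_eqF.
    rewrite Ep s1' subrr mul0r addr0 mul1r subrKC.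
    by apply: le_lt_trans (ua _) _; rewrite ltrDl.
  by right; rewrite !lt_neqAle eq_sym e1 e2 p1.
have oGood : open [set p | good p].
  rewrite openE => p [Gp Hp]; rewrite /interior.
  have nG : nbhs p [set p | G (polar2 p)].
    have nG : nbhs (polar2 p) G by apply: open_nbhs_nbhs; split => //; case: reinG.
    exact: (@polar2_continuous R p G nG).
  have nu' : nbhs p [set p | u (polar2 p) < c + gam \/ a < p.1.1 < a'].
    case: Hp => [h|/andP[h1 h2]].
      have nh : nbhs (u (polar2 p)) [set x | x < c + gam] by apply: open_nbhs_nbhs; split => //; exact: open_lt.
      have K1 : nbhs p ((u \o polar2) @^-1` [set x | x < c + gam]) := u_polar2_continuous psh Gp nh.
      by apply: filterS K1 => q hq; left.
    have n1 : nbhs (p.1.1 : R) [set x | a < x] by apply: open_nbhs_nbhs; split => //; exact: open_gt.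
    have n2 : nbhs (p.1.1 : R) [set x | x < a'] by apply: open_nbhs_nbhs; split => //; exact: open_lt.
    have K1 : nbhs p ((fun p : P4 => p.1.1) @^-1` [set x | a < x]) := cx p _ n1.
    have K2 : nbhs p ((fun p : P4 => p.1.1) @^-1` [set x | x < a']) := cx p _ n2.
    by apply: filterS (filterI K1 K2) => q [k1 k2]; right; apply/andP.
  exact: filterI nG nu'.
(* [nu] vanishes on the line through the segment, so compactness makes a whole thin strip of [K]
   good. *)
have [eta eta0 Heta] : exists2 eta : R, 0 < eta & forall p, K p -> nu p ^+ 2 < eta -> good p.
  have [B0|B0] := pselect ((K `&` ~` [set p | good p]) !=set0); last first.
    exists 1 => // p Kp _; apply: contrapT => ng; apply: B0; by exists p.
  have cB : compact (K `&` ~` [set p | good p]) by apply: compact_closedI => //; exact: open_closedC.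
  have [p /set_mem[Kp np] Hp] := compact_EVT_min B0 cB (continuous_subspaceT cnu2).
  exists (nu p ^+ 2).
    rewrite lt_neqAle sqr_ge0 andbT eq_sym sqrf_eq0; apply/eqP => n0; apply: np; exact: onseg.
  move=> q Kq lt; apply: contrapT => nq.
  by move: lt; rewrite ltNge; move/negP; apply; apply: Hp; apply/mem_set.
pose eta' := Num.min eta (b2 ^+ 2) / 2.
have eta'0 : 0 < eta' by rewrite divr_gt0 // lt_min eta0 exprn_gt0.
have eta'1 : eta' < eta /\ eta' < b2 ^+ 2.
  have : Num.min eta (b2 ^+ 2) <= eta /\ Num.min eta (b2 ^+ 2) <= b2 ^+ 2 by rewrite !ge_min !lexx orbT.
  by move: eta'0; rewrite /eta'; move: (Num.min _ _) => m; clear; lra.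
pose A := K `&` [set p | nu p ^+ 2 <= eta'].
have cA : compact A.
  apply: compact_closedI => //.
  by apply: (@preimage_closed _ _ (fun p => nu p ^+ 2) [set x | x <= eta']) => [p _|]; [exact: cnu2|exact: closed_le].
have Agood p : A p -> good p.
  by move=> [Kp /= h]; apply: Heta => //; exact: le_lt_trans eta'1.1.
have [M HM] := u_compact_bound psh cA (fun p Ap => (Agood p Ap).1).
have nq0 : nu q0 = 0 by rewrite /nu /c0 /b1 /b2 /=; ring.
have Kq0 : K q0.
  move/andP: s01 => [s00 s1]; split => //; split; rewrite /= in_itv /=.
    by apply/andP; split; [rewrite lerDl mulr_ge0 // ltW|rewrite -lerBrDl ler_piMl // ltW].
  have h1 : 0 <= (1 - s0) * (b' - b) by rewrite mulr_ge0 ?subr_ge0 // ltW.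
  have h2 : (1 - s0) * (b' - b) <= b' - b by rewrite ler_piMl ?subr_ge0 ?(ltW bb) // gerBl.
  by move: h1 h2; move: (_ * _) => y; clear; lra.
have Aq0 : A q0 by split=> //=; rewrite nq0 expr0n /= ltW.
pose E := expR a' ^+ 2 + expR (b' + 1) ^+ 2.
have E0 : 0 < E by rewrite addr_gt0 ?exprn_gt0 ?expR_gt0.
(* [E] bounds the sum of the squared moduli on [K], so the perturbation never exceeds [gam]. *)
pose d := gam / E; have d0 : 0 < d by rewrite divr_gt0.
(* At the edge of the strip the penalty is [|M - c| + 1], too large for a maximum to sit there. *)
pose C := (`|M - c| + 1) / eta'.
have C0 : 0 < C by rewrite divr_gt0 // ltr_wpDl.
pose q (p : P4) := d * (expR p.1.1 ^+ 2 + expR p.1.2 ^+ 2) - C * nu p ^+ 2.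
have cq : continuous q.
  have ce (f : P4 -> R) : continuous f -> continuous (fun p => expR (f p) ^+ 2).
    move=> cf p; rewrite /continuous_at; under eq_fun do rewrite expr2.
    by apply: cvgM; apply: (@continuous_comp _ _ _ f expR); by [exact: cf|exact: continuous_expR].
  move=> p; apply: cvgB; apply: cvgMr; last exact: cnu2.
  by apply: cvgD; [exact: (ce _ cx p)|exact: (ce _ cy p)].
have [|p Ap Hp] := @u_compact_max G u psh A q _ cA (fun p Ap => (Agood p Ap).1) cq; first by exists q0.
have Epos x y : 0 < d * (expR x ^+ 2 + expR y ^+ 2) by rewrite mulr_gt0 // addr_gt0 // exprn_gt0 ?expR_gt0.
have [[[Kp1 Kp2] Kp3] /= np] := Ap.
move: Kp1 Kp2; rewrite /= !in_itv /= => /andP[pa pa'] /andP[pb pb'].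
have Ep : d * (expR p.1.1 ^+ 2 + expR p.1.2 ^+ 2) <= gam.
  rewrite -[leRHS](divfK (lt0r_neq0 E0)) -/d ler_pM2l //.
  by apply: lerD; rewrite lerXn2r ?nnegrE ?expR_ge0 // ler_expR.
have low : c + 2 * gam <= u (polar2 p) - C * nu p ^+ 2.
  have := Hp _ Aq0; rewrite /q nq0 expr0n /= mulr0 subr0.
  have : u (polar2 q0) = c + 3 * gam by rewrite /gam; field.
  move: Ep (Epos q0.1.1 q0.1.2).
  move: (d * (expR p.1.1 ^+ 2 + expR p.1.2 ^+ 2)) (d * (expR q0.1.1 ^+ 2 + expR q0.1.2 ^+ 2)).
  by move: gam0; move: (C * nu p ^+ 2) (u (polar2 p)) (u (polar2 q0)) => z z1 z2 g0 x y; lra.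
have pin : a < p.1.1 < a'.
  have [_ [h|//]] := Agood p Ap.
  by move: low gam0 (mulr_ge0 (ltW C0) (sqr_ge0 (nu p))) h; move: (C * nu p ^+ 2) (u (polar2 p)) => x y; lra.
have pn : nu p ^+ 2 < eta'.
  rewrite -(ltr_pM2l C0) divfK ?gt_eqF //.
  have := HM p Ap; have := ler_norm (M - c); move: low gam0; move: (C * nu p ^+ 2) (u (polar2 p)) => x y.
  by move: `|M - c| => z; lra.
have pbin : b - 1 < p.1.2 < b' + 1.
  have nb : `|nu p| < b2.
    rewrite -(@ltr_pXn2r _ 2) ?nnegrE ?(ltW b20) // real_normK ?num_real //.
    exact: lt_trans eta'1.2.
  have h1 : b1 * (p.1.1 - a) <= b1 * b2 by rewrite ler_pM2l // lerD2r.
  have h2 : 0 <= b1 * (p.1.1 - a) by rewrite mulr_ge0 ?subr_ge0 // ltW.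
  have E1 : b2 * (p.1.2 - b') = nu p - b1 * (p.1.1 - a) by rewrite /nu /c0; ring.
  have h3 : b2 * (- b1 - 1) < b2 * (p.1.2 - b') < b2 * 1.
    move: nb; rewrite ltr_norml => /andP[]; rewrite E1 mulr1 mulrBr mulr1 mulrN (mulrC b2).
    move: h1 h2; move: (b1 * (p.1.1 - a)) (b1 * b2) (nu p) => x y z; lra.
  by move: h3; rewrite !ltr_pM2l //; rewrite /b1; move: (p.1.2) => y; clear; lra.
pose O := [set x : R * R | (a < x.1 < a' /\ b - 1 < x.2 < b' + 1) /\ (b1 * x.1 + b2 * x.2 - c0) ^+ 2 < eta'].
have nO : nbhs p.1 O by exact: near_box.
have [rho rho0 Hrho] := near_polar2 p.2 nO.
have bb0 : 0 < b1 + b2 by rewrite addr_gt0.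
(* The direction is tangent to the level lines of [nu], since [b1 * b2 - b2 * b1 = 0], and is
   normalised to entries of modulus at most 1. *)
apply: (@psh_no_local_max R 2 G u (polar2 p) (fun j => if j == 0 then b1 else b2)
  (fun j => if j == 0 then b2 / (b1 + b2) else - (b1 / (b1 + b2))) c0 d C rho psh) => //.
- by move=> j; rewrite mxE; case: ifP => _; exact: polar_neq0.
- by rewrite sumI2 /=; field; rewrite gt_eqF.
- by exists 0; rewrite /= mulf_neq0 ?invr_neq0 // gt_eqF.
- move=> j; case: ifP => _; rewrite ?normrN ger0_norm ?divr_ge0 ?(ltW bb0) ?(ltW b10) ?(ltW b20) //.
    by rewrite ler_pdivrMr // mul1r lerDr ltW.
  by rewrite ler_pdivrMr // mul1r lerDl ltW.
- exact: ltW.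
move=> z; rewrite {1 2}(surjective_pairing p) => /Hrho[p' [ang' HO] <-].
move: HO => [[h1 h2] h3].
have Ap' : A p'.
  split; last exact: ltW.
  move/andP: h1 => [h11 h12]; move/andP: h2 => [h21 h22].
  by split => //; split; rewrite /= in_itv /= !ltW.
split; first exact: (Agood _ Ap').1.
have lnE (p0 : P4) j : ln (cabs (polar2 p0 0 j)) = if j == 0 then p0.1.1 else p0.1.2.
  by rewrite mxE; case: ifP => _; rewrite cabs_polar expRK.
have caE (p0 : P4) j : cabs (polar2 p0 0 j) = if j == 0 then expR p0.1.1 else expR p0.1.2.
  by rewrite mxE; case: ifP => _; rewrite cabs_polar.
by have := Hp _ Ap'; rewrite /q !addrA !sumI2 !lnE !caE.
Qed.

(** Continuity principle: parallel segments sweep the triangle with corner [(a, b)], the scale being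
    [q.1]. Below the first bad scale, [segment_max] bounds [u] on each segment by its values at
    endpoints on the two legs, which lie in [G] together with their tori. So the points remain in a
    fixed compact subset of [G], and the limit point cannot leave [G]. *)
Lemma log_convex_core G u (reinG : complete_reinhardt G) (psh : continuous_psh G u) (a a' b b' : R) :
  (forall c : R, exists K : set 'rV[R[i]]_2,
      [/\ compact K, K `<=` G & [set z | G z /\ u z < c] `<=` K]) ->
  a < a' -> b < b' -> G (polar2 ((a, b'), (0, 0))) -> G (polar2 ((a', b), (0, 0))) ->
  forall l, 0 <= l <= 1 -> G (polar2 ((a + l * (a' - a), b + (1 - l) * (b' - b)), (0, 0))).
Proof.
move=> exh aa bb Gx Gy.
pose pt (q : R * R) : P4 := ((a + q.1 * q.2 * (a' - a), b + q.1 * (1 - q.2) * (b' - b)), (0, 0)).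
have cz2 (T : topologicalType) (f1 f2 : T -> R) (q : T) : {for q, continuous f1} ->
    {for q, continuous f2} -> {for q, continuous (fun q => polar2 (pt (f1 q, f2 q)))}.
  move=> c1 c2; have c0 : {for q, continuous (fun x : T => 0 : R)} by exact: cvg_cst.
  apply: continuous_row => j; rewrite (_ : (fun t => _) = if j == 0 then
      (fun q => polar (pt (f1 q, f2 q)).1.1 0) else (fun q => polar (pt (f1 q, f2 q)).1.2 0)); last first.
    by apply/funext => x; rewrite mxE; case: ifP.
  case: ifP => _; apply: (polar_continuous _ c0).
    by apply: cvgD; [exact: cvg_cst|apply: cvgMl; apply: cvgM; [exact: c1|exact: c2]].
  apply: cvgD; [exact: cvg_cst|apply: cvgMl; apply: cvgM; [exact: c1|]].
  by apply: cvgB; [exact: cvg_cst|exact: c2].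
have cz : continuous (fun q => polar2 (pt q)).
  by move=> q; apply: (cz2 _ fst snd); [exact: cvg_fst|exact: cvg_snd].
have a0 : 0 < a' - a by rewrite subr_gt0.
have b0 : 0 < b' - b by rewrite subr_gt0.
have [M1 HM1] : exists M, forall y t, b <= y <= b' -> angles t -> u (polar2 ((a, y), t)) <= M.
  have [||M H] := @u_compact_bound G u psh ((`[a, a]%classic `*` `[b, b']%classic) `*` angles).
  - by apply: compact_setX; [apply: compact_setX; exact: segment_compact|exact: compact_angles].
  - move=> [[x y] t] [[/= ]]; rewrite !in_itv /= => /andP[x1 x2] /andP[_ yb] _.
    exact: (G_polar2_le reinG _ Gx).
  by exists M => y t yb At; apply: H; split => //; split; rewrite /= in_itv //= lexx.
have [M2 HM2] : exists M, forall y t, a <= y <= a' -> angles t -> u (polar2 ((y, b), t)) <= M.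
  have [||M H] := @u_compact_bound G u psh ((`[a, a']%classic `*` `[b, b]%classic) `*` angles).
  - by apply: compact_setX; [apply: compact_setX; exact: segment_compact|exact: compact_angles].
  - move=> [[x y] t] [[/= ]]; rewrite !in_itv /= => /andP[_ x2] /andP[_ yb] _.
    exact: (G_polar2_le reinG _ Gy).
  by exists M => y t yb At; apply: H; split => //; split; rewrite /= in_itv //= lexx.
pose c := Num.max M1 M2.
have [K [cK KG HK]] := exh (c + 1).
suff H q : 0 <= q.1 <= 1 -> 0 <= q.2 <= 1 -> G (polar2 (pt q)).
  by move=> l l01; have := H (1, l); rewrite /pt /= !mul1r; apply; rewrite ?ler01 ?lexx.
move=> q1 q2; apply: contrapT => nGq.
pose S : set (R * R) := `[0, 1]%classic `*` `[0, 1]%classic.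
have B0 : (S `&` ~` [set q | G (polar2 (pt q))]) !=set0.
  by exists q; split => //; split; rewrite /= in_itv.
have oG : open [set q | G (polar2 (pt q))].
  have [oG _ _] := reinG; move/continuousP : cz => /(_ _ oG); exact.
have cB : compact (S `&` ~` [set q | G (polar2 (pt q))]).
  apply: compact_closedI; last exact: open_closedC.
  by apply: compact_setX; exact: segment_compact.
have c1 : continuous (fun x : R * R => x.1) by move=> x; exact: cvg_fst.
(* [tau] is the least scale at which a point of the triangle is missing from the domain. *)
have [[tau lam] /set_mem[[/= ]]] := compact_EVT_min B0 cB (continuous_subspaceT c1).
rewrite !in_itv /= => /andP[t0 t1] l01 nG Hmin.
have tau0 : 0 < tau.
  rewrite lt_neqAle t0 andbT eq_sym; apply/eqP => E; apply: nG.
  by apply: (G_polar2_le reinG _ Gx) => /=; rewrite E !mul0r addr0 // ltW.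
have below s l : 0 < s -> s < tau -> 0 <= l <= 1 -> G (polar2 (pt (s, l))).
  move=> s0 st l01'; apply: contrapT => ng.
  have Bsl : (S `&` ~` [set q | G (polar2 (pt q))]) (s, l).
    split => //; split; rewrite /= in_itv //=.
    by rewrite !ltW //= (lt_le_trans st).
  by have := Hmin (s, l) (mem_set Bsl); rewrite /= leNgt st.
have uc s : 0 < s -> s < tau -> u (polar2 (pt (s, lam))) <= c.
  move=> s0 st; have s1 : s <= 1 by rewrite ltW // (lt_le_trans st).
  have e1 l : pt (s, l) = ((a + l * ((a + s * (a' - a)) - a), b + (1 - l) * ((b + s * (b' - b)) - b)), (0, 0)).
    by rewrite /pt /=; congr ((_, _), _); ring.
  rewrite e1; apply: (@segment_max G u reinG psh) => //; rewrite ?ltrDl ?mulr_gt0 //.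
  - by move=> l t l01'; have := below s l s0 st l01'; rewrite e1; exact: G_polar2.
  - move=> t; have [t' [ang' ->]] : exists t', angles t' /\
        polar2 ((a, b + s * (b' - b)), t) = polar2 ((a, b + s * (b' - b)), t').
      exact: polar2_angles.
    rewrite le_max HM1 // lerDl mulr_ge0 ?(ltW s0) ?(ltW b0) //=.
    by rewrite -lerBrDl ler_piMl // ltW.
  - move=> t; have [t' [ang' ->]] := polar2_angles (a + s * (a' - a), b) t.
    rewrite le_max (HM2 (a + s * (a' - a))) ?orbT // lerDl mulr_ge0 ?(ltW s0) ?(ltW a0) //=.
    by rewrite -lerBrDl ler_piMl // ltW.
  - by rewrite /angles; split; rewrite /= in_itv /= oppr_le0 pi_ge0.
have clK : closed K by apply: compact_closed cK; exact: norm_hausdorff.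
apply: nG; apply: KG.
have cs : polar2 (pt (s, lam)) @[s --> tau^'-] --> polar2 (pt (tau, lam)).
  by apply: cvg_at_left_filter; apply: (cz2 R id (cst lam)); [exact: cvg_id|exact: cvg_cst].
apply: (closed_cvg _ clK _ _ cs); near=> s; apply: HK => /=.
have s0 : 0 < s by near: s; exact: nbhs_left_gt.
have st : s < tau by near: s; exact: nbhs_left_lt.
split; first exact: below.
by apply: le_lt_trans (uc s s0 st) _; rewrite ltrDl.
Unshelve. all: by end_near. Qed.

(** Between comparable points the segment lies below the larger one and the Reinhardt property
    suffices. Incomparable points are covered by [log_convex_core], after exchanging them if
    needed. *)
Lemma log_image_convex G : pseudoconvex G -> complete_reinhardt G ->
  convex_set (log_image G).
Proof.
move=> [u [psh exh]] reinG.
have LP (x : 'rV[R]_2) : log_image G x <-> G (polar2 ((x 0 0, x 0 1), (0, 0))).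
  by apply: log_imageP => // j; rewrite mxE; case: (ord2P j) => -> /=; rewrite cabs_polar.
have core (x y : 'rV[R]_2) (t : R) : log_image G x -> log_image G y -> 0 <= t <= 1 ->
    x 0 0 < y 0 0 -> y 0 1 < x 0 1 -> log_image G (x + t *: (y - x)).
  move=> /LP Gx /LP Gy t01 h0 h1; apply/LP; rewrite !mxE.
  have H := log_convex_core reinG psh exh h0 h1 Gx Gy t01.
  have -> : x 0 1 + t * (y 0 1 - x 0 1) = y 0 1 + (1 - t) * (x 0 1 - y 0 1) by ring.
  exact: H.
have comp (x y : 'rV[R]_2) (t : R) : log_image G x -> log_image G y -> 0 <= t <= 1 ->
    (forall j, x 0 j <= y 0 j) -> log_image G (x + t *: (y - x)).
  move=> _ Ly /andP[t0 t1] h; apply: (log_image_le reinG Ly) => j.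
  by rewrite !mxE -lerBrDl ler_piMl // subr_ge0.
have flip (x y : 'rV[R]_2) (t : R) : x + t *: (y - x) = y + (1 - t) *: (x - y).
  by apply/rowP => j; rewrite !mxE; ring.
have t01' (t : R) : 0 <= t <= 1 -> 0 <= 1 - t <= 1 by lra.
move=> x y t Lx Ly t01.
have [h0|h0] := leP (x 0 0) (y 0 0); have [h1|h1] := leP (x 0 1) (y 0 1).
- by apply: comp => // j; case: (ord2P j) => ->.
- have [e|n0] := eqVneq (x 0 0) (y 0 0).
    rewrite flip; apply: comp => //; first exact: t01'.
    by move=> j; case: (ord2P j) => ->; rewrite ?e // ltW.
  by apply: core => //; rewrite lt_neqAle n0.
- have [e|n0] := eqVneq (x 0 1) (y 0 1).
    rewrite flip; apply: comp => //; first exact: t01'.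
    by move=> j; case: (ord2P j) => ->; rewrite ?e // ltW.
  by rewrite flip; apply: core => //; [exact: t01'|rewrite lt_neqAle n0].
- rewrite flip; apply: comp => //; first exact: t01'.
  by move=> j; case: (ord2P j) => ->; rewrite ltW.
Qed.

End log_convex.

Lemma nbhs_forall (T : topologicalType) (x : T) n (P : 'I_n -> set T) :
  (forall j, nbhs x (P j)) -> nbhs x [set y | forall j, P j y].
Proof. by move=> H; apply: filter_forall. Qed.

(** * Uniform room inside a bounded Reinhardt domain *)

Section reinhardt_perturbation.
Context {R : realType} {n : nat}.
Implicit Types (x y : 'rV[R]_n) (z w : 'rV[R[i]]_n).

(** For a vector [x] of moduli, either [exp (c / 2) * x] is in [G] and openness leaves room near
    [x], or no [y] near [x] has [exp c * y] in [G]. Compactness of the box of moduli makes the room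
    uniform. *)
Lemma reinhardt_perturb (G : set 'rV[R[i]]_n) (M c : R) : complete_reinhardt G ->
  (forall z, G z -> forall j, cabs (z 0 j) <= M) -> 0 < c ->
  exists2 d : R, 0 < d & forall z w, G ((expR c)%:C *: z) -> (forall j, cabs (w 0 j) <= d) -> G (z + w).
Proof.
move=> reinG GM c0; pose U x := G (map_mx (fun a : R => a%:C) x).
have dom z x : G z -> (forall j, `|x 0 j| <= cabs (z 0 j)) -> U x.
  by move=> Gz H; apply: (reinhardt_le reinG Gz) => j; rewrite mxE cabsC; exact: H.
pose B : set 'rV[R]_n := [set x | forall j, 0 <= x 0 j <= M].
have cB : compact B.
  apply: bounded_closed_compact.
    exists (Num.max M 0); split; first exact: num_real.
    move=> M' MM' x Bx; rewrite /Num.Def.normr /= mx_normrE.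
    move: MM'; rewrite gt_max => /andP[MM' M0].
    apply: bigmax_le => [|[i j] _ /=]; first exact: ltW.
    by rewrite (ord1 i); have /andP[a b] := Bx j; rewrite ger0_norm // (le_trans b) // ltW.
  move=> x /closure_rowP clx j; apply/andP; split; apply/ler_addgt0Pr => e e0.
    have [y By /(_ j)] := clx e e0; have /andP[a _] := By j.
    by rewrite ltr_norml => /andP[]; move: (y 0 j) (x 0 j) a => p q; clear; lra.
  have [y By /(_ j)] := clx e e0; have /andP[_ a] := By j.
  by rewrite ltr_norml => /andP[]; move: (y 0 j) (x 0 j) a => p q; clear; lra.
have e1 : 1 < expR (c / 2) by rewrite expR_gt1 divr_gt0.
have ee : expR c = expR (c / 2) * expR (c / 2) by rewrite -expRD -splitr.
pose P (d : R) x := U (expR c *: x) -> U (x + const_mx d).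
have near1 x : B x -> \forall x' \near x & d \near (0 : R), P d x'.
  move=> Bx.
  have [Ux|nUx] := pselect (U (expR (c / 2) *: x)).
    have Ux1 : U x.
      apply: (dom _ _ Ux) => j; rewrite !mxE cabsC normrM ger0_norm ?expR_ge0 //.
      by rewrite ler_peMl // ltW.
    have [oG _ _] := reinG.
    have /nbhs_rowP[e e0 He] : nbhs (map_mx (fun a : R => a%:C) x) G by apply: open_nbhs_nbhs.
    have [r r0 Er] : exists2 r : R, 0 < r & r%:C = e.
      case: e e0 {He} => e1' e2 /[dup]; rewrite {1}ltcE /= => /andP[/eqP -> r0] _.
      by exists e1'.
    exists ([set y : 'rV[R]_n | forall j, `|y 0 j - x 0 j| < r / 2], [set d : R | `|d| < r / 2]).
      split; first by apply/nbhs_rowP; exists (r / 2); rewrite ?divr_gt0.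
      by apply/nbhs_ballP; exists (r / 2); rewrite /= ?divr_gt0 // => d; rewrite /ball /= sub0r normrN.
    move=> [y d] [/= hA hB] _; apply: He => j; rewrite !mxE -rmorphB normcE cabsC -Er ltcR.
    rewrite addrAC (splitr r); apply: le_lt_trans (ler_normD _ _) _; exact: ltrD.
  exists ([set y : 'rV[R]_n | forall j, expR (c / 2) * `|x 0 j| <= expR c * `|y 0 j|], setT).
    split; last exact: filterT.
    have : nbhs x [set y : 'rV[R]_n | forall j, (`|x 0 j| <= expR (c / 2) * `|y 0 j|)].
      apply: (@nbhs_forall 'rV[R]_n x n (fun j => [set y : 'rV[R]_n | (`|x 0 j| <= expR (c / 2) * `|y 0 j|)])) => j.
      have [x0|x0] := eqVneq (x 0 j) 0.
        by apply/nbhs_rowP; exists 1 => // y _ /=; rewrite x0 normr0; apply: mulr_ge0 => //; exact: expR_ge0.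
      apply/nbhs_rowP; exists (`|x 0 j| * (1 - (expR (c / 2))^-1)).
        by rewrite mulr_gt0 ?normr_gt0 // subr_gt0 invf_lt1 // expR_gt0.
      move=> y /(_ j) h /=; rewrite -ler_pdivrMl ?expR_gt0 //.
      have := ler_distD 0 (x 0 j) (y 0 j); rewrite subr0 sub0r normrN.
      have := ler_normB (y 0 j) (y 0 j - x 0 j); rewrite opprB addrC subrK.
      move: h; rewrite mulrBr mulr1 mulrC.
      by move: `|x 0 j| `|y 0 j - x 0 j| `|y 0 j| `|x 0 j - y 0 j| => p q r s; move: (_ * p) => v; clear; lra.
    move=> /nbhs_rowP[e e0 He]; apply/nbhs_rowP; exists e => // y /He H j; rewrite ee -mulrA ler_pM2l ?expR_gt0 //; exact: H.
  move=> [y d] [/= hA _] Uy; exfalso; apply: nUx; apply: (dom _ _ Uy) => j.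
  by rewrite !mxE cabsC !normrM !(ger0_norm (expR_ge0 _)).
have : \forall d \near (0 : R), B `<=` P d.
  by apply: ((@compact_near_coveringP _ B).1 cB R (nbhs (0 : R)) P _ near1).
move=> /nbhs_ballP[r /= r0 Hr]; exists (r / 2); first by rewrite divr_gt0.
move=> z w Gz wd; pose x : 'rV[R]_n := \row_j cabs (z 0 j).
have Uc : U (expR c *: x).
  by apply: (dom _ _ Gz) => j; rewrite !mxE cabsM cabsC !(ger0_norm (expR_ge0 _)) normrM
    (ger0_norm (expR_ge0 _)) (ger0_norm (cabs_ge0 _)).
have Bx : B x.
  move=> j; rewrite mxE cabs_ge0 /=; apply: le_trans (GM _ Gz j); rewrite mxE cabsM cabsC.
  by rewrite ger0_norm ?expR_ge0 // ler_peMl ?cabs_ge0 // ltW // expR_gt1.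
have := Hr (r / 2) _ x Bx Uc; rewrite /ball /= sub0r normrN gtr0_norm ?divr_gt0 //.
move=> H; apply: (reinhardt_le reinG (H _)).
  by rewrite ltr_pdivrMr // ltr_pMr // ltr1n.
move=> j; rewrite !mxE cabsC ger0_norm ?addr_ge0 ?cabs_ge0 ?divr_ge0 ?(ltW r0) //.
by apply: le_trans (cabsD _ _) _; rewrite lerD2l.
Qed.

End reinhardt_perturbation.

(** * Vector-valued holomorphic maps, coordinate by coordinate *)

Section vector_derivative.
Context {R : realType} {n : nat}.
Implicit Types (f : R[i] -> 'rV[R[i]]_n) (z : R[i]).

Lemma cvg_cder (F : R[i] -> R[i]) z d :
  h^-1 * (F (h + z) - F z) @[h --> (0 : R[i])^'] --> d -> cder F z d.
Proof.
move=> cv e e0; move/cvgr_cabsP : cv => /(_ _ e0) /=.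
rewrite near_withinE => /nbhs_cabsP[r r0 H]; exists r => // h hr.
have [->|h0] := eqVneq h 0; first by rewrite addr0 subrr mulr0 subrr cabs0 mulr0.
have := H h; rewrite subr0 => /(_ hr h0) /ltW.
have -> : h^-1 * (F (h + z) - F z) - d = h^-1 * (F (z + h) - F z - d * h).
  by rewrite (addrC h) [RHS]mulrBr (mulrC d) mulKf.
by rewrite cabsM cabsV mulrC ler_pdivrMr ?cabs_gt0.
Qed.

Lemma derivable_row_cder f z : derivable f z 1 ->
  forall j, cder (fun w => f w 0 j) z (derive1 f z 0 j).
Proof.
move=> /cvg_ex[/= d cv] j.
have dE : derive1 f z = d by rewrite derive1E /derive; apply/cvg_lim => //; exact: cv.
have cvj : h^-1 * (f (h + z) 0 j - f z 0 j) @[h --> (0 : R[i])^'] --> d 0 j.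
  have := cvg_comp _ _ cv (@coord_continuous _ _ _ 0 j d).
  by apply: cvg_trans; apply: near_eq_cvg; apply: nearW => h; rewrite /= !mxE -[h *: 1]/(h * 1) mulr1.
by rewrite dE; exact: (@cvg_cder (fun w => f w 0 j) z (d 0 j) cvj).
Qed.

Lemma cder_row_derivable f z (l : 'rV[R[i]]_n) : (forall j, cder (fun w => f w 0 j) z (l 0 j)) ->
  derivable f z 1 /\ derive1 f z = l.
Proof.
move=> H; have cv : h^-1 *: (f (h *: 1 + z) - f z) @[h --> (0 : R[i])^'] --> l.
  move=> P /nbhs_rowP[e e0 HP].
  have : \forall h \near (0 : R[i])^', forall j, `|h^-1 * (f (h *: 1 + z) 0 j - f z 0 j) - l 0 j| < e.
    apply: filter_forall => j; have [dj lj] := cder_derivable (H j).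
    move: dj => /cvg_ex[/= d cv]; have dE : d = l 0 j.
      by rewrite -lj derive1E /derive; apply/esym/cvg_lim => //; exact: cv.
    move/cvgrPdist_lt : cv => /(_ _ e0); apply: filterS => h.
    by rewrite distrC dE.
  by apply: filterS => h Hh; apply: HP => j; rewrite !mxE; exact: Hh.
split; first by apply/cvg_ex; exists l.
by rewrite derive1E /derive; apply/cvg_lim => //; exact: cv.
Qed.

Lemma holo_disc_coord (G : set 'rV[R[i]]_n) f : holo_disc G f <->
  (forall j, hol 1 (fun z => f z 0 j)) /\ (forall z, cabs z < 1 -> G (f z)).
Proof.
split=> [[hf Gf]|[hf Gf]].
  split=> [j z z1|z z1]; last by apply: Gf; rewrite disc_cabs.
  eexists; apply: derivable_row_cder; apply: hf; by rewrite disc_cabs.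
split=> z; rewrite disc_cabs => z1; last exact: Gf.
have /choice[l Hl] : forall j, exists l, cder (fun w => f w 0 j) z l by move=> j; exact: hf.
have [|//] := @cder_row_derivable f z (\row_j l j).
by move=> j; rewrite mxE.
Qed.

Lemma holo_disc_derive1 (G : set 'rV[R[i]]_n) f z j : holo_disc G f -> cabs z < 1 ->
  derive1 (fun w => f w 0 j) z = derive1 f z 0 j.
Proof.
move=> [hf _] z1; apply: cder_derive1; apply: derivable_row_cder; apply: hf.
by rewrite disc_cabs.
Qed.

End vector_derivative.

(** * Rigidity of extremal maps *)

Section extremal.
Context {R : realType}.
Implicit Types (G : set 'rV[R[i]]_2) (f : R[i] -> 'rV[R[i]]_2).

Lemma eq_cder (F H : R[i] -> R[i]) z l : (forall w, F w = H w) -> cder H z l -> cder F z l.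
Proof. by move=> /funext ->. Qed.

(** If [e^c F] maps into [G], then by [reinhardt_perturb] a small linear term may be added to [F]
    recentred at [s1]. With it the value [f s2] is attained closer to the centre or, in the
    infinitesimal case, the derivative becomes longer; both contradict the infimum. *)
Lemma extremal_rigid G f (M : R) : complete_reinhardt G ->
  (forall z, G z -> forall j, cabs (z 0 j) <= M) ->
  lempert_extremal G f \/ kobayashi_extremal G f ->
  exists s1 s2 : R[i], [/\ cabs s1 < 1, cabs s2 < 1 &
    forall (F : 'I_2 -> R[i] -> R[i]) (c : R), 0 < c -> (forall j, hol 1 (F j)) ->
      (forall j, same_data s1 s2 (F j) (fun z => f z 0 j)) ->
      ~ (forall z, cabs z < 1 -> G (\row_j ((expR c)%:C * F j z)))].
Proof.
move=> reinG GM.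
have H0P (s : R[i]) (F : 'I_2 -> R[i] -> R[i]) : cabs s < 1 -> (forall j, hol 1 (F j)) ->
    forall j, hol 1 (fun z => F j (mob s z)).
  by move=> s1 hF j; apply: hol_comp (hol_mob s1) _ (hF j) => z; exact: mob_lt1.
have corr (s : R[i]) (F : 'I_2 -> R[i] -> R[i]) (K : 'I_2 -> R[i]) (c d : R) : cabs s < 1 -> (forall j, hol 1 (F j)) ->
    (forall z w : 'rV[R[i]]_2, G ((expR c)%:C *: z) -> (forall j, cabs (w 0 j) <= d) -> G (z + w)) ->
    (forall z, cabs z < 1 -> G (\row_j ((expR c)%:C * F j z))) -> (forall j, cabs (K j) <= d) ->
    holo_disc G (fun z => \row_j (F j (mob s z) + K j * z)).
  move=> s1 hF pert GF Kd; apply/holo_disc_coord; split=> [j|z z1].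
    apply: eq_hol (_ : hol 1 (fun z => F j (mob s z) + K j * z)); first by move=> z _; rewrite mxE.
    by apply: holD; [exact: H0P|apply: holZ; exact: hol_id].
  have -> : \row_j (F j (mob s z) + K j * z) = \row_j F j (mob s z) + \row_j (K j * z).
    by apply/rowP => j; rewrite !mxE.
  apply: pert => [|j]; last first.
    rewrite mxE cabsM; apply: le_trans (Kd j); rewrite ler_piMr ?cabs_ge0 //; exact: ltW.
  have := GF _ (mob_lt1 s1 z1); congr G; by apply/rowP => j; rewrite !mxE.
case=> [[holf [s1 [s2 [d1 d2 s12 ext]]]]|[holf [s d1 ext]]].
  rewrite disc_cabs in d1; rewrite disc_cabs in d2.
  exists s1, s2; split => // F c c0 hF sd GF.
  have [d d0 pert] := reinhardt_perturb reinG GM c0.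
  have N1 : cabs (- s1) < 1 by rewrite cabsN.
  pose sg := mob (- s1) s2; have sg1 : cabs sg < 1 by exact: mob_lt1.
  have msg : mob s1 sg = s2 by have := mobK N1 d2; rewrite opprK.
  have sg0 : sg != 0 by apply: contra_notN s12 => /eqP e; rewrite -msg e mob0.
  have p0 : 0 < cabs sg by rewrite cabs_gt0.
  have near j : exists2 r : R, 0 < r & forall w, cabs (w - sg) < r ->
      cabs (F j (mob s1 w) - f s2 0 j) < d * (cabs sg / 2).
    have := hol_continuous (H0P s1 F d1 hF j) sg1; move/continuous_cabsP => /(_ (d * (cabs sg / 2))).
    rewrite /= msg (same_data_s2 (sd j)); apply; by rewrite mulr_gt0 // divr_gt0.
  have [r0 r00 Hr0] := near 0; have [r1 r10 Hr1] := near 1.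
  (* Close enough to 1 that the value at [t * sg] is within [d * |sg| / 2] of [f s2]. *)
  pose t := Num.max (1 / 2) (1 - Num.min r0 r1 / 2).
  have m0 : 0 < Num.min r0 r1 by rewrite lt_min r00.
  have t2 : 1 / 2 <= t by rewrite le_max lexx.
  have t1 : t < 1 by rewrite gt_max; move: m0; move: (Num.min _ _) => m; clear; lra.
  have tm : 1 - t < Num.min r0 r1.
    have : 1 - Num.min r0 r1 / 2 <= t by rewrite le_max lexx orbT.
    by move: m0; move: (Num.min r0 r1) => m; lra.
  have t0 : 0 < t by apply: lt_le_trans t2.
  have tsg j : cabs (F j (mob s1 (t%:C * sg)) - f s2 0 j) < d * (cabs sg / 2).
    have tl : cabs (t%:C * sg - sg) < Num.min r0 r1.
      rewrite (_ : t%:C * sg - sg = (t - 1)%:C * sg); last by rewrite rmorphB /=; ring.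
      rewrite cabsM cabsC distrC gtr0_norm ?subr_gt0 //; apply: le_lt_trans tm.
      by rewrite ler_piMr ?ltW // subr_gt0.
    move: tl; rewrite lt_min => /andP[l0 l1].
    by case: (ord2P j) => ->; [exact: Hr0|exact: Hr1].
  have tn : t%:C * sg != 0 by rewrite -cabs_gt0 cabsM cabsC mulr_gt0 // gtr0_norm.
  (* The slope that moves the value at [t * sg] to [f s2]; it is at most [d] because [t >= 1/2]. *)
  pose K j := (f s2 0 j - F j (mob s1 (t%:C * sg))) / (t%:C * sg).
  have Kd j : cabs (K j) <= d.
    rewrite cabsM cabsV ler_pdivrMr ?cabs_gt0 // cabsB (le_trans (ltW (tsg j))) //.
    by rewrite ler_pM2l // cabsM cabsC gtr0_norm // mulrC ler_pM2r //; move: t2; rewrite mul1r.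
  have hH := corr s1 F K c d d1 hF pert GF Kd.
  have le : (lempert G (f s1) (f s2) <= (poincare 0 (t%:C * sg))%:E)%E.
    apply: ereal_inf_lbound; exists (0, t%:C * sg) => //; split.
    - by rewrite disc_cabs cabs0.
    - rewrite disc_cabs cabsM cabsC gtr0_norm //; apply: lt_trans sg1; by rewrite gtr_pMl.
    exists (fun z => \row_j (F j (mob s1 z) + K j * z)) => //; split; apply/rowP => j; rewrite mxE.
      by rewrite mob0 mulr0 addr0; exact: (sd j).1.
    by rewrite /K divfK // subrKC.
  move: le; rewrite -ext lee_fin leNgt => /negP; apply.
  have e1 : cabs ((0 - t%:C * sg) / (1 - conjc 0 * (t%:C * sg))) = t * cabs sg.
    by rewrite rmorph0 mul0r subr0 divr1 sub0r cabsN cabsM cabsC gtr0_norm.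
  have e2 : cabs ((s1 - s2) / (1 - conjc s1 * s2)) = cabs sg.
    by rewrite /sg /mob rmorphN mulNr !cabsM (cabsB s1).
  rewrite /poincare e1 e2; have tq : t * cabs sg < cabs sg by rewrite gtr_pMl.
  have tq0 : 0 < t * cabs sg by rewrite mulr_gt0.
  rewrite ltr_pM2l // ltr_ln ?posrE.
  - move: tq tq0 sg1; move: (t * cabs sg) (cabs sg) => a b ab a0 b1.
    by rewrite ltr_pdivrMr ?subr_gt0 ?(lt_trans ab) // mulrAC ltr_pdivlMr ?subr_gt0 //; lra.
  - by apply: divr_gt0; [rewrite addr_gt0|rewrite subr_gt0 (lt_trans tq)].
  - by apply: divr_gt0; [rewrite addr_gt0|rewrite subr_gt0].
rewrite disc_cabs in d1; exists s, s; split => // F c c0 hF sd GF.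
have [d d0 pert] := reinhardt_perturb reinG GM c0.
pose X := derive1 f s; pose B := 1 + cabs (X 0 0) + cabs (X 0 1).
have B0 : 0 < B by rewrite ltr_wpDr ?cabs_ge0 // ltr_wpDr ?cabs_ge0.
pose e := d / B; have e0 : 0 < e by rewrite divr_gt0.
have Kd j : cabs (e%:C * X 0 j) <= d.
  rewrite cabsM cabsC gtr0_norm // -[leRHS](divfK (lt0r_neq0 B0)) -/e ler_pM2l // /B.
  have := cabs_ge0 (X 0 0); have := cabs_ge0 (X 0 1).
  by case: (ord2P j) => ->; move: (cabs _) (cabs _) => x y; clear; lra.
have hH := corr s F (fun j => e%:C * X 0 j) c d d1 hF pert GF Kd.
have c1 : 0 < 1 - cabs s ^+ 2 by rewrite subr_gt0 expr_lt1 ?cabs_ge0.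
have a0 : 0 < 1 - cabs s ^+ 2 + e by rewrite addr_gt0.
(* The correction [e X z] changes the derivative at 0 from [(1 - |s|^2) X] to
   [(1 - |s|^2 + e) X]. *)
have le : (kobayashi_royden G (f s) X <= ((1 - cabs s ^+ 2 + e)^-1)%:E)%E.
  apply: ereal_inf_lbound; exists (1 - cabs s ^+ 2 + e)^-1 => //; split; first by rewrite invr_gt0.
  exists (fun z => \row_j (F j (mob s z) + e%:C * X 0 j * z)) => //; split.
    by apply/rowP => j; rewrite mxE mob0 mulr0 addr0; exact: (sd j).1.
  have [|_ ->] := @cder_row_derivable R 2 (fun z => \row_j (F j (mob s z) + e%:C * X 0 j * z)) 0
      ((1 - cabs s ^+ 2 + e)%:C *: X).
    move=> j; rewrite mxE.
    have [l dl] := hF j s d1.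
    have lX : l = X 0 j.
      have := (sd j).2; rewrite /dd eqxx (cder_derive1 dl) => ->.
      exact: holo_disc_derive1 holf d1.
    have dm0 : cder (mob s) 0 ((1 - (cabs s ^+ 2)%:C) / (1 + s^* * 0) ^+ 2).
      by apply: cder_mob => //; rewrite cabs0.
    have dl' : cder (F j) (mob s 0) l by rewrite mob0.
    have dK : cder (fun z => e%:C * X 0 j * z) 0 (e%:C * X 0 j * 1) by apply: cderZ; exact: cder_id.
    have := cderD (cder_comp dm0 dl') dK; rewrite mulr0 addr0 expr1n divr1 mulr1 lX.
    have -> : X 0 j * (1 - (cabs s ^+ 2)%:C) + e%:C * X 0 j = (1 - cabs s ^+ 2 + e)%:C * X 0 j.
      by rewrite rmorphD rmorphB rmorph1 /=; ring.
    by apply: eq_cder => z; rewrite mxE.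
  by rewrite scalerA -rmorphM /= mulVf ?rmorph1 ?scale1r // gt_eqF.
move: le; rewrite ext lee_fin lef_pV2 ?posrE // leNgt => /negP; apply.
by rewrite ltrDl.
Qed.

End extremal.

(** * The logarithmic image as an open lower set, and its projections *)

Section log_geometry.
Context {R : realType}.
Implicit Types (G : set 'rV[R[i]]_2) (x y : 'rV[R]_2).

Lemma closure_log_lower G x y : complete_reinhardt G -> closure (log_image G) x ->
  (forall j, y 0 j < x 0 j) -> log_image G y.
Proof.
move=> reinG /closure_rowP clx yx.
have e0 : 0 < Num.min (x 0 0 - y 0 0) (x 0 1 - y 0 1) by rewrite lt_min !subr_gt0 !yx.
have [x' Lx' H] := clx _ e0; apply: (log_image_le reinG Lx') => j.
have := H j; rewrite lt_min ltr_norml => /andP[/andP[h1 h2] h3].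
move: h1 h3; rewrite ltr_norml => h1 /andP[h3 _].
have := H j; rewrite lt_min !ltr_norml => /andP[/andP[a1 _] /andP[a2 _]].
by case: (ord2P j) a1 a2 => ->; lra.
Qed.

Lemma log_image_raise G x : complete_reinhardt G -> log_image G x ->
  exists2 e : R, 0 < e & log_image G (\row_j (x 0 j + e)).
Proof.
move=> reinG Lx; pose z (a : R) : 'rV[R[i]]_2 := \row_j (expR (x 0 j + a))%:C.
have zP (a : R) : log_image G (\row_j (x 0 j + a)) <-> G (z a).
  by apply: log_imageP => // j; rewrite !mxE cabsC ger0_norm ?expR_ge0.
have Gz0 : G (z 0).
  by apply/zP; rewrite (_ : \row_j _ = x) //; apply/rowP => j; rewrite mxE addr0.
have cz : continuous z.
  move=> a; apply: continuous_row => j.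
  rewrite (_ : (fun t => _) = (fun t : R => (expR (x 0 j + t))%:C)); last by apply/funext => t; rewrite mxE.
  apply: cvg_realC; apply: (@continuous_comp _ _ _ (fun t => x 0 j + t) expR); last exact: continuous_expR.
  by apply: cvgD; [exact: cvg_cst|exact: cvg_id].
have [oG _ _] := reinG.
have nG : nbhs (z 0) G by apply: open_nbhs_nbhs.
have /nbhs_ballP[r /= r0 Hr] : nbhs (0 : R) (z @^-1` G) := cz 0 _ nG.
exists (r / 2); first by rewrite divr_gt0.
apply/zP; apply: Hr; rewrite /ball /= sub0r normrN gtr0_norm ?divr_gt0 //.
by rewrite ltr_pdivrMr // ltr_pMr // ltr1n.
Qed.

Section projection.
Variables (G : set 'rV[R[i]]_2) (r : 'I_2 -> R).
Hypothesis reinG : complete_reinhardt G.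
Hypothesis r0 : forall j, 0 < r j.
Hypothesis projG : forall j, [set z 0 j | z in G] = [set (r j)%:C * s | s in @disc R].

Lemma proj_lt z j : G z -> cabs (z 0 j) < r j.
Proof.
move=> Gz; have : [set z 0 j | z in G] (z 0 j) by exists z.
rewrite projG => -[s]; rewrite disc_cabs => s1 <-.
by rewrite cabsM cabsC gtr0_norm // gtr_pMr.
Qed.

Lemma log_image_lt x j : log_image G x -> x 0 j < ln (r j).
Proof.
move=> [z [Gz z0 ->]]; rewrite mxE ltr_ln ?posrE ?cabs_gt0 //.
exact: proj_lt.
Qed.

Lemma closure_log_le x j : closure (log_image G) x -> x 0 j <= ln (r j).
Proof.
move=> /closure_rowP clx; apply/ler_addgt0Pr => e e0.
have [y Ly /(_ j)] := clx e e0; have := log_image_lt j Ly.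
by rewrite ltr_norml => h /andP[]; move: h; move: (y 0 j) (x 0 j) (ln _) => a b c; clear; lra.
Qed.

Lemma log_image_sup j (v : R) : v < ln (r j) -> exists2 x, log_image G x & v < x 0 j.
Proof.
move=> vr; have vr' : expR v < r j by rewrite -[ltRHS](lnK (x := r j)) ?posrE ?ltr_expR.
pose a := (expR v + r j) / 2.
have [av ar] : expR v < a /\ a < r j by rewrite /a; move: vr'; move: (expR v) (r j) => p q; lra.
have a0 : 0 < a by apply: lt_trans av; exact: expR_gt0.
have [z Gz zj] : [set z 0 j | z in G] (a%:C).
  have q0 : 0 < a / r j by rewrite divr_gt0.
  have q1 : a / r j < 1 by rewrite ltr_pdivrMr ?r0 // mul1r.
  rewrite projG; exists (a / r j)%:C; first by rewrite disc_cabs cabsC gtr0_norm.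
  by rewrite -rmorphM /= mulrC divfK // gt_eqF.
have [oG _ _] := reinG.
have /nbhs_rowP[e e0 He] : nbhs z G by apply: open_nbhs_nbhs.
have [d d0 Ed] : exists2 d : R, 0 < d & d%:C = e.
  case: e e0 {He} => e1 e2 /[dup]; rewrite {1}ltcE /= => /andP[/eqP -> h0] _.
  by exists e1.
(* Only points without zero coordinates have a logarithm; openness permits replacing zeros by
   [d / 2]. *)
pose w : 'rV[R[i]]_2 := \row_k (if z 0 k == 0 then (d / 2)%:C else z 0 k).
have d2 : 0 < d / 2 by rewrite divr_gt0.
have Gw : G w.
  apply: He => k; rewrite mxE; case: eqVneq => [->|_]; last by rewrite subrr normr0.
  rewrite subr0 normcE cabsC -Ed ltcR gtr0_norm //.
  by rewrite ltr_pdivrMr // ltr_pMr // ltr1n.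
exists (\row_k ln (cabs (w 0 k))).
  exists w; split => // k; rewrite mxE.
  have [_|//] := eqVneq (z 0 k) 0.
  by rewrite -cabs_gt0 cabsC gtr0_norm.
have wj : w 0 j = a%:C.
  rewrite mxE zj; have [h|//] := eqVneq a%:C 0.
  by have := cabsC a; rewrite h cabs0 gtr0_norm // => E; move: a0; rewrite -E ltxx.
rewrite mxE wj cabsC gtr0_norm // -ltr_expR lnK ?posrE //.
Qed.

End projection.
End log_geometry.

(** * Null sets and almost-everywhere inequalities on the circle *)

Section integrals.
Context {R : realType}.
Local Notation arc := (@arc_length R).
Local Notation T := (borel_circle R).
Implicit Types (u v h : T -> R).

Lemma rint_measurable u : rint u -> measurable_fun setT u.
Proof. by move=> /integrableP[/measurable_EFinP]. Qed.

Lemma rint_indic u (E : set T) : measurable E -> rint u -> rint (fun x => u x * \1_E x).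
Proof.
move=> mE ru; apply: (le_integrable measurableT _ _ ru).
  apply/measurable_EFinP; apply: measurable_funM; first exact: rint_measurable.
  exact: measurable_indic.
move=> x _ /=; rewrite lee_fin normrM ler_piMr // indicE.
by case: (x \in E); rewrite ?normr1 ?normr0.
Qed.

Lemma rint_modify (g : T -> R) (N : set T) (p : R) : measurable N -> arc N = 0%E -> rint g ->
  rint (fun x => if x \in N then p else g x) /\
  forall k, kcont k -> pint (fun x => if x \in N then p else g x) k = pint g k.
Proof.
move=> mN N0 rg.
have rt : rint (fun x => if x \in N then p else g x).
  have -> : (fun x => if x \in N then p else g x) = (fun x => g x * \1_(~` N) x + p * \1_N x).
    apply/funext => x; rewrite !indicE in_setC; case: (x \in N) => /=.
      by rewrite mulr0 add0r mulr1.
    by rewrite mulr0 addr0 mulr1.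
  apply: rintD; first by apply: rint_indic => //; exact: measurableC.
  by apply: (rint_indic mN); exact: rint_cst.
split=> // k kc; congr (_ * fine _).
have i1 := rintK rt kc; have i2 := rintK rg kc.
rewrite (negligible_integral mN measurableT i1 N0) (negligible_integral mN measurableT i2 N0).
by apply: eq_integral => x; rewrite inE => -[_ nx] /=; rewrite memNset.
Qed.

Lemma ae_le0 h : rint h -> \int[arc]_x (h x * \1_([set x | 0 < h x]) x) <= 0 ->
  {ae arc, forall x, h x <= 0}.
Proof.
move=> rh H; set E := [set x | 0 < h x] in H.
have mE : measurable E.
  have -> : E = h @^-1` `]0, +oo[ by apply/seteqP; split => x /=; rewrite in_itv /= andbT.
  by rewrite -[X in measurable X]setTI; apply: rint_measurable.
have r1 := rint_indic mE rh.
have p1 x : 0 <= h x * \1_E x.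
  rewrite indicE; have [xE|xE] := boolP (x \in E); last by rewrite mulr0.
  by rewrite mulr1 ltW //; move: xE; rewrite inE.
have e0 : (\int[arc]_x (`| (h x * \1_E x)%:E |) = 0)%E.
  have -> : (\int[arc]_x (`| (h x * \1_E x)%:E |) = \int[arc]_x (h x * \1_E x)%:E)%E.
    by apply: eq_integral => x _; rewrite gee0_abs // lee_fin.
  rewrite integral_rint //; congr EFin; apply/eqP; rewrite eq_le H /=.
  by apply: Rintegral_ge0 => x _.
have m1 : measurable_fun setT (EFin \o (fun x => h x * \1_E x)).
  by apply/measurable_EFinP; apply: rint_measurable.
move: ((ae_eq_integral_abs arc measurableT m1).1 e0); apply: ae_sub => x /(_ I) /= [].
rewrite indicE leNgt => hx; apply/negP => hp; move: hx.
by rewrite mem_set // mulr1 => hx; move: hp; rewrite hx ltxx.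
Qed.

Lemma expi_inj_itv (s t : R) : 0 <= s -> s <= t -> t < 2 * pi -> expi s = expi t -> s = t.
Proof.
move=> s0 st t2 [ec es]; apply/eqP; rewrite eq_le st /= leNgt; apply/negP => lt.
have : cos (t - s) = 1.
  by rewrite cosB -ec -es -!expr2 cos2Dsin2.
have -> : t - s = (t - s) / 2 + (t - s) / 2 by field.
rewrite cosD -!expr2 => h.
have : 0 < sin ((t - s) / 2).
  apply: sin_gt0_pi; apply/andP; split; first by rewrite divr_gt0 // subr_gt0.
  by move: s0 t2; move: pi => q; lra.
move=> sp; have := cos2Dsin2 ((t - s) / 2); move: h.
have := exprn_gt0 2 sp; move: (sin _ ^+ 2) (cos _ ^+ 2) => a b; clear; lra.
Qed.

Lemma arc_set1 (z : T) : arc [set z] = 0%E.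
Proof.
rewrite /arc_length /= /pushforward /= /mrestr.
apply: countable_lebesgue_measure0.
have [[t0 [t0z t0i]]|no] := pselect (exists t, circle_expi t = z /\ 0 <= t < 2 * pi).
  apply: (@sub_countable _ _ _ [set t0]); last exact: finite_set_countable.
  apply: subset_card_le => t [/= tz]; rewrite in_itv /= => /andP[ta tb].
  move/andP: t0i => [a b].
  have e : expi t = expi t0 by have := congr1 (fun w : T => circle_val w) (etrans tz (esym t0z)).
  by have [h|/ltW h] := leP t t0; [apply: expi_inj_itv|apply/esym; apply: expi_inj_itv].
rewrite (_ : _ `&` _ = set0); first exact: countable0.
by apply/seteqP; split=> // t [/= tz]; rewrite in_itv /= => h; apply: no; exists t.
Qed.

End integrals.

(** * The three kernels computing the data of a Herglotz integral *)

Section kernels.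
Context {R : realType}.
Local Notation Re := (@complex.Re R).
Local Notation Im := (@complex.Im R).
Local Notation T := (borel_circle R).
Implicit Types (u : T -> R) (k : R[i] -> R).

Lemma kcontD k k' : kcont k -> kcont k' -> kcont (fun z => k z + k' z).
Proof.
move=> ck ck'; have H : ccont (fun z => (k z)%:C + (k' z)%:C).
  by move=> z z1; apply: continuousD; [exact: (ck z z1)|exact: (ck' z z1)].
rewrite /kcont (_ : (fun z => _) = (fun z => (k z)%:C + (k' z)%:C)); first exact: H.
by apply/funext => w; rewrite rmorphD.
Qed.

Lemma kcontZ a k : kcont k -> kcont (fun z => a * k z).
Proof.
move=> ck; have H : ccont (fun z => a%:C * (k z)%:C) by apply: ccontM; [exact: (@ccont_cst R a%:C)|exact: ck].
rewrite /kcont (_ : (fun z => _) = (fun z => a%:C * (k z)%:C)); first exact: H.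
by apply/funext => w; rewrite rmorphM.
Qed.

Lemma kcont_sum (I : Type) (s : seq I) (k : I -> R[i] -> R) (a : I -> R) :
  (forall i, kcont (k i)) -> kcont (fun z => \sum_(i <- s) a i * k i z).
Proof.
move=> kc; elim: s => [|i s IH].
  have -> : (fun z => \sum_(i <- [::]) a i * k i z) = (fun=> 0 : R).
    by apply/funext => w; rewrite big_nil.
  exact: (@ccont_cst R (0 : R)%:C).
have -> : (fun z => \sum_(j <- i :: s) a j * k j z) = (fun z => a i * k i z + \sum_(j <- s) a j * k j z).
  by apply/funext => w; rewrite big_cons.
by apply: kcontD; [apply: kcontZ; exact: kc|exact: IH].
Qed.

Lemma pint_sumk (I : Type) (s : seq I) u (k : I -> R[i] -> R) (a : I -> R) :
  rint u -> (forall i, kcont (k i)) ->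
  pint u (fun z => \sum_(i <- s) a i * k i z) = \sum_(i <- s) a i * pint u (k i).
Proof.
move=> ru kc; rewrite {1}/pint.
rewrite (_ : (fun x => _) = (fun x => \sum_(i <- s) a i * (u x * k i (circle_val x)))); last first.
  by apply/funext => x; rewrite mulr_sumr; apply: eq_bigr => i _; ring.
have ri i := rintK ru (kc i).
have := @pint_sum R I s (fun i x => a i * (u x * k i (circle_val x))) (fun=> 1) _ _.
rewrite {1}/pint (_ : (fun x => _ * 1) = (fun x => \sum_(i <- s) a i * (u x * k i (circle_val x)))); last first.
  by apply/funext => x; rewrite mulr1.
move=> ->.
- apply: eq_bigr => i _; rewrite /pint mulrCA; congr (_ * _).
  have -> : \int[@arc_length R]_x (a i * (u x * k i (circle_val x)) * 1) =
      \int[@arc_length R]_x (a i * (u x * k i (circle_val x))).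
    by apply: eq_Rintegral => x _; rewrite mulr1.
  by rewrite RintegralZl //; exact: ri.
- exact: (@ccont_cst R 1).
- by move=> i; exact: rintZ.
Qed.

Variables s1 s2 : R[i].
Hypotheses (s1D : cabs s1 < 1) (s2D : cabs s2 < 1).

(** Against these kernels [u] gives the real part of [herg u] at [s1] and both parts of its divided
    difference. The imaginary part at [s1] is left out: correcting it only rotates a coordinate,
    which leaves moduli unchanged. *)
Definition ker (i : 'I_3) (z : R[i]) : R :=
  if i == 0 then pk s1 z else if i == 1 then Re (dk s1 s2 z) else Im (dk s1 s2 z).

Lemma kcont_ker i : kcont (ker i).
Proof.
have cd := ccont_dk s1D s2D; rewrite /ker.
case e0 : (i == 0); first exact: kcont_pk.
case e1 : (i == 1) => z z1; apply: continuous_realC.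
  by apply: continuous_Re; exact: (cd z z1).
by apply: continuous_Im; exact: (cd z z1).
Qed.

Definition kap (a : 'rV[R]_3) (z : R[i]) : R := \sum_i a 0 i * ker i z.

Lemma kcont_kap a : kcont (kap a).
Proof. by apply: kcont_sum; exact: kcont_ker. Qed.

Lemma pint_kap u a : rint u -> pint u (kap a) = \sum_i a 0 i * pint u (ker i).
Proof. by move=> ru; apply: pint_sumk => //; exact: kcont_ker. Qed.

(** When [Re F = 1], [|F - 2| = |F|], so [1 - 2 / F] is unimodular throughout and hence constant. *)
Lemma hol_Re_cst (F : R[i] -> R[i]) : hol 1 F -> (forall z, cabs z < 1 -> Re (F z) = 1) ->
  forall z, cabs z < 1 -> F z = F 0.
Proof.
move=> hF F1 z z1.
have F0 w : cabs w < 1 -> F w != 0.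
  by move=> w1; apply/eqP => h; have := F1 w w1; rewrite h => /eqP; rewrite eq_sym oner_eq0.
pose J w := 1 + (- 2)%:C * (F w)^-1.
have hJ : hol 1 J.
  apply: holD; first exact: (@hol_cst R 1 1).
  apply: holZ => w w1; have [l dl] := hF w w1.
  by eexists; apply: (cderV (F0 w w1) dl).
have cJ w : cabs w < 1 -> cabs (J w) = 1.
  move=> w1; have -> : J w = (F w - 2%:C) / F w by rewrite /J; field; exact: F0.
  rewrite cabsM cabsV; suff -> : cabs (F w - 2%:C) = cabs (F w) by rewrite divff // cabs_eq0 F0.
  apply/eqP; rewrite -(@eqrXn2 _ 2) ?cabs_ge0 // !cabs_sqr ReB ImB ReC ImC F1 //.
  by apply/eqP; ring.
have J0 : cabs (0 : R[i]) < 1 by rewrite cabs0.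
have cJ1 w : cabs w < 1 -> cabs (J w) <= 1 by move=> /cJ ->.
have := @hol_const R J 0 z hJ cJ1 J0 (cJ 0 J0) z1.
have n2 : (- 2 : R)%:C != 0 by rewrite -cabs_gt0 cabsC normr_gt0 oppr_eq0 pnatr_eq0.
by rewrite /J => /addrI /(mulfI n2) /invr_inj.
Qed.

(** The Herglotz integral of 1 has real part 1, so it is constant and its divided difference
    vanishes. *)
Lemma pint1_dk : pint (fun=> 1 : R) (Re \o dk s1 s2) = 0 /\ pint (fun=> 1 : R) (Im \o dk s1 s2) = 0.
Proof.
have r1 : rint (fun=> 1 : R) by exact: rint_cst.
have H1 := hol_herg r1.
have Hc z : cabs z < 1 -> herg (fun=> 1 : R) z = herg (fun=> 1 : R) 0.
  by apply: hol_Re_cst => // w w1; rewrite Re_herg pint_cst.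
have e : dd s1 s2 (herg (fun=> 1 : R)) = 0.
  have [_ ->] : same_data s1 s2 (herg (fun=> 1 : R)) (fun=> herg (fun=> 1 : R) 0).
    by apply: eq_same_data.
  exact: dd_cst.
by rewrite -Re_dd_herg // -Im_dd_herg // e.
Qed.

Lemma pint1_kap a : pint (fun=> 1 : R) (kap a) = a 0 0.
Proof.
rewrite pint_kap; last exact: rint_cst.
have [h1 h2] := pint1_dk.
rewrite (bigD1 0) //= (_ : pint _ (ker 0) = 1); last by rewrite pint_cst.
rewrite big1 ?addr0 ?mulr1 // => i i0.
have : pint (fun=> 1 : R) (ker i) = 0.
  by rewrite /ker (negbTE i0); case e1 : (i == 1).
by move=> ->; rewrite mulr0.
Qed.

End kernels.

(** * Duality: a separating functional from rigidity *)

Section certificate.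
Context {R : realType}.
Local Notation Re := (@complex.Re R).
Local Notation Im := (@complex.Im R).
Local Notation T := (borel_circle R).

Lemma le_vanishing (A B C : R) : (forall k : nat, A - 2 * (k.+1%:R)^-1 * B <= C) -> A <= C.
Proof.
move=> H; rewrite leNgt; apply/negP => CA.
have d0 : 0 < (A - C) / (2 * `|B| + 1) by rewrite divr_gt0 ?subr_gt0 // ltr_wpDl // mulr_ge0.
have B1 : 0 < 2 * `|B| + 1 by rewrite ltr_wpDl // mulr_ge0.
have [k hk] := ltr_add_invr d0.
rewrite add0r (ltr_pdivlMr _ _ B1) in hk.
have q0 : 0 < (k.+1%:R)^-1 :> R by rewrite invr_gt0 ltr0n.
have h1 : (k.+1%:R)^-1 * B <= (k.+1%:R)^-1 * `|B| by rewrite ler_pM2l // ler_norm.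
have h2 := H k; move: hk h1 h2 q0; rewrite mulrDr mulr1 -mulrA (mulrCA _ 2 `|B|).
by move: (_^-1) => q; move: (q * B) (q * `|B|) => x y; lra.
Qed.

Lemma dot_mxvec m n (v : 'rV[R]_(m * n)) (A : 'M[R]_(m, n)) :
  dot v (mxvec A) = \sum_j \sum_i vec_mx v j i * A j i.
Proof.
rewrite pair_bigA /dot (reindex _ (curry_mxvec_bij _ _)) /=.
by apply: eq_bigr => -[j i] _ /=; rewrite mxvecE -{1}(vec_mxK v) mxvecE.
Qed.

Variables (G : set 'rV[R[i]]_2) (f : 'I_2 -> R[i] -> R[i]) (s1 s2 : R[i]).
Variables (g : 'I_2 -> T -> R) (c : 'I_2 -> R) (q : 'I_2 -> R[i] -> R[i]).
Hypotheses (reinG : complete_reinhardt G) (cL : convex_set (log_image G)).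
Hypotheses (s1D : cabs s1 < 1) (s2D : cabs s2 < 1).
Hypothesis rigid : forall (F : 'I_2 -> R[i] -> R[i]) (c : R), 0 < c -> (forall j, hol 1 (F j)) ->
  (forall j, same_data s1 s2 (F j) (f j)) ->
  ~ (forall z, cabs z < 1 -> G (\row_j ((expR c)%:C * F j z))).
Hypotheses (rg : forall j, rint (g j)) (gL : forall x, closure (log_image G) (\row_j g j x)).
Hypothesis hf : forall j, hol 1 (f j).
Hypothesis hq : forall j, hol 1 (q j).
Hypothesis q1 : forall j z, cabs z < 1 -> cabs (q j z) <= expR (- c j).
Hypothesis qI : forall j, same_data s1 s2 (q j) (fun z => f j z * cexp (- herg (g j) z)).

Let data (u : 'I_2 -> T -> R) : 'M[R]_(2, 3) := \matrix_(j, i) pint (u j) (ker s1 s2 i).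
(** The margin [1 / (k + 1)] below the boundary of the logarithmic image pays for approximation
    errors in the data. *)
Let adm (k : nat) (u : 'I_2 -> T -> R) := (forall j, rint (u j)) /\
  forall x, log_image G (\row_j (u j x + (k.+1%:R)^-1)).
Let C k : set 'rV[R]_(2 * 3) := [set mxvec (data u) | u in adm k].
(** The data of [g] lowered by the gain [c j] that [q j] offers over [f j * cexp (- herg (g j))]. *)
Let x0 := mxvec (data (fun j x => g j x - c j)).

Let kk := kcont_ker s1D s2D.

Let rgc j : rint (fun x => g j x - c j).
Proof. by apply: rintB => //; exact: rint_cst. Qed.

Lemma data_convex k : convex_set (C k).
Proof.
move=> _ _ t [u [ru Lu] <-] [u' [ru' Lu'] <-] t01.
exists (fun j x => u j x + t * (u' j x - u j x)).
  split=> [j|x]; first by apply: rintD => //; apply: rintZ; exact: rintB.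
  have := cL (Lu x) (Lu' x) t01; congr log_image.
  by apply/rowP => j; rewrite !mxE; ring.
rewrite -linearB -linearZ -linearD; congr mxvec; apply/matrixP => j i; rewrite !mxE.
rewrite pintD ?pintZ ?pintB //; [exact: rintB|by apply: rintZ; exact: rintB].
Qed.

(** An admissible [u] with nearly these data would make [q j * cexp (chi j)] a map with exactly the
    data of [f j], where [chi j] is [herg (u j)] plus a small affine correction. The margin of [u]
    would leave it slack [th / 4], against rigidity. *)
Lemma data_not_closure k : ~ closure (C k) x0.
Proof.
move=> /closure_rowP cl; pose th : R := (k.+1%:R)^-1.
have th0 : 0 < th by rewrite invr_gt0 ltr0n.
have e0 : 0 < th / 20 by rewrite divr_gt0.
(* The correction costs [e] at [s1] and at most [4 e] through its slope; the total [5 e] is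
   [th / 4]. *)
set e := th / 20 in e0.
have [_ [u [ru Lu] <-] Hd] := cl _ e0.
have Hji j i : `|pint (u j) (ker s1 s2 i) - pint (fun x => g j x - c j) (ker s1 s2 i)| < e.
  by have := Hd (mxvec_index j i); rewrite !mxvecE !mxE.
pose a j := herg (g j) s1 - herg (u j) s1.
pose b j := dd s1 s2 (herg (g j)) - dd s1 s2 (herg (u j)).
have [p1 p2] := pint1_dk s1D s2D.
have pc j i : pint (fun x => g j x - c j) (ker s1 s2 i) = pint (g j) (ker s1 s2 i) -
    c j * pint (fun=> 1) (ker s1 s2 i).
  rewrite pintB //; last exact: rint_cst.
  have -> : (fun _ : T => c j) = (fun x => c j * (fun=> 1) x) by apply/funext => x; rewrite mulr1.
  by rewrite pintZ //; exact: rint_cst.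
have aE j : `|Re (a j) - c j| < e.
  have := Hji j 0; rewrite pc (_ : pint (fun=> 1) (ker s1 s2 0) = 1); last by rewrite pint_cst.
  by rewrite mulr1 distrC /a ReB !Re_herg; congr (`|_| < _); rewrite /ker /=; ring.
have bE j : cabs (b j) <= 2 * e.
  have h1 := Hji j 1; have h2 := Hji j (lift ord0 (lift ord0 ord0)).
  move: h1; rewrite pc {2}/ker /= p1 mulr0 subr0 distrC => h1.
  move: h2; rewrite pc {2}/ker /= p2 mulr0 subr0 distrC => h2.
  apply: (le_trans (cabs_le_ReIm _)); rewrite /b ReB ImB !Re_dd_herg // !Im_dd_herg //.
  by rewrite mulr_natl mulr2n; apply: lerD; exact: ltW.
(* The affine term gives [chi j] the data of [herg (g j)]. Only [Re (a j)] is controlled, by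
   [c j + e], and the factor [q j] gains [c j] back. *)
pose chi j z := herg (u j) z + (a j + b j * (z - s1)).
have hlin j : hol 1 (fun z => a j + b j * (z - s1)).
  apply: holD; first exact: (@hol_cst R 1).
  by apply: holZ; apply: holB; [exact: hol_id|exact: (@hol_cst R 1)].
have hchi j : hol 1 (chi j) by apply: holD => //; exact: hol_herg.
have dchi j : same_data s1 s2 (chi j) (herg (g j)).
  split; first by rewrite /chi subrr mulr0 addr0 /a subrKC.
  rewrite /chi (ddD s2 s1D (hol_herg (ru j)) (hlin j)).
  have hi : hol 1 (fun z => b j * (z - s1)).
    by apply: holZ; apply: holB; [exact: hol_id|exact: (@hol_cst R 1)].
  have hi2 : hol 1 (fun z => z - s1) by apply: holB; [exact: hol_id|exact: (@hol_cst R 1)].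
  rewrite (ddD s2 s1D (@hol_cst R 1 (a j)) hi) dd_cst add0r.
  rewrite (ddM s2 s1D (@hol_cst R 1 (b j)) hi2) dd_cst mul0r add0r.
  by rewrite (ddB s2 s1D (@hol_id R 1) (@hol_cst R 1 s1)) (dd_id s1 s2) dd_cst subr0 mulr1 /b subrKC.
have hexp (h : R[i] -> R[i]) : hol 1 h -> hol 1 (fun z => cexp (h z)).
  by move=> hh z z1; have [l dl] := hh z z1; eexists; exact: cder_comp dl (cder_cexp _).
pose F j z := q j z * cexp (chi j z).
have hF j : hol 1 (F j) by apply: holM => //; exact: hexp.
have hN j : hol 1 (fun z => - herg (g j) z).
  have := @holZ R 1 (- 1) _ (hol_herg (rg j)); apply: eq_hol => z _; by rewrite mulN1r.
have hI j : hol 1 (fun z => f j z * cexp (- herg (g j) z)) by apply: holM => //; exact: hexp.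
have sdF j : same_data s1 s2 (F j) (f j).
  apply: (@same_data_trans _ _ _ _ (fun z => f j z * cexp (- herg (g j) z) * cexp (herg (g j) z))).
    apply: same_dataM => //; [exact: hexp|by apply: hexp; exact: hol_herg|].
    by apply: same_data_comp => //; [exact: hol_herg|eexists; exact: cder_cexp].
  apply: eq_same_data => //; first by apply: holM => //; apply: hexp; exact: hol_herg.
  by move=> z _; rewrite -mulrA -cexpD addNr cexp0 mulr1.
have th4 : 0 < th / 4 by rewrite divr_gt0.
apply: (rigid th4 hF sdF) => z z1.
(* Poisson averages of a map into the convex logarithmic image stay in its closure. *)
have clz : closure (log_image G) (\row_j pint (fun x => u j x + th) (pk z)).
  apply: average_closure => // j; apply: rintD => //; exact: rint_cst.
have Lz : log_image G (\row_j (pint (u j) (pk z) + th / 2)).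
  apply: (closure_log_lower reinG clz) => j; rewrite !mxE pintD ?pint_cst //.
  - by rewrite ltrD2l ltr_pdivrMr // ltr_pMr // ltr1n.
  - exact: rint_cst.
  - exact: kcont_pk.
pose w : 'rV[R[i]]_2 := \row_j (expR (pint (u j) (pk z) + th / 2))%:C.
have Gw : G w.
  by apply/(log_imageP reinG _).1: Lz => j; rewrite !mxE cabsC ger0_norm ?expR_ge0.
apply: (reinhardt_le reinG Gw) => j; rewrite !mxE cabsM (cabsM (q j z)) cabs_cexp !cabsC !(ger0_norm (expR_ge0 _)).
apply: (@le_trans _ _ (expR (th / 4) * (expR (- c j) * expR (Re (chi j z))))).
  by rewrite ler_pM2l ?expR_gt0 // ler_wpM2r ?expR_ge0 // q1.
rewrite -!expRD ler_expR /chi (ReD (herg (u j) z)) (ReD (a j)) Re_herg.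
have Rb : Re (b j * (z - s1)) <= 4 * e.
  apply: (le_trans (ler_norm _)); apply: (le_trans (Re_le_cabs _)); rewrite cabsM.
  have zs : cabs (z - s1) <= 2.
    apply: (le_trans (cabsD _ _)); rewrite cabsN; move: (ltW z1) (ltW s1D).
    by move: (cabs z) (cabs s1) => x y; lra.
  have -> : 4 * e = 2 * e * 2 by ring.
  by apply: ler_pM => //; exact: cabs_ge0.
have := aE j; rewrite ltr_norml => /andP[_].
move: Rb; rewrite /e; move: (Re (b j * _)) (Re (a j)) (pint _ _) (c j) => x1 x2 x3 x4; lra.
Qed.

(** The normal separating [x0] from all [C k] is a vector of [R^6], read as two combinations of the
    kernels. A perturbation [g + w] in the closed logarithmic image is lowered by [2 / (k + 1)] to
    become admissible, and [k] tends to infinity. *)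
Theorem dual_certificate : exists V : 'M[R]_(2, 3), V != 0 /\
  forall w : 'I_2 -> T -> R, (forall j, rint (w j)) ->
    (forall x, closure (log_image G) (\row_j (g j x + w j x))) ->
    \sum_j pint (w j) (kap s1 s2 (row j V)) <= - \sum_j c j * V j 0.
Proof.
have Cinc k m : (k <= m)%N -> C k `<=` C m.
  move=> km _ [u [ru Lu] <-]; exists u => //; split => // x.
  apply: (log_image_le reinG (Lu x)) => j; rewrite !mxE lerD2l.
  by rewrite lef_pV2 ?posrE ?ltr0n // ler_nat.
have lowL (w : 'I_2 -> T -> R) k : (forall j, rint (w j)) ->
    (forall x, closure (log_image G) (\row_j (g j x + w j x))) ->
    adm k (fun j x => g j x + w j x - 2 * (k.+1%:R)^-1).
  move=> rw Lw; have k0 : 0 < (k.+1%:R)^-1 :> R by rewrite invr_gt0 ltr0n.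
  split=> [j|x]; first by apply: rintB; [exact: rintD|exact: rint_cst].
  apply: (closure_log_lower reinG (Lw x)) => j; rewrite !mxE.
  by move: k0 (g j x) (w j x); move: (_^-1) => y y0 a b; lra.
have [|v v0 Hv] := limit_separation data_convex _ Cinc data_not_closure.
  have z0 : forall x, closure (log_image G) (\row_j (g j x + 0)).
    by move=> x; have := @gL x; congr closure; apply/rowP => j; rewrite !mxE addr0.
  eexists; eexists; last reflexivity; apply: (lowL (fun _ _ => 0)) => // j; exact: (@rint_cst R 0).
exists (vec_mx v); split.
  by apply: contra_neq v0 => h; rewrite -(vec_mxK v) h linear0.
move=> w rw Lw; set V := vec_mx v.
have sE (u : 'I_2 -> T -> R) : (forall j, rint (u j)) ->
    dot v (mxvec (data u)) = \sum_j pint (u j) (kap s1 s2 (row j V)).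
  move=> ru; rewrite dot_mxvec; apply: eq_bigr => j _; rewrite pint_kap //.
  by apply: eq_bigr => i _; rewrite !mxE.
have ck j : kcont (kap s1 s2 (row j V)) by exact: kcont_kap.
have p1 j d : pint (fun=> d) (kap s1 s2 (row j V)) = d * V j 0.
  have h := pint1_kap s1D s2D (row j V).
  rewrite mxE in h; rewrite -h -pintZ //; last exact: rint_cst.
  by congr pint; apply/funext => x; rewrite mulr1.
apply: (@le_vanishing _ (\sum_j V j 0)) => k.
have := Hv k (mxvec (data (fun j x => g j x + w j x - 2 * (k.+1%:R)^-1))).
rewrite /x0 !sE //; last by move=> j; apply: rintB; [exact: rintD|exact: rint_cst].
have e1 : \sum_j pint (fun x => g j x + w j x - 2 * (k.+1%:R)^-1) (kap s1 s2 (row j V)) =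
    \sum_j pint (g j) (kap s1 s2 (row j V)) + (\sum_j pint (w j) (kap s1 s2 (row j V)) -
    2 * (k.+1%:R)^-1 * \sum_j V j 0).
  rewrite mulr_sumr -sumrB -big_split; apply: eq_bigr => j _ /=.
  rewrite pintB ?pintD ?p1 ?addrA //; [exact: rintD|exact: rint_cst].
have e2 : \sum_j pint (fun x => g j x - c j) (kap s1 s2 (row j V)) =
    \sum_j pint (g j) (kap s1 s2 (row j V)) - \sum_j c j * V j 0.
  by rewrite -sumrB; apply: eq_bigr => j _; rewrite pintB ?p1 //; exact: rint_cst.
rewrite e1 e2 lerD2l; apply.
by eexists; last reflexivity; exact: lowL.
Qed.

End certificate.

(** * The kernels as quadratic polynomials on the circle *)

Section circle_zeros.
Context {R : realType}.
Local Notation Re := (@complex.Re R).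
Local Notation Im := (@complex.Im R).
Local Notation T := (borel_circle R).
Local Notation arc := (@arc_length R).

Lemma ae_circle_val_neq (a : R[i]) : {ae arc, forall x, circle_val x <> a}.
Proof.
have [[x0 <-]|no] := pselect (exists x0 : T, circle_val x0 = a); last first.
  by apply: aeW => x h; apply: no; exists x.
exists [set x0]; split; [|exact: arc_set1|].
- have -> : [set x0] = (fun x : T => cabs (circle_val x - circle_val x0) ^+ 2) @^-1` [set 0].
    apply/seteqP; split=> [x /= ->|x /= /eqP]; first by rewrite subrr cabs0 expr0n.
    rewrite sqrf_eq0 cabs_eq0 subr_eq0 => /eqP h; exact: val_inj h.
  rewrite -[X in measurable X]setTI; apply: (measurable_dist_sqr (circle_val x0)) => //.
- by move=> x /= h; apply: val_inj; apply: contrapT => nh; apply: h.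
Qed.

Lemma quadratic_zeros (c0 c1 c2 : R[i]) : [\/ c0 != 0, c1 != 0 | c2 != 0] ->
  exists a b : R[i], forall z, c0 + c1 * z + c2 * z ^+ 2 = 0 -> z = a \/ z = b.
Proof.
move=> nz; pose P z := c0 + c1 * z + c2 * z ^+ 2.
have [[a Pa]|no] := pselect (exists a, P a = 0); last first.
  by exists 0, 0 => z hz; exfalso; apply: no; exists z.
have [[b [ab Pb]]|no] := pselect (exists b, b <> a /\ P b = 0); last first.
  exists a, a => z hz; left; apply: contrapT => za; apply: no; by exists z.
exists a, b => z Pz; apply: contrapT => /not_orP[za zb].
have ba0 : b - a != 0 by rewrite subr_eq0; apply/eqP.
have z1 : z - a != 0 by rewrite subr_eq0; apply/eqP.
have z2 : z - b != 0 by rewrite subr_eq0; apply/eqP.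
have h1 : (b - a) * (c1 + c2 * (a + b)) = 0.
  have -> : (b - a) * (c1 + c2 * (a + b)) = P b - P a by rewrite /P; ring.
  by rewrite Pa Pb subrr.
have h1' : c1 + c2 * (a + b) = 0 by move/eqP: h1; rewrite mulf_eq0 (negbTE ba0) => /eqP.
have h2 : c2 * ((z - a) * (z - b)) = 0.
  have -> : c2 * ((z - a) * (z - b)) = P z - P a - (c1 + c2 * (a + b)) * (z - a) by rewrite /P; ring.
  by rewrite -/(P z) in Pz; rewrite Pz Pa h1' mul0r !subrr.
have c20 : c2 = 0 by move/eqP: h2; rewrite !mulf_eq0 (negbTE z1) (negbTE z2) !orbF => /eqP.
have c10 : c1 = 0 by move: h1'; rewrite c20 mul0r addr0.
have c00 : c0 = 0 by move: Pa; rewrite /P c20 c10 !mul0r !addr0.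
by case: nz; rewrite ?c20 ?c10 ?c00 eqxx.
Qed.

Variables s1 s2 : R[i].
Hypotheses (s1D : cabs s1 < 1) (s2D : cabs s2 < 1).

(** Chosen so that [Re (kcoef a * w)] is the combination of [Re w] and [Im w] with the last two
    entries of [a] as coefficients. *)
Definition kcoef (a : 'rV[R]_3) : R[i] := a 0 1 +i* - a 0 (lift ord0 (lift ord0 ord0)).

(* [z^* * kpoly a z] is the positive multiple [|z - s1|^2 |z - s2|^2] of [kap a z] on the
   circle. *)
Definition kpoly (a : 'rV[R]_3) (z : R[i]) : R[i] :=
  (a 0 0 * (1 - cabs s1 ^+ 2))%:C * ((z - s2) * (1 - s2^* * z)) +
  kcoef a * ((1 - s1^* * z) * (1 - s2^* * z)) + (kcoef a)^* * ((z - s1) * (z - s2)).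

Lemma kap3 a z : kap s1 s2 a z = a 0 0 * pk s1 z + Re (kcoef a * dk s1 s2 z).
Proof.
rewrite /kap !big_ord_recl big_ord0 addr0 /ker /=.
have -> : lift ord0 ord0 = 1 :> 'I_3 by apply: val_inj.
by rewrite /= ReM /kcoef /=; ring.
Qed.

(** On the circle [1 - conj s * z = z * conj (z - s)], which turns each product in [kpoly] into [z]
    times a term of the kernel after clearing denominators. *)
Lemma kpolyE a z : cabs z = 1 ->
  z^* * kpoly a z = (kap s1 s2 a z * (cabs (z - s1) ^+ 2 * cabs (z - s2) ^+ 2))%:C.
Proof.
move=> z1; have zz : z * z^* = 1 by rewrite mulrJ z1 expr1n.
have d1 : z - s1 != 0 by apply: sub_neq0; rewrite z1.
have d2 : z - s2 != 0 by apply: sub_neq0; rewrite z1.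
have J (s : R[i]) : 1 - s^* * z = z * (z - s)^* by rewrite rmorphB /= mulrBr zz (mulrC z).
rewrite kap3 pkE // mulrDl.
have p1 : a 0 0 * ((1 - cabs s1 ^+ 2) / cabs (z - s1) ^+ 2) * (cabs (z - s1) ^+ 2 * cabs (z - s2) ^+ 2) =
    a 0 0 * (1 - cabs s1 ^+ 2) * cabs (z - s2) ^+ 2.
  by field; rewrite cabs_eq0.
rewrite p1; set b := kcoef a.
have p2 : (Re (b * dk s1 s2 z) * (cabs (z - s1) ^+ 2 * cabs (z - s2) ^+ 2))%:C =
    b * z * ((z - s1)^* * (z - s2)^*) + (b * z)^* * ((z - s1) * (z - s2)).
  set W := cabs (z - s1) ^+ 2 * _.
  have WE : W%:C = (z - s1) * (z - s1)^* * ((z - s2) * (z - s2)^*) by rewrite !mulrJ -rmorphM.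
  have -> : Re (b * dk s1 s2 z) * W = Re (b * dk s1 s2 z * W%:C).
    by rewrite [RHS]ReM ReC ImC mulr0 subr0.
  have -> : b * dk s1 s2 z * W%:C = 2%:C * (b * z * ((z - s1)^* * (z - s2)^*)).
    rewrite WE /dk; move: (z - s1)^* (z - s2)^* => x y; field; by rewrite d1 d2.
  have R2 (w : R[i]) : (Re (2%:C * w))%:C = w + w^* by apply: complexP; rewrite !ReImE; ring.
  by rewrite R2 !rmorphM /= !conjK.
have zJ : z^* != 0 by rewrite -cabs_gt0 cabsJ z1.
have addC (x y : R) : (x + y)%:C = x%:C + y%:C by rewrite rmorphD.
have mulC (x y : R) : (x * y)%:C = x%:C * y%:C by rewrite rmorphM.
rewrite addC p2 (mulC (a 0 0 * _)) -(mulrJ (z - s2)) /kpoly -/b !J (rmorphM _ b z) /=.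
move: (z - s1) (z - s2) (z - s1)^* (z - s2)^* (b^*) (_%:C) => x y x' y' b' A.
have -> : z^* * (A * (y * (z * y')) + b * (z * x' * (z * y')) + b' * (x * y)) =
  (z * z^*) * (A * (y * y')) + (z * z^*) * (b * z * (x' * y')) + b' * z^* * (x * y) by ring.
by rewrite zz !mul1r addrA.
Qed.

(** The polynomial has degree at most two. If it vanished identically, its value at [s2] would give
    [kcoef a = 0], and then its value at 1 would give [a = 0]. *)
Lemma kpoly_zeros (a : 'rV[R]_3) : a != 0 ->
  exists z1 z2 : R[i], forall z, kpoly a z = 0 -> z = z1 \/ z = z2.
Proof.
move=> a0; pose A : R[i] := (a 0 0 * (1 - cabs s1 ^+ 2))%:C; pose b := kcoef a; pose b' := b^*.
pose c0 := - A * s2 + b + b' * (s1 * s2).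
pose c1 := A * (1 + s2 * s2^*) - b * (s1^* + s2^*) - b' * (s1 + s2).
pose c2 := - A * s2^* + b * (s1^* * s2^*) + b'.
have E z : kpoly a z = c0 + c1 * z + c2 * z ^+ 2.
  by rewrite /kpoly -/A -/b -/b' /c0 /c1 /c2; ring.
suff /quadratic_zeros[z1 [z2 H]] : [\/ c0 != 0, c1 != 0 | c2 != 0].
  by exists z1, z2 => z; rewrite E; exact: H.
apply: contrapT => no.
have E0 z : kpoly a z = 0.
  rewrite E; have [h0|h0] := eqVneq c0 0; last by exfalso; apply: no; apply: Or31.
  have [h1|h1] := eqVneq c1 0; last by exfalso; apply: no; apply: Or32.
  have [h2|h2] := eqVneq c2 0; last by exfalso; apply: no; apply: Or33.
  by rewrite h0 h1 h2 !mul0r !addr0.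
have n1 (s z : R[i]) : cabs s < 1 -> cabs z <= 1 -> 1 - s^* * z != 0.
  move=> ss zz; apply: sub_neq0; rewrite cabs1 cabsM cabsJ.
  by apply: le_lt_trans ss; rewrite ler_piMr ?cabs_ge0.
have b0 : b = 0.
  move: (E0 s2); rewrite /kpoly subrr !(mul0r, mulr0) add0r addr0 => /eqP.
  rewrite !mulf_eq0 -/b (negbTE (n1 _ _ s1D (ltW s2D))) (negbTE (n1 _ _ s2D (ltW s2D))) !orbF.
  by move/eqP.
have A0 : A = 0.
  move: (E0 1); rewrite /kpoly -/b b0 rmorph0 !mul0r !addr0 => /eqP; rewrite !mulf_eq0 -/A.
  have c1le : cabs (1 : R[i]) <= 1 by rewrite cabs1.
  rewrite (negbTE (n1 _ _ s2D c1le)) orbF => /orP[/eqP //|].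
  by rewrite (negbTE (sub_neq0 (z := 1) _)) // cabs1.
have a00 : a 0 0 = 0.
  move: A0 => /(congr1 Re); rewrite ReC => /eqP; rewrite mulf_eq0.
  have : 0 < 1 - cabs s1 ^+ 2 by rewrite subr_gt0 expr_lt1 ?cabs_ge0.
  by move=> h; rewrite (gt_eqF h) orbF => /eqP.
move/eqP: a0; apply; apply/rowP => i; rewrite mxE.
have a01 : a 0 1 = 0 by have := congr1 Re b0.
have a02 : a 0 (lift ord0 (lift ord0 ord0)) = 0.
  by have /eqP := congr1 Im b0; rewrite /b /kcoef /= oppr_eq0 => /eqP.
case: i => [[|[|[|//]]] hi].
- by rewrite -a00; congr (a 0 _); exact: val_inj.
- by rewrite -a01; congr (a 0 _); exact: val_inj.
- by rewrite -a02; congr (a 0 _); exact: val_inj.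
Qed.

Lemma ae_kap_neq0 (a : 'rV[R]_3) : a != 0 ->
  {ae arc, forall x, kap s1 s2 a (circle_val x) != 0}.
Proof.
move=> /kpoly_zeros[z1 [z2 H]].
apply: ae_sub (ae_and (ae_circle_val_neq z1) (ae_circle_val_neq z2)) => x [h1 h2].
apply/eqP => k0; have x1 := cabs_circle_val x.
have := kpolyE a x1; rewrite k0 mul0r => /eqP; rewrite mulf_eq0 => /orP[/eqP e|/eqP/H[]//].
by have := cabsJ (circle_val x); rewrite e cabs0 x1 => /eqP; rewrite eq_sym oner_eq0.
Qed.

End circle_zeros.

(** * Sign, complementary slackness and normality from the certificate *)

Section certificate_consequences.
Context {R : realType}.
Local Notation T := (borel_circle R).
Local Notation arc := (@arc_length R).

Lemma closure_log_le_mono (G : set 'rV[R[i]]_2) (x y : 'rV[R]_2) : complete_reinhardt G ->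
  closure (log_image G) x -> (forall j, y 0 j <= x 0 j) -> closure (log_image G) y.
Proof.
move=> reinG clx yx; apply/closure_rowP => e e0; exists (\row_j (y 0 j - e / 2)).
  apply: (closure_log_lower reinG clx) => j; rewrite mxE; apply: lt_le_trans (yx j).
  by rewrite gtrBl divr_gt0.
move=> j; rewrite mxE addrAC subrr add0r normrN gtr0_norm ?divr_gt0 //.
by rewrite ltr_pdivrMr // ltr_pMr // ltr1n.
Qed.

Variables (G : set 'rV[R[i]]_2) (s1 s2 : R[i]) (g : 'I_2 -> T -> R) (c : 'I_2 -> R) (V : 'M[R]_(2, 3)).
Hypothesis reinG : complete_reinhardt G.
Hypotheses (s1D : cabs s1 < 1) (s2D : cabs s2 < 1).
Hypotheses (rg : forall j, rint (g j)) (gL : forall x, closure (log_image G) (\row_j g j x)).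
Hypothesis c0 : forall j, 0 <= c j.
Hypothesis cert : forall w : 'I_2 -> T -> R, (forall j, rint (w j)) ->
  (forall x, closure (log_image G) (\row_j (g j x + w j x))) ->
  \sum_j pint (w j) (kap s1 s2 (row j V)) <= - \sum_j c j * V j 0.

Let K j x := kap s1 s2 (row j V) (circle_val x).
Let ck j : kcont (kap s1 s2 (row j V)). Proof. exact: kcont_kap. Qed.
Let rK j : rint (K j).
Proof.
have := rintK (@rint_cst R 1) (@ck j).
by rewrite (_ : (fun x => 1 * _) = K j) //; apply/funext => x; rewrite mul1r.
Qed.
Let E j : set T := [set x | 0 < - K j x].
Let mE j : measurable (E j).
Proof.
have -> : E j = K j @^-1` `]-oo, 0[ by apply/seteqP; split => x; rewrite /E /= in_itv /= oppr_gt0.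
by rewrite -[X in measurable X]setTI; apply: (rint_measurable (rK j)).
Qed.
Let r1E j : rint (\1_(E j) : T -> R).
Proof.
have := rint_indic (mE j) (@rint_cst R 1).
by rewrite (_ : (fun x => 1 * _) = \1_(E j)) //; apply/funext => x; rewrite mul1r.
Qed.

Let p0 j : pint (fun=> 0 : R) (kap s1 s2 (row j V)) = 0.
Proof.
by have := pintZ 0 (@rint_cst R 0) (@ck j); rewrite !mul0r.
Qed.

(** Lowering [g j] by [N] where its kernel is negative stays in the closed lower set. A negative
    integral there would make the left side of the certificate grow without bound with [N]. *)
Lemma pint_neg_part j : 0 <= pint (\1_(E j) : T -> R) (kap s1 s2 (row j V)).
Proof.
rewrite leNgt; apply/negP => neg; set m := pint _ _ in neg.
pose C := - \sum_j c j * V j 0.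
have H (N : R) : 0 <= N -> - N * m <= C.
  move=> N0; pose w i x := if i == j then - N * \1_(E j) x else 0.
  have rw i : rint (w i).
    rewrite /w; case: (i == j); last exact: (@rint_cst R 0).
    exact: rintZ.
  have := @cert w rw; rewrite (bigD1 j) //= big1 => [|i ij]; last first.
    by rewrite (_ : w i = (fun=> 0)) ?p0 //; apply/funext => x; rewrite /w (negbTE ij).
  rewrite addr0 (_ : w j = (fun x => - N * \1_(E j) x)); last by apply/funext => x; rewrite /w eqxx.
  rewrite pintZ //; apply => x; apply: (closure_log_le_mono reinG (@gL x)) => i; rewrite !mxE.
  rewrite gerDl /w; case: (i == j) => //; rewrite mulNr oppr_le0 mulr_ge0 //.
have := H ((`|C| + 1) / (- m)); rewrite divr_ge0 ?addr_ge0 // ?oppr_ge0 ?(ltW neg) // => /(_ isT).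
have -> : - ((`|C| + 1) / - m) * m = `|C| + 1 by field; rewrite lt_eqF.
by have := ler_norm C; move: `|C| => y; lra.
Qed.

Lemma ae_kap_ge0 j : {ae arc, forall x, 0 <= K j x}.
Proof.
have rN : rint (fun x => - K j x).
  by rewrite (_ : (fun x => - K j x) = (fun x => (-1) * K j x)); [exact: rintZ|apply/funext => x; rewrite mulN1r].
have : {ae arc, forall x, - K j x <= 0}.
  apply: ae_le0 => //; rewrite -/(E j).
  have -> : \int[arc]_x (- K j x * \1_(E j) x) = - \int[arc]_x (\1_(E j) x * K j x).
    rewrite -[RHS]mulN1r -RintegralZl //; last exact: (rintK (r1E j) (@ck j)).
    by apply: eq_Rintegral => x _; ring.
  rewrite oppr_le0; have := pint_neg_part j; rewrite pmulr_rge0 // invr_gt0; exact: twopi_gt0.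
by apply: ae_sub => x; rewrite oppr_le0.
Qed.

Let part j : \int[arc]_x (K j x * \1_([set x | 0 < K j x]) x) =
  \int[arc]_x (K j x) - \int[arc]_x (\1_(E j) x * K j x).
Proof.
rewrite -RintegralB //; [|exact: rK|exact: (rintK (r1E j) (@ck j))].
apply: eq_Rintegral => x _; rewrite !indicE.
have -> : (x \in E j) = (K j x < 0) by apply/idP/idP; rewrite inE /E /= oppr_gt0.
have -> : (x \in [set x | 0 < K j x]) = (0 < K j x) by apply/idP/idP; rewrite inE.
by case: (ltrgtP (K j x) 0) => [_|_|->] /=; rewrite ?(mulr0, mulr1, mul1r, mul0r, subrr, subr0).
Qed.

Lemma V0_int j : V j 0 = (2 * pi)^-1 * \int[arc]_x K j x.
Proof.
have := pint1_kap s1D s2D (row j V); rewrite mxE => <-; congr (_ * _).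
by apply: eq_Rintegral => x _; rewrite mul1r.
Qed.

Lemma V0_ge0 j : 0 <= V j 0.
Proof.
have i0 : 0 <= (2 * pi : R)^-1 by rewrite invr_ge0 ltW // twopi_gt0.
rewrite V0_int mulr_ge0 //.
have : 0 <= \int[arc]_x (K j x * \1_([set x | 0 < K j x]) x).
  apply: Rintegral_ge0 => x _; rewrite indicE.
  have [xE|xE] := boolP (x \in _); last by rewrite mulr0.
  by rewrite mulr1 ltW //; move: xE; rewrite inE.
rewrite part; have := pint_neg_part j; rewrite /pint pmulr_rge0 ?invr_gt0 ?twopi_gt0 // => h.
by rewrite subr_ge0; apply: le_trans.
Qed.

(** [V j 0] is the mean of the kernel. A nonnegative kernel of mean 0 vanishes almost everywhere,
    whereas a nonzero row leaves it at most two zeros on the circle. *)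
Lemma V0_eq0 j : V j 0 = 0 -> row j V = 0.
Proof.
move=> V0; apply/eqP; apply: contrapT => /negP V1.
have K0 : \int[arc]_x K j x = 0.
  by move/eqP: V0; rewrite V0_int mulf_eq0 invr_eq0 gt_eqF ?twopi_gt0 // => /eqP.
have aeP : {ae arc, forall x, K j x <= 0}.
  apply: ae_le0; first exact: rK.
  rewrite part K0 sub0r oppr_le0.
  by have := pint_neg_part j; rewrite /pint pmulr_rge0 // invr_gt0 twopi_gt0.
have : {ae arc, forall x : T, False}.
  apply: ae_sub (ae_and (ae_and aeP (ae_kap_ge0 j)) (ae_kap_neq0 s1D s2D V1)) => x [[h1 h2] h3].
  by move/eqP: h3; apply; apply/eqP; rewrite eq_le h1 h2.
move=> [N [mN N0 sub]].
have NT : N = setT by apply/seteqP; split=> // x _; apply: sub.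
have := @fine_arc R; rewrite -NT N0 /= => h; have := @twopi_gt0 R; by rewrite -h ltxx.
Qed.

(** Complementary slackness: testing with [w = 0] bounds by 0 a sum of nonnegative terms. *)
Lemma cV0 j : c j * V j 0 = 0.
Proof.
have H : \sum_j c j * V j 0 <= 0.
  have := @cert (fun _ _ => 0) (fun _ => @rint_cst R 0).
  rewrite big1 => [|i _]; last exact: p0.
  rewrite oppr_ge0; apply => x; have := @gL x; congr closure.
  by apply/rowP => i; rewrite !mxE addr0.
apply/eqP; rewrite eq_le (mulr_ge0 (c0 j) (V0_ge0 j)) andbT.
apply: le_trans H; rewrite (bigD1 j) //= lerDl; apply: sumr_ge0 => i _.
by rewrite mulr_ge0 // V0_ge0.
Qed.

Lemma row_eq0 j : 0 < c j -> row j V = 0.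
Proof. by move=> cj; apply: V0_eq0; move/eqP: (cV0 j); rewrite mulf_eq0 gt_eqF // => /eqP. Qed.

(** Moving [g] to [y] on the set [F] where the sum is positive is an admissible test, and by [cV0]
    the right side of the certificate is 0. *)
Lemma ae_normal (y : 'rV[R]_2) : log_image G y ->
  {ae arc, forall x, \sum_j (y 0 j - g j x) * K j x <= 0}.
Proof.
move=> Ly.
have ry j : rint (fun x => y 0 j - g j x) by apply: rintB => //; exact: rint_cst.
have ryK j : rint (fun x => (y 0 j - g j x) * K j x) by exact: (rintK (ry j) (@ck j)).
have rh : rint (fun x => \sum_j (y 0 j - g j x) * K j x) by apply: rint_sum.
apply: ae_le0 => //; set F := [set x | _].
have mF : measurable F.
  have -> : F = (fun x => \sum_j (y 0 j - g j x) * K j x) @^-1` `]0, +oo[.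
    by apply/seteqP; split => x; rewrite /F /= in_itv /= andbT.
  by rewrite -[X in measurable X]setTI; apply: (rint_measurable rh).
have rw j : rint (fun x => (y 0 j - g j x) * \1_F x) by exact: rint_indic.
have := @cert (fun j x => (y 0 j - g j x) * \1_F x) rw.
have -> : \sum_j c j * V j 0 = 0 by rewrite big1 // => j _; exact: cV0.
rewrite oppr0.
have -> : \sum_j pint (fun x => (y 0 j - g j x) * \1_F x) (kap s1 s2 (row j V)) =
    (2 * pi)^-1 * \int[arc]_x ((\sum_j (y 0 j - g j x) * K j x) * \1_F x).
  rewrite sumI2 /pint -mulrDr -RintegralD //; [|exact: (rintK (rw 0) (@ck 0))|exact: (rintK (rw 1) (@ck 1))].
  by congr (_ * _); apply: eq_Rintegral => x _; rewrite sumI2 /K; ring.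
rewrite pmulr_rle0 ?invr_gt0 ?twopi_gt0 //; apply => x.
rewrite indicE; case: (x \in F).
  by apply: subset_closure; move: Ly; congr log_image; apply/rowP => j; rewrite !mxE /= mulr1 subrKC.
by have := @gL x; congr closure; apply/rowP => j; rewrite !mxE /= mulr0 addr0.
Qed.

End certificate_consequences.

(** * Herglotz integrals as integrals against charges with density *)

HB.instance Definition _ (R : realType) :=
  @Measure_isFinite.Build _ _ _ (@arc_length R)
    (lty_fin_num_fun (@arc_lty R)).

Section charge_density.
Context {R : realType}.
Local Notation T := (borel_circle R).
Local Notation arc := (@arc_length R).
Variables (u : T -> R) (iu : rint u).

Definition density_charge : {charge set T -> \bar R} := induced_charge iu.

(** Both Jordan parts are absolutely continuous with respect to arc length, and the difference of
    their Radon-Nikodym derivatives is [u] almost everywhere, whichever Hahn decomposition is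
    taken. *)
Lemma jordan_Rintegral (P N : set T) (H : hahn_decomposition density_charge P N) (K : T -> R) (M : R) :
  measurable_fun setT K -> (forall x, `|K x| <= M) ->
  \int[jordan_pos H]_x K x - \int[jordan_neg H]_x K x = \int[arc]_x (u x * K x).
Proof.
move=> mK KM.
have bK : [bounded K x | x in [set: T]].
  by exists M; split; [exact: num_real|move=> y My x _ /=; rewrite (le_trans (KM x)) // ltW].
have dom : density_charge `<< arc.
  apply/null_content_dominatesP => A mA A0; apply: null_set_integral => //.
  by apply: measurable_funTS; exact: (measurable_int arc iu).
have dp : jordan_pos H `<< arc by exact: jordan_pos_dominates.
have dn : jordan_neg H `<< arc by exact: jordan_neg_dominates.
pose fp := Radon_Nikodym (charge_of_finite_measure (jordan_pos H)) arc.
pose fn := Radon_Nikodym (charge_of_finite_measure (jordan_neg H)) arc.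
have ifp : arc.-integrable setT fp by exact: Radon_Nikodym_integrable.
have ifn : arc.-integrable setT fn by exact: Radon_Nikodym_integrable.
have iK (m : {finite_measure set T -> \bar R}) : m.-integrable setT (EFin \o K).
  apply: measurable_bounded_integrable => //.
  by apply: fin_num_fun_lty => A mA; exact: fin_num_measure.
have ep : (\int[jordan_pos H]_x (K x)%:E = \int[arc]_x ((K x)%:E * fp x))%E.
  by rewrite -(@Radon_Nikodym_change_of_variables _ _ _ _ _ dp (EFin \o K) setT).
have en : (\int[jordan_neg H]_x (K x)%:E = \int[arc]_x ((K x)%:E * fn x))%E.
  by rewrite -(@Radon_Nikodym_change_of_variables _ _ _ _ _ dn (EFin \o K) setT).
have iKp : arc.-integrable setT (fun x => (K x)%:E * fp x)%E by exact: (integrableMr measurableT mK bK ifp).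
have iKn : arc.-integrable setT (fun x => (K x)%:E * fn x)%E by exact: (integrableMr measurableT mK bK ifn).
rewrite /Rintegral ep en -fineB ?integrable_fin_num // -integralB //; congr fine.
have aeu : ae_eq arc setT (fun x => fp x - fn x)%E (EFin \o u).
  apply: integral_ae_eq => //; first exact: integrableB.
    by apply: measurable_int iu.
  move=> A _ mA; rewrite integralB //; [|exact: integrableS ifp|exact: integrableS ifn].
  rewrite -Radon_Nikodym_integral // -Radon_Nikodym_integral //.
  have := jordan_decomp H mA; rewrite /cadd /= cscaleN1 => <-.
  by [].
apply: ae_eq_integral => //.
- by apply: (measurable_int arc); exact: integrableB.
- by apply/measurable_EFinP; apply: measurable_funM => //; exact: rint_measurable.
apply: filterS aeu => x /(_ I) /= h _.
have fpx : fp x \is a fin_num by exact: Radon_Nikodym_fin_num.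
have fnx : fn x \is a fin_num by exact: Radon_Nikodym_fin_num.
by rewrite -muleBr ?fin_num_adde_defr // h -EFinM mulrC.
Qed.

Lemma charge_integral_density (F : R[i] -> R[i]) : ccont F ->
  charge_integral density_charge (fun x => F (circle_val x)) =
  cint arc setT (fun x => (u x)%:C * F (circle_val x)).
Proof.
move=> cF; have [M _ HM] := ccont_bounded cF; have [m1 m2] := cmeasurable_ccont cF.
have HM' x : cabs (F (circle_val x)) <= M by apply: HM; exact: cabs_circle_val.
rewrite /charge_integral /complex_integral; apply: complexP; rewrite ?ReB ?ImB ?Re_cint ?Im_cint.
  rewrite (@jordan_Rintegral _ _ _ _ M) //; last by move=> x; exact: le_trans (Re_le_cabs _) (HM' x).
  by apply: eq_Rintegral => x _; rewrite ReM ReC ImC mul0r subr0.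
rewrite (@jordan_Rintegral _ _ _ _ M) //; last by move=> x; exact: le_trans (Im_le_cabs _) (HM' x).
by apply: eq_Rintegral => x _; rewrite ImM ReC ImC mul0r addr0.
Qed.

End charge_density.

(** * One null set for all points of the logarithmic image *)

Section normal_strict.
Context {R : realType}.
Local Notation T := (borel_circle R).
Local Notation arc := (@arc_length R).
Variables (G : set 'rV[R[i]]_2) (g K : 'I_2 -> T -> R).
Hypothesis reinG : complete_reinhardt G.
Hypothesis K0 : forall j, {ae arc, forall x, 0 <= K j x}.
Hypothesis nor : forall y : 'rV[R]_2, log_image G y ->
  {ae arc, forall x, \sum_j (y 0 j - g j x) * K j x <= 0}.

(** Each point of the logarithmic image lies strictly below a rational point of it in both
    coordinates, and the kernels are nonnegative, so countably many inequalities suffice. The margin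
    [e] later yields the strict inequality of [Pset]. *)
Lemma ae_normal_all : {ae arc, forall x, forall y, log_image G y -> exists2 e : R, 0 < e &
  \sum_j (y 0 j + e - g j x) * K j x <= 0}.
Proof.
pose Q n : 'rV[R]_2 := let p := odflt (0, 0) (unpickle n : option (rat * rat)) in
  \row_j (if j == 0 then ratr p.1 else ratr p.2).
have aeQ : {ae arc, forall x, forall n, log_image G (Q n) -> \sum_j (Q n 0 j - g j x) * K j x <= 0}.
  apply: ae_foralln => n; have [Ln|nLn] := pselect (log_image G (Q n)).
    by apply: ae_sub (nor Ln) => x h _.
  by apply: aeW.
apply: ae_sub (ae_and aeQ (ae_and (K0 0) (K0 1))) => x [H [k0 k1]] y Ly.
have [e e0 Le] := log_image_raise reinG Ly.
have ye (a : R) : a < a + e by rewrite ltrDl.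
have [p pr] := rat_in_itvoo (ye (y 0 0)); have [q qr] := rat_in_itvoo (ye (y 0 1)).
move: pr qr; rewrite !in_itv /= => /andP[p1 p2] /andP[q1 q2].
have QE : Q (pickle (p, q)) = \row_j (if j == 0 then ratr p else ratr q) by rewrite /Q pickleK.
have LQ : log_image G (Q (pickle (p, q))).
  by apply: (log_image_le reinG Le) => j; rewrite QE !mxE; case: (ord2P j) => -> /=; exact: ltW.
have := H _ LQ; rewrite QE !sumI2 !mxE /=.
exists (Num.min (ratr p - y 0 0) (ratr q - y 0 1)); first by rewrite lt_min !subr_gt0 p1.
set m := Num.min _ _.
have m1 : m <= ratr p - y 0 0 by rewrite ge_min lexx.
have m2 : m <= ratr q - y 0 1 by rewrite ge_min lexx orbT.
rewrite sumI2; apply: le_trans (_ : (ratr p - g 0 x) * K 0 x + (ratr q - g 1 x) * K 1 x <= 0) => //.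
by apply: lerD; apply: ler_wpM2r => //; [move: m1|move: m2]; lra.
Qed.

End normal_strict.

(** * Coordinate functions, boundary values and supporting lines *)

Section coordinates.
Context {R : realType}.
Local Notation Re := (@complex.Re R).
Local Notation Im := (@complex.Im R).
Local Notation T := (borel_circle R).
Local Notation arc := (@arc_length R).

Lemma eq_aut_disc (B I : R[i] -> R[i]) :
  (forall z, cabs z < 1 -> I z = B z) -> aut_disc I -> aut_disc B.
Proof.
move=> E [[hI I1] [I' [hI' I1'] K]]; split.
  split; first by apply/holomorphic_on_hol; apply: (eq_hol E); exact/holomorphic_on_hol.
  by move=> z z1; rewrite -E; [exact: I1|rewrite -disc_cabs].
exists I' => // z z1; have [k1 k2] := K z z1; split; first by rewrite -E // -disc_cabs.
by rewrite -E // -disc_cabs; exact: I1'.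
Qed.

(** A uniform form of the trichotomy: gain 0 with [q = I] in the two rigid cases, gain [- ln rho] in
    the third. *)
Lemma contractive_model (s1 s2 : R[i]) (I : R[i] -> R[i]) : cabs s1 < 1 -> cabs s2 < 1 ->
  hol 1 I -> (forall z, cabs z < 1 -> cabs (I z) <= 1) ->
  exists (q : R[i] -> R[i]) (c : R), [/\ 0 <= c, hol 1 q,
    forall z, cabs z < 1 -> cabs (q z) <= expR (- c), same_data s1 s2 q I &
    c = 0 -> aut_disc I \/ exists2 C, cabs C = 1 & forall z, cabs z < 1 -> I z = C].
Proof.
move=> s1D s2D hI I1.
have triv (P : Prop) : P -> exists (q : R[i] -> R[i]) (c : R), [/\ 0 <= c, hol 1 q,
    forall z, cabs z < 1 -> cabs (q z) <= expR (- c), same_data s1 s2 q I & c = 0 -> P].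
  by move=> p; exists I, 0; split => // z z1; rewrite oppr0 expR0; exact: I1.
case: (schwarz_pick_trichotomy s1D s2D hI I1) => [C|A|[q [rho [hq /andP[r0 r1] q1 sd]]]].
- by apply: triv; right.
- by apply: triv; left.
have c0 : 0 < - ln rho by rewrite oppr_gt0 ln_lt0 // r0.
exists q, (- ln rho); split => //; first exact: ltW.
  by move=> z z1; rewrite opprK lnK ?posrE //; exact: q1.
by move=> h; move: c0; rewrite h ltxx.
Qed.

(* If one coordinate vanishes identically, the other one is extremal in the disc of
   radius [r k]. *)
Lemma vanishing_coordinate (G : set 'rV[R[i]]_2) (r : 'I_2 -> R) (f : 'I_2 -> R[i] -> R[i])
    (s1 s2 : R[i]) (j k : 'I_2) : complete_reinhardt G -> (forall j, 0 < r j) ->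
  (forall j, [set z 0 j | z in G] = [set (r j)%:C * s | s in @disc R]) ->
  cabs s1 < 1 -> cabs s2 < 1 -> (forall j, hol 1 (f j)) ->
  (forall j z, cabs z < 1 -> cabs (f j z) < r j) ->
  (forall F c, 0 < c -> (forall j, hol 1 (F j)) -> (forall j, same_data s1 s2 (F j) (f j)) ->
    ~ (forall z, cabs z < 1 -> G (\row_j ((expR c)%:C * F j z)))) ->
  (forall i, i != k -> i = j) -> (forall z, cabs z < 1 -> f j z = 0) ->
  aut_disc (fun s => (r k)^-1%:C * f k s).
Proof.
move=> reinG r0 projG s1D s2D hf fr rigid kj fj.
pose I z := (r k)^-1%:C * f k z.
have hI : hol 1 I by apply: holZ; exact: hf.
have cI z : cabs (I z) = cabs (f k z) / r k.
  by rewrite cabsM cabsC gtr0_norm ?invr_gt0 // mulrC.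
have I1 z : cabs z < 1 -> cabs (I z) < 1 by move=> z1; rewrite cI ltr_pdivrMr // mul1r fr.
have z0 : cabs (0 : R[i]) < 1 by rewrite cabs0.
case: (schwarz_pick_trichotomy s1D s2D hI (fun z z1 => ltW (I1 z z1))) => [[C C1 IC]|//|].
  by have := I1 0 z0; rewrite IC // C1 ltxx.
move=> [q [rho [hq /andP[rho0 rho1] q1 sd]]]; exfalso.
pose F i z := if i == k then (r k)%:C * q z else 0.
have rk0 : (r k)%:C != 0 :> R[i] by rewrite -cabs_gt0 cabsC normr_gt0 gt_eqF.
(* Strictly between [rho] and 1, so that [a / rho] is a slack factor greater than 1 and the disc of
   radius [a * r k] is still covered by the projection. *)
pose a := (rho + 1) / 2.
have [a0 [a1 ra]] : 0 < a /\ a < 1 /\ 1 < a / rho.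
  have h : rho < a by rewrite /a; move: rho1; clear; lra.
  have h2 : 1 < a / rho by rewrite -[ltLHS](divff (lt0r_neq0 rho0)) ltr_pM2r ?invr_gt0.
  by split; [|split => //]; rewrite /a; move: rho0 rho1; clear; lra.
have c0 : 0 < ln (a / rho) by rewrite ln_gt0.
apply: (rigid F (ln (a / rho)) c0).
- move=> i; rewrite /F; case: (i == k); last exact: (@hol_cst R 1).
  by apply: holZ.
- move=> i; rewrite /F; have [->|/kj ->] := eqVneq i k.
    have -> : f k = (fun z => (r k)%:C * I z).
      by apply/funext => z; rewrite /I mulrA -rmorphM /= divff ?gt_eqF // mul1r.
    apply: same_dataM => //; [exact: (@hol_cst R 1)|exact: (@hol_cst R 1)].
  by apply: eq_same_data => //; [exact: (@hol_cst R 1)|move=> z z1; rewrite fj].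
move=> z z1.
have [w Gw wk] : [set z 0 k | z in G] ((a * r k)%:C).
  rewrite projG; exists a%:C; first by rewrite disc_cabs cabsC gtr0_norm.
  by rewrite -rmorphM mulrC.
apply: (reinhardt_le reinG Gw) => i; rewrite mxE /F.
have [->|_] := eqVneq i k; last by rewrite mulr0 cabs0 cabs_ge0.
have ar : 0 < a / rho by exact: lt_trans ra.
rewrite wk cabsC !cabsM !cabsC (gtr0_norm (expR_gt0 _)) lnK ?posrE // (gtr0_norm (mulr_gt0 a0 (r0 k))) (gtr0_norm (r0 k)).
apply: (@le_trans _ _ (a / rho * (r k * rho))).
  by rewrite ler_pM2l // ler_pM2l // q1.
by rewrite le_eqVlt; apply/orP; left; apply/eqP; field; rewrite gt_eqF.
Qed.

Lemma boundary_closure (G : set 'rV[R[i]]_2) (f : 'I_2 -> R[i] -> R[i]) (t : nat -> R)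
    (g : 'I_2 -> T -> R) : (forall z, cabs z < 1 -> G (\row_j f j z)) ->
  (forall n, 0 < t n < 1) ->
  {ae arc, forall x, forall j, (exists N, forall n, (N <= n)%N -> f j ((t n)%:C * circle_val x) != 0) /\
    ln (cabs (f j ((t n)%:C * circle_val x))) @[n --> \oo] --> g j x} ->
  {ae arc, forall x, closure (log_image G) (\row_j g j x)}.
Proof.
move=> Gf t01; apply: ae_sub => x H; apply/closure_rowP => e e0.
have near j : exists N, forall n, (N <= n)%N -> f j ((t n)%:C * circle_val x) != 0 /\
    `|ln (cabs (f j ((t n)%:C * circle_val x))) - g j x| < e.
  have [[N1 H1] /cvgrPdist_lt/(_ e e0)[N2 _ H2]] := H j.
  exists (maxn N1 N2) => n; rewrite geq_max => /andP[n1 n2]; split; first exact: H1.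
  by rewrite distrC; exact: H2.
have [N0 H0] := near 0; have [N1 H1] := near 1.
pose n := maxn N0 N1.
have Hn j : f j ((t n)%:C * circle_val x) != 0 /\ `|ln (cabs (f j ((t n)%:C * circle_val x))) - g j x| < e.
  by case: (ord2P j) => ->; [apply: H0; exact: leq_maxl|apply: H1; exact: leq_maxr].
exists (\row_j ln (cabs (f j ((t n)%:C * circle_val x)))).
  exists (\row_j f j ((t n)%:C * circle_val x)); split.
  - apply: Gf; rewrite cabsM cabsC cabs_circle_val mulr1.
    by have /andP[h1 h2] := t01 n; rewrite gtr0_norm.
  - by move=> j; rewrite mxE; exact: (Hn j).1.
  - by apply/rowP => j; rewrite !mxE.
by move=> j; rewrite !mxE; exact: (Hn j).2.
Qed.

Lemma cexp_im (t : R) : cexp (0 +i* t) = expi t.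
Proof. by rewrite /cexp /= expR0 mul1r. Qed.

Lemma base_DG (G : set 'rV[R[i]]_2) : base (DG G) = log_image G.
Proof.
apply/seteqP; split => [_ [z Dz <-] //|x Lx].
have E : re_vec (map_mx (fun a : R => a%:C) x) = x by apply/rowP => j; rewrite !mxE.
by exists (map_mx (fun a : R => a%:C) x) => //; rewrite /DG /tube /= E.
Qed.

Lemma hol_kpoly s1 s2 (a : 'rV[R]_3) z : exists l, cder (kpoly s1 s2 a) z l.
Proof.
have h : hol (cabs z + 1) (kpoly s1 s2 a).
  have hi : hol (cabs z + 1) (@id R[i]) by exact: hol_id.
  have hc (w : R[i]) : hol (cabs z + 1) (fun=> w) by exact: (@hol_cst R _ w).
  have h1 (s : R[i]) : hol (cabs z + 1) (fun z => z - s) by exact: (holB hi (hc s)).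
  have h2 (s : R[i]) : hol (cabs z + 1) (fun z => 1 - s^* * z) by apply: holB; [exact: (hc 1)|exact: (@holZ _ _ s^* id hi)].
  apply: holD; first apply: holD.
  - by apply: holZ; exact: (holM (h1 s2) (h2 s2)).
  - by apply: holZ; exact: (holM (h2 s1) (h2 s2)).
  - by apply: holZ; exact: (holM (h1 s1) (h1 s2)).
by apply: h; rewrite ltrDl.
Qed.

Lemma Hclass_kpoly s1 s2 (V : 'M[R]_(2, 3)) : cabs s1 < 1 -> cabs s2 < 1 ->
  @Hclass R 2 (fun z => \row_j kpoly s1 s2 (row j V) z).
Proof.
move=> s1D s2D; split=> [z _|z].
  have /choice[l Hl] : forall j : 'I_2, exists l, cder (kpoly s1 s2 (row j V)) z l.
    by move=> j; exact: hol_kpoly.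
  have [|//] := @cder_row_derivable R 2 (fun z => \row_j kpoly s1 s2 (row j V) z) z (\row_j l j).
  by move=> j; rewrite mxE; apply: eq_cder (Hl j) => w; rewrite mxE.
by rewrite norm1_cabs => z1 j; rewrite mxE kpolyE // ImC.
Qed.

(** By [kpolyE] the normal is the vector of kernels times the positive number [W]. The margin [e]
    and the nonvanishing of the first kernel make the supporting inequality strict. *)
Lemma Pset_kpoly (G : set 'rV[R[i]]_2) s1 s2 (V : 'M[R]_(2, 3)) (g : 'I_2 -> T -> R) x :
  cabs s1 < 1 -> cabs s2 < 1 -> closure (log_image G) (\row_j g j x) ->
  (forall j, 0 <= kap s1 s2 (row j V) (circle_val x)) ->
  kap s1 s2 (row 0 V) (circle_val x) != 0 ->
  (forall y : 'rV[R]_2, log_image G y -> exists2 e : R, 0 < e &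
    \sum_j (y 0 j + e - g j x) * kap s1 s2 (row j V) (circle_val x) <= 0) ->
  Pset (DG G) (re_vec ((circle_val x)^* *: \row_j kpoly s1 s2 (row j V) (circle_val x)))
    (\row_j g j x).
Proof.
move=> s1D s2D clg k0 kn H; rewrite /Pset base_DG; split => // y /H[e e0].
have x1 := cabs_circle_val x.
set W := cabs (circle_val x - s1) ^+ 2 * cabs (circle_val x - s2) ^+ 2.
have W0 : 0 < W.
  by rewrite mulr_gt0 // exprn_gt0 // cabs_gt0; apply: sub_neq0; rewrite x1.
have -> : dot (y - \row_j g j x) (re_vec ((circle_val x)^* *: \row_j kpoly s1 s2 (row j V) (circle_val x))) =
    W * \sum_j (y 0 j - g j x) * kap s1 s2 (row j V) (circle_val x).
  rewrite /dot mulr_sumr; apply: eq_bigr => j _; rewrite !mxE kpolyE // ReC -/W; ring.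
rewrite pmulr_rlt0 // !sumI2.
have := k0 1; have k00 : 0 < kap s1 s2 (row 0 V) (circle_val x) by rewrite lt_neqAle eq_sym kn k0.
move: (kap s1 s2 (row 0 V) (circle_val x)) (kap s1 s2 (row 1 V) (circle_val x)) k00 => K0 K1 k00 k1.
have : 0 < e * K0 by rewrite mulr_gt0.
have : 0 <= e * K1 by rewrite mulr_ge0 // ltW.
have -> : (y 0 0 + e - g 0 x) * K0 + (y 0 1 + e - g 1 x) * K1 =
  (y 0 0 - g 0 x) * K0 + (y 0 1 - g 1 x) * K1 + (e * K0 + e * K1) by ring.
by move: (e * K0) (e * K1) ((y 0 0 - g 0 x) * K0) ((y 0 1 - g 1 x) * K1) => a b a' b'; clear; lra.
Qed.

(* Only one coordinate is constrained by the supporting functional, so its boundary values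
   are [ln (r k)] almost everywhere. *)
Lemma one_sided (G : set 'rV[R[i]]_2) (r : 'I_2 -> R) (g : 'I_2 -> T -> R) (K : 'I_2 -> T -> R)
    (f : R[i] -> R[i]) (k : 'I_2) : complete_reinhardt G -> (forall j, 0 < r j) ->
  (forall j, [set z 0 j | z in G] = [set (r j)%:C * s | s in @disc R]) ->
  (forall j, rint (g j)) -> (forall x, closure (log_image G) (\row_j g j x)) ->
  {ae arc, forall x, 0 < K k x /\ (forall j, j != k -> K j x = 0)} ->
  {ae arc, forall x, forall y : 'rV[R]_2, log_image G y -> exists2 e : R, 0 < e &
    \sum_j (y 0 j + e - g j x) * K j x <= 0} ->
  forall z, cabs z < 1 ->
    (r k)^-1%:C * f z = f z * cexp (- herg (g k) z).
Proof.
move=> reinG r0 projG rg gL aeK aeN.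
have aeg : {ae arc, forall x, g k x = ln (r k)}.
  apply: ae_sub (ae_and aeK aeN) => x [[Kk Kj] H]; apply/eqP; rewrite eq_le.
  have := closure_log_le r0 projG k (@gL x); rewrite mxE => -> /=.
  rewrite leNgt; apply/negP => lt.
  have [y Ly lty] := log_image_sup reinG r0 projG lt.
  have [e e0] := H y Ly; rewrite (bigD1 k) //= big1 => [|j jk]; last by rewrite Kj // mulr0.
  rewrite addr0 pmulr_lle0 // => h.
  by move: lty e0 h; move: (y 0 k) (g k x) => a b; clear; lra.
have [N [mN N0 sub]] := aeg.
have [rt pt] := rint_modify (ln (r k)) mN N0 (rg k).
have p1 z : cabs z < 1 -> pint (g k) (pk z) = ln (r k).
  move=> z1; rewrite -pt; last exact: kcont_pk.
  rewrite -[RHS](pint_cst (ln (r k)) z1); congr pint; apply/funext => x.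
  have [//|] := boolP (x \in N); rewrite notin_setE => nx.
  by apply: contrapT => h; apply: nx; apply: sub.
(* Since [g k] has Poisson integral [ln (r k)], [J] is unimodular throughout the disc, hence
   constant, and its value at 0 is 1. *)
pose J z := (r k)%:C * cexp (- herg (g k) z).
have hJ : hol 1 J.
  apply: holZ => z z1; have [l dl] := hol_herg (rg k) z1.
  by eexists; exact: cder_comp (cderN dl) (cder_cexp _).
have J1 z : cabs z < 1 -> cabs (J z) = 1.
  move=> z1; rewrite cabsM cabsC cabs_cexp ReN Re_herg p1 // expRN lnK ?posrE //.
  by rewrite gtr0_norm // divff // gt_eqF.
have z0 : cabs (0 : R[i]) < 1 by rewrite cabs0.
have J1' z : cabs z < 1 -> cabs (J z) <= 1 by move=> /J1 ->.
have rk0 : (r k)%:C != 0 :> R[i] by rewrite -cabs_gt0 cabsC normr_gt0 gt_eqF.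
have J0 : J 0 = 1.
  have -> : J 0 = (r k)%:C * cexp (- (ln (r k))%:C).
    congr (_ * cexp (- _)); apply: complexP; first by rewrite Re_herg p1 // ReC.
    by rewrite Im_herg0 ImC.
  rewrite /cexp ReN ImN ReC ImC oppr0 cos0 sin0 expRN lnK ?posrE // mulr1.
  by rewrite -rmorphM /= divff // gt_eqF.
move=> z z1; have := hol_const hJ J1' z0 (J1 0 z0) z1; rewrite J0 /J => e.
have -> : cexp (- herg (g k) z) = (r k)^-1%:C by apply: (mulfI rk0); rewrite e -rmorphM /= divff // gt_eqF.
by rewrite mulrC.
Qed.

End coordinates.

(** * The factorised form of the map *)

Section factorisation.
Context {R : realType}.
Local Notation T := (borel_circle R).
Local Notation arc := (@arc_length R).

(** Since [f = I * cexp h], an automorphism [I] is kept as the factor [B], while a unimodular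
    constant [expi t] is absorbed in the exponent. *)
Lemma phase_factor (f h : R[i] -> R[i]) :
  let I := fun z => f z * cexp (- h z) in
  aut_disc I \/ (exists2 C, cabs C = 1 & forall z, cabs z < 1 -> I z = C) ->
  exists (B : R[i] -> R[i]) (t : R), (aut_disc B \/ forall s, disc s -> B s = 1) /\
    forall z, cabs z < 1 -> f z = B z * cexp (h z + (0 +i* t)).
Proof.
move=> I; have fE z : f z = I z * cexp (h z) by rewrite -mulrA -cexpD addNr cexp0 mulr1.
case=> [A|[C C1 IC]].
  exists I, 0; split; [by left|move=> z _].
  by rewrite fE; congr (_ * cexp _); rewrite -[LHS]addr0; congr (_ + _).
have [t _ tC] := unimodular_expi C1.
exists (fun=> 1), t; split; [by right|move=> z z1].
by rewrite mul1r cexpD cexp_im tC fE IC // mulrC.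
Qed.

(** The exponent [herg (g j) + i t] has boundary measure with density [g j], as [herg] is real at 0.
    The polynomials [kpoly] of the rows of [V] form the map in [Hclass] that places [g] in
    [Gclass]. *)
Lemma boundary_form (G : set 'rV[R[i]]_2) (f : R[i] -> 'rV[R[i]]_2) (s1 s2 : R[i])
    (g : 'I_2 -> T -> R) (V : 'M[R]_(2, 3)) : cabs s1 < 1 -> cabs s2 < 1 ->
  (forall j, rint (g j)) -> (forall x, closure (log_image G) (\row_j g j x)) ->
  (forall j, {ae arc, forall x, 0 <= kap s1 s2 (row j V) (circle_val x)}) ->
  row 0 V != 0 ->
  {ae arc, forall x, forall y : 'rV[R]_2, log_image G y -> exists2 e : R, 0 < e &
    \sum_j (y 0 j + e - g j x) * kap s1 s2 (row j V) (circle_val x) <= 0} ->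
  (forall j, exists (B : R[i] -> R[i]) (t : R), (aut_disc B \/ forall s, disc s -> B s = 1) /\
    forall z, cabs z < 1 -> f z 0 j = B z * cexp (herg (g j) z + (0 +i* t))) ->
  exists (B : 'I_2 -> R[i] -> R[i]) (g : borel_circle R -> 'rV[R]_2)
          (phi : R[i] -> 'rV[R[i]]_2)
          (mu : 'I_2 -> {charge set borel_circle R -> \bar R}),
     (forall j, aut_disc (B j) \/ (forall s, disc s -> B j s = 1)) /\
     Gclass (DG G) g /\
     Mclass phi /\
     is_boundary_measure phi mu /\
     has_density mu g /\
     (forall s j, disc s -> f s 0 j = B j s * cexp (phi s 0 j)).
Proof.
move=> s1D s2D rg gL k0 V0 nor HB.
have /choice[B HB1] := HB; have /choice[t Ht] := HB1.
pose phi z : 'rV[R[i]]_2 := \row_j (herg (g j) z + (0 +i* t j)).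
pose mu j : {charge set T -> \bar R} := density_charge (rg j).
have bm : is_boundary_measure phi mu.
  move=> l j; rewrite disc_cabs => l1; rewrite !mxE.
  have E := charge_integral_density (rg j) (ccont_hk l1).
  have Im0 : complex.Im (herg (g j) 0 + (0 +i* t j)) = t j by rewrite ImD Im_herg0 add0r.
  have it : (0 +i* t j) = 'i * (t j)%:C by simpc.
  have E' : charge_integral (mu j) (fun z => (circle_val z + l) / (circle_val z - l)) =
      cint arc setT (fun x => (g j x)%:C * hk l (circle_val x)) by exact: E.
  by rewrite Im0 E' it.
have hphi : holomorphic_on (@disc R) phi.
  move=> z; rewrite disc_cabs => z1.
  have /choice[l Hl] : forall j, exists l, cder (herg (g j)) z l.
    by move=> j; exact: (hol_herg (rg j)).
  have [|//] := @cder_row_derivable R 2 phi z (\row_j l j).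
  move=> j; rewrite mxE; have := cderD (Hl j) (cder_cst (0 +i* t j) z); rewrite addr0.
  by apply: eq_cder => w; rewrite mxE.
exists B, (fun x => \row_j g j x), phi, mu; split; first by move=> j; exact: (Ht j).1.
split; [split|split; [split => //; by exists mu|split => //; split]].
- move=> j; rewrite (_ : (fun z => _) = g j); first exact: rint_measurable.
  by apply/funext => x; rewrite mxE.
- move=> j; rewrite (_ : (fun z => _) = EFin \o g j); first exact: rg.
  by apply/funext => x; rewrite mxE.
- exists (fun z => \row_j kpoly s1 s2 (row j V) z); first exact: Hclass_kpoly.
  apply: ae_sub (ae_and (ae_and (k0 0) (k0 1)) (ae_and nor (ae_kap_neq0 s1D s2D V0))).
  move=> x [[k00 k01] [hn kn]]; apply: Pset_kpoly => //.
  by move=> j; case: (ord2P j) => ->.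
- move=> j A mA; apply: eq_integral => x _; by rewrite mxE.
- move=> s j; rewrite disc_cabs => sd; rewrite mxE; exact: (Ht j).2.
Qed.

End factorisation.

(** * Conclusion: the dichotomy read off from the rows of [V] *)

Theorem proposition5p2 (R : realType) (G : set 'rV[R[i]]_2) (r : 'I_2 -> R)
    (f : R[i] -> 'rV[R[i]]_2) :
  bounded_set G -> pseudoconvex G -> complete_reinhardt G ->
  (forall j, 0 < r j) ->
  (forall j, [set z 0 j | z in G] = [set (r j)%:C * s | s in @disc R]) ->
  holo_disc G f ->
  lempert_extremal G f \/ kobayashi_extremal G f ->
  (exists j : 'I_2, aut_disc (fun s => (r j)^-1%:C * f s 0 j)) \/
  (exists (B : 'I_2 -> R[i] -> R[i]) (g : borel_circle R -> 'rV[R]_2)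
          (phi : R[i] -> 'rV[R[i]]_2)
          (mu : 'I_2 -> {charge set borel_circle R -> \bar R}),
     (forall j, aut_disc (B j) \/ (forall s, disc s -> B j s = 1)) /\
     Gclass (DG G) g /\
     Mclass phi /\
     is_boundary_measure phi mu /\
     has_density mu g /\
     (forall s j, disc s -> f s 0 j = B j s * cexp (phi s 0 j))).
Proof.
move=> _ psc reinG r0 projG holf ext.
have [hf Gf] := (holo_disc_coord G f).1 holf.
have fr j z : cabs z < 1 -> cabs (f z 0 j) < r j by move=> z1; exact: proj_lt (Gf z z1).
pose M := r 0 + r 1.
have rM j : r j <= M by case: (ord2P j) => ->; rewrite /M ?lerDl ?lerDr ltW.
have GM z : G z -> forall j, cabs (z 0 j) <= M.
  by move=> Gz j; apply: le_trans (rM j); apply: ltW; exact: proj_lt.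
have [s1 [s2 [s1D s2D rigid]]] := extremal_rigid reinG GM ext.
have cL := log_image_convex psc reinG.
have other (j k : 'I_2) : j != k -> forall i, i != k -> i = j.
  by case: (ord2P j) => ->; case: (ord2P k) => ->; rewrite ?eqxx // => _ i; case: (ord2P i) => ->.
have neq (j : 'I_2) : exists k : 'I_2, j != k by case: (ord2P j) => ->; [exists 1|exists 0].
(* A coordinate that is identically 0 has no boundary logarithm and is settled apart. *)
have [[j fj]|nz] := pselect (exists j, forall z, cabs z < 1 -> f z 0 j = 0).
  left; have [k jk] := neq j; exists k.
  exact: (@vanishing_coordinate R G r (fun j z => f z 0 j) s1 s2 j k reinG r0 projG s1D s2D hf fr rigid (other _ _ jk) fj).
have nz' j : exists2 w, cabs w < 1 & f w 0 j != 0.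
  apply: contrapT => h; apply: nz; exists j => z z1; apply: contrapT => fz.
  by apply: h; exists z => //; exact/eqP.
have fM j z : cabs z < 1 -> cabs (f z 0 j) <= M.
  by move=> z1; apply: le_trans (rM j); apply: ltW; exact: fr.
have [t [g0 [t01 rg0 fg0 aeg0]]] := @boundary_log R (fun j z => f z 0 j) M hf fM nz'.
have Gf' z : cabs z < 1 -> G (\row_j f z 0 j).
  by move=> z1; rewrite (_ : \row_j _ = f z); [exact: Gf|apply/rowP => j; rewrite mxE].
have [N [mN N0 sub]] := boundary_closure Gf' t01 aeg0.
have lr : ln (r 0) - 1 < ln (r 0) by rewrite gtrBl.
have [p Lp _] := log_image_sup reinG r0 projG lr.
(* Resetting the boundary values to a point [p] of the logarithmic image on the null set [N] puts
   them in its closure at every point, without changing Poisson integrals. *)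
pose g j x := if x \in N then p 0 j else g0 j x.
have rg j : rint (g j) by exact: (rint_modify (p 0 j) mN N0 (rg0 j)).1.
have fg j z : cabs z < 1 -> cabs (f z 0 j) <= expR (pint (g j) (pk z)).
  move=> z1; rewrite (rint_modify (p 0 j) mN N0 (rg0 j)).2; last exact: kcont_pk.
  exact: fg0.
have gL x : closure (log_image G) (\row_j g j x).
  have [xN|] := boolP (x \in N).
    apply: subset_closure; rewrite (_ : \row_j _ = p) //.
    by apply/rowP => j; rewrite mxE /g xN.
  rewrite notin_setE => xN; apply: contrapT => h; apply: (xN); apply: sub => cl; apply: h.
  suff -> : \row_j g j x = \row_j g0 j x by exact: cl.
  by apply/rowP => j; rewrite !mxE /g memNset.
pose I j z := f z 0 j * cexp (- herg (g j) z).
have hI j : hol 1 (I j).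
  apply: holM; first exact: hf.
  move=> z z1; have [l dl] := hol_herg (rg j) z1.
  by eexists; exact: cder_comp (cderN dl) (cder_cexp _).
have I1 j z : cabs z < 1 -> cabs (I j z) <= 1.
  move=> z1; rewrite cabsM cabs_cexp ReN Re_herg expRN ler_pdivrMr ?expR_gt0 // mul1r.
  exact: fg.
have /choice[q /choice[c Hqc]] : forall j, exists (q : R[i] -> R[i]) (c : R), [/\ 0 <= c, hol 1 q,
    forall z, cabs z < 1 -> cabs (q z) <= expR (- c), same_data s1 s2 q (I j) &
    c = 0 -> aut_disc (I j) \/ exists2 C, cabs C = 1 & forall z, cabs z < 1 -> I j z = C].
  by move=> j; exact: contractive_model (hI j) (I1 j).
have c0 j : 0 <= c j by have [] := Hqc j.
have hq j : hol 1 (q j) by have [] := Hqc j.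
have q1 j z : cabs z < 1 -> cabs (q j z) <= expR (- c j) by have [_ _ h _ _] := Hqc j; exact: h.
have qI j : same_data s1 s2 (q j) (I j) by have [] := Hqc j.
have cI j : c j = 0 -> aut_disc (I j) \/ exists2 C, cabs C = 1 & forall z, cabs z < 1 -> I j z = C.
  by have [] := Hqc j.
have [V [V0 cert]] := @dual_certificate R G (fun j z => f z 0 j) s1 s2 g c q reinG cL s1D s2D rigid rg gL hf hq q1 qI.
have k0 := ae_kap_ge0 reinG s1D s2D gL cert.
have nor y (Ly : log_image G y) := ae_normal reinG s1D s2D rg gL c0 cert Ly.
have aeN := ae_normal_all reinG k0 nor.
(* Complementary slackness: a coordinate that enters the separating functional admits no gain. *)
have cz j : row j V != 0 -> c j = 0.
  move=> rj; apply/eqP; rewrite eq_le c0 andbT leNgt; apply/negP => cj.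
  by move/eqP: rj; apply; exact: (row_eq0 reinG s1D s2D gL c0 cert cj).
(* A zero row leaves coordinate [k] alone in the supporting functional, which gives (i); two nonzero
   rows give (ii). *)
have [[j Vj]|nV] := pselect (exists j, row j V = 0).
  left; have [k jk] := neq j; exists k.
  have Vk : row k V != 0.
    apply: contra_neq V0 => Vk; apply/row_matrixP => i; rewrite row0.
    by have [->//|/(other _ _ jk) ->] := eqVneq i k.
  have aeK : {ae arc_length (R:=R), forall x, 0 < kap s1 s2 (row k V) (circle_val x) /\
      (forall i, i != k -> kap s1 s2 (row i V) (circle_val x) = 0)}.
    apply: ae_sub (ae_and (k0 k) (ae_kap_neq0 s1D s2D Vk)) => x [h1 h2]; split.
      by rewrite lt_neqAle eq_sym h2 h1.
    move=> i /(other _ _ jk) ->; rewrite Vj /kap big1 // => m _; by rewrite mxE mul0r.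
  have E := one_sided (fun z => f z 0 k) reinG r0 projG rg gL aeK aeN.
  case: (cI k (cz k Vk)) => [A|[C C1 IC]].
    by apply: eq_aut_disc A => z z1; rewrite E.
  have z0 : cabs (0 : R[i]) < 1 by rewrite cabs0.
  (* A unimodular constant is impossible here, because [|f k| < r k] in the disc. *)
  have fC : (r k)^-1%:C * f 0 0 k = C := etrans (E 0 z0) (IC 0 z0).
  have fr1 : (r k)^-1 * cabs (f 0 0 k) < 1 by rewrite mulrC ltr_pdivrMr // mul1r fr.
  have := congr1 (@cabs R) fC; rewrite C1 cabsM cabsC gtr0_norm ?invr_gt0 // => fr2.
  by move: fr1; rewrite fr2 ltxx.
right; have nV' j : row j V != 0 by apply/eqP => h; apply: nV; exists j.
apply: (boundary_form s1D s2D rg gL k0 (nV' 0) aeN) => j.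
by apply: phase_factor; exact: cI (cz j (nV' j)).
Qed.
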